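(* Let $n\ge1$, $\alpha\in T_n^n$ and $j\in\{1,\ldots,n\}$. For every $v\in\mathrm{Conv}(\mathbb{R}^n;\mathbb{R})$ there exists a convex body $K^v\in\mathcal{K}^{n+1}$ such that for the $i$th coordinate of $\mathrm{t}_{j,\alpha}^*(v)$, $i\in\{1,\ldots,n\}$, we have $$\big(\mathrm{t}_{j,\alpha}^*(v)\big)_i=\binom{n}{j}\int_{\mathbb{S}^n_-}(\mathcal{T}^{n-j}\alpha)(|\mathrm{gno}(z)|)\,z_i\,\mathrm{d}S_j(K^v,z).$$ In addition, if $v(x)=h_K(x,-1)$, $x\in\mathbb{R}^n$, for some $K\in\mathcal{K}^{n+1}$, then we may choose $K^v=K$.
   Context: $C_b((0,\infty))$ is the set of continuous functions $\zeta\colon(0,\infty)\to\mathbb{R}$ with bounded support; for $j\in\{1,\ldots,n\}$, $T_j^n=\{\zeta\in C_b((0,\infty)):\lim_{s\to0^+}s^{n-j+1}\zeta(s)=0\}$; note $T_n^n\subset T_j^n$. For $\zeta\in C_b((0,\infty))$ and $s>0$, $\mathcal{T}\zeta(s)=\sqrt{1+s^2}\,\zeta(s)+\int_s^\infty\frac{t\zeta(t)}{\sqrt{1+t^2}}\,\mathrm{d}t$; $\mathcal{T}^l$ is the $l$-fold iterate and $\mathcal{T}^0$ the identity. $\mathrm{Conv}(\mathbb{R}^n;\mathbb{R})$ is the set of convex functions $v\colon\mathbb{R}^n\to\mathbb{R}$ with the topology of epi-convergence (equivalently, pointwise convergence). A map $\mathrm{z}\colon\mathrm{Conv}(\mathbb{R}^n;\mathbb{R})\to\mathbb{R}^n$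 is a valuation if $\mathrm{z}(v\vee w)+\mathrm{z}(v\wedge w)=\mathrm{z}(v)+\mathrm{z}(w)$ whenever $v,w$, their pointwise maximum $v\vee w$ and minimum $v\wedge w$ all belong to $\mathrm{Conv}(\mathbb{R}^n;\mathbb{R})$; dually epi-translation invariant if $\mathrm{z}(v+a)=\mathrm{z}(v)$ for every affine $a$; rotation equivariant if $\mathrm{z}(v\circ\vartheta^{-1})=\vartheta\,\mathrm{z}(v)$ for every $\vartheta\in\mathrm{SO}(n)$. For $\zeta\in T_j^n$, $\mathrm{t}_{j,\zeta}^*\colon\mathrm{Conv}(\mathbb{R}^n;\mathbb{R})\to\mathbb{R}^n$ denotes the unique continuous, dually epi-translation invariant, rotation equivariant valuation such that $\mathrm{t}_{j,\zeta}^*(v)=\int_{\mathbb{R}^n}\zeta(|x|)x\,[\mathrm{D}^2v(x)]_j\,\mathrm{d}x$ for every $v\in\mathrm{Conv}(\mathbb{R}^n;\mathbb{R})\cap C^2(\mathbb{R}^n)$, where $[A]_j$ is the $j$th elementary symmetric function of the eigenvalues of $A$. (Its existence is established in the same work.) $\mathcal{K}^{n+1}$ is the set of nonempty compact convex subsets of $\mathbb{R}^{n+1}$ and $h_K(x)=\max_{y\in K}\langle x,y\rangle$ is the support function. $S_n(K,\cdot)$ is the surface area measure of $K\in\mathcal{K}^{n+1}$ on $\mathbb{S}^n\subset\mathbb{R}^{n+1}$, and the area measures $S_j(K,\cdot)$, $0\le j\le n$, are defined by $S_n(K+rB^{n+1},\cdot)=\sum_{j=0}^n\binom{n}{j}r^{n-j}S_j(K,\cdot)$,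 $r>0$, with $B^{n+1}$ the Euclidean unit ball. $\mathbb{S}^n_-=\{z\in\mathbb{S}^n:z_{n+1}<0\}$ and $\mathrm{gno}\colon\mathbb{S}^n_-\to\mathbb{R}^n$, $\mathrm{gno}(z)=(z_1,\ldots,z_n)/|z_{n+1}|$. The integrand is understood to be $0$ at $z=-e_{n+1}$ (its continuous extension). *)

(* Defs.v *)
From HB Require Import structures.
From mathcomp Require Import all_boot all_order all_algebra.
From mathcomp Require Import all_classical all_reals all_analysis measurable_realfun.
Set Implicit Arguments.
Unset Strict Implicit.
Unset Printing Implicit Defensive.
Import Order.TTheory GRing.Theory Num.Theory.
Import numFieldNormedType.Exports.
Local Open Scope classical_set_scope.
Local Open Scope ring_scope.

(* 'rV[R]_n carries its Borel sigma-algebra. *)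
Definition measure_rV_display : measure_display.
Proof. exact: default_measure_display. Qed.

Section borel_rV.
Context (R : realType) (n : nat).

HB.instance Definition _ := @isMeasurable.Build
  measure_rV_display 'rV[R]_n
  <<s (@open 'rV[R]_n) >> (@sigma_algebra0 _ setT _)
  (@sigma_algebraC _ (@open 'rV[R]_n)) (@sigma_algebra_bigcup _ setT _).

Lemma open_measurable_rV (U : set 'rV[R]_n) : open U -> measurable U.
Proof. exact: sub_sigma_algebra. Qed.

Lemma measurable_rV_coord (i : 'I_n) :
  measurable_fun setT (fun x : 'rV[R]_n => (x 0 i : measurableTypeR R)).
Proof.
move=> mT; apply: (measurability _ (measurable_realfun.RGenOpens.measurableE R)) => //.
move=> _ [_ [a [b ->]] <-].
rewrite setTI; apply: open_measurable_rV.
apply: open_comp; last exact: interval_open.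
by move=> x _; exact: coord_continuous.
Qed.

Lemma measurable_fun_rVP d (T : measurableType d) (f : T -> 'rV[R]_n) :
  (forall i, measurable_fun setT (fun t => (f t 0 i : measurableTypeR R))) ->
  measurable_fun setT f.
Proof.
move=> mf; apply: (@measurability _ _ _ _ setT f (@open 'rV[R]_n)) => //.
move=> _ [U oU <-]; rewrite setTI.
pose c (p : 'rV[rat]_n * nat) : 'rV[R]_n := map_mx ratr p.1.
have mb p : measurable (f @^-1` ball (c p) p.2.+1%:R^-1).
  rewrite (_ : _ @^-1` _ = \bigcap_(i in [set: 'I_n])
      (fun t => f t 0 i) @^-1` ball (c p 0 i) p.2.+1%:R^-1).
    apply: fin_bigcap_measurable; first exact: finite_finset.
    move=> i _; rewrite -[X in measurable X]setTI.
    apply: mf => //; apply: open_measurable; apply: ball_open;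
      rewrite invr_gt0 ltr0n.
  apply/seteqP; split => t /=.
    by move=> bt i _; case: bt => _ /(_ 0 i).
  move=> bt; split => [|j i]; first by rewrite invr_gt0 ltr0n.
  by rewrite ord1; exact: bt.
pose F p := if `[< ball (c p) p.2.+1%:R^-1 `<=` U >]
  then f @^-1` ball (c p) p.2.+1%:R^-1 else set0.
rewrite (_ : f @^-1` U = \bigcup_p F p).
  apply: countable_bigcupT_measurable; first exact: countableP.
  by move=> p; rewrite /F; case: ifPn => // _; exact: mb.
apply/seteqP; split => [t /= Ut|t [p _]]; last first.
  by rewrite /F; case: asboolP => // + /= bt; apply.
have /nbhs_ballP[e /= e0 eU] : nbhs (f t) U by exact: open_nbhs_nbhs.
have [k ke] : exists k : nat, k.+1%:R^-1 < e / 2.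
  have /ltr_add_invr[k] : 0 < e / 2 by rewrite divr_gt0.
  by rewrite add0r => ?; exists k.
have k0 : 0 < k.+1%:R^-1 :> R by rewrite invr_gt0 ltr0n.
have qP (i : 'I_n) : exists q : rat, `|f t 0 i - ratr q| < k.+1%:R^-1.
  have /rat_in_itvoo[q] : f t 0 i - k.+1%:R^-1 < f t 0 i + k.+1%:R^-1.
    by rewrite ltrBlDr -addrA ltrDl addr_gt0.
  rewrite in_itv/= => /andP[q1 q2]; exists q.
  by rewrite ltr_distlC q1 q2.
have [q qE] := choice qP.
exists ((\row_i q i), k) => //=; rewrite /F.
have bt : ball (c (\row_i q i, k)) k.+1%:R^-1 (f t).
  split=> [//|j i]; rewrite ord1 /ball /= /c /= !mxE distrC; exact: qE.
case: asboolP => //; case => y yb; apply: eU.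
rewrite [e](splitr e); apply: (@ball_triangle _ _ (c (\row_i q i, k))).
  apply: ball_sym; exact: (le_ball (ltW ke)).
exact: (le_ball (ltW ke)).
Qed.

End borel_rV.

Section lebesgue_rV_succ.
Context (R : realType) (n : nat).
Variable m : {sigma_finite_measure set 'rV[R]_n -> \bar R}.

Definition rV_cons (p : measurableTypeR R * 'rV[R]_n) : 'rV[R]_n.+1 :=
  row_mx (const_mx p.1 : 'rV[R]_1) p.2.

Lemma measurable_rV_cons : measurable_fun setT rV_cons.
Proof.
apply/measurable_fun_rVP => i; case: (@split_ordP 1 n i) => j ->.
  rewrite [X in measurable_fun _ X](_ : _ = fst)//; apply/funext => p.
  exact: (etrans (row_mxEl _ _ _ _) (mxE _ _ _ _)).
rewrite [X in measurable_fun _ X](_ : _ = (fun x : 'rV[R]_n => x 0 j) \o snd).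
  exact: (measurableT_comp (measurable_rV_coord j) measurable_snd).
by apply/funext => p; exact: (row_mxEr (const_mx p.1) p.2 0 j).
Qed.

HB.instance Definition _ :=
  isMeasurableFun.Build _ _ _ _ rV_cons measurable_rV_cons.

Definition lebesgue_rV_succ : set 'rV[R]_n.+1 -> \bar R :=
  pushforward (@lebesgue_measure R \x m)%E rV_cons.

Let lebesgue_rV_succ0 : lebesgue_rV_succ set0 = 0%E.
Proof. exact: measure0. Qed.

Let lebesgue_rV_succ_ge0 A : (0 <= lebesgue_rV_succ A)%E.
Proof. exact: measure_ge0. Qed.

Let lebesgue_rV_succ_sigma_additive : semi_sigma_additive lebesgue_rV_succ.
Proof. exact: measure_semi_sigma_additive. Qed.

HB.instance Definition _ := isMeasure.Build _ _ _ lebesgue_rV_succ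
  lebesgue_rV_succ0 lebesgue_rV_succ_ge0 lebesgue_rV_succ_sigma_additive.

Let rV_uncons (x : 'rV[R]_n.+1) : measurableTypeR R * 'rV[R]_n :=
  (x 0 0, \row_i x 0 (lift ord0 i)).

Let rV_consK : cancel rV_cons rV_uncons.
Proof.
move=> [a x]; rewrite /rV_uncons /rV_cons /=; congr pair.
  have -> : 0 = lshift n (0 : 'I_1) :> 'I_n.+1 by exact/val_inj.
  exact: (etrans (row_mxEl _ _ _ _) (mxE _ _ _ _)).
apply/rowP => i; rewrite mxE.
have -> : lift ord0 i = rshift 1 i by exact/val_inj.
exact: row_mxEr.
Qed.

Let measurable_rV_uncons : measurable_fun setT rV_uncons.
Proof.
apply: measurable_fun_pair; first exact: measurable_rV_coord.
apply/measurable_fun_rVP => i; under eq_fun do rewrite mxE.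
exact: measurable_rV_coord.
Qed.

Let lebesgue_rV_succ_sigma_finite : sigma_finite setT lebesgue_rV_succ.
Proof.
have /sigma_finiteP[F [FT ndF Foo]] := sigma_finiteT (@lebesgue_measure R).
have /sigma_finiteP[G [GT ndG Goo]] := sigma_finiteT m.
exists (fun k => rV_uncons @^-1` (F k `*` G k)).
  rewrite -preimage_bigcup -[LHS](preimage_setT rV_uncons); congr (_ @^-1` _).
  rewrite -setXTT FT GT predeqE => -[x y]; split; last first.
    by move=> [k _ []/= ? ?]; split; exists k.
  move=> [/= [i _ Fx] [k _ Gy]]; exists (maxn i k) => //; split.
  - by move: x Fx; exact/subsetPset/ndF/leq_maxl.
  - by move: y Gy; exact/subsetPset/ndG/leq_maxr.
move=> k; have [mF oF] := Foo k; have [mG oG] := Goo k; split.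
  by rewrite -[X in measurable X]setTI; apply: measurable_rV_uncons => //;
    exact: measurableX.
rewrite /lebesgue_rV_succ /pushforward -comp_preimage.
rewrite (_ : _ \o _ = id) ?preimage_id; last by apply/funext; exact: rV_consK.
by rewrite product_measure1E// lte_mul_pinfty// ge0_fin_numE.
Qed.

HB.instance Definition _ := Measure_isSigmaFinite.Build _ _ _
  lebesgue_rV_succ lebesgue_rV_succ_sigma_finite.

End lebesgue_rV_succ.

(* Lebesgue measure on R^n, as an iterated product of the one-dimensional one. *)
Fixpoint lebesgue_rV (R : realType) (n : nat) :
    {sigma_finite_measure set 'rV[R]_n -> \bar R} :=
  if n is n'.+1 then lebesgue_rV_succ (lebesgue_rV R n') else \d_(0 : 'rV[R]_0).

Section euclidean_space.
Context (R : realType) (n : nat).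
Implicit Types (x y b : 'rV[R]_n) (v : 'rV[R]_n -> R).

Definition dotv x y : R := \sum_i x 0 i * y 0 i.

(* The library norm `|x| on 'rV[R]_n is the sup norm; it induces the same
   topology as this Euclidean norm. *)
Definition enorm x : R := Num.sqrt (dotv x x).

Definition affine_fun b (c : R) : 'rV[R]_n -> R := fun x => dotv b x + c.

Definition basis_vec (i : 'I_n) : 'rV[R]_n := delta_mx 0 i.

Definition C2 v : Prop :=
  continuous v /\
  forall i, [/\ forall x, derivable v x (basis_vec i),
    continuous (fun x => 'D_(basis_vec i) v x) &
    forall j,
      (forall x, derivable (fun y => 'D_(basis_vec i) v y) x (basis_vec j)) /\
      continuous (fun x =>
        'D_(basis_vec j) (fun y => 'D_(basis_vec i) v y) x)].

Definition hessian v x : 'M[R]_n :=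
  \matrix_(i, j) 'D_(basis_vec j) (fun y => 'D_(basis_vec i) v y) x.

(* The eigenvalues of A with multiplicity, when the characteristic polynomial
   of A splits over R (as it does for symmetric A), and [::] otherwise. *)
Definition eigenvalues (A : 'M[R]_n) : seq R :=
  xget [::] [set s : seq R | char_poly A = \prod_(l <- s) ('X - l%:P)].

Definition elementary_sym (j : nat) (s : seq R) : R :=
  \sum_(I : {set 'I_(size s)} | #|I| == j) \prod_(i in I) s`_i.

Definition SO (theta : 'M[R]_n) : Prop :=
  theta *m theta^T = 1%:M /\ \det theta = 1.

(* theta acts on the left on vectors, here written as rows. *)
Definition rotate (theta : 'M[R]_n) x : 'rV[R]_n := x *m theta^T.

Definition Conv v : Prop := convex_function setT v.

Definition epi_cvg (w : nat -> 'rV[R]_n -> R) v : Prop :=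
  forall x,
    (forall u : nat -> 'rV[R]_n, u @ \oo --> x ->
      ((v x)%:E <= limn_einf (fun k => (w k (u k))%:E))%E) /\
    (exists u : nat -> 'rV[R]_n, u @ \oo --> x /\ w k (u k) @[k --> \oo] --> v x).

End euclidean_space.

Section vector_valued_valuations.
Context (R : realType) (n : nat).
(* Only the values of z on Conv are constrained. *)
Implicit Type z : ('rV[R]_n -> R) -> 'rV[R]_n.

Definition valuation z : Prop := forall v w : 'rV[R]_n -> R,
  Conv v -> Conv w -> Conv (v \max w) -> Conv (v \min w) ->
  z (v \max w) + z (v \min w) = z v + z w.

(* Epi-convergence on Conv is metrizable, so continuity is sequential. *)
Definition epi_continuous z : Prop := forall w (v : 'rV[R]_n -> R),
  (forall k, Conv (w k)) -> Conv v -> epi_cvg w v ->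
  z (w k) @[k --> \oo] --> z v.

Definition dually_epi_translation_invariant z : Prop :=
  forall v, Conv v -> forall b c, z (v \+ affine_fun b c) = z v.

Definition rotation_equivariant z : Prop :=
  forall v, Conv v -> forall theta, SO theta ->
  z (v \o rotate (invmx theta)) = rotate theta (z v).

End vector_valued_valuations.

Section density_classes.
Context (R : realType).
Implicit Type zeta : R -> R.

(* Functions on (0, +oo) are represented by functions on R whose values on
   (-oo, 0] are irrelevant. *)
Definition Cb zeta : Prop :=
  {in `]0, +oo[, continuous zeta} /\
  exists M, forall s, 0 < s -> M < s -> zeta s = 0.

Definition Tclass (n j : nat) zeta : Prop :=
  Cb zeta /\ s ^+ (n - j + 1) * zeta s @[s --> 0^'+] --> 0.

Definition Ttrans zeta : R -> R := fun s =>
  Num.sqrt (1 + s ^+ 2) * zeta s +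
  \int[lebesgue_measure]_(t in `]s, +oo[) (t * zeta t / Num.sqrt (1 + t ^+ 2)).

End density_classes.

(* z restricts on Conv to the functional t*_(j,zeta). *)
Definition is_tstar (R : realType) (n j : nat) (zeta : R -> R)
    (z : ('rV[R]_n -> R) -> 'rV[R]_n) : Prop :=
  [/\ valuation z, epi_continuous z, dually_epi_translation_invariant z,
      rotation_equivariant z &
      forall v, Conv v -> C2 v -> forall i,
        (z v 0 i)%:E = (\int[lebesgue_rV R n]_x
          (zeta (enorm x) * x 0 i * elementary_sym j (eigenvalues (hessian v x)))%:E)%E].

Section convex_bodies.
Context (R : realType) (d : nat).
Implicit Types (K omega : set 'rV[R]_d).

Definition convex_body K : Prop := [/\ K !=set0, compact K & convex_set K].

Definition support_function K (x : 'rV[R]_d) : R := sup [set dotv x y | y in K].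

Definition parallel_body K (r : R) : set 'rV[R]_d :=
  [set x + r *: b | x in K & b in [set b : 'rV[R]_d | enorm b <= 1]].

(* The points at distance in (0, rho] from K whose unit vector pointing away
   from their nearest point p in K belongs to omega. *)
Definition local_parallel_set K (rho : R) omega : set 'rV[R]_d :=
  [set x | ~ K x /\ exists p, [/\ K p,
    forall q, K q -> enorm (x - p) <= enorm (x - q),
    enorm (x - p) <= rho & omega ((enorm (x - p))^-1 *: (x - p))]].

(* The surface area measure S_(d-1)(K, .) as the first-order coefficient in rho
   of the local Steiner formula (Schneider, Convex Bodies, Section 4.2). A measure
   on the sphere is represented by a Borel measure on R^d carried by the sphere:
   only unit vectors of omega matter. *)
Definition surface_area_measure K omega : \bar R :=
  lim ((rho^-1)%:E * lebesgue_rV R d (local_parallel_set K rho omega)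
         @[rho --> 0^'+])%E.

End convex_bodies.

Section area_measures.
Context (R : realType) (n : nat).
Implicit Types (K : set 'rV[R]_(n + 1)).

Definition is_area_measures K
    (S : nat -> {measure set 'rV[R]_(n + 1) -> \bar R}) : Prop :=
  forall r : R, 0 < r -> forall omega, measurable omega ->
  surface_area_measure (parallel_body K r) omega =
  (\sum_(j < n.+1) ('C(n, j)%:R * r ^+ (n - j))%:E * S j omega)%E.

(* The family (S_j)_(j <= n) is determined by K: the defining identity is between
   polynomials in r, with finite values. The default mzero is never reached on a
   convex body. *)
Definition area_measure K : nat -> {measure set 'rV[R]_(n + 1) -> \bar R} :=
  if pselect (exists S, is_area_measures K S) is left h then sval (cid h)
  else fun=> mzero.

Definition lower_hemisphere : set 'rV[R]_(n + 1) :=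
  [set z | enorm z = 1 /\ rsubmx z 0 0 < 0].

(* At -e_(n+1) the argument |gno z| is 0, outside the domain of the density, but
   there z_i = 0 for i <= n, so that products with z_i vanish as required. *)
Definition gno (z : 'rV[R]_(n + 1)) : 'rV[R]_n :=
  `|rsubmx z 0 0|^-1 *: lsubmx z.

End area_measures.

Arguments lower_hemisphere R n : clear implicits.
Arguments Ttrans {R} zeta s.

(* Main.v *)
(* Let h be the support function of K, v(x) = h(x, -1), w(x) = sqrt(1 + |x|^2) and
   k = n - j. For a convex function u and t > 0, the map inverse to
   y |-> du(y) + t y is single-valued, and the image of Lebesgue measure under it
   is the Monge-Ampere measure of u + t |y|^2 / 2: it depends continuously on u,
   has density det (D^2 u + t) where u is C^2, and is polynomial in t. For u = h
   the inverse is x |-> (x - p_K(x)) / t with p_K the metric projection, so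
   its coefficients evaluated on truncated cones are the area measures S_j(K, .),
   by the local Steiner formula.
   Now mollify v and extend the result to a 1-homogeneous function on the lower
   half-space. With A the Hessian of the mollified v, X = y' / rho and
   rho = - y_(n+1), the Hessian of the extension is N A N^T / rho for N with rows
   e_1, ..., e_n, X; Sylvester's identity turns its characteristic polynomial into
   det (A + rho t (1 + X^T X)^-1), and integration over cones expresses the integral
   of f(gno z) against S_j(K, .) through the coefficient of tau^k in
   det (A + tau (1 + x^T x)^-1). That coefficient is [A]_j minus a quadratic form in
   x, which an integration by parts (null Lagrangians) transfers to the density:
   this is where T^k alpha = w^k alpha + k G_k, G_k(s) the integral of
   t alpha(t) w(t)^(k-2) over t > s, comes from.
   For general v only the values of v on a large ball matter, and on a ball v
   coincides with h_K(., -1) for K the set of bounded affine minorants there. *)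

Require Import Defs.
From HB Require Import structures.
From mathcomp Require Import all_boot all_order all_algebra.
From mathcomp Require Import fingroup perm.
From mathcomp Require Import all_classical all_reals all_analysis measurable_realfun.
From mathcomp Require complex.
From mathcomp Require Import zify ring lra.
Set Implicit Arguments.
Unset Strict Implicit.
Unset Printing Implicit Defensive.
Import Order.TTheory GRing.Theory Num.Theory.
Import numFieldNormedType.Exports.
Local Open Scope classical_set_scope.
Local Open Scope ring_scope.

(** * Lebesgue integration on R^n *)

(** Each side is given indirectly. The functional is explicit only on C^2 functions. The area
    measures are an arbitrarily chosen family satisfying a one-sided limit, so that a family has to
    be exhibited first: the coefficients [Psi] of the Monge-Ampere polynomial are computed on
    continuous functions only, and their positivity must reach indicators of Borel sets before they
    define measures. Both sides are then limits along the same mollifications of v, and uniqueness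
    of limits identifies them. Two obstacles shape the estimates. Mollifying h in R^(n+1) would
    destroy its homogeneity; averaging h over shears keeps it convex and globally Lipschitz, and
    below the equator coincides with the homogeneous extension of the mollified v. Moreover alpha
    may blow up at 0, where only s alpha(s) is controlled, so alpha enters the integrations by parts
    only through products with a coordinate. All integrations by parts rest on translation
    invariance of Lebesgue measure, and the change of variables for gradient maps is a degree
    argument with null Lagrangians. *)

Section measurability_rV.
Context (R : realType) (m : nat).
Local Notation E := 'rV[R]_m.

Lemma continuous_measurable_rV (f : E -> R) :
  continuous f -> measurable_fun setT f.
Proof.
move=> cf mT.
apply: (measurability _ (measurable_realfun.RGenOpens.measurableE R)) => //.
move=> _ [_ [a [b ->]] <-]; rewrite setTI; apply: open_measurable_rV.
by apply: open_comp; [move=> x _; exact: cf|exact: interval_open].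
Qed.

Lemma continuous_measurable_rV_rV k (F : E -> 'rV[R]_k) :
  continuous F -> measurable_fun setT F.
Proof.
move=> cF; apply: (@measurability _ _ _ _ setT F (@open 'rV[R]_k)) => //.
move=> _ [U oU <-]; rewrite setTI; apply: open_measurable_rV.
by apply: open_comp => // x _; exact: cF.
Qed.

Lemma mx_norm_coord (x : E) i : `|x 0 i| <= `|x|.
Proof.
rewrite [leRHS]mx_normrE.
by rewrite (le_bigmax _ (fun ij : 'I_1 * 'I_m => `|x ij.1 ij.2|) (0, i)).
Qed.

Lemma mx_norm_leP (x : E) (M : R) : 0 <= M ->
  (`|x| <= M) <-> (forall i, `|x 0 i| <= M).
Proof.
move=> M0; split=> [xM i|xM]; first exact: le_trans (mx_norm_coord x i) xM.
rewrite [leLHS]mx_normrE; apply: bigmax_le => // -[a i] _ /=.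
by rewrite ord1.
Qed.

Lemma mx_norm_ltP (x : E) (M : R) : 0 <= M -> M < `|x| ->
  exists i, M < `|x 0 i|.
Proof.
move=> M0 Mx; apply: contrapT => /forallNP h.
move: Mx; apply/negP; rewrite -leNgt; apply/mx_norm_leP => // i.
by rewrite leNgt; apply/negP.
Qed.

End measurability_rV.

(** * Translations and dilations of the line *)

Section lebesgue1.
Context (R : realType).
Local Notation mu := (@lebesgue_measure R).

Definition addr_fun (h : R) (x : measurableTypeR R) : measurableTypeR R := x + h.
Definition mull_fun (t : R) (x : measurableTypeR R) : measurableTypeR R := t * x.

Lemma measurable_addr (h : R) : measurable_fun setT (addr_fun h).
Proof. by apply: measurable_funD => //; exact: measurable_cst. Qed.

Lemma measurable_scaler (t : R) : measurable_fun setT (mull_fun t).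
Proof. by apply: measurable_funM => //; exact: measurable_cst. Qed.

HB.instance Definition _ (h : R) := isMeasurableFun.Build _ _ _ _
  (addr_fun h) (measurable_addr h).
HB.instance Definition _ (t : R) := isMeasurableFun.Build _ _ _ _
  (mull_fun t) (measurable_scaler t).

Lemma ge0_integral_lebesgue_shift (f : measurableTypeR R -> \bar R) (h : R) :
  measurable_fun setT f -> (forall x, 0 <= f x)%E ->
  (\int[mu]_x f (x + h)%R = \int[mu]_x f x)%E.
Proof.
move=> mf f0.
have := @ge0_integral_pushforward _ _ _ _ _ _ (measurable_addr h) mu setT f
  measurableT mf (fun y _ => f0 y).
rewrite preimage_setT => <-.
apply: eq_measure_integral => A mA _.
(* Lebesgue measure is determined by half-open intervals, so the image measure is computed on these
   only. *)
apply/esym; apply: lebesgue_measure_unique => // X [[a b]/= _ <-].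
rewrite /pushforward (_ : _ @^-1` _ = `]a - h, b - h]%classic).
  rewrite !lebesgue_measure_itv /= !lte_fin ltrD2r -!EFinD.
  by case: ifP => // _; congr (_%:E); ring.
by apply/seteqP; split => x /=; rewrite !in_itv/= ltrBlDr lerBrDr.
Qed.

Lemma ge0_integral_lebesgue_scale (f : measurableTypeR R -> \bar R) (t : R) :
  0 < t -> measurable_fun setT f -> (forall x, 0 <= f x)%E ->
  (t%:E * \int[mu]_x f (t * x)%R = \int[mu]_x f x)%E.
Proof.
move=> t0 mf f0.
have := @ge0_integral_pushforward _ _ _ _ _ _ (measurable_scaler t) mu setT f
  measurableT mf (fun y _ => f0 y).
rewrite preimage_setT => <-.
pose T := NngNum (ltW t0).
pose nu := measure_function_pushforward__canonical__measure_function_Measure mu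
  (measurable_scaler t).
transitivity (\int[mscale T nu]_x f x)%E.
  by rewrite ge0_integral_mscale.
apply: eq_measure_integral => A mA _.
apply/esym; apply: lebesgue_measure_unique => // X [[a b]/= _ <-].
rewrite /mscale /= /pushforward
  (_ : _ @^-1` _ = `]a / t, b / t]%classic).
  rewrite !lebesgue_measure_itv /= !lte_fin ltr_pM2r ?invr_gt0// -!EFinD.
  case: ifP => // _; last by rewrite mule0.
  by rewrite -EFinM; congr (_%:E); field; rewrite gt_eqF.
apply/seteqP; split => x /=; rewrite !in_itv/=.
  by rewrite ltr_pdivrMr// ler_pdivlMr// ![x * t]mulrC.
by rewrite ltr_pdivrMr// ler_pdivlMr// ![x * t]mulrC.
Qed.

End lebesgue1.

(** * Slicing, translations and dilations in R^n *)

Section lebesgue_rV_theory.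
Context (R : realType).

Lemma ge0_integral_rV_cons m (f : 'rV[R]_m.+1 -> \bar R) :
  measurable_fun setT f -> (forall x, 0 <= f x)%E ->
  (\int[lebesgue_rV R m.+1]_x f x =
   \int[@lebesgue_measure R]_a \int[lebesgue_rV R m]_x f (rV_cons (a, x)))%E.
Proof.
move=> mf f0; rewrite /= /lebesgue_rV_succ.
rewrite (ge0_integral_pushforward (@measurable_rV_cons R m))//.
rewrite preimage_setT fubini_tonelli1//=.
by apply: measurableT_comp => //; exact: measurable_rV_cons.
Qed.

Lemma measurable_rV_cons_slice m (f : 'rV[R]_m.+1 -> \bar R) a :
  measurable_fun setT f -> measurable_fun setT (fun x => f (rV_cons (a, x))).
Proof.
move=> mf; apply: (measurableT_comp mf).
exact: (measurableT_comp (@measurable_rV_cons R m) (measurable_pair1 a)).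
Qed.

Lemma measurable_rV_cons_integral m (f : 'rV[R]_m.+1 -> \bar R) :
  measurable_fun setT f -> (forall x, 0 <= f x)%E ->
  measurable_fun setT
    (fun a : measurableTypeR R => \int[lebesgue_rV R m]_x f (rV_cons (a, x)))%E.
Proof.
move=> mf f0.
apply: (measurable_fun_fubini_tonelli_F (m2 := lebesgue_rV R m)
  (f \o @rV_cons R m)) => //; last by move=> x; exact: f0.
by apply: measurableT_comp => //; exact: measurable_rV_cons.
Qed.

Lemma rV_consD m (a b : R) (x y : 'rV[R]_m) :
  rV_cons (a + b, x + y) = rV_cons (a, x) + rV_cons (b, y).
Proof.
rewrite /rV_cons /=; apply/rowP => i; rewrite !mxE.
by case: fintype.split => j; rewrite !mxE.
Qed.

Lemma rV_consZ m (t a : R) (x : 'rV[R]_m) :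
  rV_cons (t * a, t *: x) = t *: rV_cons (a, x).
Proof.
rewrite /rV_cons /=; apply/rowP => i; rewrite !mxE.
by case: fintype.split => j; rewrite !mxE.
Qed.

Lemma rV_consE m (x : 'rV[R]_m.+1) :
  exists p : R * 'rV[R]_m, x = rV_cons p.
Proof.
exists (x 0 (lshift m (0 : 'I_1)), \row_i x 0 (rshift 1 i)).
apply/rowP => i; rewrite /rV_cons !mxE /=.
case: (@split_ordP 1 m i) => j ->; first by rewrite !mxE ord1.
by rewrite !mxE.
Qed.

Lemma rV_cons0 m (a : R) (x : 'rV[R]_m) : rV_cons (a, x) 0 (lshift m (0 : 'I_1)) = a.
Proof. exact: (etrans (row_mxEl _ _ _ _) (mxE _ _ _ _)). Qed.

Lemma rV_consS m (a : R) (x : 'rV[R]_m) i : rV_cons (a, x) 0 (rshift 1 i) = x 0 i.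
Proof. exact: row_mxEr. Qed.

Lemma ge0_integral_rV_shift m (f : 'rV[R]_m -> \bar R) h :
  measurable_fun setT f -> (forall x, 0 <= f x)%E ->
  (\int[lebesgue_rV R m]_x f (x + h)%R = \int[lebesgue_rV R m]_x f x)%E.
Proof.
elim: m => [|m IH] in f h *; move=> mf f0.
  by apply: eq_integral => x _; congr (f _); rewrite [x + h]thinmx0 [x]thinmx0.
have mfh : measurable_fun setT (fun x : 'rV[R]_m.+1 => f (x + h)).
  apply: (measurableT_comp mf); apply: continuous_measurable_rV_rV => x.
  exact: (cvgD cvg_id (cvg_cst h)).
rewrite [RHS](ge0_integral_rV_cons mf)//.
rewrite [LHS](ge0_integral_rV_cons mfh (fun x => f0 _)).
have [[b k] hE] := rV_consE h.
transitivity (\int[@lebesgue_measure R]_a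
  \int[lebesgue_rV R m]_x f (rV_cons ((a + b)%R, x)))%E.
  apply: eq_integral => a _; rewrite -[RHS](IH _ k)//.
    by apply: eq_integral => x _; rewrite rV_consD -hE.
  exact: measurable_rV_cons_slice.
rewrite (ge0_integral_lebesgue_shift (f := fun a => \int[lebesgue_rV R m]_x f (rV_cons (a, x)))%E)//.
  exact: measurable_rV_cons_integral.
by move=> a; exact: integral_ge0.
Qed.

Lemma ge0_integral_rV_scale m (f : 'rV[R]_m -> \bar R) (t : R) : 0 < t ->
  measurable_fun setT f -> (forall x, 0 <= f x)%E ->
  ((t ^+ m)%:E * \int[lebesgue_rV R m]_x f (t *: x)%R =
   \int[lebesgue_rV R m]_x f x)%E.
Proof.
move=> t0; elim: m => [|m IH] in f *; move=> mf f0.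
  rewrite expr0 mul1e; apply: eq_integral => x _; congr (f _).
  by rewrite [_ *: x]thinmx0 [x]thinmx0.
have mft : measurable_fun setT (fun x : 'rV[R]_m.+1 => f (t *: x)).
  apply: (measurableT_comp mf); apply: continuous_measurable_rV_rV => x.
  exact: (cvgZ (cvg_cst t) cvg_id).
have tm0 : 0 <= t ^+ m by rewrite exprn_ge0// ltW.
rewrite [RHS](ge0_integral_rV_cons mf)//.
rewrite (ge0_integral_rV_cons mft (fun x => f0 _)).
rewrite exprS EFinM -muleA -ge0_integralZl//; last 2 first.
  exact: (measurable_rV_cons_integral (f := fun x : 'rV[R]_m.+1 => f (t *: x))).
  by move=> a _; exact: integral_ge0.
rewrite -[RHS](ge0_integral_lebesgue_scale t0 (f := fun a => \int[lebesgue_rV R m]_x f (rV_cons (a, x)))%E)//.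
- congr (_ * _)%E; apply: eq_integral => a _.
  rewrite -[RHS]IH//; last exact: measurable_rV_cons_slice.
  by congr (_ * _)%E; apply: eq_integral => x _; rewrite rV_consZ.
- exact: measurable_rV_cons_integral.
- by move=> a; exact: integral_ge0.
Qed.

Lemma lebesgue_rV_box m (M : R) : 0 <= M ->
  lebesgue_rV R m [set x | forall i, (`|x 0 i| <= M)%R] = ((M *+ 2) ^+ m)%:E.
Proof.
move=> M0.
pose B k := [set x : 'rV[R]_k | forall i, `|x 0 i| <= M].
have mB k : measurable (B k).
  rewrite (_ : B k = \bigcap_(i in [set: 'I_k])
      (fun x : 'rV[R]_k => x 0 i) @^-1` `[-M, M]).
    apply: fin_bigcap_measurable; first exact: finite_finset.
    move=> i _; rewrite -[X in measurable X]setTI.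
    exact: measurable_rV_coord.
  apply/seteqP; split => x /=.
    by move=> xM i _; rewrite /= in_itv /= -ler_norml.
  by move=> xM i; have := xM i Logic.I; rewrite /= in_itv /= -ler_norml.
suff : lebesgue_rV R m (B m) = ((M *+ 2) ^+ m)%:E by [].
elim: m => [|m IH].
  by rewrite /= diracE mem_set// => -[].
rewrite [LHS](_ : _ = (@lebesgue_measure R \x lebesgue_rV R m)%E
  (@rV_cons R m @^-1` B m.+1))//.
have -> : @rV_cons R m @^-1` B m.+1 = `[-M, M]%classic `*` B m.
  apply/seteqP; split => -[a x] /=.
    move=> h; split; first by rewrite /= in_itv /= -ler_norml -(rV_cons0 a x).
    by move=> i; rewrite -(rV_consS a x).
  rewrite in_itv /= -ler_norml => -[aM xM] i.
  by case: (@split_ordP 1 m i) => j ->; rewrite ?ord1 ?rV_cons0 ?rV_consS.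
pose J : set R := `[-M, M]%classic.
have -> : (@lebesgue_measure R \x lebesgue_rV R m)%E (J `*` B m) =
    (@lebesgue_measure R J * lebesgue_rV R m (B m))%E.
  rewrite product_measure1E; [reflexivity|exact: measurable_itv|exact: mB].
rewrite IH /J lebesgue_measure_itv /= lte_fin.
have [->|M1] := eqVneq M 0; first by rewrite oppr0 ltxx mul0e mul0rn exprS mul0r.
have M2 : 0 < M by rewrite lt_def M1 M0.
rewrite ifT; last by lra.
by rewrite -EFinD -EFinM opprK -mulr2n exprS.
Qed.

Lemma integral_rV0 (f : 'rV[R]_0 -> \bar R) :
  (\int[lebesgue_rV R 0]_x f x = f 0%R)%E.
Proof.
under eq_integral do rewrite [x in f x]thinmx0.
by rewrite integral_cst//= diracT mule1.
Qed.

Lemma measurable_row_mx_last m :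
  measurable_fun setT
    (fun p : 'rV[R]_m * measurableTypeR R => row_mx p.1 (const_mx p.2 : 'rV_1)).
Proof.
apply/measurable_fun_rVP => i.
case: (@split_ordP m 1 i) => j ->.
  under eq_fun do rewrite row_mxEl.
  exact: (measurableT_comp (measurable_rV_coord j) measurable_fst).
rewrite [X in measurable_fun _ X](_ : _ = snd); first exact: measurable_snd.
by apply/funext => p; rewrite row_mxEr mxE.
Qed.

Lemma rV_cons_row_mx m (a b : R) (x : 'rV[R]_m) :
  rV_cons (a, row_mx x (const_mx b : 'rV_1)) =
  row_mx (rV_cons (a, x)) (const_mx b : 'rV_1) :> 'rV_(m.+1 + 1).
Proof.
apply/rowP => i; case: (@split_ordP 1 (m + 1) i) => j ->.
  rewrite ord1 rV_cons0.
  have -> : lshift (m + 1) (0 : 'I_1) = lshift 1 (lshift m (0 : 'I_1)) :> 'I_(m.+1 + 1).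
    exact/val_inj.
  by rewrite row_mxEl rV_cons0.
rewrite rV_consS; case: (@split_ordP m 1 j) => k ->; rewrite ?row_mxEl ?row_mxEr.
  have -> : rshift 1 (lshift 1 k) = lshift 1 (rshift 1 k) :> 'I_(m.+1 + 1).
    exact/val_inj.
  by rewrite row_mxEl rV_consS.
have -> : rshift 1 (rshift m k) = rshift m.+1 k :> 'I_(m.+1 + 1).
  exact/val_inj.
by rewrite row_mxEr !mxE.
Qed.

(** The measure is built by prepending coordinates, whereas the depth below the equator is the last
    coordinate of R^(n+1). Induction on [m] moves the split to that end. *)
Lemma ge0_integral_rV_last m (f : 'rV[R]_(m + 1) -> \bar R) :
  measurable_fun setT f -> (forall x, 0 <= f x)%E ->
  (\int[lebesgue_rV R (m + 1)]_x f x =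
   \int[lebesgue_rV R m]_x \int[@lebesgue_measure R]_a
     f (row_mx x (const_mx a)))%E.
Proof.
elim: m => [|m IH] in f *; move=> mf f0.
  rewrite [LHS](ge0_integral_rV_cons mf f0).
  rewrite [RHS](integral_rV0 (fun x => \int[lebesgue_measure]_a f (row_mx x (const_mx a)))%E).
  apply: eq_integral => a _.
  rewrite [LHS](integral_rV0 (fun x => f (rV_cons (a, x)))); congr (f _).
  apply/rowP => i; rewrite /rV_cons !mxE /=.
  case: splitP => j ij; case: splitP => k ik; rewrite ?mxE//; last by case: j ij.
  by case: k ik.
rewrite [LHS](@ge0_integral_rV_cons (m + 1) f mf f0).
rewrite [RHS](@ge0_integral_rV_cons m
  (fun x => \int[lebesgue_measure]_a f (row_mx x (const_mx a)))%E); last 2 first.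
- apply: (measurable_fun_fubini_tonelli_F (m2 := @lebesgue_measure R)
    (fun p : 'rV[R]_m.+1 * measurableTypeR R => f (row_mx p.1 (const_mx p.2)))) => //.
  exact: (measurableT_comp mf (@measurable_row_mx_last m.+1)).
- by move=> x; exact: integral_ge0.
apply: eq_integral => a _.
rewrite [LHS](IH (fun x => f (rV_cons (a, x)))) => [|//|x]; last 2 first.
- exact: (@measurable_rV_cons_slice (m + 1)).
- exact: f0.
by apply: eq_integral => x _; apply: eq_integral => b _; rewrite rV_cons_row_mx.
Qed.

End lebesgue_rV_theory.

(** * Integrals of bounded functions with bounded support *)

Section bounded_support_integrals.
Context (R : realType) (m : nat).
Local Notation E := 'rV[R]_m.
Local Notation mu := (lebesgue_rV R m).
Implicit Types (f g : E -> R).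

(* Short for bounded, measurable, of bounded support. *)
Definition bms f := measurable_fun setT f /\
  exists C M : R, [/\ 0 <= C, 0 <= M, forall x, `|f x| <= C &
                      forall x, M < `|x| -> f x = 0].

Definition Cc f := continuous f /\ exists M : R, forall x, M < `|x| -> f x = 0.

Lemma measurable_nball (M : R) : measurable [set x : E | `|x| <= M].
Proof.
have mn : measurable_fun setT (fun x : E => `|x|).
  by apply: continuous_measurable_rV => x; exact: norm_continuous.
rewrite (_ : [set x | _] = (fun x : E => `|x|) @^-1` `]-oo, M]).
  by rewrite -[X in measurable X]setTI; apply: mn.
by apply/seteqP; split => x /=; rewrite in_itv.
Qed.

Lemma nball_fin (M : R) : (mu [set x : E | (`|x| <= M)%R] < +oo)%E.
Proof.
have [M0|M0] := leP 0 M; last first.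
  rewrite (_ : [set x | _] = set0) ?measure0 ?ltry//.
  apply/seteqP; split => x //= xM.
  by have := le_lt_trans xM M0; rewrite ltNge normr_ge0.
rewrite (_ : [set x | _] = [set x : E | forall i, `|x 0 i| <= M]).
  by rewrite lebesgue_rV_box// ltry.
by apply/seteqP; split => x /= /(mx_norm_leP _ M0).
Qed.

Lemma compact_nball (M : R) : compact [set x : E | `|x| <= M].
Proof.
apply: bounded_closed_compact.
  exists M; split; first exact: num_real.
  by move=> y My x /= xM; exact: le_trans xM (ltW My).
rewrite (_ : [set x | _] = (fun x : E => `|x|) @^-1` [set y | y <= M])//.
apply: preimage_closed; last exact: closed_le.
by move=> x _; exact: norm_continuous.
Qed.

Lemma Cc_bms f : Cc f -> bms f.
Proof.
move=> [cf [M fM]]; split; first exact: continuous_measurable_rV.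
have cK := @compact_nball `|M|.
have K0 : [set x : E | `|x| <= `|M|] !=set0 by exists 0; rewrite /= normr0.
have cn : continuous (fun x => `|f x|).
  by move=> x; apply: continuous_comp; [exact: cf|exact: norm_continuous].
have [c cM cmax] := EVT_max_rV K0 cK (continuous_subspaceT cn).
exists `|f c|, `|M|; split => // [x|x Mx].
  have [xM|xM] := leP `|x| `|M|; first by apply: cmax; rewrite inE.
  by rewrite fM ?normr0//; exact: le_lt_trans (ler_norm M) xM.
by apply: fM; exact: le_lt_trans (ler_norm M) Mx.
Qed.

Lemma bms_integrable f : bms f -> mu.-integrable setT (EFin \o f).
Proof.
move=> [mf [C [M [C0 M0 fC fM]]]].
pose K := [set x : E | `|x| <= M].
apply: (@le_integrable _ _ _ mu setT measurableT _ (fun x => (C * \1_K x)%:E)).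
- exact/measurable_EFinP.
- move=> x _ /=; rewrite lee_fin.
  have [xM|xM] := leP `|x| M.
    by rewrite indicE mem_set// mulr1 (le_trans (fC x))// ler_norm.
  by rewrite fM// normr0.
- apply/integrableP; split.
    apply/measurable_EFinP; apply: measurable_funM; first exact: measurable_cst.
    by apply: measurable_indic; exact: measurable_nball.
  under eq_integral.
    move=> x _; rewrite /= ger0_norm; last by rewrite mulr_ge0// indicE.
    rewrite EFinM; over.
  rewrite ge0_integralZl//; last first.
    by apply/measurable_EFinP/measurable_indic; exact: measurable_nball.
  rewrite integral_indic//; last exact: measurable_nball.
  by rewrite setIT lte_mul_pinfty// nball_fin.
Qed.

Lemma integral_bms f : bms f ->
  (\int[mu]_x (f x)%:E)%E = (\int[mu]_x f x)%:E.
Proof.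
move=> /bms_integrable bf; rewrite /Rintegral fineK//.
exact: integrable_fin_num.
Qed.

Lemma bmsD f g : bms f -> bms g -> bms (fun x => f x + g x).
Proof.
move=> [mf [C [M [C0 M0 fC fM]]]] [mg [D [N [D0 N0 gD gN]]]]; split.
  exact: measurable_funD.
exists (C + D), (M + N); split; [exact: addr_ge0|exact: addr_ge0| |].
  by move=> x; rewrite (le_trans (ler_normD _ _))// lerD.
move=> x MNx; rewrite fM ?gN ?addr0//; apply: le_lt_trans MNx.
  by rewrite lerDr.
by rewrite lerDl.
Qed.

Lemma bmsM f g : measurable_fun setT g -> (exists D, forall x, `|g x| <= D) ->
  bms f -> bms (fun x => g x * f x).
Proof.
move=> mg [D gD] [mf [C [M [C0 M0 fC fM]]]]; split.
  exact: measurable_funM.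
exists (`|D| * C), M; split => //; first exact: mulr_ge0.
  by move=> x; rewrite normrM ler_pM// (le_trans (gD x))// ler_norm.
by move=> x Mx; rewrite fM ?mulr0.
Qed.

Lemma bmsZ (c : R) f : bms f -> bms (fun x => c * f x).
Proof.
by move=> bf; apply: bmsM => //; exists `|c|.
Qed.

Lemma bmsN f : bms f -> bms (fun x => - f x).
Proof.
move=> /(bmsZ (-1)); congr (bms _); by apply/funext => x; rewrite mulN1r.
Qed.

Lemma bms0 : bms (fun=> 0).
Proof.
split; first exact: measurable_cst.
by exists 0, 0; split => // x; rewrite normr0.
Qed.

Lemma bms_sum (I : Type) (r : seq I) (P : pred I) (F : I -> E -> R) :
  (forall i, P i -> bms (F i)) -> bms (fun x => \sum_(i <- r | P i) F i x).
Proof.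
move=> bF; rewrite -fct_sumE; elim/big_ind : _ => //; first exact: bms0.
by move=> f g; exact: bmsD.
Qed.

Lemma RintD f g : bms f -> bms g ->
  \int[mu]_x (f x + g x) = \int[mu]_x f x + \int[mu]_x g x.
Proof. by move=> /bms_integrable bf /bms_integrable bg; rewrite RintegralD. Qed.

Lemma RintB f g : bms f -> bms g ->
  \int[mu]_x (f x - g x) = \int[mu]_x f x - \int[mu]_x g x.
Proof. by move=> /bms_integrable bf /bms_integrable bg; rewrite RintegralB. Qed.

Lemma RintZ (c : R) f : bms f -> \int[mu]_x (c * f x) = c * \int[mu]_x f x.
Proof. by move=> /bms_integrable bf; rewrite RintegralZl. Qed.

Lemma Rint_sum (I : Type) (r : seq I) (P : pred I) (F : I -> E -> R) :
  (forall i, P i -> bms (F i)) ->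
  \int[mu]_x (\sum_(i <- r | P i) F i x) = \sum_(i <- r | P i) \int[mu]_x F i x.
Proof.
move=> bF; elim: r => [|i r IH].
  rewrite big_nil; under eq_Rintegral do rewrite big_nil.
  by rewrite Rintegral_cst//= mul0r.
rewrite big_cons; under eq_Rintegral do rewrite big_cons.
case: ifPn => Pi //; rewrite RintD ?IH//; first exact: bF.
exact: bms_sum.
Qed.

Lemma Rint_le f g : bms f -> bms g -> (forall x, f x <= g x) ->
  \int[mu]_x f x <= \int[mu]_x g x.
Proof.
move=> /bms_integrable bf /bms_integrable bg fg.
by apply: le_Rintegral => //; move=> x _; exact: fg.
Qed.

Lemma Rint_ge0 f : (forall x, 0 <= f x) -> 0 <= \int[mu]_x f x.
Proof. by move=> f0; apply: Rintegral_ge0 => x _; exact: f0. Qed.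

(** A common bound and a common bounded support give a multiple of the indicator of a ball as
    dominating function. Most limits of integrals below are taken in this form. *)
Lemma Rint_dct (F : nat -> E -> R) f (C M : R) :
  (forall k, measurable_fun setT (F k)) ->
  (forall k x, `|F k x| <= C) -> (forall k x, M < `|x| -> F k x = 0) ->
  (forall x, F k x @[k --> \oo] --> f x) ->
  bms f /\ \int[mu]_x F k x @[k --> \oo] --> \int[mu]_x f x.
Proof.
move=> mF FC FM Ff.
have mf : measurable_fun setT f.
  by apply: (measurable_fun_cvg (h := F)) => // x _; exact: Ff.
have bf : bms f.
  split => //; exists `|C|, `|M|; split => // x.
    have h : `|F k x| @[k --> \oo] --> `|f x| by apply: cvg_norm; exact: Ff.
    rewrite -(cvg_lim (@Rhausdorff R) h); apply: limr_le.
      by apply/cvg_ex; eexists; exact: h.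
    by near=> k; apply: le_trans (FC k x) _; exact: ler_norm.
  move=> Mx; rewrite -(cvg_lim (@Rhausdorff R) (Ff x)).
  rewrite (_ : (fun k => F k x) = cst 0) ?lim_cst//.
  apply/funext => k; apply: FM; exact: le_lt_trans (ler_norm M) Mx.
split => //.
pose K := [set x : E | `|x| <= `|M|].
pose g x := (`|C| * \1_K x)%:E.
have bg : bms (fun x => `|C| * \1_K x).
  apply: bmsZ; split.
    by apply: measurable_indic; exact: measurable_nball.
  exists 1, `|M|; split => // x.
    by rewrite indicE; case: (_ \in _); rewrite ?normr1 ?normr0.
  by move=> Mx; rewrite indicE memNset//= => /(lt_le_trans Mx); rewrite ltxx.
have [] := @dominated_convergence _ _ _ mu setT measurableT
  (fun k x => (F k x)%:E) (fun x => (f x)%:E) g.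
- by move=> k; exact/measurable_EFinP.
- exact/measurable_EFinP.
- by apply/aeW => x _; apply: cvg_EFin; [exact: nearW|exact: Ff].
- exact: bms_integrable bg.
- apply/aeW => x k _; rewrite lee_fin.
  have [xM|xM] := leP `|x| `|M|.
    by rewrite indicE mem_set// mulr1 (le_trans (FC k x))// ler_norm.
  by rewrite FM ?normr0 ?mulr_ge0//; exact: le_lt_trans (ler_norm M) xM.
by move=> _ _ h; apply: fine_cvg; rewrite integral_bms// in h *.
Unshelve. all: by end_near. Qed.

Lemma bms_max0 f : bms f -> bms (fun x => Num.max (f x) 0).
Proof.
move=> [mf [C [M [C0 M0 fC fM]]]]; split.
  by apply: measurable_maxr => //; exact: measurable_cst.
exists C, M; split => // x; last by move=> /fM ->; rewrite maxxx.
by rewrite ger0_norm ?le_max ?lexx ?orbT// ge_max C0 (le_trans (ler_norm _)).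
Qed.

Lemma max0_split f : f = (fun x => Num.max (f x) 0 - Num.max (- f x) 0).
Proof.
apply/funext => x; have [f0|f0] := leP 0 (f x).
  by rewrite max_r ?subr0// oppr_le0.
by rewrite max_l ?oppr_ge0 ?(ltW f0)// opprK add0r.
Qed.

Lemma Rint_scale f (t : R) : 0 < t -> bms f ->
  t ^+ m * \int[mu]_x f (t *: x) = \int[mu]_x f x.
Proof.
move=> t0 bf; have tm : 0 <= t ^+ m by rewrite exprn_ge0// ltW.
have bt g : bms g -> bms (fun x => g (t *: x)).
  move=> [mg [C [M [C0 M0 gC gM]]]]; split.
    apply: (measurableT_comp mg); apply: continuous_measurable_rV_rV => x.
    exact: (cvgZ (cvg_cst t) cvg_id).
  exists C, (M / t); split => //; first by rewrite divr_ge0// ltW.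
  move=> x Mx; apply: gM; rewrite normrZ gtr0_norm//.
  by rewrite mulrC -ltr_pdivrMr.
have pos g : bms g -> (forall x, 0 <= g x) ->
    t ^+ m * \int[mu]_x g (t *: x) = \int[mu]_x g x.
  move=> bg g0; apply: EFin_inj; rewrite EFinM -(integral_bms bg).
  rewrite -(integral_bms (bt _ bg)).
  apply: (ge0_integral_rV_scale t0 (f := EFin \o g)).
    by apply/measurable_EFinP; case: bg.
  by move=> x; rewrite lee_fin.
have bm := bms_max0 bf; have bn := bms_max0 (bmsN bf).
rewrite (max0_split f) [RHS]RintB// [X in _ * X](RintB (bt _ bm) (bt _ bn)).
by rewrite mulrBr (pos _ bm) ?(pos _ bn)// => x; rewrite le_max lexx orbT.
Qed.

Lemma eq_bms f g : f =1 g -> bms f -> bms g.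
Proof. by move=> /funext ->. Qed.

Lemma bms_shift f h : bms f -> bms (fun x => f (x + h)).
Proof.
move=> [mf [C [M [C0 M0 fC fM]]]]; split.
  apply: (measurableT_comp mf); apply: continuous_measurable_rV_rV => x.
  exact: (cvgD cvg_id (cvg_cst h)).
exists C, (M + `|h|); split => //; first exact: addr_ge0.
move=> x Mx; apply: fM; have := ler_normB (x + h) h; rewrite addrK.
by move: Mx; lra.
Qed.

Lemma Rint_shift f h : bms f -> \int[mu]_x f (x + h) = \int[mu]_x f x.
Proof.
have pos g : bms g -> (forall x, 0 <= g x) ->
    \int[mu]_x g (x + h) = \int[mu]_x g x.
  move=> bg g0; apply: EFin_inj; rewrite -(integral_bms bg).
  rewrite -(integral_bms (bms_shift h bg)).
  apply: (ge0_integral_rV_shift h (f := EFin \o g)).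
    by apply/measurable_EFinP; case: bg.
  by move=> x; rewrite lee_fin.
move=> bf; have bm := bms_max0 bf; have bn := bms_max0 (bmsN bf).
rewrite (max0_split f) [RHS]RintB// (RintB (bms_shift h bm) (bms_shift h bn)).
by rewrite (pos _ bm) ?(pos _ bn)// => x; rewrite le_max lexx orbT.
Qed.

Lemma CcD f g : Cc f -> Cc g -> Cc (fun x => f x + g x).
Proof.
move=> [cf [M fM]] [cg [N gN]]; split.
  by move=> x; apply: continuousD; [exact: cf|exact: cg].
exists (Num.max M N) => x; rewrite gt_max => /andP[Mx Nx].
by rewrite fM// gN// addr0.
Qed.

Lemma CcM f g : continuous g -> Cc f -> Cc (fun x => g x * f x).
Proof.
move=> cg [cf [M fM]]; split.
  by move=> x; apply: continuousM; [exact: cg|exact: cf].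
by exists M => x Mx; rewrite fM// mulr0.
Qed.

Lemma continuous_sum_fct (I : Type) (r : seq I) (P : pred I) (F : I -> E -> R) :
  (forall i, P i -> continuous (F i)) ->
  continuous (fun x => \sum_(i <- r | P i) F i x).
Proof.
move=> cF; rewrite -fct_sumE; elim/big_ind : _ => //.
  exact: cst_continuous.
by move=> f g cf cg x; apply: continuousD; [exact: cf|exact: cg].
Qed.

Lemma continuous_prod_fct (I : Type) (r : seq I) (P : pred I) (F : I -> E -> R) :
  (forall i, P i -> continuous (F i)) ->
  continuous (fun x => \prod_(i <- r | P i) F i x).
Proof.
move=> cF; elim: r => [|i r IH].
  rewrite (_ : (fun=> _) = cst 1); first exact: cst_continuous.
  by apply/funext => x; rewrite big_nil.
under eq_fun do rewrite big_cons.
case: (P i) (cF i) => // /(_ isT) cFi x.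
by apply: continuousM; [exact: cFi|exact: IH].
Qed.

Lemma Cc_sum (I : Type) (r : seq I) (P : pred I) (F : I -> E -> R) :
  (forall i, P i -> Cc (F i)) -> Cc (fun x => \sum_(i <- r | P i) F i x).
Proof.
move=> cF; rewrite -fct_sumE; elim/big_ind : _ => //; last by move=> f g; exact: CcD.
by split; [exact: cst_continuous|exists 0].
Qed.

End bounded_support_integrals.

(** * Directional derivatives *)

Section derivatives_rV.
Context (R : realType) (m : nat).
Local Notation E := 'rV[R]_m.
Local Notation mu := (lebesgue_rV R m).
Local Notation e := (@basis_vec R m).
Implicit Types (f g : E -> R).

(** Turns a directional derivative into a derivative in one variable, where the mean value theorem
    and the chain rule apply. *)
Lemma is_derive_lineP (V : normedModType R) (f : V -> R) (x v : V) (df : R) :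
  is_derive x v f df <-> is_derive (0 : R) 1 (fun t : R => f (x + t *: v)) df.
Proof.
have E1 : (fun h : R => h^-1 *: ((f \o shift x) (h *: v) - f x)) =
  (fun h : R => h^-1 *: (((fun t : R => f (x + t *: v)) \o shift 0) (h *: 1) -
                       f (x + 0 *: v))).
  apply/funext => h /=.
  by rewrite scale0r !addr0 [h%:A]mulr1 (addrC x).
by split => -[dv <-]; split; move: dv; rewrite /derivable /derive -E1 ?E1.
Qed.

Lemma is_derive_line f (x v : E) (t : R) (df : R) :
  is_derive (x + t *: v) v f df ->
  is_derive t 1 (fun s : R => f (x + s *: v)) df.
Proof.
move=> H; apply/is_derive_lineP; move/is_derive_lineP : H.
congr is_derive; apply/funext => s.
by rewrite scalerDl addrA [s%:A]mulr1.
Qed.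

(* Translation invariance kills the integral of the difference quotients. *)
Lemma Rint_deriv0 f df i : Cc f -> Cc df ->
  (forall x, is_derive x (e i) f (df x)) -> \int[mu]_x df x = 0.
Proof.
move=> Cf Cdf fdf.
have [D [M [D0 M0 dD dM]]] := (Cc_bms Cdf).2.
have [D' [N [D0' N0 fD fN]]] := (Cc_bms Cf).2.
pose h k : R := k.+1%:R^-1.
have h0 k : 0 < h k by rewrite invr_gt0.
pose F k x := (h k)^-1 * (f (x + h k *: e i) - f x).
have line x t : is_derive (t : R) (1 : R) (fun s : R => f (x + s *: e i)) (df (x + t *: e i)).
  exact: is_derive_line.
have FD k x : `|F k x| <= D.
  have [|c _] := @MVT_segment _ (fun s : R => f (x + s *: e i))
    (fun s => df (x + s *: e i)) 0 (h k) (ltW (h0 k)) (fun t _ => line x t).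
    apply: derivable_within_continuous => t _; by case: (line x t).
  rewrite scale0r addr0 subr0 /F => ->.
  by rewrite mulrC mulfK ?gt_eqF.
have ni : `|e i| <= 1.
  apply/mx_norm_leP => // k; rewrite mxE; case: (_ && _); rewrite ?normr1 ?normr0//.
have [] := @Rint_dct R m F df D (N + 1).
- move=> k; apply: measurable_funM; first exact: measurable_cst.
  by apply: measurable_funB; [case: (bms_shift (h k *: e i) (Cc_bms Cf))|case: (Cc_bms Cf)].
- exact: FD.
- move=> k x Nx; rewrite /F !fN ?subr0 ?mulr0//; first by lra.
  have := ler_normB (x + h k *: e i) (h k *: e i); rewrite addrK normrZ gtr0_norm//.
  have h1 : h k <= 1 by rewrite invf_le1// ler1n.
  have : h k * `|e i| <= 1 by rewrite mulr_ile1// ltW.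
  by lra.
- move=> x.
  have /is_derive_lineP[] := fdf x.
  move=> /cvg_ex[l] H; rewrite /derive (cvg_lim (@Rhausdorff R) H) => ldf; subst l.
  move/cvgr_dnbhsP : H => /(_ h) H.
  have /H : (forall k, h k != 0) /\ h k @[k --> \oo] --> 0.
    by split=> [k|]; [rewrite gt_eqF|exact: cvg_harmonic].
  apply: cvg_trans; apply: near_eq_cvg; apply: nearW => k /=.
  by rewrite scale0r !addr0 /F [(h k)%:A]mulr1.
move=> _; rewrite (_ : (fun k => _) = cst 0).
  by move/(cvg_lim (@Rhausdorff R)) <-; rewrite lim_cst.
apply/funext => k; rewrite /F RintZ; last first.
  by apply: (bmsD (bms_shift _ (Cc_bms Cf)) (bmsN (Cc_bms Cf))).
by rewrite RintB ?Rint_shift ?subrr ?mulr0//; [exact: Cc_bms|exact/bms_shift/Cc_bms|exact: Cc_bms].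
Qed.

End derivatives_rV.

(** * Null Lagrangians *)

Section continuity_combinators.
Context (R : realType) (T : topologicalType).
Implicit Types f g : T -> R.

Lemma contD f g : continuous f -> continuous g -> continuous (fun x => f x + g x).
Proof. by move=> cf cg x; apply: continuousD; [exact: cf|exact: cg]. Qed.

Lemma contB f g : continuous f -> continuous g -> continuous (fun x => f x - g x).
Proof. by move=> cf cg x; apply: continuousB; [exact: cf|exact: cg]. Qed.

Lemma contM f g : continuous f -> continuous g -> continuous (fun x => f x * g x).
Proof. by move=> cf cg x; apply: continuousM; [exact: cf|exact: cg]. Qed.

Lemma contZ c f : continuous f -> continuous (fun x => c * f x).
Proof. by move=> cf; apply: contM => //; exact: cst_continuous. Qed.

End continuity_combinators.

Section product_rule.
Context (R : realType) (V : normedModType R).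

Lemma is_derive_eq0 (f : V -> R) (x v : V) (d : R) :
  (\forall y \near x, f y = 0) -> is_derive x v f d -> d = 0.
Proof.
move=> fx0 [_ <-].
rewrite (@near_eq_derive _ _ _ f (cst 0) x v); last exact: fx0.
exact: derive_cst.
Qed.

Lemma is_derive_prod_seq (I : eqType) (r : seq I) (F : I -> V -> R)
    (dF : I -> R) (x v : V) : uniq r ->
  (forall i, i \in r -> is_derive x v (F i) (dF i)) ->
  is_derive x v (fun y => \prod_(k <- r) F k y)
    (\sum_(l <- r) dF l * \prod_(k <- r | k != l) F k x).
Proof.
elim: r => [_ _|i r IH /= /andP[ir ur] dFr].
  rewrite big_nil (_ : (fun _ => _) = cst 1); first exact: is_derive_cst.
  by apply/funext => y; rewrite big_nil.
have di := dFr i (mem_head _ _).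
have {IH} dr := IH ur (fun k kr => dFr k (mem_behead (s := i :: r) kr)).
have := is_deriveM di dr.
congr is_derive; first by apply/funext => y; rewrite big_cons.
rewrite big_cons big_cons eqxx /= addrC; congr (_ + _).
  rewrite [LHS]mulrC; congr (_ * _); rewrite [RHS]big_seq_cond [LHS]big_seq.
  apply: eq_bigl => k; case: (boolP (k \in r)) => //= kr.
  by apply/esym; apply: contraNneq ir => <-.
rewrite [LHS]mulr_sumr [LHS]big_seq [RHS]big_seq; apply: eq_bigr => l lr.
rewrite big_cons ifT; last by apply: contraNneq ir => ->.
by rewrite mulrCA.
Qed.

Lemma is_derive_prod (I : finType) (P : pred I) (F : I -> V -> R)
    (dF : I -> R) (x v : V) :
  (forall i, P i -> is_derive x v (F i) (dF i)) ->
  is_derive x v (fun y => \prod_(k | P k) F k y)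
    (\sum_(l | P l) dF l * \prod_(k | P k && (k != l)) F k x).
Proof.
move=> dFP; have := @is_derive_prod_seq I (enum P) F dF x v (enum_uniq P).
move=> /(_ _)/wrap[i|]; first by rewrite mem_enum => /dFP.
congr is_derive; first by apply/funext => y; rewrite big_enum.
rewrite big_enum /=; apply: eq_bigr => l Pl; congr (_ * _).
by rewrite big_enum_cond.
Qed.

End product_rule.

Section null_lagrangian.
Context (R : realType) (m : nat).
Local Notation E := 'rV[R]_m.
Local Notation mu := (lebesgue_rV R m).
Local Notation e := (@basis_vec R m).

(** Composition with the transposition permutes the summation range and flips the sign, so the sum
    equals its own opposite. *)
Lemma perm_antisym_sum0 (i0 l : 'I_m) (T : {perm 'I_m} -> R) : l != i0 ->
  (forall s : {perm 'I_m}, T (tperm i0 l * s)%g = T s) ->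
  \sum_(s : {perm 'I_m}) (-1) ^+ s * T s = 0.
Proof.
move=> li0 Ts; set S := \sum_s _.
suff : S = - S by move/eqP; rewrite -addr_eq0 -mulr2n mulrn_eq0 /= => /eqP.
rewrite {1}/S (reindex_inj (mulgI (tperm i0 l))) /= -sumrN.
apply: eq_bigr => s _; rewrite Ts odd_permM odd_tperm eq_sym li0.
by rewrite signr_addb expr1 mulN1r mulNr.
Qed.

(* Expanding the determinant by the Leibniz formula and integrating by parts,
   the second derivatives of the H_k cancel in pairs of permutations. *)
Lemma null_lagrangian (i0 : 'I_m) (W : E -> R) (dW : 'I_m -> E -> R)
    (dH : 'I_m -> 'I_m -> E -> R) (d2H : 'I_m -> 'I_m -> 'I_m -> E -> R) (M : R) :
  continuous W -> (forall a, continuous (dW a)) ->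
  (forall a x, is_derive x (e a) W (dW a x)) ->
  (forall k a, continuous (dH k a)) ->
  (forall k a b, continuous (d2H k a b)) ->
  (forall k a b x, is_derive x (e b) (dH k a) (d2H k a b x)) ->
  (forall k a b x, d2H k a b x = d2H k b a x) ->
  (forall x, M < `|x| -> W x = 0 \/
     exists2 k, k != i0 & forall a, dH k a x = 0) ->
  \int[mu]_x (\det (\matrix_(k, a) if k == i0 then dW a x else dH k a x)) = 0.
Proof.
move=> cW cdW WdW cdH cd2H dHd2H symH supp.
pose P (s : {perm 'I_m}) x := \prod_(k | k != i0) dH k (s k) x.
pose Phi s x := W x * P s x.
pose Q (s : {perm 'I_m}) l x := \prod_(k | (k != i0) && (k != l)) dH k (s k) x.
pose S (s : {perm 'I_m}) x := \sum_(l | l != i0) d2H l (s l) (s i0) x * Q s l x.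
pose dPhi (s : {perm 'I_m}) x := dW (s i0) x * P s x + W x * S s x.
have PhidPhi (s : {perm 'I_m}) x : is_derive x (e (s i0)) (Phi s) (dPhi s x).
  have := is_deriveM (WdW (s i0) x)
    (@is_derive_prod R _ _ (fun k => k != i0) (fun k => dH k (s k))
      (fun l => d2H l (s l) (s i0) x) x (e (s i0)) (fun k _ => dHd2H k (s k) (s i0) x)).
  by congr is_derive; rewrite /dPhi addrC; congr (_ + _); rewrite [LHS]mulrC.
have cP (s : {perm 'I_m}) : continuous (P s) by apply: continuous_prod_fct => k _; exact: cdH.
have cS (s : {perm 'I_m}) : continuous (S s).
  apply: continuous_sum_fct => l _ x.
  apply: continuousM; first exact: cd2H.
  by apply: continuous_prod_fct => k _; exact: cdH.
have Phi0 (s : {perm 'I_m}) x : M < `|x| -> Phi s x = 0.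
  move=> /supp[W0|[k ki0 dH0]]; first by rewrite /Phi W0 mul0r.
  by rewrite /Phi /P (bigD1 k)//= dH0 mul0r mulr0.
have CcPhi (s : {perm 'I_m}) : Cc (Phi s).
  split; last by exists M => x; exact: Phi0.
  by move=> x; apply: continuousM; [exact: cW|exact: cP].
have CcdPhi (s : {perm 'I_m}) : Cc (dPhi s).
  split.
    apply: contD; first by apply: contM; [exact: cdW|exact: cP].
    by apply: contM; [exact: cW|exact: cS].
  exists M => x Mx; apply: is_derive_eq0 (PhidPhi s x).
  have : \forall y \near x, M < `|y|.
    exact: (cvgr_gt _ (@norm_continuous _ _ x) _ Mx).
  by apply: filterS => y; exact: Phi0.
have detE x : \det (\matrix_(k, a) if k == i0 then dW a x else dH k a x) =
    \sum_(s : {perm 'I_m}) (-1) ^+ s * dPhi s x.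
  transitivity (\sum_(s : {perm 'I_m}) (-1) ^+ s * (dW (s i0) x * P s x) +
    W x * \sum_(l | l != i0) \sum_(s : {perm 'I_m}) (-1) ^+ s * (d2H l (s l) (s i0) x * Q s l x)).
    rewrite [X in _ + _ * X]big1 ?mulr0 ?addr0; last first.
      move=> l li0; apply: (perm_antisym_sum0 li0) => s.
      rewrite permM tpermR permM tpermL symH; congr (_ * _).
      apply: eq_bigr => k /andP[ki0 kl]; rewrite permM tpermD 1?eq_sym//.
    rewrite /determinant; apply: eq_bigr => s _; congr (_ * _).
    rewrite (bigD1 i0)//= mxE eqxx; congr (_ * _).
    by apply: eq_bigr => k ki0; rewrite mxE (negbTE ki0).
  rewrite exchange_big mulr_sumr -big_split; apply: eq_bigr => s _ /=.
  rewrite /dPhi /S mulrDr; congr (_ + _).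
  by rewrite -mulr_sumr mulrCA.
under eq_Rintegral do rewrite detE.
rewrite Rint_sum => [|s _]; last exact/bmsZ/Cc_bms.
apply: big1 => s _; rewrite RintZ; last exact: Cc_bms.
by rewrite (Rint_deriv0 (CcPhi s) (CcdPhi s) (PhidPhi s)) mulr0.
Qed.

(* Telescoping over the rows. *)
Lemma det_null_lagrangian_diff (H1 H2 : 'I_m -> E -> R)
    (d1 d2 : 'I_m -> 'I_m -> E -> R)
    (dd1 dd2 : 'I_m -> 'I_m -> 'I_m -> E -> R) (M : R) :
  (forall k, continuous (H1 k)) -> (forall k, continuous (H2 k)) ->
  (forall k a, continuous (d1 k a)) -> (forall k a, continuous (d2 k a)) ->
  (forall k a b, continuous (dd1 k a b)) -> (forall k a b, continuous (dd2 k a b)) ->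
  (forall k a x, is_derive x (e a) (H1 k) (d1 k a x)) ->
  (forall k a x, is_derive x (e a) (H2 k) (d2 k a x)) ->
  (forall k a b x, is_derive x (e b) (d1 k a) (dd1 k a b x)) ->
  (forall k a b x, is_derive x (e b) (d2 k a) (dd2 k a b x)) ->
  (forall k a b x, dd1 k a b x = dd1 k b a x) ->
  (forall k a b x, dd2 k a b x = dd2 k b a x) ->
  (forall x, M < `|x| -> exists k, [/\ H1 k x = H2 k x,
     forall a, d1 k a x = 0 & forall a, d2 k a x = 0]) ->
  bms (fun x => \det (\matrix_(k, a) d1 k a x)) /\
  \int[mu]_x (\det (\matrix_(k, a) d1 k a x)) =
  \int[mu]_x (\det (\matrix_(k, a) d2 k a x)).
Proof.
move=> c1 c2 cd1 cd2 cdd1 cdd2 D1 D2 DD1 DD2 s1 s2 supp.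
(* A hybrid matrix: its rows before [i] come from [d2], the others from [d1]. Consecutive hybrids
   differ in one row, so the difference of their determinants has the form treated by
   [null_lagrangian]. *)
pose A i x : 'M[R]_m := \matrix_(k, a) if (k < i)%N then d2 k a x else d1 k a x.
have cdet (F : 'I_m -> 'I_m -> E -> R) : (forall k a, continuous (F k a)) ->
    continuous (fun x => \det (\matrix_(k, a) F k a x)).
  move=> cF; rewrite /determinant; apply: continuous_sum_fct => s _; apply: contZ.
  apply: continuous_prod_fct => k _.
  by under eq_fun do rewrite mxE; exact: cF.
have CcA i : Cc (fun x => \det (A i x)).
  split.
    have := @cdet (fun k a x => if (k < i)%N then d2 k a x else d1 k a x).
    by apply => k a; case: (k < i)%N.
  exists M => x /supp[k [_ d10 d20]].
  rewrite (expand_det_row _ k); apply: big1 => a _.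
  by rewrite mxE; case: ifP; rewrite ?d10 ?d20 mul0r.
have step i : (i <= m)%N -> \int[mu]_x \det (A i x) = \int[mu]_x \det (A 0%N x).
  elim: i => // i IH im; rewrite -(IH (ltnW im)).
  apply/eqP; rewrite -subr_eq0 -RintB; [|exact: Cc_bms..].
  pose i0 := Ordinal im.
  have li0 k : (lift i0 k == i0) = false.
    by apply/negbTE; rewrite eq_sym neq_lift.
  have li k : (lift i0 k == i :> nat) = false by have := li0 k; rewrite -val_eqE.
  pose dW a x := d2 i0 a x - d1 i0 a x.
  pose dH (k a : 'I_m) x := if (k < i)%N then d2 k a x else d1 k a x.
  apply/eqP; rewrite -[RHS](@null_lagrangian i0 (fun x => H2 i0 x - H1 i0 x) dW dH
    (fun k a b x => if (k < i)%N then dd2 k a b x else dd1 k a b x) M).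
  - apply: eq_Rintegral => x _; apply/eqP.
    rewrite subr_eq -[X in X + _]mul1r -[X in _ + X]mul1r eq_sym; apply/eqP/esym.
    apply: (determinant_multilinear (i0 := i0)).
    + apply/rowP => a; rewrite !mxE eqxx ltnS leqnn ltnn !mul1r /dW.
      by rewrite subrK.
    + apply/matrixP => k a; rewrite !mxE ?li0 /dH.
      by rewrite ?ltnS ?[(lift i0 k <= i)%N]leq_eqVlt ?li.
    + apply/matrixP => k a; rewrite !mxE ?li0 /dH.
      by rewrite ?ltnS ?[(lift i0 k <= i)%N]leq_eqVlt ?li.
  - by move=> x; apply: continuousB; [exact: c2|exact: c1].
  - by move=> a x; apply: continuousB; [exact: cd2|exact: cd1].
  - by move=> k a; rewrite /dH; case: (k < i)%N.
  - by move=> k a b; case: (k < i)%N.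
  - by move=> k a b x; rewrite /dH; case: (k < i)%N.
  - by move=> k a b x; rewrite (s1 k a b) (s2 k a b).
  - move=> x /supp[k [kH k1 k2]]; have [ki|ki] := eqVneq k i0.
      by left; rewrite -ki kH subrr.
    by right; exists k => // a; rewrite /dH; case: ifP.
have A0 x : A 0%N x = \matrix_(k, a) d1 k a x by apply/matrixP => k a; rewrite !mxE.
have Am x : A m x = \matrix_(k, a) d2 k a x.
  by apply/matrixP => k a; rewrite !mxE ltn_ord.
split; first by under eq_fun do rewrite -A0; exact: Cc_bms.
have := step m (leqnn m).
by under eq_Rintegral do rewrite Am; under [in RHS]eq_Rintegral do rewrite A0.
Qed.

End null_lagrangian.

(** * Convexity and mollification *)

Section euclidean.
Context (R : realType) (m : nat).
Local Notation E := 'rV[R]_m.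
Implicit Types (x y z : E) (c : R).

Lemma dotvC x y : dotv x y = dotv y x.
Proof. by apply: eq_bigr => i _; rewrite mulrC. Qed.

Lemma dotvDl x y z : dotv (x + y) z = dotv x z + dotv y z.
Proof. by rewrite -big_split; apply: eq_bigr => i _; rewrite mxE mulrDl. Qed.

Lemma dotvZl c x z : dotv (c *: x) z = c * dotv x z.
Proof. by rewrite mulr_sumr; apply: eq_bigr => i _; rewrite mxE mulrA. Qed.

Lemma dotvDr x y z : dotv z (x + y) = dotv z x + dotv z y.
Proof. by rewrite dotvC dotvDl !(dotvC z). Qed.

Lemma dotvZr c x z : dotv z (c *: x) = c * dotv z x.
Proof. by rewrite dotvC dotvZl dotvC. Qed.

Lemma dotvNl x z : dotv (- x) z = - dotv x z.
Proof. by rewrite -scaleN1r dotvZl mulN1r. Qed.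

Lemma dotvNr x z : dotv z (- x) = - dotv z x.
Proof. by rewrite dotvC dotvNl dotvC. Qed.

Lemma dotvBl x y z : dotv (x - y) z = dotv x z - dotv y z.
Proof. by rewrite dotvDl dotvNl. Qed.

Lemma dotvBr x y z : dotv z (x - y) = dotv z x - dotv z y.
Proof. by rewrite dotvDr dotvNr. Qed.

Lemma dotv0l x : dotv 0 x = 0.
Proof. by rewrite -(scale0r x) dotvZl mul0r. Qed.

Lemma dotv0r x : dotv x 0 = 0.
Proof. by rewrite dotvC dotv0l. Qed.

Definition dotvE := (dotvDl, dotvDr, dotvBl, dotvBr, dotvZl, dotvZr, dotvNl,
  dotvNr, dotv0l, dotv0r).

Lemma dotv_ge0 x : 0 <= dotv x x.
Proof. by apply: sumr_ge0 => i _; rewrite -expr2 sqr_ge0. Qed.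

Lemma dotv_eq0 x : dotv x x = 0 -> x = 0.
Proof.
move=> /eqP; rewrite psumr_eq0; last by move=> i _; rewrite -expr2 sqr_ge0.
move=> /allP h; apply/rowP => i; rewrite mxE.
by have := h i (mem_index_enum _); rewrite -expr2 sqrf_eq0 => /eqP.
Qed.

Lemma enorm_ge0 x : 0 <= enorm x.
Proof. exact: sqrtr_ge0. Qed.

Lemma enorm_sqr x : enorm x ^+ 2 = dotv x x.
Proof. by rewrite sqr_sqrtr// dotv_ge0. Qed.

Lemma enorm0 : enorm (0 : E) = 0.
Proof. by rewrite /enorm dotv0l sqrtr0. Qed.

Lemma enorm_eq0 x : enorm x = 0 -> x = 0.
Proof. by move=> x0; apply: dotv_eq0; rewrite -enorm_sqr x0 expr0n. Qed.

Lemma enorm_gt0 x : (0 < enorm x) = (x != 0).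
Proof.
rewrite lt_def enorm_ge0 andbT; congr negb; apply/eqP/eqP => [/enorm_eq0//|->].
exact: enorm0.
Qed.

Lemma enormZ c x : enorm (c *: x) = `|c| * enorm x.
Proof.
rewrite /enorm dotvZl dotvZr mulrA -expr2 sqrtrM ?sqr_ge0//.
by rewrite sqrtr_sqr.
Qed.

Lemma enormN x : enorm (- x) = enorm x.
Proof. by rewrite -scaleN1r enormZ normrN1 mul1r. Qed.

Lemma enorm_distC x y : enorm (x - y) = enorm (y - x).
Proof. by rewrite -opprB enormN. Qed.

Lemma cauchy_schwarz x y : dotv x y <= enorm x * enorm y.
Proof.
have [->|y0] := eqVneq y 0; first by rewrite dotv0r enorm0 mulr0.
have [->|x0] := eqVneq x 0; first by rewrite dotv0l enorm0 mul0r.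
have := dotv_ge0 (enorm y *: x - enorm x *: y).
rewrite !dotvE -!enorm_sqr (dotvC y x).
have ex : 0 < enorm x by rewrite enorm_gt0.
have ey : 0 < enorm y by rewrite enorm_gt0.
have exy : 0 < enorm x * enorm y by rewrite mulr_gt0.
move=> h; have : 0 <= enorm x * enorm y * (enorm x * enorm y - dotv x y) by lra.
by rewrite pmulr_rge0// subr_ge0.
Qed.

Lemma ler_enormD x y : enorm (x + y) <= enorm x + enorm y.
Proof.
rewrite -(@ler_pXn2r _ 2)// ?nnegrE ?addr_ge0 ?enorm_ge0//.
rewrite enorm_sqr !dotvE sqrrD !enorm_sqr (dotvC y x).
by have := cauchy_schwarz x y; lra.
Qed.

Lemma ler_enorm_dist x y : enorm x <= enorm y + enorm (x - y).
Proof. by apply: le_trans (ler_enormD _ _); rewrite addrC subrK. Qed.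

Lemma mx_norm_le_enorm x : `|x| <= enorm x.
Proof.
apply/mx_norm_leP; first exact: enorm_ge0.
move=> i; rewrite -sqrtr_sqr ler_sqrt ?dotv_ge0//.
rewrite /dotv (bigD1 i)//= -expr2 lerDl.
by apply: sumr_ge0 => k _; rewrite -expr2 sqr_ge0.
Qed.

Lemma enorm_le_mx_norm x : enorm x <= m%:R * `|x|.
Proof.
rewrite -(@ler_pXn2r _ 2)// ?nnegrE ?enorm_ge0 ?mulr_ge0//.
rewrite enorm_sqr exprMn; apply: (@le_trans _ _ (m%:R * `|x| ^+ 2)).
  have -> : m%:R * `|x| ^+ 2 = \sum_(i < m) `|x| ^+ 2.
    by rewrite sumr_const card_ord mulr_natl.
  apply: ler_sum => i _; rewrite -expr2 -[leLHS]real_normK ?num_real// lerXn2r ?nnegrE//.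
  exact: mx_norm_coord.
rewrite ler_wpM2r ?sqr_ge0//.
by case: (m) => [|k]; rewrite ?expr2 ?mulr0// ler_peMr// ler1n.
Qed.

Lemma coord_cont i : continuous (fun x : E => x 0 i).
Proof. exact: coord_continuous. Qed.

Lemma dotv_cont y : continuous (fun x : E => dotv x y).
Proof.
apply: continuous_sum_fct => i _; apply: contM; first exact: coord_cont.
exact: cst_continuous.
Qed.

Lemma dotvxx_cont : continuous (fun x : E => dotv x x).
Proof.
by apply: continuous_sum_fct => i _; apply: contM; exact: coord_cont.
Qed.

Lemma enorm_cont : continuous (@enorm R m).
Proof.
move=> x; apply: continuous_comp; first exact: dotvxx_cont.
exact: sqrt_continuous.
Qed.

(** Dominated convergence speaks of sequences, so continuity of parametric integrals is tested on
    sequences. *)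
Lemma seq_continuous (f : E -> R) x :
  (forall u : nat -> E, u k @[k --> \oo] --> x -> f (u k) @[k --> \oo] --> f x) ->
  {for x, continuous f}.
Proof.
move=> fu; apply/(@cvgrPdist_lt _ _ _ (nbhs x) (nbhs_filter x)) => eps e0; apply: contrapT => nfx.
have H k : exists y, `|x - y| < k.+1%:R^-1 /\ eps <= `|f x - f y|.
  apply: contrapT => /forallNP nH; apply: nfx.
  have k0 : 0 < k.+1%:R^-1 :> R by rewrite invr_gt0.
  apply: (@filterS _ (nbhs x) _ (ball x k.+1%:R^-1)); last exact: nbhsx_ballx.
  move=> y; rewrite -ball_normE /= => xy; rewrite ltNge; apply/negP => ey.
  exact: (nH y).
have [u uH] := choice H.
have ux : u k @[k --> \oo] --> x.
  apply/cvgrPdist_lt => d d0; near=> k.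
  apply: lt_trans (uH k).1 _.
  by near: k; exact: near_infty_natSinv_lt (PosNum d0).
have /cvgrPdist_lt /(_ eps e0)[N _ /(_ N (leqnn _))] := fu _ ux.
by move=> /(le_lt_trans (uH N).2); rewrite ltxx.
Unshelve. all: by end_near. Qed.

Lemma continuous_rV k (F : E -> 'rV[R]_k) :
  (forall i, continuous (fun x => F x 0 i)) -> continuous F.
Proof.
move=> cF x; apply/(@cvgrPdist_le _ _ _ (nbhs x) (nbhs_filter x)) => eps e0.
have : \forall y \near x, forall i, `|F x 0 i - F y 0 i| <= eps.
  apply: (@filter_forall _ _ (fun i y => `|F x 0 i - F y 0 i| <= eps) (nbhs x) (nbhs_filter x)) => i; have /(@cvgrPdist_le _ _ _ (nbhs x) (nbhs_filter x)) := cF i x; exact.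
apply: filterS => y h; apply/mx_norm_leP; first exact: ltW.
by move=> i; rewrite !mxE.
Qed.

End euclidean.

Section convexity.
Context (R : realType).

(** Convexity with a plain real coefficient in place of the bundled element of the unit interval in
    [convex_function]. *)
Definition cvx (V : lmodType R) (v : V -> R) := forall x y (t : R), 0 <= t <= 1 ->
  v (t *: x + (1 - t) *: y) <= t * v x + (1 - t) * v y.

Lemma ConvP m (v : 'rV[R]_m -> R) : Conv v <-> cvx v.
Proof.
split=> [cv x y t /andP[t0 t1]|cv t x y _ _].
  have := cv (Itv01 t0 t1) x y; rewrite !inE => /(_ Logic.I Logic.I).
  by rewrite convRE.
have := cv x y t%:num; rewrite convRE; apply.
by rewrite ge0 le1.
Qed.

End convexity.

(** * A bump function with three continuous derivatives *)

Section smooth_kernel.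
Context (R : realType).
Implicit Types (s x : R).

Definition ppart s : R := Num.max 0 s.

Lemma ppart_ge0 s : 0 <= ppart s.
Proof. by rewrite /ppart le_max lexx. Qed.

Lemma ppart_cont : continuous ppart.
Proof.
move=> s; apply: (@continuous_max R _ (cst 0) id s); first exact: cst_continuous.
exact: cvg_id.
Qed.

(** Away from the kink the function is locally zero or a power; at the kink the difference quotient
    of a power at least two is eventually bounded by [|h|]. *)
Lemma is_derive_ppartX (k : nat) s :
  is_derive s (1 : R) (fun x => ppart x ^+ k.+2) (k.+2%:R * ppart s ^+ k.+1).
Proof.
have [s0|s0|s0] := ltgtP s 0.
- rewrite [ppart s]max_l ?(ltW s0)// expr0n mulr0.
  apply: (@near_eq_is_derive _ _ _ (cst (0 : R)) (fun x => ppart x ^+ k.+2) s 1 0).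
  have : \forall x \near s, x < 0 by exact: (cvgr_lt _ (@cvg_id _ (nbhs s)) _ s0).
  by apply: filterS => x x0; rewrite /ppart max_l ?(ltW x0)// expr0n.
- rewrite [ppart s]max_r ?(ltW s0)//.
  apply: (@near_eq_is_derive _ _ _ (fun x : R => x ^+ k.+2)
    (fun x => ppart x ^+ k.+2)).
    have : \forall x \near s, 0 < x by exact: (cvgr_gt _ (@cvg_id _ (nbhs s)) _ s0).
    by apply: filterS => x x0; rewrite /ppart max_r// ltW.
  have := @is_deriveX R R id k.+1.+1 s 1 1 (is_derive_id s 1).
  congr is_derive; last by rewrite [LHS]mulr1.
  elim: (k.+2) => [|l IH]; first by apply/funext => x; rewrite expr0.
  by rewrite exprS IH; apply/funext => x; rewrite exprS.
- rewrite s0 [ppart 0]maxxx expr0n mulr0.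
  have H : h^-1 *: (ppart (h *: 1 + 0) ^+ k.+2 - ppart 0 ^+ k.+2) @[h --> (0:R)^'] --> (0 : R).
    have -> : ppart 0 = 0 by rewrite /ppart maxxx.
    rewrite expr0n /=; apply/cvgrPdist_lt => eps e0.
    near=> h; rewrite subr0 sub0r normrN addr0 [h%:A]mulr1 normrZ.
    have h0 : h != 0 by near: h; exact: nbhs_dnbhs_neq.
    have hh : 0 < `|h| by rewrite normr_gt0.
    have ph : `|ppart h| <= `|h|.
      rewrite ger0_norm ?ppart_ge0// /ppart ge_max normr_ge0 ler_norm//.
    have he : `|h| < eps.
      near: h; apply: nbhs_dnbhs; have /cvgrPdist_lt/(_ eps e0) : h @[h --> (0:R)] --> (0:R) by exact: cvg_id.
      by apply: filterS => y; rewrite sub0r normrN.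
    have h1 : `|h| < 1.
      near: h; apply: nbhs_dnbhs; have /cvgrPdist_lt/(_ 1 ltr01) : h @[h --> (0:R)] --> (0:R) by exact: cvg_id.
      by apply: filterS => y; rewrite sub0r normrN.
    apply: le_lt_trans he; rewrite normfV normrX ler_pdivrMl//.
    apply: (@le_trans _ _ (`|h| ^+ k.+2)); first exact: lerXn2r.
    rewrite 2!exprS mulrA -expr2 ler_piMr ?sqr_ge0// exprn_ile1// ltW//.
  apply: DeriveDef; last exact: (cvg_lim (@Rhausdorff R) H).
  by apply/cvg_ex; exists 0.
Unshelve. all: by end_near. Qed.

(* (-1)^a times the a-th derivative of max(0, 1 - s^2)^5, for a <= 3. *)
Definition bump (a : nat) s : R :=
  let p := ppart (1 - s ^+ 2) in
  match a with
  | 0%N => p ^+ 5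
  | 1%N => 10 * s * p ^+ 4
  | 2%N => 80 * s ^+ 2 * p ^+ 3 - 10 * p ^+ 4
  | _ => 480 * s ^+ 3 * p ^+ 2 - 240 * s * p ^+ 3
  end.

Let q s : R := ppart (1 - s ^+ 2).

Let is_derive_q k s :
  is_derive s (1 : R) (fun x => q x ^+ k.+2) (- 2 * k.+2%:R * s * q s ^+ k.+1).
Proof.
have h : is_derive s (1 : R) (fun x : R => 1 - x ^+ 2) (- (2 * s)).
  have := is_deriveB (is_derive_cst (1 : R) s 1) (@is_deriveX R R id 2 s 1 1 (is_derive_id s 1)).
  by congr is_derive; rewrite /= sub0r [X in - X]mulr1.
have := @is_derive1_comp _ (fun x => ppart x ^+ k.+2) (fun x => 1 - x ^+ 2) s _ _
  (is_derive_ppartX k (1 - s ^+ 2)) h.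
by congr is_derive; rewrite /q; ring.
Qed.

(** The alternating sign in [bump] absorbs the sign produced by differentiating a kernel in [y - x]
    with respect to [x], so that derivatives of mollifications carry no sign. Order three is reached
    because the null Lagrangian argument differentiates the Hessian once more. *)
Lemma is_derive_bump a s : (a < 3)%N ->
  is_derive s (1 : R) (bump a) (- bump a.+1 s).
Proof.
have idd := is_derive_id s (1 : R).
case: a => [|[|[|//]]] _.
- have := is_derive_q 3 s; congr is_derive.
  by rewrite /bump -/(q s); ring.
- have : is_derive s (1 : R) (fun x : R => 10 * x * q x ^+ 4)
      (10 * s * (- 2 * 4%:R * s * q s ^+ 3) + q s ^+ 4 * (10 * 1)).
    exact: (is_deriveM (is_deriveZ (10 : R) idd) (is_derive_q 2 s)).
  by congr is_derive; rewrite /bump -/(q s); ring.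
- have : is_derive s (1 : R) (fun x : R => 80 * x ^+ 2 * q x ^+ 3 - 10 * q x ^+ 4)
      (80 * s ^+ 2 * (- 2 * 3%:R * s * q s ^+ 2) +
       q s ^+ 3 * (80 * (2 * s ^+ 1 * 1)) - 10 * (- 2 * 4%:R * s * q s ^+ 3)).
    exact: (is_deriveB
      (is_deriveM (is_deriveZ (80 : R) (@is_deriveX R R id 2 s 1 1 idd)) (is_derive_q 1 s))
      (is_deriveZ (10 : R) (is_derive_q 2 s))).
  by congr is_derive; rewrite /bump -/(q s); ring.
Qed.

Lemma bump_cont a : continuous (bump a).
Proof.
have cq k : continuous (fun s => q s ^+ k).
  move=> s; apply: (@continuous_comp _ _ _ q (fun y => y ^+ k)); last exact: exprn_continuous.
  apply: (@continuous_comp _ _ _ (fun s : R => 1 - s ^+ 2) ppart); last exact: ppart_cont.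
  by apply: contB; [exact: cst_continuous|exact: exprn_continuous].
have ci k : continuous (fun s : R => s ^+ k) by exact: exprn_continuous.
case: a => [|[|[|a]]]; rewrite /bump.
- exact: cq.
- by apply: contM; [apply: contZ => s; exact: cvg_id|exact: cq].
- by apply: contB; [apply: contM; [exact: contZ|exact: cq]|apply: contZ; exact: cq].
- apply: contB; [apply: contM; [exact: contZ|exact: cq]|].
  by apply: contM; [apply: contZ => s; exact: cvg_id|exact: cq].
Qed.

Lemma bump_supp a s : 1 < `|s| -> bump a s = 0.
Proof.
move=> s1; have q0 : ppart (1 - s ^+ 2) = 0.
  rewrite /ppart max_l// subr_le0 -real_normK ?num_real//.
  by rewrite expr_ge1// ltW.
by case: a => [|[|[|a]]]; rewrite /bump q0 !expr0n ?mulr0 ?subrr.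
Qed.

Lemma bump0_ge0 s : 0 <= bump 0 s.
Proof. by rewrite exprn_ge0// ppart_ge0. Qed.

Lemma bump0_even s : bump 0 (- s) = bump 0 s.
Proof. by rewrite /bump sqrrN. Qed.

Lemma bump0_gt s : `|s| <= 1 / 2 -> (3 / 4) ^+ 5 <= bump 0 s.
Proof.
move=> s2; rewrite /bump lerXn2r ?nnegrE ?ppart_ge0//.
rewrite /ppart le_max; apply/orP; right.
have : s ^+ 2 <= (1 / 2) ^+ 2.
  by rewrite -[leLHS]real_normK ?num_real// lerXn2r ?nnegrE.
by lra.
Qed.

End smooth_kernel.

(** * Differentiation under the integral and convolution *)

Section parametric_integrals.
Context (R : realType) (m : nat).
Local Notation E := 'rV[R]_m.
Local Notation mu := (lebesgue_rV R m).
Local Notation e := (@basis_vec R m).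
Implicit Types (f k dk v : E -> R) (x y : E).

(** The point 0 and the interval of radius one are enough, since [is_derive_lineP] transports any
    point and direction there. *)
Lemma Rint_deriv_under (f df : R -> E -> R) (D M : R) :
  (forall t, `|t| < 1 -> bms (f t)) ->
  (forall t y, `|t| < 1 -> is_derive t (1 : R) (fun s => f s y) (df t y)) ->
  (forall t y, `|t| < 1 -> `|df t y| <= D) ->
  (forall t y, `|t| < 1 -> M < `|y| -> df t y = 0) ->
  is_derive (0 : R) (1 : R) (fun t => \int[mu]_y f t y) (\int[mu]_y df 0 y).
Proof.
move=> bf dfP dfD dfM.
have I1 t : `]-1, 1[%classic t -> `|t| < 1 :> R.
  by rewrite /= in_itv /= -ltr_norml.
have pE t y : `|t| < 1 -> partial1of2 f t y = df t y.
  move=> t1; rewrite partial1of2E.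
  by have [_ <-] := dfP t y t1.
have := @cvg_differentiation_under_integral R _ E mu f setT measurableT 0 (-1) 1
  _ _ _ (fun y => `|D| * \1_[set x : E | `|x| <= `|M|] y) _ _ _.
move=> /(_ _)/wrap[|]; first by rewrite /= in_itv /= oppr_lt0 ltr01.
move=> /(_ _)/wrap[t /I1 t1|]; first exact/bms_integrable/bf.
move=> /(_ _)/wrap[t y /I1 t1 _|]; first by case: (dfP t y t1).
move=> /(_ _)/wrap[y|]; first by rewrite mulr_ge0// indicE.
move=> /(_ _)/wrap[|].
  apply: bms_integrable; apply: bmsZ; split.
    by apply: measurable_indic; exact: measurable_nball.
  exists 1, `|M|; split => // x.
    by rewrite indicE; case: (_ \in _); rewrite ?normr1 ?normr0.
  by move=> Mx; rewrite indicE memNset//= => /(lt_le_trans Mx); rewrite ltxx.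
move=> /(_ _)/wrap[t y /I1 t1 _|].
  rewrite pE//; have [yM|yM] := leP `|y| `|M|.
    by rewrite indicE mem_set// mulr1 (le_trans (dfD t y t1))// ler_norm.
  by rewrite dfM ?normr0 ?mulr_ge0// (le_lt_trans (ler_norm M)).
rewrite (_ : \int[mu]_y partial1of2 f 0 y = \int[mu]_y df 0 y); last first.
  by apply: eq_Rintegral => y _; rewrite pE// normr0.
move=> H; apply: DeriveDef.
  apply/cvg_ex; exists (\int[mu]_y df 0 y); apply: cvg_trans H.
  by under eq_fun do rewrite [_%:A]mulr1.
apply: (cvg_lim (@Rhausdorff R)).
rewrite /= ; apply: cvg_trans H.
by under eq_fun do rewrite [_%:A]mulr1.
Qed.

Lemma cont_bounded_ball v (M : R) : continuous v ->
  exists2 V, 0 <= V & forall y, `|y| <= M -> `|v y| <= V.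
Proof.
move=> cv; have cn : continuous (fun x => `|v x|).
  by move=> x; apply: continuous_comp; [exact: cv|exact: norm_continuous].
have K0 : [set x : E | `|x| <= `|M|] !=set0 by exists 0; rewrite /= normr0.
have [c cM cmax] := EVT_max_rV K0 (@compact_nball R m `|M|) (continuous_subspaceT cn).
exists `|v c| => // y yM; apply: cmax; rewrite inE /=.
exact: le_trans yM (ler_norm M).
Qed.

Lemma comp_subr_cont k x : continuous k -> continuous (fun y => k (y - x)).
Proof.
move=> ck y; apply: (@continuous_comp _ _ _ (fun y => y - x) k); last exact: ck.
exact: (cvgB cvg_id (cvg_cst x)).
Qed.

Lemma Cc_comp_subr k x : Cc k -> Cc (fun y => k (y - x)).
Proof.
move=> [ck [M kM]]; split; first exact: comp_subr_cont.
exists (M + `|x|) => y My; apply: kM.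
have := ler_normD (y - x) x; rewrite subrK; lra.
Qed.

Lemma Rint_conv_shift v k x : continuous v -> Cc k ->
  \int[mu]_y (v y * k (y - x)) = \int[mu]_y (v (x + y) * k y).
Proof.
move=> cv Ck; rewrite -(@Rint_shift R m (fun y => v y * k (y - x)) x).
  by apply: eq_Rintegral => y _; rewrite addrK addrC.
by apply: Cc_bms; apply: CcM => //; exact: Cc_comp_subr.
Qed.

Lemma conv_cont v k : continuous v -> Cc k ->
  continuous (fun x => \int[mu]_y (v y * k (y - x))).
Proof.
move=> cv Ck x; apply: seq_continuous => u ux.
have [_ [C [M [C0 M0 kC kM]]]] := Cc_bms Ck.
have [N _ uN] : \forall n \near \oo, `|x - u n| < 1.
  by have /cvgrPdist_lt := ux; apply.
have [V V0 vV] := cont_bounded_ball (M + `|x| + 1) cv.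
rewrite -(cvg_shiftn N).
have small n y : M + `|x| + 1 < `|y| -> k (y - u (n + N)%N) = 0.
  move=> My; apply: kM.
  have := uN (n + N)%N (leq_addl _ _) => /= ?.
  have := ler_normD (y - u (n + N)%N) (u (n + N)%N); rewrite subrK.
  have := ler_normB x (x - u (n + N)%N); rewrite opprB addrC subrK; lra.
have [||||_ H] := @Rint_dct R m (fun n y => v y * k (y - u (n + N)%N))
  (fun y => v y * k (y - x)) (V * C) (M + `|x| + 1); last exact: H.
- move=> n; apply: (Cc_bms _).1; apply: CcM => //; exact: Cc_comp_subr.
- move=> n y; have [yM|yM] := leP `|y| (M + `|x| + 1).
    by rewrite normrM ler_pM// vV.
  by rewrite small// mulr0 normr0 mulr_ge0.
- by move=> n y My; rewrite small// mulr0.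
- move=> y; apply: cvgM; first exact: cvg_cst.
  have : k (y - u n) @[n --> \oo] --> k (y - x).
    by case: Ck => ck _; apply: (cvg_comp _ _ (cvgB (cvg_cst y) ux) (ck (y - x))).
  by rewrite -(cvg_shiftn N).
Qed.

(** The derivative falls on the kernel, so continuity of [v] suffices. *)
Lemma is_derive_conv v k dk x (w : E) : continuous v -> Cc k -> Cc dk ->
  (forall y, is_derive y w k (dk y)) ->
  is_derive x w (fun x => \int[mu]_y (v y * k (y - x)))
    (\int[mu]_y (v y * - dk (y - x))).
Proof.
move=> cv Ck Cdk kdk; apply/is_derive_lineP.
have [_ [C [M [C0 M0 kC kM]]]] := Cc_bms Cdk.
have [V V0 vV] := cont_bounded_ball (M + `|x| + `|w|) cv.
have small t y : `|t| < 1 -> M + `|x| + `|w| < `|y| -> dk (y - (x + t *: w)) = 0.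
  move=> t1 My; apply: kM.
  have := ler_normD (y - (x + t *: w)) (x + t *: w); rewrite subrK.
  have := ler_normD x (t *: w); rewrite normrZ.
  have : `|t| * `|w| <= `|w| by rewrite ler_piMl// ltW.
  lra.
have := @Rint_deriv_under (fun t y => v y * k (y - (x + t *: w)))
  (fun t y => v y * - dk (y - (x + t *: w))) (V * C) (M + `|x| + `|w|).
rewrite scale0r addr0; apply.
- by move=> t _; apply: Cc_bms; apply: CcM => //; exact: Cc_comp_subr.
- move=> t y _.
  have H : is_derive t 1 ((fun s : R => k (y - x + s *: w)) \o -%R)
      (dk (y - (x + t *: w)) * -1).
    apply: is_derive1_comp.
    by rewrite opprD addrA -scaleNr; exact: is_derive_line.
  have := is_deriveZ (v y) H; rewrite mulrN1.
  by congr is_derive; apply/funext => s /=; rewrite opprD addrA -scaleNr.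
- move=> t y t1; have [yM|yM] := leP `|y| (M + `|x| + `|w|).
    by rewrite normrM normrN ler_pM// vV.
  by rewrite small// oppr0 mulr0 normr0 mulr_ge0.
- by move=> t y t1 My; rewrite small// oppr0 mulr0.
Qed.

End parametric_integrals.

(** * Product kernels and mollification *)

Section kernel.
Context (R : realType) (m : nat).
Local Notation E := 'rV[R]_m.
Local Notation mu := (lebesgue_rV R m).
Local Notation e := (@basis_vec R m).
Implicit Types (d : R) (a : 'I_m -> nat) (f g : E -> R) (x y : E).

Definition bumps d (a : nat) (s : R) : R := d ^- a * bump a (s / d).

Lemma is_derive_bumps d (a : nat) (s : R) : (a < 3)%N ->
  is_derive s (1 : R) (bumps d a) (- bumps d a.+1 s).
Proof.
move=> a3; have H : is_derive s (1 : R) (fun s : R => s / d) d^-1.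
  have := is_deriveZ d^-1 (is_derive_id s (1 : R)).
  by congr is_derive; [apply/funext => x /=; rewrite mulrC|rewrite [LHS]mulr1].
have := is_deriveZ (d ^- a) (@is_derive1_comp _ _ (fun s : R => s / d) s _ _
  (is_derive_bump (s / d) a3) H).
congr is_derive; rewrite /bumps exprSr invfM; set b := bump _ _.
by rewrite -[LHS]/(d ^- a * (- b * d^-1)); ring.
Qed.

Lemma bumps_cont d (a : nat) : continuous (bumps d a).
Proof.
apply: contZ => s; apply: (@continuous_comp _ _ _ (fun s : R => s / d) (bump a)).
  apply: (@contM R R id (fun=> d^-1)); first by move=> ?; exact: cvg_id.
  exact: cst_continuous.
exact: bump_cont.
Qed.

Lemma bumps_supp d (a : nat) (s : R) : 0 < d -> d < `|s| -> bumps d a s = 0.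
Proof.
move=> d0 ds; rewrite /bumps bump_supp ?mulr0// normrM normfV (gtr0_norm d0).
by rewrite ltr_pdivlMr// mul1r.
Qed.

(** Here [a] is the multi-index of differentiation. The product form lets [kern_change] distribute
    the factors over the rows of a determinant. *)
Definition kern d a y : R := \prod_i bumps d (a i) (y 0 i).

Definition incr a (i : 'I_m) : 'I_m -> nat := fun k => (a k + (k == i))%N.

Lemma incrC a i j : incr (incr a i) j = incr (incr a j) i.
Proof. by apply/funext => k; rewrite /incr addnAC. Qed.

Lemma is_derive_coord (g : R -> R) (dg : R) x (v : E) (k : 'I_m) :
  is_derive (x 0 k) (1 : R) g dg ->
  is_derive x (v : E) (fun y : E => g (y 0 k)) (dg * v 0 k).
Proof.
move=> gdg; apply/is_derive_lineP.
have H : is_derive (0 : R) (1 : R) (fun t : R => x 0 k + t * v 0 k) (v 0 k).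
  have := is_deriveD (is_derive_cst (x 0 k) (0 : R) 1)
    (is_deriveZ (v 0 k) (is_derive_id (0 : R) (1 : R))).
  by congr is_derive; [apply/funext => t /=; rewrite mulrC|rewrite add0r [LHS]mulr1].
have := @is_derive1_comp R g (fun t : R => x 0 k + t * v 0 k) 0 dg (v 0 k).
move=> /(_ _ H)/wrap[|]; first by rewrite mul0r addr0.
by congr is_derive; apply/funext => t; rewrite /= !mxE.
Qed.

Lemma is_derive_kern d a x (w : E) : (forall i, a i < 3)%N ->
  is_derive x w (kern d a) (\sum_i w 0 i * - kern d (incr a i) x).
Proof.
move=> a3.
have := @is_derive_prod R _ _ xpredT (fun k y => bumps d (a k) (y 0 k))
  (fun k => - bumps d (a k).+1 (x 0 k) * w 0 k) x w.
move=> /(_ _)/wrap[k _|]; first exact: is_derive_coord (is_derive_bumps d _ (a3 k)).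
congr is_derive; apply: eq_bigr => i _.
rewrite mulrN mulNr mulNr /kern [in RHS](bigD1 i)//= {1}/incr eqxx addn1.
rewrite mulrAC [w 0 i * _]mulrC; congr (- (_ * _ * _)); apply: eq_bigr => k /negbTE ki.
by rewrite /incr ki addn0.
Qed.

Lemma Cc_kern d a : 0 < d -> Cc (kern d a).
Proof.
move=> d0; split.
  apply: continuous_prod_fct => i _ x.
  by apply: continuous_comp; [exact: coord_cont|exact: bumps_cont].
exists d => x dx; have [i di] := mx_norm_ltP (ltW d0) dx.
by rewrite /kern (bigD1 i)//= bumps_supp// mul0r.
Qed.

Lemma kern_supp d a x : 0 < d -> d < `|x| -> kern d a x = 0.
Proof.
move=> d0 dx; have [i di] := mx_norm_ltP (ltW d0) dx.
by rewrite /kern (bigD1 i)//= bumps_supp// mul0r.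
Qed.

Local Notation z := (fun=> 0%N : nat).

Lemma kern0_ge0 d x : 0 <= kern d z x.
Proof.
by apply: prodr_ge0 => i _; rewrite /bumps expr0 invr1 mul1r bump0_ge0.
Qed.

Lemma kern0_even d x : kern d z (- x) = kern d z x.
Proof.
by apply: eq_bigr => i _; rewrite /bumps mxE mulNr bump0_even.
Qed.

Definition kmass d : R := \int[mu]_y kern d z y.

(** The kernel is left unnormalised and averages are divided by its mass. A lower bound for the mass
    comes from the half-size cube, where each factor is at least (1 - 1/4)^5. *)
Lemma kmass_gt0 d : 0 < d -> 0 < kmass d.
Proof.
move=> d0; pose B := [set x : E | forall i, `|x 0 i| <= d / 2].
have d2 : 0 <= d / 2 by rewrite divr_ge0// ltW.
have BE : B = [set x : E | `|x| <= d / 2].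
  by apply/seteqP; split => x /= /(mx_norm_leP _ d2).
pose c : R := ((3 / 4) ^+ 5) ^+ m.
have c0 : 0 < c by rewrite !exprn_gt0//; lra.
have mB : measurable B by rewrite BE; exact: measurable_nball.
apply: (@lt_le_trans _ _ (\int[mu]_y (c * \1_B y))).
  rewrite RintZ; last first.
    split; first exact: measurable_indic.
    exists 1, (d / 2); split => // x.
      by rewrite indicE; case: (_ \in _); rewrite ?normr1 ?normr0.
    by rewrite BE => Mx; rewrite indicE memNset//= => /(lt_le_trans Mx); rewrite ltxx.
  have lB : mu B = ((d / 2 *+ 2) ^+ m)%:E by exact: lebesgue_rV_box.
  have -> : \int[mu]_y \1_B y = (d / 2 *+ 2) ^+ m.
    transitivity (fine (mu B)); last by rewrite lB.
    by rewrite /Rintegral integral_indic// setIT.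
  rewrite mulr_gt0//.
  by rewrite exprn_gt0//; lra.
apply: Rint_le.
- apply: bmsZ; split; first exact: measurable_indic.
  exists 1, (d / 2); split => // x.
    by rewrite indicE; case: (_ \in _); rewrite ?normr1 ?normr0.
  by rewrite BE => Mx; rewrite indicE memNset//= => /(lt_le_trans Mx); rewrite ltxx.
- exact/Cc_bms/Cc_kern.
- move=> x; rewrite indicE; case: (boolP (x \in B)) => [/set_mem xB|_].
    rewrite mulr1 /c -[X in _ ^+ X]card_ord -prodr_const; apply: ler_prod => i _.
    rewrite exprn_ge0 /=; last by lra.
    rewrite /bumps expr0 invr1 mul1r; apply: bump0_gt.
    rewrite normrM normfV (gtr0_norm d0) ler_pdivrMr//; have := xB i; lra.
  by rewrite mulr0 kern0_ge0.
Qed.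

Definition avg d f : R := (kmass d)^-1 * \int[mu]_y (f y * kern d z y).

Let bmk d f : 0 < d -> continuous f -> bms (fun y => f y * kern d z y).
Proof. by move=> d0 cf; apply/Cc_bms/CcM => //; exact: Cc_kern. Qed.

Lemma avg_le d f g : 0 < d -> continuous f -> continuous g ->
  (forall y, `|y| <= d -> f y <= g y) -> avg d f <= avg d g.
Proof.
move=> d0 cf cg fg; rewrite ler_pM2l ?invr_gt0 ?kmass_gt0//.
apply: Rint_le; [exact: bmk|exact: bmk|move=> y].
have [yd|yd] := leP `|y| d; last by rewrite kern_supp// !mulr0.
by rewrite ler_wpM2r ?kern0_ge0// fg.
Qed.

Lemma avg_cst d (c : R) : 0 < d -> avg d (fun=> c) = c.
Proof.
move=> d0; rewrite /avg RintZ; last exact/Cc_bms/Cc_kern.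
by rewrite mulrCA mulVf ?mulr1// gt_eqF// kmass_gt0.
Qed.

Lemma avgD d f g : 0 < d -> continuous f -> continuous g ->
  avg d (fun y => f y + g y) = avg d f + avg d g.
Proof.
move=> d0 cf cg; rewrite /avg -mulrDr; congr (_ * _).
rewrite -RintD; [|exact: bmk..].
by apply: eq_Rintegral => y _; rewrite mulrDl.
Qed.

Lemma avgZ d f (c : R) : 0 < d -> continuous f ->
  avg d (fun y => c * f y) = c * avg d f.
Proof.
move=> d0 cf; rewrite /avg mulrCA; congr (_ * _).
rewrite -RintZ; last exact: bmk.
by apply: eq_Rintegral => y _; rewrite mulrA.
Qed.

Lemma avg_close d f (c eta : R) : 0 < d -> continuous f ->
  (forall y, `|y| <= d -> `|f y - c| <= eta) -> `|avg d f - c| <= eta.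
Proof.
move=> d0 cf fc.
have le1 : avg d f <= c + eta.
  rewrite -(avg_cst (c + eta) d0); apply: avg_le => //; first exact: cst_continuous.
  by move=> y /fc; rewrite ler_norml => /andP[]; lra.
have le2 : c - eta <= avg d f.
  rewrite -(avg_cst (c - eta) d0); apply: avg_le => //; first exact: cst_continuous.
  by move=> y /fc; rewrite ler_norml => /andP[]; lra.
by rewrite ler_norml; apply/andP; split; lra.
Qed.

(* The partial derivative of multi-index a of the mollification of v. *)
Definition moll (v : E -> R) d a x : R := (kmass d)^-1 * \int[mu]_y (v y * kern d a (y - x)).

Lemma moll_cont (v : E -> R) d a : 0 < d -> continuous v -> continuous (moll v d a).
Proof.
by move=> d0 cv; apply: contZ; apply: conv_cont => //; exact: Cc_kern.
Qed.

Lemma is_derive_moll_dir (v : E -> R) d a x (w : E) :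
  0 < d -> continuous v -> (forall i, a i < 3)%N ->
  is_derive x w (moll v d a) (\sum_i w 0 i * moll v d (incr a i) x).
Proof.
move=> d0 cv a3.
have Cdk : Cc (fun y => \sum_i w 0 i * - kern d (incr a i) y).
  apply: Cc_sum => i _.
  have := CcM (@cst_continuous E R (- w 0 i)) (Cc_kern (incr a i) d0).
  by congr Cc; apply/funext => y; rewrite mulrN mulNr.
have := is_deriveZ (kmass d)^-1 (is_derive_conv x cv (Cc_kern a d0) Cdk
  (fun y => is_derive_kern d y w a3)).
congr is_derive; rewrite /moll.
transitivity ((kmass d)^-1 * \sum_i w 0 i * \int[mu]_y (v y * kern d (incr a i) (y - x))).
  congr (_ * _); rewrite (eq_Rintegral _ _
    (g := fun y => \sum_i w 0 i * (v y * kern d (incr a i) (y - x)))); last first.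
    move=> y _; rewrite -sumrN mulr_sumr; apply: eq_bigr => i _.
    by ring.
  have bm i : bms (fun y => v y * kern d (incr a i) (y - x)).
    by apply/Cc_bms/CcM => //; apply: Cc_comp_subr; exact: Cc_kern.
  rewrite Rint_sum; last by move=> i _; exact: bmsZ.
  by apply: eq_bigr => i _; rewrite RintZ.
by rewrite mulr_sumr; apply: eq_bigr => i _; rewrite mulrCA.
Qed.

Lemma is_derive_moll (v : E -> R) d a x i :
  0 < d -> continuous v -> (forall i, a i < 3)%N ->
  is_derive x (e i) (moll v d a) (moll v d (incr a i) x).
Proof.
move=> d0 cv a3; have := is_derive_moll_dir x (e i) d0 cv a3.
congr is_derive; rewrite (bigD1 i)//= mxE !eqxx mul1r big1 ?addr0// => k ki.
by rewrite mxE (negbTE ki) andbF mul0r.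
Qed.

Lemma moll0E (v : E -> R) d x : 0 < d -> continuous v ->
  moll v d z x = avg d (fun y => v (x + y)).
Proof.
by move=> d0 cv; rewrite /moll Rint_conv_shift//; exact: Cc_kern.
Qed.

Lemma moll_local (v v' : E -> R) d a x : 0 < d -> (forall y, `|y - x| <= d -> v y = v' y) ->
  moll v d a x = moll v' d a x.
Proof.
move=> d0 vv'; rewrite /moll; congr (_ * _); apply: eq_Rintegral => y _.
by have [/vv' ->//|yd] := leP `|y - x| d; rewrite kern_supp// !mulr0.
Qed.

End kernel.

(** * Regularity of convex functions and of their mollifications *)

Section convex_functions.
Context (R : realType) (m : nat).
Local Notation E := 'rV[R]_m.
Local Notation e := (@basis_vec R m).
Implicit Types (u v : E -> R) (x y z w : E).

Definition lip (L : R) v := forall x y, `|v x - v y| <= L * enorm (x - y).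

(** On a cube the values are controlled by those at the vertices: one coordinate after the other is
    moved to an end point where the function is not smaller. The sum of absolute values stands in
    for the maximum over the vertices. *)
Lemma cvx_bounded_above v (r : R) : cvx v -> 0 < r ->
  exists B, forall x, `|x| <= r -> v x <= B.
Proof.
move=> cv r0.
pose vert (s : {ffun 'I_m -> bool}) : E := \row_i if s i then r else - r.
exists (\sum_s `|v (vert s)|) => x xr.
have vertex k : (k <= m)%N -> exists2 y : E, v x <= v y &
    (forall i : 'I_m, `|y 0 i| <= r) /\
    forall i : 'I_m, (i < k)%N -> y 0 i = r \/ y 0 i = - r.
  elim: k => [_|k IH km].
    by exists x => //; split => // i; move/mx_norm_leP : xr; apply; exact: ltW.
  have [y vxy [yr yk]] := IH (ltnW km).
  pose ik := Ordinal km.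
  pose yy (c : R) : E := \row_i if i == ik then c else y 0 i.
  pose t := (y 0 ik + r) / (2 * r).
  have r20 : 0 < 2 * r by lra.
  have := yr ik; rewrite ler_norml => /andP[yr1 yr2].
  have t01 : 0 <= t <= 1.
    by rewrite divr_ge0/= ?ler_pdivrMr//; lra.
  have yE : y = t *: yy r + (1 - t) *: yy (- r).
    apply/rowP => i; rewrite !mxE; case: eqVneq => [->|_]; last by ring.
    by rewrite /t; field; rewrite gt_eqF.
  have := cv (yy r) (yy (- r)) t t01; rewrite -yE => vy.
  have yyr c : `|c| <= r -> (c = r \/ c = - r) -> (forall i : 'I_m, `|yy c 0 i| <= r) /\
    forall i : 'I_m, (i < k.+1)%N -> yy c 0 i = r \/ yy c 0 i = - r.
    move=> cr cr2; split => i; rewrite mxE; case: eqVneq => // ink ik1.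
    apply: yk; move: ik1; rewrite ltnS leq_eqVlt => /orP[/eqP ik2|//].
    by move: ink; rewrite -val_eqE /= ik2 eqxx.
  have [le|le] := leP (v (yy (- r))) (v (yy r)).
    exists (yy r); last by apply: yyr; [rewrite gtr0_norm|left].
    apply: (le_trans vxy); apply: (le_trans vy).
    have : (1 - t) * v (yy (- r)) <= (1 - t) * v (yy r).
      by apply: ler_wpM2l => //; move: t01; lra.
    by lra.
  exists (yy (- r)); last by apply: yyr; [rewrite normrN gtr0_norm|right].
  apply: (le_trans vxy); apply: (le_trans vy).
  have : t * v (yy r) <= t * v (yy (- r)).
    by apply: ler_wpM2l; [move: t01; lra|exact: ltW].
  by lra.
have [y vxy [_ yr]] := vertex m (leqnn m).
have -> : v x <= \sum_s `|v (vert s)|; last by [].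
apply: (le_trans vxy); rewrite (_ : y = vert [ffun i => y 0 i == r]).
  rewrite (bigD1 [ffun i => y 0 i == r])//=; apply: (le_trans (ler_norm _)).
  by rewrite lerDl sumr_ge0.
apply/rowP => i; rewrite !mxE ffunE; case: eqVneq => // yi.
by have [yir|//] := yr i (ltn_ord i); rewrite yir eqxx in yi.
Qed.

(** Reflection at the origin turns the upper bound on the doubled cube into a lower bound, and a
    function bounded on the doubled cube cannot have steep chords inside. *)
Lemma cvx_lip_ball v (r : R) : cvx v -> 0 < r ->
  exists2 C, 0 <= C & forall x y, `|x| <= r -> `|y| <= r ->
    `|v x - v y| <= C * `|x - y|.
Proof.
move=> cv r0; have r2 : 0 < 2 * r by lra.
have [B vB] := cvx_bounded_above cv r2.
have vlow x : `|x| <= 2 * r -> 2 * v 0 - B <= v x.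
  move=> xr; have t01 : 0 <= (1 / 2 : R) <= 1 by lra.
  have := cv x (- x) (1 / 2) t01.
  have -> : (1 / 2) *: x + (1 - 1 / 2) *: - x = 0.
    by apply/rowP => i; rewrite !mxE; field.
  have : v (- x) <= B by apply: vB; rewrite normrN.
  by lra.
pose D := 2 * B - 2 * v 0.
have D0 : 0 <= D.
  have := vlow 0; have := vB 0; rewrite normr0 => /(_ (ltW r2)) ? /(_ (ltW r2)) ?.
  by rewrite /D; lra.
exists (D / r); first by rewrite divr_ge0// ltW.
have one x y : `|x| <= r -> `|y| <= r -> v y - v x <= D / r * `|x - y|.
  move=> xr yr; have [->|xy] := eqVneq x y; first by rewrite !subrr normr0 mulr0.
  pose dl := `|x - y|.
  have d0 : 0 < dl by rewrite normr_gt0 subr_eq0.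
  (* Continue the segment from [x] through [y] by the length [r]: the point stays in the doubled
     cube, and [y] is a convex combination of it and [x] with weight [t]. *)
  pose w := y + (r / dl) *: (y - x).
  have wr : `|w| <= 2 * r.
    apply: (le_trans (ler_normD _ _)); rewrite normrZ (distrC y x) -/dl.
    by rewrite gtr0_norm ?divr_gt0// -mulrA mulVf ?gt_eqF// mulr1; lra.
  pose t := dl / (r + dl).
  have rd : 0 < r + dl by rewrite addr_gt0.
  have t01 : 0 <= t <= 1.
    by rewrite /t divr_ge0 ?(ltW d0) ?(ltW rd)//= ler_pdivrMr// mul1r; lra.
  have := cv w x t t01.
  have -> : t *: w + (1 - t) *: x = y.
    apply/rowP => i; rewrite !mxE /t; field.
    by rewrite !gt_eqF.
  move=> vy; have ww := vB w wr.
  have xx : 2 * v 0 - B <= v x by apply: vlow; lra.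
  have h1 : v y - v x <= t * (v w - v x) by lra.
  apply: (le_trans h1); apply: (@le_trans _ _ (t * D)).
    by apply: ler_wpM2l; [move: t01; lra|rewrite /D; lra].
  rewrite mulrC -mulrA ler_wpM2l// -/dl /t mulrC ler_wpM2r// ?(ltW d0)//.
  by rewrite lef_pV2 ?posrE//; lra.
move=> x y xr yr; rewrite ler_norml; apply/andP; split.
  by have := one x y xr yr; lra.
by have := one y x yr xr; rewrite distrC; lra.
Qed.

Lemma lip_ball_cont v :
  (forall r, 0 < r -> exists2 C, 0 <= C & forall x y, `|x| <= r -> `|y| <= r ->
    `|v x - v y| <= C * `|x - y|) -> continuous v.
Proof.
move=> lv x; apply: seq_continuous => u0 ux.
have r0 : 0 < `|x| + 1 by have := normr_ge0 x; lra.
have [C C0 vC] := lv _ r0.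
apply/cvgrPdist_le => eps eps0.
have e0 : 0 < eps / (C + 1) by rewrite divr_gt0//; lra.
have H1 : \forall k \near \oo, `|x - u0 k| < 1 by have /cvgrPdist_lt := ux; apply.
have H2 : \forall k \near \oo, `|x - u0 k| < eps / (C + 1).
  by have /cvgrPdist_lt := ux; apply.
near=> k.
have h1 : `|x - u0 k| < 1 by near: k; exact: H1.
have h2 : `|x - u0 k| < eps / (C + 1) by near: k; exact: H2.
have uk : `|u0 k| <= `|x| + 1.
  by have := ler_normB x (x - u0 k); rewrite opprB addrC subrK; lra.
apply: (le_trans (vC x (u0 k) _ uk)); first by lra.
apply: (@le_trans _ _ (C * (eps / (C + 1)))); first by rewrite ler_wpM2l// ltW.
by rewrite mulrA ler_pdivrMr; [rewrite mulrC ler_wpM2l//; lra|lra].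
Unshelve. all: by end_near. Qed.

Lemma cvx_cont v : cvx v -> continuous v.
Proof. by move=> cv; apply: lip_ball_cont => r; exact: cvx_lip_ball. Qed.

Lemma lip_cont L v : lip L v -> continuous v.
Proof.
move=> lv; apply: lip_ball_cont => r r0.
exists (`|L| * m%:R) => [|x y _ _]; first exact: mulr_ge0.
apply: (le_trans (lv x y)); rewrite -mulrA.
apply: (@le_trans _ _ (`|L| * enorm (x - y))).
  by rewrite ler_wpM2r ?enorm_ge0 ?ler_norm.
by rewrite ler_wpM2l ?enorm_le_mx_norm.
Qed.

Lemma is_derive_seq u x w (D : R) : is_derive x w u D ->
  k.+1%:R * (u (x + k.+1%:R^-1 *: w) - u x) @[k --> \oo] --> D.
Proof.
move=> /is_derive_lineP[]; rewrite /derivable /derive => /cvg_ex[l H].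
rewrite (cvg_lim (@Rhausdorff R) H) => lD; subst l.
have /cvgr_dnbhsP := H => /(_ (fun k => k.+1%:R^-1)) {}H.
have /H : (forall k, k.+1%:R^-1 != 0 :> R) /\ (k.+1%:R^-1 : R) @[k --> \oo] --> (0 : R).
  by split=> [k|]; [rewrite invr_eq0|exact: cvg_harmonic].
apply: cvg_trans; apply: near_eq_cvg; apply: nearW => k /=.
by rewrite scale0r !addr0 invrK [_%:A]mulr1.
Qed.

Lemma cvx_gradient u x y (D : R) : cvx u -> is_derive x (y - x) u D ->
  u x + D <= u y.
Proof.
move=> cu /is_derive_seq H; rewrite -lerBrDl.
have <- := cvg_lim (@Rhausdorff R) H; apply: limr_le.
  by apply/cvg_ex; exists D.
apply: nearW => k.
have k0 : 0 < k.+1%:R^-1 :> R by rewrite invr_gt0.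
have k1 : k.+1%:R^-1 <= 1 :> R by rewrite invf_le1// ler1n.
have k01 : 0 <= (k.+1%:R^-1 : R) <= 1 by rewrite (ltW k0).
have := cu y x _ k01.
have -> : k.+1%:R^-1 *: y + (1 - k.+1%:R^-1) *: x = x + k.+1%:R^-1 *: (y - x).
  by rewrite scalerBl scale1r scalerBr addrCA.
move: k0; set c := k.+1%:R^-1 => k0 h.
by rewrite -(ler_pM2l k0) mulrA mulVf ?mul1r ?pnatr_eq0//; lra.
Qed.

Lemma lip_deriv_bound L u x w (D : R) : lip L u -> is_derive x w u D ->
  `|D| <= L * enorm w.
Proof.
move=> lu /is_derive_seq H.
have H2 : `|k.+1%:R * (u (x + k.+1%:R^-1 *: w) - u x)| @[k --> \oo] --> `|D|.
  by apply: cvg_norm.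
have <- := cvg_lim (@Rhausdorff R) H2; apply: limr_le.
  by apply/cvg_ex; exists `|D|.
apply: nearW => k; have k0 : 0 < k.+1%:R :> R by [].
rewrite normrM gtr0_norm// -ler_pdivlMl//.
apply: (le_trans (lu _ _)).
by rewrite addrC addKr enormZ gtr0_norm ?invr_gt0// mulrCA.
Qed.

Section mollified.
Variables (v : E -> R) (d : R).
Hypotheses (cv : continuous v) (d0 : 0 < d).
Local Notation z := (fun _ : 'I_m => 0%N).
Local Notation u := (moll v d z).
Local Notation du i := (moll v d (incr z i)).
Local Notation ddu i j := (moll v d (incr (incr z i) j)).

Lemma shift_cont x : continuous (fun y => v (x + y)).
Proof.
rewrite (_ : (fun _ => _) = (fun y => v (y - - x))); first exact: comp_subr_cont.
by apply/funext => y; rewrite opprK addrC.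
Qed.

Lemma moll_close x (eta : R) : (forall y, `|y| <= d -> `|v (x + y) - v x| <= eta) ->
  `|u x - v x| <= eta.
Proof. by move=> h; rewrite moll0E//; apply: avg_close => //; exact: shift_cont. Qed.

Lemma cvx_moll : cvx v -> cvx u.
Proof.
move=> cxv x y t t01; rewrite !moll0E//.
rewrite -!avgZ; [|done|exact: shift_cont|done|exact: shift_cont].
rewrite -avgD//; [|by apply: contZ; exact: shift_cont..].
apply: avg_le => //; first exact: shift_cont.
  by apply: contD; apply: contZ; exact: shift_cont.
move=> w _; have := cxv (x + w) (y + w) t t01.
have -> // : t *: (x + w) + (1 - t) *: (y + w) = t *: x + (1 - t) *: y + w.
by apply/rowP => i; rewrite !mxE; ring.
Qed.

Lemma lip_moll L : lip L v -> lip L u.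
Proof.
move=> lv x y; rewrite !moll0E//.
have -> : avg d (fun w => v (x + w)) - avg d (fun w => v (y + w)) =
    avg d (fun w => v (x + w) - v (y + w)) - 0.
  rewrite subr0 -[X in _ - X]mul1r -mulNr -avgZ//; last exact: shift_cont.
  rewrite -avgD//; [|exact: shift_cont|by apply: contZ; exact: shift_cont].
  by congr avg; apply/funext => w; rewrite mulN1r.
apply: avg_close => //; first by apply: contB; exact: shift_cont.
move=> w _; rewrite subr0; apply: (le_trans (lv _ _)).
by rewrite opprD addrACA subrr addr0.
Qed.

Lemma moll_lip_close L x : lip L v -> 0 <= L -> `|u x - v x| <= L * (m%:R * d).
Proof.
move=> lv L0; apply: moll_close => y yd; apply: (le_trans (lv _ _)).
rewrite ler_wpM2l// addrC addKr (le_trans (enorm_le_mx_norm _))//.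
by rewrite ler_wpM2l.
Qed.

Let z3 i : (z i < 3)%N. Proof. by []. Qed.

Let iz3 k i : (incr z k i < 3)%N. Proof. by rewrite /incr; case: (_ == _). Qed.

Let iiz3 k l i : (incr (incr z k) l i < 3)%N.
Proof. by rewrite /incr; case: (_ == _); case: (_ == _). Qed.

Lemma is_derive_moll0 x i : is_derive x (e i) u (du i x).
Proof. exact: (is_derive_moll _ _ d0 cv z3). Qed.

Lemma is_derive_moll1 x i j : is_derive x (e j) (du i) (ddu i j x).
Proof. exact: (is_derive_moll _ _ d0 cv (iz3 i)). Qed.

Lemma is_derive_moll2 x i j k :
  is_derive x (e k) (ddu i j) (moll v d (incr (incr (incr z i) j) k) x).
Proof. exact: (is_derive_moll _ _ d0 cv (iiz3 i j)). Qed.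

Lemma moll_gradient x y : cvx v ->
  u x + \sum_i (y - x) 0 i * du i x <= u y.
Proof.
move=> cxv; apply: (cvx_gradient (cvx_moll cxv)).
exact: is_derive_moll_dir.
Qed.

(** The gradient inequalities at two points of a line add up to monotonicity of the derivative along
    it. The quadratic form is the limit of the difference quotients of that derivative. *)
Lemma moll_hess_psd x w : cvx v ->
  0 <= \sum_i \sum_j w 0 i * w 0 j * ddu i j x.
Proof.
have aux (p q s s' : R) : p + s <= q -> q + - s' <= p -> s <= s' by lra.
move=> cxv; pose g y := \sum_i w 0 i * du i y.
have H : is_derive x w g (\sum_i \sum_j w 0 i * w 0 j * ddu i j x).
  have := @is_derive_sum R E R m (fun i y => w 0 i * du i y) x w
    (fun i => \sum_j w 0 i * w 0 j * ddu i j x).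
  move=> /(_ _)/wrap[i|]; last by congr is_derive; rewrite fct_sumE.
  have := is_deriveZ (w 0 i) (is_derive_moll_dir x w d0 cv (iz3 i)).
  congr is_derive; rewrite -[LHS]/(_ * _) mulr_sumr.
  by apply: eq_bigr => j _; rewrite mulrA.
have := is_derive_seq H => {}H.
have <- := cvg_lim (@Rhausdorff R) H; apply: limr_ge.
  by apply/cvg_ex; eexists; exact: H.
apply: nearW => k; rewrite mulr_ge0// subr_ge0.
set y := x + _.
have k0 : 0 < k.+1%:R^-1 :> R by rewrite invr_gt0.
have h1 := moll_gradient x y cxv; have h2 := moll_gradient y x cxv.
have E1 : \sum_i (y - x) 0 i * du i x = k.+1%:R^-1 * g x.
  rewrite mulr_sumr; apply: eq_bigr => i _.
  by rewrite /y (addrC x) addrK mxE -mulrA.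
have E2 : \sum_i (x - y) 0 i * du i y = - (k.+1%:R^-1 * g y).
  rewrite mulr_sumr -sumrN; apply: eq_bigr => i _.
  have -> : (x - y) 0 i = - (k.+1%:R^-1 * w 0 i) by rewrite !mxE opprD addrA subrr sub0r.
  by ring.
rewrite E1 in h1; rewrite E2 in h2; rewrite -(ler_pM2l k0).
exact: aux h1 h2.
Qed.

End mollified.

End convex_functions.

(** * Monge-Ampere measures *)

Lemma cont_seq (R : realType) m (f : 'rV[R]_m -> R) (u : nat -> 'rV[R]_m) x :
  continuous f -> u k @[k --> \oo] --> x -> f (u k) @[k --> \oo] --> f x.
Proof. by move=> cf ux; apply: continuous_cvg => //; exact: cf. Qed.

(** * Resolvents of subdifferentials *)

Section resolvent.
Context (R : realType) (m : nat).
Local Notation E := 'rV[R]_m.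
Local Notation mu := (lebesgue_rV R m).
Implicit Types (u v phi : E -> R) (x y z w : E) (t L : R).

(* x - t y is a subgradient of u at y. *)
Definition is_res u t x y := forall y', u y + dotv (x - t *: y) (y' - y) <= u y'.

(** The point minimises [u y + t / 2 * dotv y y - dotv x y], which is coercive because [u] is
    Lipschitz. Comparing the minimum with nearby points on segments yields the subgradient
    inequality. *)
Lemma res_exists u t x L : 0 <= L -> lip L u -> cvx u -> 0 < t ->
  exists y, is_res u t x y.
Proof.
move=> L0 lu cu t0; pose g y := u y + t / 2 * dotv y y - dotv x y.
have cg : continuous g.
  apply: contB; first apply: contD.
  - exact: lip_cont lu.
  - by apply: contZ; exact: dotvxx_cont.
  - rewrite (_ : dotv x = (fun y => dotv y x)); first exact: dotv_cont.
    by apply/funext => y; rewrite dotvC.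
(* Beyond this radius the quadratic term outweighs the linear growth with slope at most
   [L + enorm x], so the minimum over the ball is global. *)
pose r := 2 / t * (L + enorm x).
have r0 : 0 <= r by rewrite mulr_ge0 ?divr_ge0 ?(ltW t0) ?addr_ge0 ?enorm_ge0.
have K0 : [set y : E | `|y| <= r] !=set0 by exists 0; rewrite /= normr0.
have [y yr ymin] := EVT_min_rV K0 (@compact_nball R m r) (continuous_subspaceT cg).
have gmin y' : g y <= g y'.
  have [yr'|yr'] := leP `|y'| r; first by apply: ymin; rewrite inE.
  apply: (@le_trans _ _ (g 0)); first by apply: ymin; rewrite inE /= normr0.
  have re : r <= enorm y' by rewrite (le_trans (ltW yr'))// mx_norm_le_enorm.
  have h1 := lu 0 y'; rewrite sub0r enormN in h1.
  have h2 := cauchy_schwarz x y'.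
  have h3 : u 0 - u y' <= L * enorm y' by rewrite (le_trans (ler_norm _)).
  have h4 : (L + enorm x) * enorm y' <= t / 2 * enorm y' ^+ 2.
    rewrite expr2 mulrA ler_wpM2r ?enorm_ge0//.
    apply: (@le_trans _ _ (t / 2 * r)); last by rewrite ler_wpM2l// divr_ge0// ltW.
    by rewrite /r mulrA (_ : t / 2 * (2 / t) = 1) ?mul1r//; field; rewrite gt_eqF.
  by rewrite /g !dotv0r -enorm_sqr; lra.
exists y => y'; rewrite (_ : y' = y + (y' - y)); last by rewrite addrC subrK.
move: (y' - y) => {y'} w; rewrite [y + w - y]addrAC subrr add0r.
rewrite leNgt; apply/negP => lt.
pose D := u y + dotv (x - t *: y) w - u (y + w).
have D0 : 0 < D by rewrite /D subr_gt0.
pose N := t / 2 * dotv w w.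
have N0 : 0 <= N by rewrite mulr_ge0 ?dotv_ge0// divr_ge0// ltW.
(* A step so short that its second-order cost [s * N] stays below the presumed defect [D]. *)
pose s := D / (D + N + 1).
have dn : 0 < D + N + 1 by lra.
have s01 : 0 <= s <= 1 by rewrite /s divr_ge0 ?ler_pdivrMr ?mul1r//=; lra.
have s0 : 0 < s by rewrite divr_gt0.
have := gmin (y + s *: w); have := cu (y + w) y s s01.
have -> : s *: (y + w) + (1 - s) *: y = y + s *: w.
  by apply/rowP => i; rewrite !mxE; ring.
rewrite /g !(dotvDr, dotvDl, dotvZl, dotvZr).
rewrite (dotvC w y) => h1 h2.
have h3 : D <= s * N.
  rewrite -(ler_pM2l s0) /D /N dotvBl dotvZl; lra.
have : s * N < D.
  rewrite /s mulrAC ltr_pdivrMr// ltr_pM2l//; lra.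
by rewrite ltNge h3.
Qed.

(** Adding the two subgradient inequalities gives strong monotonicity with constant [t];
    Cauchy-Schwarz does the rest. *)
Lemma res_lip u t x x' y y' : 0 < t -> is_res u t x y -> is_res u t x' y' ->
  t * enorm (y - y') <= enorm (x - x').
Proof.
move=> t0 /(_ y') h1 /(_ y) h2.
have h3 : t * dotv (y - y') (y - y') <= dotv (x - x') (y - y').
  move: h1 h2; rewrite !(dotvBl, dotvBr, dotvZl) (dotvC y' y); lra.
have h4 := cauchy_schwarz (x - x') (y - y').
have [e0|e0] := eqVneq (enorm (y - y')) 0; first by rewrite e0 mulr0 enorm_ge0.
have e1 : 0 < enorm (y - y') by rewrite lt_def e0 enorm_ge0.
rewrite -(ler_pM2r e1) -mulrA -expr2 enorm_sqr.
exact: le_trans h3 h4.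
Qed.

Lemma res_uniq u t x y y' : 0 < t -> is_res u t x y -> is_res u t x y' -> y = y'.
Proof.
move=> t0 h1 h2; have := res_lip t0 h1 h2; rewrite subrr enorm0.
rewrite pmulr_rle0// => e0; apply/eqP; rewrite -subr_eq0; apply/eqP/enorm_eq0.
by apply/eqP; rewrite eq_le e0 enorm_ge0.
Qed.

(** The default 0 is not reached when [u] is convex and Lipschitz and [t] is positive. *)
Definition J u t x : E := xget 0 [set y | is_res u t x y].

Lemma JP u t x L : 0 <= L -> lip L u -> cvx u -> 0 < t -> is_res u t x (J u t x).
Proof.
by move=> L0 lu cu t0; have [y yP] := res_exists x L0 lu cu t0; exact: (xgetI _ yP).
Qed.

Lemma J_eq u t x y : 0 < t -> is_res u t x y -> J u t x = y.
Proof. by move=> t0 yP; apply: (res_uniq t0) (yP); exact: (xgetI _ yP). Qed.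

(** Testing the subgradient at [y] plus itself compares its squared norm with the Lipschitz bound.
    Hence [J u t] differs from division by [t] by a bounded amount, and preimages of bounded sets
    are bounded. *)
Lemma res_bound u t x y L : 0 <= L -> lip L u -> is_res u t x y ->
  enorm (x - t *: y) <= L.
Proof.
move=> L0 lu /(_ (y + (x - t *: y))).
rewrite addrAC subrr add0r -enorm_sqr; set w := x - _ => h.
have h1 : u (y + w) - u y <= L * enorm w.
  by rewrite (le_trans (ler_norm _))// (le_trans (lu _ _))// addrAC subrr add0r.
have [e0|e0] := eqVneq (enorm w) 0; first by rewrite e0.
have e1 : 0 < enorm w by rewrite lt_def e0 enorm_ge0.
by rewrite -(ler_pM2r e1) -expr2; lra.
Qed.

Section with_lip.
Variables (u : E -> R) (L t : R).
Hypotheses (L0 : 0 <= L) (lu : lip L u) (cu : cvx u) (t0 : 0 < t).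

Lemma J_cont i : continuous (fun x => J u t x 0 i).
Proof.
have h : lip t^-1 (fun x => J u t x 0 i).
  move=> x y; have := res_lip t0 (JP x L0 lu cu t0) (JP y L0 lu cu t0).
  rewrite -ler_pdivlMl//; apply: le_trans.
  apply: le_trans (mx_norm_le_enorm _).
  by have := mx_norm_coord (J u t x - J u t y) i; rewrite !mxE.
exact: lip_cont h.
Qed.

Lemma J_cont_rV : continuous (J u t).
Proof. exact/continuous_rV/J_cont. Qed.

Lemma J_large x (r : R) : m%:R * (t * r) + L < `|x| -> r < enorm (J u t x).
Proof.
move=> h; rewrite ltNge; apply/negP => Jr.
have h1 := res_bound L0 lu (JP x L0 lu cu t0).
have h2 := mx_norm_le_enorm x.
have h3 := ler_enorm_dist x (t *: J u t x).
rewrite enormZ gtr0_norm// in h3.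
have h4 : t * enorm (J u t x) <= t * r by rewrite ler_wpM2l// ltW.
have h5 : t * enorm (J u t x) <= m%:R * (t * r).
  case: (m) (J u t x) h4 => [|k] y h4; last by rewrite (le_trans h4)// ler_peMl// ?ler1n// (le_trans _ h4)// mulr_ge0 ?enorm_ge0 ?ltW.
  by rewrite /enorm /dotv big_ord0 sqrtr0 mulr0 mul0r.
by lra.
Qed.

Lemma Cc_comp_J phi : Cc phi -> Cc (fun x => phi (J u t x)).
Proof.
move=> [cphi [M phiM]]; split.
  by move=> x; apply: continuous_comp; [exact: J_cont_rV|exact: cphi].
exists (m%:R * (t * (m%:R * `|M|)) + L) => x /J_large h; apply: phiM.
have := lt_le_trans h (enorm_le_mx_norm _).
case: (m) (J u t x) => [|k] y; first by rewrite !mul0r ltxx.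
by rewrite ltr_pM2l// => /(le_lt_trans (ler_norm M)).
Qed.

End with_lip.

(** Strong monotonicity bounds [t] times the squared distance of the two resolvent points by twice
    the uniform distance of the functions on a ball containing all these points. *)
Lemma J_cvg (uk : nat -> E -> R) u L t x : 0 <= L -> 0 < t ->
  (forall k, lip L (uk k)) -> (forall k, cvx (uk k)) -> lip L u -> cvx u ->
  (forall r eps, 0 < eps -> \forall k \near \oo, forall y, `|y| <= r ->
     `|uk k y - u y| <= eps) ->
  J (uk k) t x @[k --> \oo] --> J u t x.
Proof.
move=> L0 t0 luk cuk lu cu uku.
set y := J u t x; pose r := t^-1 * (enorm x + L).
have yP : is_res u t x y := JP x L0 lu cu t0.
have ykP k : is_res (uk k) t x (J (uk k) t x) := JP x L0 (luk k) (cuk k) t0.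
have bnd (w : E -> R) z : lip L w -> is_res w t x z -> `|z| <= r.
  move=> lw zP; rewrite (le_trans (mx_norm_le_enorm z))// ler_pdivlMl//.
  have := res_bound L0 lw zP; have := ler_enorm_dist (t *: z) x.
  by rewrite enormZ gtr0_norm// enorm_distC; lra.
apply/cvgrPdist_le => eps e0.
have e1 : 0 < t * eps ^+ 2 / 2 by rewrite divr_gt0// mulr_gt0// exprn_gt0.
have := uku r _ e1; apply: filterS => k hk.
set z := J (uk k) t x.
have h1 := hk y (bnd _ _ lu yP); have h2 := hk z (bnd _ _ (luk k) (ykP k)).
have h3 := yP z; have h4 := ykP k y; rewrite -/z in h4.
have h5 : t * dotv (y - z) (y - z) <= t * eps ^+ 2.
  move: h1 h2; rewrite !ler_norml => /andP[a1 a2] /andP[b1 b2].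
  move: h3 h4; rewrite !(dotvBl, dotvBr, dotvZl) (dotvC z y); lra.
rewrite (le_trans (mx_norm_le_enorm _))// -(@ler_pXn2r _ 2) ?nnegrE ?enorm_ge0 ?(ltW e0)//.
by rewrite enorm_sqr -(ler_pM2l t0).
Qed.

Lemma MA_limit (uk : nat -> E -> R) u phi L t : 0 <= L -> 0 < t ->
  (forall k, lip L (uk k)) -> (forall k, cvx (uk k)) -> lip L u -> cvx u ->
  (forall r eps, 0 < eps -> \forall k \near \oo, forall y, `|y| <= r ->
     `|uk k y - u y| <= eps) ->
  Cc phi ->
  \int[mu]_x phi (J (uk k) t x) @[k --> \oo] --> \int[mu]_x phi (J u t x).
Proof.
move=> L0 t0 luk cuk lu cu uku Cphi.
have [_ [C [M [C0 M0 phiC phiM]]]] := Cc_bms Cphi.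
have [||||_ H] := @Rint_dct R m (fun k x => phi (J (uk k) t x))
  (fun x => phi (J u t x)) C (m%:R * (t * (m%:R * M)) + L); last exact: H.
- by move=> k; exact: (Cc_bms (Cc_comp_J L0 (luk k) (cuk k) t0 Cphi)).1.
- by move=> k x; exact: phiC.
- move=> k x /(J_large L0 (luk k) (cuk k) t0) h; apply: phiM.
  have := lt_le_trans h (enorm_le_mx_norm _).
  case: (m) (J _ t x) => [|l] y; first by rewrite !mul0r ltxx.
  by rewrite ltr_pM2l.
- move=> x; apply: cont_seq; first by case: Cphi.
  exact: (J_cvg L0 t0 luk cuk lu cu uku).
Qed.

End resolvent.

(** * Primitives of functions with bounded support *)

Section antiderivative.
Context (R : realType).
Local Notation leb := (@lebesgue_measure R).

Lemma integrable_bounded_support (f : R -> R) (d : R) : continuous f ->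
  (forall s, d < `|s| -> f s = 0) -> leb.-integrable setT (EFin \o f).
Proof.
move=> cf fd; pose K := `[- d, d]%classic : set R.
have : leb.-integrable K (EFin \o f).
  apply: continuous_compact_integrable; first exact: segment_compact.
  exact: continuous_subspaceT.
move=> /integrable_mkcond; have mK : measurable K by exact: measurable_itv.
move=> /(_ mK); congr (_.-integrable _ _); apply/funext => s /=.
rewrite /patch; case: ifPn => // /negP sK; rewrite fd//.
rewrite ltNge; apply/negP => sd; apply: sK; apply/mem_set.
by rewrite /K /= in_itv /= -ler_norml.
Qed.

(** Constancy on both sides of the support is what allows two maps composed with [G] to agree far
    away although the maps themselves differ. *)
Lemma antiderivative_exists (f : R -> R) (d : R) : continuous f ->
  (forall s, d < `|s| -> f s = 0) ->
  exists G : R -> R, [/\ forall s, is_derive s (1 : R) G (f s),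
    forall s s', d < s -> d < s' -> G s = G s' &
    forall s s', s < - d -> s' < - d -> G s = G s'].
Proof.
move=> cf fd; have intf := integrable_bounded_support cf fd.
exists (fun s => \int[leb]_(x in `]-oo, s]) f x); split.
- move=> s.
  pose F s := \int[leb]_(x in `]-oo, s]) f x.
  suff : derivable F s 1 /\ F^`()%classic s = f s.
    change (derivable F s 1 /\ F^`()%classic s = f s -> is_derive s (1 : R) F (f s)).
    move: {intf} F => F [df dF].
    by apply: DeriveDef; [exact: df|rewrite -derive1E].
  apply: (@continuous_FTC1 _ f -oo%O s (s + 1)) => //; first by rewrite ltrDl.
  - exact: integrableS intf.
  - exact: ltNyr.
  - exact: cf.
- move=> s s' ds ds'; rewrite [LHS]Rintegral_mkcond [RHS]Rintegral_mkcond.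
  apply: eq_Rintegral => x _; rewrite /patch !mem_setE !in_itv /= -/(0 : R).
  have f0 : d < x -> f x = 0 by move=> dx; rewrite fd// ltr_normr dx.
  by case: leP => h1; case: leP => h2 //; rewrite f0//; lra.
- move=> s s' ds ds'; rewrite [LHS]Rintegral_mkcond [RHS]Rintegral_mkcond.
  apply: eq_Rintegral => x _; rewrite /patch !mem_setE !in_itv /= -/(0 : R).
  have f0 : x < - d -> f x = 0 by move=> dx; rewrite fd// ltr_normr ltrNr dx orbT.
  by case: leP => h1; case: leP => h2 //; rewrite f0//; lra.
Qed.

End antiderivative.

(** * Change of variables for gradient maps *)

Section change_of_variables.
Context (R : realType) (m : nat).
Local Notation E := 'rV[R]_m.
Local Notation mu := (lebesgue_rV R m).
Local Notation e := (@basis_vec R m).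
Local Notation z := (fun _ : 'I_m => 0%N).

Lemma is_derive_comp1 (V : normedModType R) (f : V -> R) (g : R -> R) (x w : V) (df dg : R) :
  is_derive x w f df -> is_derive (f x) (1 : R) g dg ->
  is_derive x w (fun y => g (f y)) (dg * df).
Proof.
move=> /is_derive_lineP hf hg; apply/is_derive_lineP.
apply: (@is_derive1_comp _ g (fun t : R => f (x + t *: w))) => //.
by rewrite scale0r addr0.
Qed.

Lemma det_scale_rows (c : 'I_m -> R) (A : 'M[R]_m) :
  \det (\matrix_(i, j) (c i * A i j)) = (\prod_i c i) * \det A.
Proof.
have -> : \matrix_(i, j) (c i * A i j) = diag_mx (\row_i c i) *m A.
  by apply/matrixP => i j; rewrite mul_diag_mx !mxE.
by rewrite det_mulmx det_diag; congr (_ * _); apply: eq_bigr => i _; rewrite mxE.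
Qed.

Lemma Rint_Fubini (f : E * E -> R) (C A : R) : measurable_fun setT f ->
  (forall p, `|f p| <= C) -> (forall p, A < `|p.1| -> f p = 0) ->
  (forall p, A < `|p.2| -> f p = 0) ->
  \int[mu]_x \int[mu]_y f (x, y) = \int[mu]_y \int[mu]_x f (x, y).
Proof.
move=> mf fC f1 f2.
pose B := [set x : E | `|x| <= `|A|].
have mB : measurable B by exact: measurable_nball.
have lt1 (x : E) : x \notin B -> A < `|x|.
  by move=> /negP xB; apply: le_lt_trans (ler_norm A) _; rewrite ltNge;
    apply/negP => xA; apply: xB; rewrite inE.
have slice1 x : bms (fun y => f (x, y)).
  split; first exact: measurableT_comp mf (measurable_pair1 x).
  exists `|C|, `|A|; split => // [y|y Ay]; first by rewrite (le_trans (fC _))// ler_norm.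
  by apply: f2; exact: le_lt_trans (ler_norm A) Ay.
have slice2 y : bms (fun x => f (x, y)).
  split; first exact: measurableT_comp mf (measurable_pair2 y).
  exists `|C|, `|A|; split => // [x|x Ax]; first by rewrite (le_trans (fC _))// ler_norm.
  by apply: f1; exact: le_lt_trans (ler_norm A) Ax.
have intf : (mu \x mu)%E.-integrable setT (EFin \o f).
  apply/integrable12ltyP; first exact/measurable_EFinP.
  apply: (@le_lt_trans _ _ (\int[mu]_x \int[mu]_y (`|C| * \1_B x * \1_B y)%:E)%E).
    apply: ge0_le_integral => //.
    - by move=> x _; exact: integral_ge0.
    - apply: (@measurable_fun_fubini_tonelli_F _ _ _ _ _ mu (fun p => `|(f p)%:E|%E)) => //.
      by apply: measurableT_comp => //; exact/measurable_EFinP.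
    - apply: (@measurable_fun_fubini_tonelli_F _ _ _ _ _ mu (fun p => (`|C| * \1_B p.1 * \1_B p.2)%:E)) => //.
        apply/measurable_EFinP; apply: measurable_funM; last exact: measurableT_comp (measurable_indic mB) measurable_snd.
        by apply: measurable_funM => //; exact: measurableT_comp (measurable_indic mB) measurable_fst.
    - move=> x _; apply: ge0_le_integral => //.
      + apply: measurableT_comp => //; apply/measurable_EFinP.
        exact: (slice1 x).1.
      + by apply/measurable_EFinP; apply: measurable_funM.
      + move=> y _; rewrite lee_fin !indicE.
        case: (boolP (x \in B)) => [_|/lt1 xA]; last by rewrite f1// normr0 mulr0 mul0r.
        case: (boolP (y \in B)) => [_|/lt1 yA]; last by rewrite f2// normr0 mulr0.
        by rewrite !mulr1 (le_trans (fC _))// ler_norm.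
  have inn x : (\int[mu]_y (`|C| * \1_B x * \1_B y)%:E = (`|C|%:E * mu B) * (\1_B x)%:E)%E.
    under eq_integral do rewrite EFinM.
    rewrite ge0_integralZl//; last by apply/measurable_EFinP.
    by rewrite integral_indic// setIT EFinM muleAC.
  rewrite (eq_integral (fun x => (`|C|%:E * mu B) * (\1_B x)%:E)%E); last by move=> x _; exact: inn.
  have Bfin : mu B \is a fin_num by rewrite ge0_fin_numE// nball_fin.
  rewrite ge0_integralZl//; last 2 first.
  - by apply/measurable_EFinP.
  - by rewrite mule_ge0.
  rewrite integral_indic// setIT.
  by rewrite ltey_eq !fin_numM.
have := @Fubini _ _ _ _ _ mu mu (EFin \o f) intf.
under eq_integral do rewrite (integral_bms (slice1 _)).
under [RHS]eq_integral do rewrite (integral_bms (slice2 _)).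
by move=> h; rewrite /Rintegral h.
Qed.

Variables (v : E -> R) (d L t : R).
Hypotheses (lv : lip L v) (cv : cvx v) (L0 : 0 <= L) (d0 : 0 < d) (t0 : 0 < t).
Local Notation u := (moll v d z).
Local Notation du i := (moll v d (incr z i)).
Local Notation ddu i j := (moll v d (incr (incr z i) j)).
Local Notation dddu i j k := (moll v d (incr (incr (incr z i) j) k)).

Let contv : continuous v := lip_cont lv.

(** The gradient map of [u] plus [t |y|^2 / 2]; [DF] is its Jacobian matrix. *)
Let F k (y : E) := du k y + t * y 0 k.
Let DF y : 'M[R]_m := \matrix_(k, j) (ddu k j y + t * (k == j)%:R).

Let du_bound k y : `|du k y| <= L.
Proof.
have := lip_deriv_bound (lip_moll contv d0 lv) (is_derive_moll0 contv d0 y k).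
rewrite /enorm /dotv (bigD1 k)//= big1 ?addr0.
  by rewrite !mxE !eqxx mulr1 sqrtr1 mulr1.
by move=> i ik; rewrite !mxE (negbTE ik) andbF mul0r.
Qed.

Let is_derive_lin k j x (c : R) : is_derive x (e j) (fun y : E => t * y 0 k - c) (t * (k == j)%:R).
Proof.
have H : is_derive (x 0 k) (1 : R) (fun s : R => t * s - c) t.
  have := is_deriveB (is_deriveZ t (is_derive_id (x 0 k) (1 : R))) (is_derive_cst c (x 0 k) 1).
  by congr is_derive; rewrite subr0 [LHS]mulr1.
by have := is_derive_coord (e j) H; rewrite mxE eqxx.
Qed.

Let is_derive_F k j x (c : R) : is_derive x (e j) (fun y => F k y - c) (DF x k j).
Proof.
have := is_deriveD (is_derive_moll1 contv d0 x k j) (is_derive_lin k j x c).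
by congr is_derive; [apply/funext => y; rewrite /F -[LHS]/(_ + (_ - _)) addrA|rewrite mxE].
Qed.

Let is_derive_DF k j l x :
  is_derive x (e l) (fun y => DF y k j) (dddu k j l x).
Proof.
have := is_deriveD (is_derive_moll2 contv d0 x k j l)
  (is_derive_cst (t * (k == j)%:R) x (e l)).
by congr is_derive; [apply/funext => y; rewrite mxE|rewrite addr0].
Qed.

Let cF k : continuous (F k).
Proof.
apply: contD; first exact: moll_cont.
by apply: contZ; exact: coord_cont.
Qed.

Let cDF k j : continuous (fun y => DF y k j).
Proof.
rewrite (_ : (fun y => _) = (fun y => ddu k j y + t * (k == j)%:R)).
  by apply: contD; [exact: moll_cont|exact: cst_continuous].
by apply/funext => y; rewrite mxE.
Qed.

Let rowF (y : E) : E := \row_k F k y.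

Lemma continuous_comp1 (f : E -> R) (g : R -> R) :
  continuous f -> continuous g -> continuous (fun x => g (f x)).
Proof. by move=> cf cg x; apply: continuous_comp; [exact: cf|exact: cg]. Qed.

Let rowF_large (y : E) (r : R) : r + L < t * `|y| -> r < `|rowF y|.
Proof.
move=> h; rewrite ltNge; apply/negP => Fr.
have : `|t *: y| <= r + L.
  have r0 : 0 <= r by exact: le_trans Fr.
  apply/mx_norm_leP => [|i]; first by rewrite addr_ge0.
  have := mx_norm_coord (rowF y) i; rewrite !mxE => h1.
  have := du_bound i y; have := ler_normB (F i y) (du i y).
  by rewrite /F addrAC subrr add0r; move: h1 Fr; rewrite /F; lra.
by rewrite normrZ gtr0_norm//; lra.
Qed.

(** A degree computation. With [G] a primitive of the one-dimensional bump, the integrand is the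
    Jacobian determinant of the map with components [G (F k y - a 0 k)]. The same map built from the
    linear part [t y] has, far from the origin, one component with the same locally constant value.
    Null Lagrangians then equate the two integrals, and the linear one is a dilation and a
    translation of the kernel. *)
Lemma kern_change (a : E) (dl : R) : 0 < dl ->
  bms (fun y => kern dl z (rowF y - a) * \det (DF y)) /\
  \int[mu]_y (kern dl z (rowF y - a) * \det (DF y)) = kmass m dl.
Proof.
move=> dl0; set b0 := bumps dl 0; set b1 := bumps dl 1.
have b01 s : is_derive s (1 : R) b0 (- b1 s) by exact: is_derive_bumps.
have cb0 : continuous b0 by exact: bumps_cont.
have cb1 : continuous b1 by exact: bumps_cont.
have b0s s : dl < `|s| -> b0 s = 0 by move=> ?; exact: bumps_supp.
have [G [dG Gp Gn]] := antiderivative_exists cb0 b0s.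
have cG : continuous G.
  move=> s; apply: differentiable_continuous; apply/derivable1_diffP.
  by case: (dG s).
pose T k (y : E) := t * y 0 k.
have cT k : continuous (T k) by apply: contZ; exact: coord_cont.
have cFa k : continuous (fun y => F k y - a 0 k).
  by apply: contB => //; exact: cst_continuous.
have cTa k : continuous (fun y => T k y - a 0 k).
  by apply: contB => //; exact: cst_continuous.
(* Beyond this radius some coordinate of [t y] exceeds [|a| + L + dl] in absolute value. Gradients
   are bounded by [L], so [F k] and [T k] then leave the support of the bump on the same side. *)
pose M := (`|a| + L + dl) / t.
have := @det_null_lagrangian_diff R m
  (fun k y => G (F k y - a 0 k)) (fun k y => G (T k y - a 0 k))
  (fun k j y => b0 (F k y - a 0 k) * DF y k j)
  (fun k j y => b0 (T k y - a 0 k) * (t * (k == j)%:R))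
  (fun k j l y => b0 (F k y - a 0 k) * dddu k j l y +
                  DF y k j * (- b1 (F k y - a 0 k) * DF y k l))
  (fun k j l y => t * (k == j)%:R * (- b1 (T k y - a 0 k) * (t * (k == l)%:R)))
  M.
move=> /(_ _)/wrap[k|]; first exact: (continuous_comp1 (cFa k) cG).
move=> /(_ _)/wrap[k|]; first exact: (continuous_comp1 (cTa k) cG).
move=> /(_ _)/wrap[k j|].
  by apply: contM => //; exact: (continuous_comp1 (cFa k) cb0).
move=> /(_ _)/wrap[k j|].
  by apply: contM; [exact: (continuous_comp1 (cTa k) cb0)|exact: cst_continuous].
have cNb1 : continuous (fun s => - b1 s).
  by move=> s; apply: continuousN; exact: cb1.
move=> /(_ _)/wrap[k j l|].
  apply: contD; apply: contM => //.
  - exact: (continuous_comp1 (cFa k) cb0).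
  - exact: moll_cont.
  - by apply: contM => //; exact: (continuous_comp1 (cFa k) cNb1).
move=> /(_ _)/wrap[k j l|].
  apply: contZ; apply: contM; last exact: cst_continuous.
  exact: (continuous_comp1 (cTa k) cNb1).
move=> /(_ _)/wrap[k j x|].
  exact: (is_derive_comp1 (is_derive_F k j x (a 0 k)) (dG _)).
move=> /(_ _)/wrap[k j x|].
  exact: (is_derive_comp1 (is_derive_lin k j x (a 0 k)) (dG _)).
move=> /(_ _)/wrap[k j l x|].
  exact: (is_deriveM (is_derive_comp1 (is_derive_F k l x (a 0 k)) (b01 _))
    (is_derive_DF k j l x)).
move=> /(_ _)/wrap[k j l x|].
  have := is_deriveZ (t * (k == j)%:R)
    (is_derive_comp1 (is_derive_lin k l x (a 0 k)) (b01 _)).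
  by congr is_derive; apply/funext => y; rewrite [RHS]mulrC.
move=> /(_ _)/wrap[k j l x|].
  by rewrite (incrC (incr z k) j l); ring.
move=> /(_ _)/wrap[k j l x|]; first by ring.
have M0 : 0 <= M by rewrite divr_ge0 ?(ltW t0)// !addr_ge0// ltW.
move=> /(_ _)/wrap[x Mx|].
  have [k] := mx_norm_ltP M0 Mx; rewrite /M ltr_pdivrMr// => hk; exists k.
  have ak := mx_norm_coord a k; have dk := du_bound k x.
  have [big|big] : (dl < F k x - a 0 k /\ dl < T k x - a 0 k) \/
      (F k x - a 0 k < - dl /\ T k x - a 0 k < - dl).
    move: ak dk hk; rewrite /F /T ler_norml => /andP[a1 a2].
    rewrite ler_norml => /andP[d1 d2]; have [x0|x0] := leP 0 (x 0 k).
      by rewrite ger0_norm// => hk; left; split; lra.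
    by rewrite ltr0_norm// => hk; right; split; lra.
  - have [h1 h2] := big; split; first exact: Gp.
      by move=> j; rewrite b0s ?mul0r// ltr_normr h1.
    by move=> j; rewrite b0s ?mul0r// ltr_normr h2.
  - have [h1 h2] := big; split; first exact: Gn.
      by move=> j; rewrite b0s ?mul0r// ltr_normr ltrNr h1 orbT.
    by move=> j; rewrite b0s ?mul0r// ltr_normr ltrNr h2 orbT.
have E1 y : \det (\matrix_(k, j) (b0 (F k y - a 0 k) * DF y k j)) =
    kern dl z (rowF y - a) * \det (DF y).
  rewrite det_scale_rows; congr (_ * _); apply: eq_bigr => k _.
  by rewrite !mxE.
have E2 y : \det (\matrix_(k, j) (b0 (T k y - a 0 k) * (t * (k == j)%:R))) =
    t ^+ m * kern dl z (t *: y - a).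
  transitivity (\det (\matrix_(k, j) (b0 (T k y - a 0 k) * (t%:M : 'M[R]_m) k j))).
    by congr (\det _); apply/matrixP => k j; rewrite !mxE mulr_natr.
  rewrite det_scale_rows det_scalar mulrC; congr (_ * _).
  by apply: eq_bigr => k _; rewrite !mxE.
under eq_fun do rewrite E1.
move=> [b1' I1]; split => //.
rewrite I1; under eq_Rintegral do rewrite E2.
have Ck : Cc (fun y => kern dl z (y - a)) by apply: Cc_comp_subr; exact: Cc_kern.
have bk := Cc_bms (Cc_kern z dl0).
rewrite /kmass -(Rint_shift (- a) bk) -(Rint_scale t0 (Cc_bms Ck)).
rewrite RintZ//; apply: Cc_bms; split.
  have c1 : continuous (fun y : E => t *: y).
    by move=> y; exact: (cvgZ (cvg_cst t) cvg_id).
  case: Ck => ck _ y.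
  exact: (@continuous_comp _ _ _ (fun y : E => t *: y) (fun y => kern dl z (y - a)) y (c1 y) (ck _)).
case: Ck => _ [N kN]; exists (N / t) => y; rewrite ltr_pdivrMr// => h.
by apply: kN; rewrite normrZ gtr0_norm// mulrC.
Qed.

(** The gradient inequality of the mollified convex function is the defining inequality of the
    resolvent. *)
Lemma J_rowF y : J u t (rowF y) = y.
Proof.
apply: J_eq => // y'; apply: le_trans (moll_gradient contv d0 y y' cv).
rewrite lerD2l le_eqVlt; apply/orP; left; apply/eqP.
by apply: eq_bigr => i _; rewrite !mxE /F addrK mulrC.
Qed.

Lemma moll_cvg (w : E -> R) x : continuous w ->
  moll w k.+1%:R^-1 z x @[k --> \oo] --> w x.
Proof.
move=> cw; apply/cvgrPdist_le => eta eta0.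
have /nbhs_ballP[r /= r0 rw] : nbhs x [set y | `|w x - w y| <= eta].
  by have := cw x; move=> /(@cvgrPdist_le _ _ _ (nbhs x) (nbhs_filter x)); exact.
near=> k; rewrite distrC; apply: moll_close => //.
move=> y yk; rewrite distrC; apply: rw; rewrite -ball_normE/= opprD addrA subrr add0r normrN.
apply: le_lt_trans yk _; near: k.
exact: near_infty_natSinv_lt (PosNum r0).
Unshelve. all: by end_near. Qed.

(** The function [phi] composed with the resolvent is mollified and integrated; Fubini and
    [kern_change], applied for each centre, bring in the Jacobian, and the width of the kernel tends
    to 0. No injectivity or local inversion of the gradient map is invoked: [J_rowF] identifies the
    limit. *)
Lemma MA_smooth phi : Cc phi ->
  bms (fun y => phi y * \det (DF y)) /\
  \int[mu]_x phi (J u t x) = \int[mu]_y (phi y * \det (DF y)).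
Proof.
move=> Cphi; have lu := lip_moll contv d0 lv; have cu := cvx_moll contv d0 cv.
have Cpsi := Cc_comp_J L0 lu cu t0 Cphi; set psi := fun x => phi (J u t x) in Cpsi *.
have cdet : continuous (fun y => \det (DF y)).
  rewrite /determinant; apply: continuous_sum_fct => s _; apply: contZ.
  by apply: continuous_prod_fct => k _; exact: cDF.
have [_ [C [A [C0 A0 psiC psiA]]]] := Cc_bms Cpsi.
pose Y := (A + 1 + L) / t.
have [D D0 detD] := cont_bounded_ball Y cdet.
have bmsD' : bms (fun y => phi y * \det (DF y)).
  have := CcM cdet Cphi; move/Cc_bms; apply: eq_bms => y; exact: mulrC.
split=> //.
have crowF : continuous rowF.
  by apply: continuous_rV => i; under eq_fun do rewrite mxE; exact: cF.
have mollC dl y : 0 < dl -> `|moll psi dl z y| <= C.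
  move=> dl0; rewrite moll0E//; last exact: Cpsi.1.
  rewrite -[avg _ _]subr0; apply: avg_close => // [|y' _]; last by rewrite subr0.
  exact: (shift_cont Cpsi.1).
have supY dl y : 0 < dl -> dl <= 1 -> Y < `|y| -> moll psi dl z (rowF y) = 0.
  move=> dl0 dl1; rewrite /Y ltr_pdivrMr// mulrC => /rowF_large h.
  rewrite moll0E//; last exact: Cpsi.1.
  apply/eqP; rewrite -normr_le0 -[avg _ _]subr0; apply: avg_close => // [|y' y'd].
    exact: (shift_cont Cpsi.1).
  rewrite subr0 psiA ?normr0//.
  by have := ler_normB (rowF y + y') y'; rewrite addrK; lra.
have bmolP dl : 0 < dl -> dl <= 1 ->
    bms (fun y => moll psi dl z (rowF y) * \det (DF y)).
  move=> dl0 dl1; apply: Cc_bms; split.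
    apply: contM => // y; apply: continuous_comp; first exact: crowF.
    by apply: moll_cont; [|exact: Cpsi.1].
  by exists Y => y Yy; rewrite supY// mul0r.
(* The two iterated integrals of [f] are the two sides, each multiplied by the mass of the
   kernel. *)
have key dl : 0 < dl -> dl <= 1 -> \int[mu]_x psi x =
    \int[mu]_y (moll psi dl z (rowF y) * \det (DF y)).
  move=> dl0 dl1; have km := kmass_gt0 m dl0.
  have [_ [K [N [K0 N0 kK _]]]] := Cc_bms (Cc_kern z dl0).
  pose f (p : E * E) := psi p.1 * (kern dl z (rowF p.2 - p.1) * \det (DF p.2)).
  have supp2 p : psi p.1 != 0 -> Y < `|p.2| -> kern dl z (rowF p.2 - p.1) = 0.
    move=> psi0; rewrite /Y ltr_pdivrMr// mulrC => /rowF_large h.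
    apply: kern_supp => //.
    have pA : `|p.1| <= A by rewrite leNgt; apply/negP => /psiA; move/eqP: psi0.
    have := ler_normD (rowF p.2 - p.1) p.1; rewrite subrK; lra.
  have mf : measurable_fun setT f.
    apply: measurable_funM.
      exact: measurableT_comp (continuous_measurable_rV Cpsi.1) measurable_fst.
    apply: measurable_funM; last first.
      exact: measurableT_comp (continuous_measurable_rV cdet) measurable_snd.
    apply: (measurableT_comp (continuous_measurable_rV (Cc_kern z dl0).1)).
    apply/measurable_fun_rVP => i; under eq_fun do rewrite !mxE.
    apply: measurable_funB.
      exact: (measurableT_comp (continuous_measurable_rV (@cF i)) measurable_snd).
    exact: (measurableT_comp (measurable_rV_coord i) measurable_fst).
  have := @Rint_Fubini f (C * (K * D)) (Num.max A Y) mf.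
  move=> /(_ _)/wrap[p|].
    have [p0|p0] := eqVneq (psi p.1) 0.
      by rewrite /f p0 mul0r normr0 mulr_ge0// mulr_ge0.
    have [pY|pY] := leP `|p.2| Y; last first.
      by rewrite /f (supp2 _ p0 pY) mul0r mulr0 normr0 mulr_ge0// mulr_ge0.
    by rewrite /f !normrM ler_pM// ler_pM// detD.
  move=> /(_ _)/wrap[p|].
    by rewrite gt_max => /andP[pA _]; rewrite /f psiA// mul0r.
  move=> /(_ _)/wrap[p|].
    rewrite gt_max => /andP[_ pY]; have [p0|p0] := eqVneq (psi p.1) 0.
      by rewrite /f p0 mul0r.
    by rewrite /f (supp2 _ p0 pY) mul0r mulr0.
  have I1 x : \int[mu]_y f (x, y) = psi x * kmass m dl.
    by rewrite /f /= RintZ; [rewrite (kern_change x dl0).2|exact: (kern_change x dl0).1].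
  have I2 y : \int[mu]_x f (x, y) = kmass m dl * (moll psi dl z (rowF y) * \det (DF y)).
    rewrite /moll mulrA mulrA mulfV ?gt_eqF// mul1r mulrC -RintZ; last first.
      by apply/Cc_bms/CcM; [exact: Cpsi.1|apply: Cc_comp_subr; exact: Cc_kern].
    apply: eq_Rintegral => x _; rewrite /f /= -kern0_even opprB; ring.
  move: I1 I2; generalize f => g I1 I2.
  under eq_Rintegral do rewrite I1.
  under [RHS]eq_Rintegral do rewrite I2.
  have bmol := bmolP _ dl0 dl1.
  rewrite (RintZ _ bmol).
  under eq_Rintegral do rewrite mulrC.
  rewrite RintZ; last exact: Cc_bms.
  by move/(mulfI (lt0r_neq0 km)).
pose dk (k : nat) : R := k.+1%:R^-1.
have dk0 k : 0 < dk k by rewrite invr_gt0.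
have dk1 k : dk k <= 1 by rewrite invf_le1// ler1n.
have [||||_ H] := @Rint_dct R m
  (fun k y => moll psi (dk k) z (rowF y) * \det (DF y))
  (fun y => phi y * \det (DF y)) (C * D) Y.
- by move=> k; exact: (bmolP _ (dk0 k) (dk1 k)).1.
- move=> k y; have [yY|yY] := leP `|y| Y; last first.
    by rewrite supY// mul0r normr0 mulr_ge0.
  by rewrite normrM ler_pM// ?mollC// detD.
- by move=> k y Yy; rewrite supY// mul0r.
- move=> y; apply: cvgM; last exact: cvg_cst.
  by have := @moll_cvg psi (rowF y) Cpsi.1; rewrite /psi J_rowF.
apply/esym; apply: cvg_unique H _ => //.
rewrite /=; under eq_fun do rewrite -key//.
exact: cvg_cst.
Qed.

End change_of_variables.

(** * Determinantal polynomials of symmetric matrices *)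

Section pencils.
Context (R : realType).
Implicit Types (p q : {poly R}) (t : R).

Lemma poly_eq_pos p q : (forall t, 0 < t -> p.[t] = q.[t]) -> p = q.
Proof.
move=> pq; apply/eqP; rewrite -subr_eq0; apply/eqP.
pose s := [seq (k.+1%:R : R) | k <- iota 0 (size (p - q))].
apply: (@roots_geq_poly_eq0 _ _ s).
- apply/allP => _ /mapP[k _ ->]; rewrite rootE hornerD hornerN pq ?subrr//.
- rewrite map_inj_uniq ?iota_uniq// => a b /eqP.
  by rewrite eqr_nat => /eqP[].
- by rewrite size_map size_iota.
Qed.

(** Inverting a Vandermonde matrix makes each coefficient a fixed linear combination of the values
    at 1, ..., N. Continuity, limits and integrals thus pass from values of pencils to their
    coefficients. *)
Lemma interpolation N : exists c : nat -> nat -> R, forall p, (size p <= N)%N ->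
  forall j, (j < N)%N -> p`_j = \sum_(k < N) c j k * p.[k.+1%:R].
Proof.
pose V : 'M[R]_N := Vandermonde N (\row_(k < N) k.+1%:R).
have uV : V \in unitmx.
  rewrite unitmxE det_Vandermonde unitfE; apply/prodf_neq0 => i _.
  apply/prodf_neq0 => k ik; rewrite !mxE subr_eq0 eqr_nat eqSS.
  by rewrite neq_ltn ik orbT.
exists (fun j k => match insub j, insub k with
  Some j', Some k' => invmx V k' j' | _, _ => 0 end).
move=> p pN j jN; pose r : 'rV[R]_N := \row_i p`_i.
have rV k : (r *m V) 0 k = p.[k.+1%:R].
  rewrite mxE (horner_coef_wide _ pN).
  by apply: eq_bigr => i _; rewrite !mxE.
transitivity ((r *m V *m invmx V) 0 (Ordinal jN)); first by rewrite mulmxK// mxE.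
rewrite mxE; apply: eq_bigr => k _; rewrite rV mulrC insubT/= valK.
by congr (invmx V _ _ * _).
Qed.

Variable n : nat.
Implicit Types A B : 'M[R]_n.

Definition pencil A B : {poly R} := \det (map_mx polyC A + 'X *: map_mx polyC B).

Lemma pencil_mxE A B i k :
  (map_mx polyC A + 'X *: map_mx polyC B) i k = (A i k)%:P + 'X * (B i k)%:P.
Proof. by rewrite mxE [X in _ + X]mxE !(mxE map_mx_key). Qed.

Lemma pencil_horner A B t : (pencil A B).[t] = \det (A + t *: B).
Proof.
rewrite -[LHS]/(horner_eval t _) -det_map_mx; congr (\det _).
apply/matrixP => i j; rewrite [LHS]mxE pencil_mxE /= /horner_eval.
by rewrite hornerD hornerM hornerX !hornerC [RHS]mxE [in RHS]mxE.
Qed.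

Lemma size_pencil A B : (size (pencil A B) <= n.+1)%N.
Proof.
apply: (leq_trans (size_sum _ _ _)); apply/bigmax_leqP => s _.
rewrite -[(-1) ^+ _]/(GRing.sign _ _) -signr_odd.
have -> : forall b : bool, size (((-1) ^+ b : {poly R}) *
   \prod_i (map_mx polyC A + 'X *: map_mx polyC B) i (s i)) =
   size (\prod_i (map_mx polyC A + 'X *: map_mx polyC B) i (s i)).
  by case; rewrite ?expr1 ?expr0 ?mulN1r ?mul1r ?size_polyN.
apply: (leq_trans (size_poly_prod_leq _ _)).
rewrite leq_subLR card_ord addnS ltnS.
apply: (@leq_trans (\sum_(i < n) 2)%N); last by rewrite sum_nat_const card_ord; lia.
apply: leq_sum => i _; rewrite !mxE.
apply: (leq_trans (size_polyD _ _)); rewrite geq_max.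
rewrite (leq_trans (size_polyC_leq1 _))//=.
apply: (leq_trans (size_polyMleq _ _)); rewrite size_polyX.
by have := size_polyC_leq1 (B i (s i)); lia.
Qed.

End pencils.

(** * Real spectra of symmetric matrices *)

Section symmetric_splitting.
Import complex.
Context (R : realType) (n : nat).

(** The polynomial splits over the complex numbers. Evaluating the form of [A] at an eigenvector and
    its conjugate in two ways shows that each root is real; eigenvectors are then found over the
    reals. *)
Lemma symmetric_char_poly_splits (A : 'M[R]_n) : A^T = A ->
  exists2 s : seq R, char_poly A = \prod_(l <- s) ('X - l%:P) &
  forall l, l \in s -> exists2 x : 'rV[R]_n, x *m A = l *: x & x != 0.
Proof.
move=> symA; pose toC : R -> complex R := real_complex R.
pose AC := map_mx toC A.
have [sC sCE] := closed_field_poly_normal (char_poly AC).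
have mon : char_poly AC \is monic by exact: char_poly_monic.
rewrite (monicP mon) scale1r in sCE.
have realC l : l \in sC -> exists a : R, l = toC a.
  move=> ls; have : root (char_poly AC) l by rewrite sCE root_prod_XsubC.
  rewrite -eigenvalue_root_char => /eigenvalueP[x xA x0].
  pose y := map_mx Num.conj x.
  have ACr : map_mx Num.conj AC = AC.
    by apply/matrixP => i j; rewrite !mxE; exact: conjc_real.
  have h1 : x *m AC *m y^T = l *: (x *m y^T) by rewrite xA scalemxAl.
  have h2 : x *m AC *m y^T = Num.conj l *: (x *m y^T).
    rewrite -mulmxA -[AC]trmxK -trmx_mul.
    have -> : y *m AC^T = Num.conj l *: y.
      by rewrite /AC map_trmx symA -/AC -{1}ACr -map_mxM xA map_mxZ.
    by rewrite linearZ /= -scalemxAr.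
  have xy : x *m y^T != 0.
    apply/negP => /eqP/matrixP/(_ 0 0); rewrite !mxE => /eqP.
    under eq_bigr do rewrite !mxE -normCK.
    rewrite psumr_eq0; last by move=> i _; rewrite exprn_ge0.
    move=> /allP h; move/negP: x0; apply; apply/eqP/rowP => i; rewrite mxE.
    have /implyP/(_ isT) := h i (mem_index_enum i).
    by rewrite expf_eq0 normr_eq0 /= => /eqP.
  have : l = Num.conj l.
    apply/eqP; rewrite -subr_eq0; move: xy; apply: contraNT => ll.
    have : (l - Num.conj l) *: (x *m y^T) = 0 by rewrite scalerBl -h1 -h2 subrr.
    by move/eqP; rewrite scaler_eq0 (negbTE ll).
  move/esym/CrealP => lr; exists (Re l).
  by rewrite /toC RRe_real.
have [s sE] : exists s : seq R, sC = map toC s.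
  elim: sC realC {sCE} => [|l sC IH] h; first by exists [::].
  have [a la] := h l (mem_head _ _).
  have [|s ->] := IH; first by move=> l' l's; apply: h; rewrite inE l's orbT.
  by exists (a :: s); rewrite /= la.
exists s.
  apply: (map_poly_inj toC); rewrite map_char_poly -/AC sCE sE big_map.
  rewrite rmorph_prod; apply: eq_bigr => l _.
  by rewrite rmorphB /= map_polyX map_polyC.
move=> l ls.
have : root (char_poly AC) (toC l) by rewrite sCE root_prod_XsubC sE map_f.
rewrite -map_char_poly fmorph_root -eigenvalue_root_char => /eigenvalueP[x xA x0].
by exists x.
Qed.

End symmetric_splitting.

(** * Coefficients of pencils of symmetric matrices *)

Section symmetric_pencil.
Context (R : realType) (n : nat).
Implicit Types A B : 'M[R]_n.

Lemma pencil1E A (s : seq R) : char_poly A = \prod_(l <- s) ('X - l%:P) ->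
  size s = n /\ pencil A 1%:M = \prod_(l <- s) ('X + l%:P).
Proof.
move=> sE; have ss : size s = n.
  by have := size_char_poly A; rewrite sE size_prod_XsubC => -[].
split=> //; apply: poly_eq_pos => t _; rewrite pencil_horner.
have -> : A + t *: 1%:M = - (- A + (- t) *: 1%:M).
  by rewrite opprD opprK scaleNr opprK.
rewrite -scaleN1r detZ -[\det (- A + _)]pencil_horner.
have -> : pencil (- A) 1%:M = char_poly A.
  rewrite /pencil /char_poly /char_poly_mx; congr (\det _); apply/matrixP => i k.
  rewrite pencil_mxE !(mxE) polyCN addrC; case: (i == k); by rewrite ?mulr1n ?mulr0n ?mulr1 ?mulr0.
rewrite sE -{1}ss; elim: (s) => [|l s' IH]; first by rewrite !big_nil !hornerC mulr1.
rewrite !big_cons !hornerM -IH hornerXsubC hornerD hornerX hornerC /= exprS; ring.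
Qed.

Lemma pencil1_coef A (s : seq R) (j : nat) :
  char_poly A = \prod_(l <- s) ('X - l%:P) -> (j <= n)%N ->
  (pencil A 1%:M)`_(n - j) = elementary_sym j s.
Proof.
move=> /pencil1E[ss ->] jn.
rewrite (big_nth 0) big_mkord.
rewrite (eq_bigr (fun i : 'I_(size s) => (s`_i)%:P + 'X)); last by move=> i _; rewrite addrC.
rewrite bigA_distr coef_sum /elementary_sym [RHS]big_mkcond /=.
apply: eq_bigr => J _.
have Jn : (#|J| <= n)%N by have := max_card J; rewrite card_ord => /leq_trans; apply; rewrite ss.
have -> : \prod_i (if i \in J then (s`_i)%:P else 'X) =
    (\prod_(i in J) s`_i)%:P * 'X^(n - #|J|).
  rewrite (bigID (mem J)) /=; congr (_ * _).
    by rewrite rmorph_prod; apply: eq_bigr => i ->.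
  rewrite (eq_bigr (fun=> 'X)); last by move=> i /negbTE ->.
  rewrite prodr_const; congr ('X^_).
  have := cardsC J; rewrite card_ord => JE.
  transitivity #|~: J|; first by apply: eq_card => i; rewrite !inE.
  by apply: (@addnI #|J|); rewrite subnKC//; exact: etrans JE ss.
rewrite coefCM coefXn; have -> : (n - j == n - #|J|)%N = (#|J| == j).
  by apply/eqP/eqP; lia.
by case: (_ == _); rewrite ?mulr1 ?mulr0.
Qed.

Lemma elementary_sym_eigenvalues A (j : nat) : A^T = A -> (j <= n)%N ->
  elementary_sym j (eigenvalues A) = (pencil A 1%:M)`_(n - j).
Proof.
move=> symA jn; have [s sE _] := symmetric_char_poly_splits symA.
rewrite (@pencil1_coef A (eigenvalues A))// /eigenvalues.
(* The empty default of [eigenvalues] is excluded because a splitting exists. *)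
by case: xgetP => // h; have := h s sE.
Qed.

(** The coefficient is an elementary symmetric function of the eigenvalues, and each eigenvalue is a
    Rayleigh quotient. *)
Lemma pencil1_coef_ge0 A (m : nat) : A^T = A ->
  (forall x : 'rV[R]_n, 0 <= (x *m A *m x^T) 0 0) -> 0 <= (pencil A 1%:M)`_m.
Proof.
move=> symA psd; have [mn|mn] := leqP m n; last first.
  by rewrite nth_default//; apply: leq_trans (size_pencil _ _) _.
have [s sE sl] := symmetric_char_poly_splits symA.
rewrite -(subKn mn) (pencil1_coef sE) ?leq_subr//.
apply: sumr_ge0 => J _; apply: prodr_ge0 => i _.
have [x xA x0] := sl _ (mem_nth 0 (ltn_ord i)).
have := psd x; rewrite xA -scalemxAl mxE.
have xx : 0 < (x *m x^T) 0 0.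
  rewrite lt_def mxE sumr_ge0 ?andbT; last by move=> k _; rewrite mxE -expr2 sqr_ge0.
  apply: contra x0; rewrite psumr_eq0; last by move=> k _; rewrite mxE -expr2 sqr_ge0.
  move=> /allP h; apply/eqP/rowP => k; rewrite mxE.
  by have := h k (mem_index_enum k); rewrite mxE mulf_eq0 orbb => /eqP.
by rewrite pmulr_lge0.
Qed.

Lemma det_pencil1_gt0 A t : A^T = A ->
  (forall x : 'rV[R]_n, 0 <= (x *m A *m x^T) 0 0) -> 0 < t -> 0 < \det (A + t *: 1%:M).
Proof.
move=> symA psd t0; have [s sE _] := symmetric_char_poly_splits symA.
rewrite -pencil_horner (horner_coef_wide _ (size_pencil _ _)) big_ord_recr /=.
rewrite ltr_wpDl//.
  apply: sumr_ge0 => i _; rewrite mulr_ge0 ?pencil1_coef_ge0 ?exprn_ge0// ltW//.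
rewrite mulr_gt0 ?exprn_gt0//.
have := pencil1_coef sE (leq0n n); rewrite subn0 => ->.
rewrite /elementary_sym (big_pred1 finset.set0) => [|J]; last by rewrite cards_eq0.
by rewrite finset.big_set0.
Qed.

Lemma deriv_prod_ord (k : nat) (F : 'I_k -> {poly R}) :
  (\prod_i F i)^`() = \sum_i \prod_l (if l == i then (F l)^`() else F l).
Proof.
elim: k F => [|k IH] F; first by rewrite !big_ord0 derivC.
rewrite big_ord_recl derivM IH [RHS]big_ord_recl; congr (_ + _).
  by rewrite big_ord_recl eqxx.
rewrite mulr_sumr; apply: eq_bigr => i _; rewrite big_ord_recl; congr (_ * _).
Qed.

Lemma deriv_det (M : 'M[{poly R}]_n) :
  (\det M)^`() = \sum_i \det (\matrix_(k, l) if k == i then (M k l)^`() else M k l).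
Proof.
rewrite /determinant raddf_sum exchange_big /=; apply: eq_bigr => s _.
rewrite -mulr_sumr -signr_odd.
have -> : forall (b : bool) p, ((-1) ^+ b * p : {poly R})^`() = (-1) ^+ b * p^`().
  by case=> p; rewrite ?expr1 ?expr0 ?mulN1r ?mul1r ?derivN.
congr (_ * _); rewrite deriv_prod_ord; apply: eq_bigr => i _.
by apply: eq_bigr => k _; rewrite mxE.
Qed.

Definition pencil_adj A : 'M[{poly R}]_n := \adj (map_mx polyC A + 'X *: map_mx polyC 1%:M).

Lemma pencil_adj_horner A i k t : (pencil_adj A i k).[t] = \adj (A + t *: 1%:M) i k.
Proof.
transitivity (map_mx (horner_eval t) (pencil_adj A) i k); first by rewrite [RHS]mxE.
rewrite map_mx_adj; congr (\adj _ _ _); apply/matrixP => i' k'.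
rewrite [LHS]mxE pencil_mxE /= /horner_eval.
by rewrite hornerD hornerM hornerX !hornerC [RHS]mxE [X in _ = _ + X]mxE.
Qed.

(** Jacobi's formula: differentiating row by row replaces the row by a unit vector and leaves a
    diagonal cofactor. *)
Lemma deriv_pencil1 A : (pencil A 1%:M)^`() = \tr (pencil_adj A).
Proof.
rewrite /pencil /pencil_adj deriv_det.
have dM k l : ((map_mx polyC A + 'X *: map_mx polyC 1%:M) k l)^`() = (k == l)%:R%:P :> {poly R}.
  by rewrite pencil_mxE derivD derivM derivX !derivC mulr0 addr0 add0r mul1r mxE.
move: dM; set M := _ + _ => dM; apply: eq_bigr => i _.
rewrite [RHS]mxE -[RHS]mul1r (expand_det_row _ i) (bigD1 i)//= big1 ?addr0.
  rewrite mxE eqxx dM eqxx; congr (_ * _).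
  rewrite /cofactor; congr (_ * \det _); apply/matrixP => k l.
  by rewrite !mxE eq_sym (negbTE (neq_lift _ _)).
by move=> l li; rewrite mxE eqxx dM eq_sym (negbTE li) mul0r.
Qed.

Lemma pencil1_coef_trace A (k : nat) :
  (pencil A 1%:M)`_k.+1 *+ k.+1 = \sum_i (pencil_adj A i i)`_k.
Proof. by rewrite -coef_deriv deriv_pencil1 coef_sum. Qed.

(** Both elimination orders of the bordered matrix [C] give its determinant. The inverse is then
    rewritten as an adjugate, which is polynomial in the entries. *)
Lemma det_rank1 (B : 'M[R]_n) (c : R) (x y : 'rV[R]_n) : B \in unitmx ->
  \det (B + c *: (x^T *m y)) = \det B + c * \sum_i \sum_k y 0 i * \adj B i k * x 0 k.
Proof.
move=> uB.
have S : \det (B + c *: (x^T *m y)) = \det B * \det (1%:M + c *: (y *m invmx B *m x^T)).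
  pose C := block_mx B (- (c *: x^T)) y (1%:M : 'M[R]_1).
  have h1 : \det C = \det (B + c *: (x^T *m y)).
    have := det_mulmx C (block_mx 1%:M 0 (- y) 1%:M).
    rewrite mulmx_block !mulmx1 !mulmx0 !mul1mx !add0r subrr det_lblock !det1 !mulr1.
    rewrite det_ublock det1 mulr1 => <-; congr (\det (_ + _)).
    by rewrite mulNmx mulmxN opprK scalemxAl.
  rewrite -h1; have := det_mulmx (block_mx 1%:M 0 (- (y *m invmx B)) 1%:M) C.
  rewrite mulmx_block !mul1mx !mul0mx !addr0 det_lblock !det1 !mul1r => <-.
  rewrite mulNmx mulmxKV// addNr det_ublock; congr (_ * \det _).
  by rewrite mulmxN mulNmx opprK addrC -scalemxAr.
rewrite S det_mx11 !mxE eqxx mulr1n mulrDr mulr1; congr (_ + _).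
rewrite mulrCA; congr (_ * _); rewrite mulr_sumr exchange_big /=.
apply: eq_bigr => k _; rewrite !mxE mulrA mulr_sumr mulr_suml.
apply: eq_bigr => i _; congr (_ * _); rewrite mulrCA; congr (_ * _).
by rewrite /invmx uB mxE mulrA mulfV ?mul1r// -unitfE -unitmxE.
Qed.

End symmetric_pencil.

Section sylvester.
Context (R : realType) (n d : nat).

(** Two block eliminations of the same square matrix of size [d + n]; the powers of [t] replace
    divisions. *)
Lemma det_sylvester (t : R) (P : 'M[R]_(d, n)) (Q : 'M[R]_(n, d)) :
  t ^+ n * \det (t%:M + P *m Q) = t ^+ d * \det (t%:M + Q *m P).
Proof.
pose C := block_mx (t%:M : 'M[R]_d) (- P) Q (1%:M : 'M[R]_n).
have h1 : \det C = \det (t%:M + P *m Q).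
  have := det_mulmx C (block_mx 1%:M 0 (- Q) 1%:M).
  rewrite mulmx_block !mulmx1 !mulmx0 !mul1mx !add0r subrr det_lblock !det1 !mulr1.
  by rewrite det_ublock det1 mulr1 => <-; rewrite mulNmx mulmxN opprK.
have := det_mulmx (block_mx (1%:M : 'M[R]_d) 0 (- Q) (t%:M : 'M[R]_n)) C.
rewrite mulmx_block !mul1mx !mul0mx !addr0 det_lblock det1 mul1r det_scalar h1 => <-.
rewrite mulNmx mul_mx_scalar mul_scalar_mx addNr det_ublock det_scalar.
by rewrite mulmxN mulNmx opprK mulmx1 addrC.
Qed.

End sylvester.

(** * Steiner polynomials of Monge-Ampere measures *)

Lemma eq_cvg_seq (R : realType) (F G : nat -> R) (l : R) : (forall k, F k = G k) ->
  F k @[k --> \oo] --> l -> G k @[k --> \oo] --> l.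
Proof. by move=> /funext ->. Qed.

Lemma cvg_sum_fin (R : realType) (I : Type) (r : seq I) (P : pred I) (F : I -> nat -> R) (l : I -> R) :
  (forall i, P i -> F i k @[k --> \oo] --> l i) ->
  \sum_(i <- r | P i) F i k @[k --> \oo] --> \sum_(i <- r | P i) l i.
Proof.
move=> Fl; elim: r => [|i r IH].
  by rewrite big_nil; under eq_fun do rewrite big_nil; exact: cvg_cst.
rewrite big_cons; under eq_fun do rewrite big_cons.
by case: (boolP (P i)) => // Pi; apply: cvgD => //; exact: Fl.
Qed.

Lemma cvg_prod_fin (R : realType) (I : Type) (r : seq I) (P : pred I) (F : I -> nat -> R) (l : I -> R) :
  (forall i, P i -> F i k @[k --> \oo] --> l i) ->
  \prod_(i <- r | P i) F i k @[k --> \oo] --> \prod_(i <- r | P i) l i.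
Proof.
move=> Fl; elim: r => [|i r IH].
  by rewrite big_nil; under eq_fun do rewrite big_nil; exact: cvg_cst.
rewrite big_cons; under eq_fun do rewrite big_cons.
by case: (boolP (P i)) => // Pi; apply: cvgM => //; exact: Fl.
Qed.

(** * Monge-Ampere integrals as polynomials *)

Section hessian_limits.
Context (R : realType) (m : nat).
Local Notation E := 'rV[R]_m.
Local Notation mu := (lebesgue_rV R m).
Local Notation e := (@basis_vec R m).
Local Notation z := (fun _ : 'I_m => 0%N).
Implicit Types (h phi : E -> R) (x y : E) (t d L : R).

Definition mollH h d y : 'M[R]_m := \matrix_(i, j) moll h d (incr (incr z i) j) y.

Lemma mollH_sym h d y : (mollH h d y)^T = mollH h d y.
Proof. by apply/matrixP => i j; rewrite !mxE incrC. Qed.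

Lemma mollH_psd h d y (x : E) : continuous h -> cvx h -> 0 < d ->
  0 <= (x *m mollH h d y *m x^T) 0 0.
Proof.
move=> ch cxh d0; have := moll_hess_psd ch d0 y x cxh.
congr (_ <= _); rewrite mxE [LHS]exchange_big; apply: eq_bigr => j _ /=.
rewrite !mxE mulr_suml; apply: eq_bigr => i _; rewrite !mxE; ring.
Qed.

Lemma pencil_coef_cont (A B : E -> 'M[R]_m) (l : nat) :
  (forall i j, continuous (fun y => A y i j)) ->
  (forall i j, continuous (fun y => B y i j)) ->
  continuous (fun y => (pencil (A y) (B y))`_l).
Proof.
move=> cA cB; have [c cE] := interpolation R m.+1.
have [lm|lm] := ltnP l m.+1; last first.
  rewrite (_ : (fun y => _) = fun=> 0); first exact: cst_continuous.
  by apply/funext => y; rewrite nth_default// (leq_trans (size_pencil _ _)).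
rewrite (_ : (fun y => _) = (fun y => \sum_(k < m.+1)
    c l k * \det (A y + k.+1%:R *: B y))); last first.
  apply/funext => y; rewrite (cE _ (size_pencil _ _))//.
  by apply: eq_bigr => k _; rewrite pencil_horner.
apply: continuous_sum_fct => k _; apply: contZ.
apply: continuous_sum_fct => s _; apply: contZ; apply: continuous_prod_fct => i _.
rewrite (_ : (fun y => _) = (fun y => A y i (s i) + k.+1%:R * B y i (s i))).
  by apply: contD => //; apply: contZ.
by apply/funext => y; rewrite !mxE.
Qed.

(* J h t inverts the multifunction y |-> dh(y) + t y. The integral is that of phi against the
   Monge-Ampere measure of h + t |y|^2 / 2, i.e. det (D^2 h + t) dy if h is C^2. *)
Definition MA h t phi : R := \int[mu]_x phi (J h t x).

Definition dk (k : nat) : R := k.+1%:R^-1.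

Lemma dk_gt0 k : 0 < dk k. Proof. by rewrite invr_gt0. Qed.

Lemma dk_near (eps : R) : 0 < eps -> \forall k \near \oo, dk k < eps.
Proof. by move=> e0; exact: (near_infty_natSinv_lt (PosNum e0)). Qed.

Lemma MA_mollE h t phi L d : 0 <= L -> lip L h -> cvx h -> 0 < t -> 0 < d -> Cc phi ->
  MA (moll h d z) t phi = \int[mu]_y (phi y * (pencil (mollH h d y) 1%:M).[t]).
Proof.
move=> L0 lh ch t0 d0 Cphi; rewrite /MA (MA_smooth lh ch L0 d0 t0 Cphi).2.
apply: eq_Rintegral => y _; rewrite pencil_horner; congr (_ * \det _).
by apply/matrixP => i j; rewrite !mxE.
Qed.

Lemma MA_moll_cvg h t phi L : 0 <= L -> lip L h -> cvx h -> 0 < t -> Cc phi ->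
  MA (moll h (dk k) z) t phi @[k --> \oo] --> MA h t phi.
Proof.
move=> L0 lh ch t0 Cphi; have conth := lip_cont lh.
apply: (@MA_limit R m _ h phi L t) => //.
- by move=> k; exact: (lip_moll conth (dk_gt0 k) lh).
- by move=> k; exact: (cvx_moll conth (dk_gt0 k) ch).
move=> r eps eps0.
have e1 : 0 < eps / (L * m%:R + 1).
  by rewrite divr_gt0// ltr_wpDl// mulr_ge0.
have := dk_near e1; apply: filterS => k.
rewrite ltr_pdivlMr; last by rewrite ltr_wpDl// mulr_ge0.
move=> ke y _; apply: (le_trans (moll_lip_close conth (dk_gt0 k) y lh L0)).
have := dk_gt0 k; nra.
Qed.

Lemma mollP_coef_cont h d l : continuous h -> 0 < d ->
  continuous (fun y => (pencil (mollH h d y) 1%:M)`_l).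
Proof.
move=> ch d0; apply: pencil_coef_cont => i j; last exact: cst_continuous.
rewrite (_ : (fun y => _) = moll h d (incr (incr z i) j)); first exact: moll_cont.
by apply/funext => y; rewrite mxE.
Qed.

Lemma Rint_pencil phi (A B : E -> 'M[R]_m) t : Cc phi ->
  (forall i j, continuous (fun y => A y i j)) ->
  (forall i j, continuous (fun y => B y i j)) ->
  \int[mu]_y (phi y * (pencil (A y) (B y)).[t]) =
  \sum_(l < m.+1) t ^+ l * \int[mu]_y (phi y * (pencil (A y) (B y))`_l).
Proof.
move=> Cphi cA cB.
have b l : bms (fun y => phi y * (pencil (A y) (B y))`_l).
  have := CcM (pencil_coef_cont (l := l) cA cB) Cphi; move/Cc_bms.
  by apply: eq_bms => y; rewrite mulrC.
under [RHS]eq_bigr => l _ do rewrite -(RintZ _ (b l)).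
rewrite -Rint_sum; last by move=> l _; exact: bmsZ.
apply: eq_Rintegral => y _; rewrite (horner_coef_wide _ (size_pencil _ _)) mulr_sumr.
by apply: eq_bigr => l _; ring.
Qed.

Definition icoef : nat -> nat -> R := sval (cid (interpolation R m.+1)).

(* The coefficient of t^l in the polynomial t |-> MA h t phi. *)
Definition Psi h (l : nat) phi : R := \sum_(k < m.+1) icoef l k * MA h k.+1%:R phi.

(** Polynomials of bounded degree that converge at every positive point have convergent
    coefficients, by interpolation. *)
Lemma coef_cvg (G : nat -> nat -> R) (M : R -> R) :
  (forall t, 0 < t -> \sum_(l < m.+1) t ^+ l * G k l @[k --> \oo] --> M t) ->
  forall l, (l < m.+1)%N ->
  G k l @[k --> \oo] --> \sum_(i < m.+1) icoef l i * M i.+1%:R.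
Proof.
move=> GM l lm.
have GE k : G k l = \sum_(i < m.+1) icoef l i * \sum_(j < m.+1) i.+1%:R ^+ j * G k j.
  have := svalP (cid (interpolation R m.+1)) (\poly_(j < m.+1) G k j) (size_poly _ _) l lm.
  rewrite coef_poly lm => ->; apply: eq_bigr => i _; congr (_ * _).
  by rewrite horner_poly; apply: eq_bigr => j _; rewrite mulrC.
under eq_fun do rewrite GE.
apply: cvg_sum_fin => i _; apply: cvgM; first exact: cvg_cst.
exact: GM.
Qed.

Lemma Psi_moll_cvg h L phi l : 0 <= L -> lip L h -> cvx h -> Cc phi -> (l < m.+1)%N ->
  \int[mu]_y (phi y * (pencil (mollH h (dk k) y) 1%:M)`_l) @[k --> \oo] --> Psi h l phi.
Proof.
move=> L0 lh ch Cphi lm; have conth := lip_cont lh.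
apply: (@coef_cvg (fun k l => \int[mu]_y (phi y * (pencil (mollH h (dk k) y) 1%:M)`_l))
  (fun t => MA h t phi)) => // t t0.
have := MA_moll_cvg L0 lh ch t0 Cphi; apply: eq_cvg_seq => k; rewrite (MA_mollE L0 lh ch t0 (dk_gt0 k) Cphi).
apply: Rint_pencil => // i j; last exact: cst_continuous.
rewrite (_ : (fun y => _) = moll h (dk k) (incr (incr z i) j)).
  by apply: moll_cont => //; exact: dk_gt0.
by apply/funext => y; rewrite mxE.
Qed.

(** The interpolation formula has weights of both signs. Positivity is visible only on the mollified
    side, where the integrand is a pencil coefficient of a positive semidefinite Hessian. *)
Lemma Psi_ge0 h L phi l : 0 <= L -> lip L h -> cvx h -> Cc phi -> (l < m.+1)%N ->
  (forall y, 0 <= phi y) -> 0 <= Psi h l phi.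
Proof.
move=> L0 lh ch Cphi lm phi0; have := Psi_moll_cvg L0 lh ch Cphi lm.
move=> /(@cvg_lim _ (@Rhausdorff R)) <-.
apply: limr_ge; first by apply/cvg_ex; eexists; exact: (Psi_moll_cvg L0 lh ch Cphi lm).
apply: nearW => k; apply: Rint_ge0 => y; apply: mulr_ge0 => //.
apply: pencil1_coef_ge0; first exact: mollH_sym.
by move=> x; apply: mollH_psd => //; [exact: lip_cont lh|exact: dk_gt0].
Qed.

(** The identity holds for each mollification, where the integrand is a determinant, and both sides
    pass to the limit. *)
Lemma MA_poly h L phi t : 0 <= L -> lip L h -> cvx h -> Cc phi -> 0 < t ->
  MA h t phi = \sum_(l < m.+1) t ^+ l * Psi h l phi.
Proof.
move=> L0 lh ch Cphi t0; have conth := lip_cont lh.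
have H1 := MA_moll_cvg L0 lh ch t0 Cphi.
have H2 : \sum_(l < m.+1) t ^+ l * \int[mu]_y (phi y * (pencil (mollH h (dk k) y) 1%:M)`_l)
    @[k --> \oo] --> \sum_(l < m.+1) t ^+ l * Psi h l phi.
  apply: cvg_sum_fin => l _; apply: cvgM; first exact: cvg_cst.
  exact: (Psi_moll_cvg L0 lh ch Cphi).
apply: (cvg_unique (@Rhausdorff R) H1); move: H2; apply: eq_cvg_seq => k; rewrite (MA_mollE L0 lh ch t0 (dk_gt0 k) Cphi).
apply/esym/Rint_pencil => // i j; last exact: cst_continuous.
rewrite (_ : (fun y => _) = moll h (dk k) (incr (incr z i) j)).
  by apply: moll_cont => //; exact: dk_gt0.
by apply/funext => y; rewrite mxE.
Qed.

(** Moves a derivative from the kernel to the function. Differentiability is only asked for on the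
    support of the kernel, since outside it the product is locally zero. *)
Lemma moll_ibp h hi d (a : 'I_m -> nat) i x : 0 < d -> (forall k, a k < 3)%N ->
  continuous h -> continuous hi ->
  (forall y, `|y - x| <= d -> is_derive y (e i) h (hi y)) ->
  moll h d (incr a i) x = moll hi d a x.
Proof.
move=> d0 a3 ch chi hd; rewrite /moll; congr (_ * _).
have Ck : Cc (fun y => kern d a (y - x)) by apply: Cc_comp_subr; exact: Cc_kern.
have Ck' : Cc (fun y => kern d (incr a i) (y - x)) by apply: Cc_comp_subr; exact: Cc_kern.
have C1 := CcM chi Ck; have C2 := CcM ch Ck'.
pose dW y := hi y * kern d a (y - x) - h y * kern d (incr a i) (y - x).
have CdW : Cc dW.
  have := CcD C1 (CcM (@cst_continuous _ _ (-1 : R)) C2).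
  by rewrite (_ : (fun _ => _) = dW)//; apply/funext => y; rewrite mulN1r.
have := Rint_deriv0 (CcM ch Ck) CdW.
move=> /(_ i)/(_ _)/wrap[y|]; last first.
  rewrite RintB; [|exact: Cc_bms|exact: Cc_bms].
  by move/eqP; rewrite subr_eq0 => /eqP.
have dk1 : is_derive y (e i) (fun y => kern d a (y - x)) (- kern d (incr a i) (y - x)).
  apply/is_derive_lineP; have := is_derive_kern d (y - x) (e i) a3.
  rewrite (bigD1 i)//= big1 => [|k ki]; last by rewrite mxE (negbTE ki) andbF mul0r.
  rewrite mxE !eqxx mul1r addr0 => /is_derive_lineP.
  congr is_derive; apply/funext => s; congr (kern d a _).
  by rewrite addrAC.
have [yd|yd] := leP `|y - x| d.
  have := is_deriveM (hd y yd) dk1.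
  by congr is_derive; rewrite /dW -[LHS]/(_ * _ + _ * _); ring.
rewrite /dW !kern_supp// !mulr0 subrr.
have d0y : is_derive y (e i) (fun=> 0 : R) 0 by exact: is_derive_cst.
apply: (near_eq_is_derive _ d0y).
have cn : continuous (fun y' : E => `|y' - x|).
  move=> y'; apply: continuous_comp; last exact: norm_continuous.
  exact: (cvgB cvg_id (cvg_cst x)).
have S := cvgr_gt _ (cn y) _ yd; near=> y'.
have h1 : d < `|y' - x| by near: y'; exact: S.
by rewrite kern_supp// mulr0.
Unshelve. all: by end_near. Qed.

(** The function need only be smooth on a neighbourhood [U] of the support of [phi]; [hi] and [hij]
    are continuous everywhere but equal the derivatives only there. For small widths the mollified
    Hessian at points of the support is the mollification of [hij]. *)
Lemma MA_C2 h (hi : 'I_m -> E -> R) (hij : 'I_m -> 'I_m -> E -> R) (U : set E) L phi t r :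
  0 <= L -> lip L h -> cvx h -> 0 < t -> Cc phi -> 0 < r ->
  (forall i, continuous (hi i)) -> (forall i j, continuous (hij i j)) ->
  (forall i y, U y -> is_derive y (e i) h (hi i y)) ->
  (forall i j y, U y -> is_derive y (e j) (hi i) (hij i j y)) ->
  (forall y x, phi y != 0 -> `|x - y| <= r -> U x) ->
  MA h t phi = \int[mu]_y (phi y * (pencil (\matrix_(i, j) hij i j y) 1%:M).[t]).
Proof.
move=> L0 lh ch t0 Cphi r0 chi chij dh dhi phiU; have conth := lip_cont lh.
have [_ [C [A [C0 A0 phiC phiA]]]] := Cc_bms Cphi.
have mE d y i j : 0 < d -> d <= r -> phi y != 0 ->
    mollH h d y i j = moll (hij i j) d z y.
  move=> d0 dr py; rewrite mxE incrC.
  transitivity (moll (hi i) d (incr z j) y).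
    apply: moll_ibp => //; first by move=> k; rewrite /incr; case: (_ == _).
    by move=> x xy; apply: dh; apply: (phiU y); rewrite ?(le_trans xy).
  apply: moll_ibp => // x xy.
  by apply: dhi; apply: (phiU y); rewrite ?(le_trans xy).
have H1 := MA_moll_cvg L0 lh ch t0 Cphi.
apply: (cvg_unique (@Rhausdorff R) H1).
rewrite (_ : (fun k => _) = (fun k => \int[mu]_y (phi y * (pencil (mollH h (dk k) y) 1%:M).[t]))); last first.
  by apply/funext => k; rewrite (MA_mollE L0 lh ch t0 (dk_gt0 k) Cphi).
(* From the index [N] on, the mollification width is below the margin [r]. *)
have [N _ kN] := dk_near r0.
pose F k y := phi y * \det (\matrix_(i, j) (moll (hij i j) (dk k) z y + t * (i == j)%:R)).
suff : \int[mu]_y F (k + N)%N y @[k --> \oo] -->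
    \int[mu]_y (phi y * (pencil (\matrix_(i, j) hij i j y) 1%:M).[t]).
  rewrite -[X in _ -> X](cvg_shiftn N); apply: eq_cvg_seq => k.
  apply: eq_Rintegral => y _; rewrite /F; have [->|py] := eqVneq (phi y) 0.
    by rewrite !mul0r.
  congr (_ * _); rewrite pencil_horner; congr (\det _); apply/matrixP => i j.
  rewrite [LHS]mxE [RHS]mxE -(mE (dk (k + N)%N) y i j) ?dk_gt0//.
    by rewrite [X in _ = _ + X]mxE [X in _ = _ + _ * X]mxE.
  by apply/ltW/kN; rewrite /= leq_addl.
have cdet (B : 'I_m -> 'I_m -> E -> R) : (forall i j, continuous (B i j)) ->
    continuous (fun y => \det (\matrix_(i, j) (B i j y + t * (i == j)%:R))).
  move=> cB; apply: continuous_sum_fct => s _; apply: contZ; apply: continuous_prod_fct => i _.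
  rewrite (_ : (fun y => _) = (fun y => B i (s i) y + t * (i == s i)%:R)).
    by apply: contD; [exact: cB|exact: cst_continuous].
  by apply/funext => y; rewrite mxE.
have [D D0 hD] : exists2 D, 0 <= D & forall i j y, `|y| <= A + 1 -> `|hij i j y| <= D.
  have DPex (p : 'I_m * 'I_m) : exists D : R, 0 <= D /\ forall y, `|y| <= A + 1 -> `|hij p.1 p.2 y| <= D.
    by have [D D0 hD] := cont_bounded_ball (A + 1) (chij p.1 p.2); exists D.
  have [D DP] := choice DPex.
  exists (\sum_p D p); first by apply: sumr_ge0 => p _; case: (DP p).
  move=> i j y yA; apply: (le_trans ((DP (i, j)).2 y yA)).
  rewrite (bigD1 (i, j))//= lerDl; apply: sumr_ge0 => p _; by case: (DP p).
(* A crude bound for the determinant: one product of entry bounds for each permutation. *)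
pose B0 := \sum_(s : {perm 'I_m}) \prod_(i < m) (D + t).
have [||||_ H] := @Rint_dct R m (fun k => F (k + N)%N)
  (fun y => phi y * (pencil (\matrix_(i, j) hij i j y) 1%:M).[t]) (C * B0) A; last exact: H.
- move=> k; apply: continuous_measurable_rV; apply: contM; first by case: Cphi.
  by apply: cdet => i j; apply: moll_cont => //; exact: dk_gt0.
- move=> k y; rewrite /F; have [yA|yA] := leP `|y| A; last first.
    rewrite phiA// mul0r normr0 mulr_ge0// sumr_ge0// => s _.
    by rewrite prodr_ge0// => i _; rewrite addr_ge0// ltW.
  rewrite normrM ler_pM// (le_trans (ler_norm_sum _ _ _))//.
  apply: ler_sum => s _; rewrite normrM normr_sign mul1r normr_prod.
  apply: ler_prod => i _; rewrite normr_ge0 mxE (le_trans (ler_normD _ _))// lerD//.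
    rewrite moll0E//; last exact: dk_gt0.
    rewrite -[avg _ _]subr0; apply: avg_close; first exact: dk_gt0.
      exact: shift_cont.
    move=> x xd; rewrite subr0 hD// (le_trans (ler_normD _ _))// lerD//.
    by rewrite (le_trans xd)// /dk invf_le1// ler1n.
  by rewrite normrM gtr0_norm// ler_piMr ?(ltW t0)//; case: (i == s i); rewrite ?normr1 ?normr0.
- by move=> k y yA; rewrite /F phiA// mul0r.
- move=> y; apply: cvgM; first exact: cvg_cst.
  rewrite pencil_horner; apply: cvg_sum_fin => s _; apply: cvgM; first exact: cvg_cst.
  apply: cvg_prod_fin => i _.
  have -> : (fun k => (\matrix_(i0, j) (moll (hij i0 j) (dk (k + N)) z y + t * (i0 == j)%:R)) i (s i)) =
      (fun k => moll (hij i (s i)) (dk (k + N)) z y + t * (i == s i)%:R).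
    by apply/funext => k; rewrite mxE.
  rewrite !mxE; apply: cvgD; last exact: cvg_cst.
  by have := @moll_cvg R m (hij i (s i)) y (chij i (s i)); rewrite -(cvg_shiftn N).
Qed.

End hessian_limits.

Lemma cvg_maxr (R : realType) (T : Type) (F : set_system T) (f g : T -> R) (a b : R) : Filter F ->
  f x @[x --> F] --> a -> g x @[x --> F] --> b ->
  Num.max (f x) (g x) @[x --> F] --> Num.max a b.
Proof.
move=> FF fa gb; rewrite maxr_absE; under eq_fun do rewrite maxr_absE.
by apply: cvgM; [apply: cvgD; [exact: cvgD|apply: cvg_norm; exact: cvgB]|exact: cvg_cst].
Qed.

Lemma cvg_minr (R : realType) (T : Type) (F : set_system T) (f g : T -> R) (a b : R) : Filter F ->
  f x @[x --> F] --> a -> g x @[x --> F] --> b ->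
  Num.min (f x) (g x) @[x --> F] --> Num.min a b.
Proof.
move=> FF fa gb; rewrite minr_absE; under eq_fun do rewrite minr_absE.
by apply: cvgM; [apply: cvgB; [exact: cvgD|apply: cvg_norm; exact: cvgB]|exact: cvg_cst].
Qed.

Lemma contmax (R : realType) (T : topologicalType) (f g : T -> R) :
  continuous f -> continuous g -> continuous (fun x => Num.max (f x) (g x)).
Proof. by move=> cf cg x; exact: (cvg_maxr _ (cf x) (cg x)). Qed.

Lemma contmin (R : realType) (T : topologicalType) (f g : T -> R) :
  continuous f -> continuous g -> continuous (fun x => Num.min (f x) (g x)).
Proof. by move=> cf cg x; exact: (cvg_minr _ (cf x) (cg x)). Qed.

(** * From continuous test functions to Borel sets *)

Section baire_functions.
Context (R : realType) (m : nat).
Local Notation E := 'rV[R]_m.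
Local Notation mu := (lebesgue_rV R m).
Implicit Types (f g : E -> R) (A U : set E).

(** The values are kept in the unit interval so that every limit in the induction is dominated by
    1. *)
Inductive baire : (E -> R) -> Prop :=
| baire_cont f : continuous f -> (forall x, 0 <= f x <= 1) -> baire f
| baire_lim (F : nat -> E -> R) f : (forall k, baire (F k)) ->
    (forall x, F k x @[k --> \oo] --> f x) -> baire f.

Lemma baire_measurable f : baire f -> measurable_fun setT f.
Proof.
elim=> [{}f cf _|F {}f _ mF Ff]; first exact: continuous_measurable_rV.
by apply: (measurable_fun_cvg (h := F)) => // x _; exact: Ff.
Qed.

Lemma baire_range f x : baire f -> 0 <= f x <= 1.
Proof.
elim=> [{}f _ //|F {}f _ F01 Ff]; have cF : cvgn (fun k => F k x) by apply/cvg_ex; exists (f x).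
rewrite -(cvg_lim (@Rhausdorff R) (Ff x)); apply/andP; split.
  by apply: limr_ge => //; apply: nearW => k; case/andP: (F01 k).
by apply: limr_le => //; apply: nearW => k; case/andP: (F01 k).
Qed.

Lemma baire_compl f : baire f -> baire (fun x => 1 - f x).
Proof.
elim=> [{}f cf f01|F {}f _ bF Ff].
  apply: baire_cont; first by apply: contB => //; exact: cst_continuous.
  by move=> x; have := f01 x; lra.
by apply: (baire_lim bF) => x; apply: cvgB; [exact: cvg_cst|exact: Ff].
Qed.

Lemma baire_max f g : baire f -> baire g -> baire (fun x => Num.max (f x) (g x)).
Proof.
move=> bf bg; elim: bf => [{}f cf f01|F {}f _ bF Ff]; last first.
  by apply: (baire_lim bF) => x; apply: cvg_maxr; [exact: Ff|exact: cvg_cst].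
elim: bg => [{}g cg g01|G {}g _ bG Gg]; last first.
  by apply: (baire_lim bG) => x; apply: cvg_maxr; [exact: cvg_cst|exact: Gg].
apply: baire_cont => [|x]; first exact: contmax.
by have := f01 x; have := g01 x; case: (leP (f x) (g x)).
Qed.

Lemma lipschitz_continuous f : (forall x y, f x - f y <= `|x - y|) -> continuous f.
Proof.
move=> fl x; apply/(@cvgrPdist_le _ _ _ (nbhs x) (nbhs_filter x)) => eps e0.
apply/nbhs_ballP; exists eps => //= y; rewrite -ball_normE /= => xy.
rewrite ler_norml; apply/andP; split; last exact: le_trans (fl x y) (ltW xy).
by have := le_trans (fl y x); rewrite distrC => /(_ _ (ltW xy)); lra.
Qed.

Lemma baire_indic_open U : open U -> baire \1_U.
Proof.
move=> oU; have [[c cU]|noC] := pselect (exists c, ~ U c); last first.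
  have -> : \1_U = (fun=> 1 : R) :> (E -> R).
    apply/funext => x; rewrite indicE mem_set//.
    by apply: contrapT => Ux; apply: noC; exists x.
  apply: baire_cont; first exact: cst_continuous.
  by move=> x; rewrite ler01 lexx.
pose D x := [set `|x - y| | y in ~` U]; pose dist x := inf (D x).
have Dn x : D x !=set0 by exists `|x - c|; exists c.
have Dlb x : has_lbound (D x) by exists 0 => _ [y _ <-].
have dist0 x : 0 <= dist x by apply: lb_le_inf => // _ [y _ <-].
have cdist : continuous dist.
  apply: lipschitz_continuous => x y; rewrite lerBlDr -lerBlDl.
  apply: lb_le_inf => // _ [w Uw <-]; rewrite lerBlDl.
  apply: (@le_trans _ _ `|x - w|); first by apply: ge_inf => //; exists w.
  by have := ler_normD (x - y) (y - w); rewrite addrA subrK addrC.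
apply: (@baire_lim (fun k x => Num.min 1 (k%:R * dist x))) => [k|x].
  apply: baire_cont => [|x].
    by apply: contmin; [exact: cst_continuous|exact: contZ].
  by rewrite ge_min lexx le_min ler01 mulr_ge0.
rewrite indicE; case: (boolP (x \in U)) => /=; last first.
  move/negP => xU; have -> : dist x = 0.
    apply/eqP; rewrite eq_le dist0 andbT; apply: ge_inf => //.
    by exists x => [Ux|]; [apply: xU; exact: mem_set|rewrite subrr normr0].
  by under eq_fun do rewrite mulr0 min_r//; exact: cvg_cst.
move=> /set_mem Ux; have /nbhs_ballP[r /= r0 rU] : nbhs x U by exact: open_nbhs_nbhs.
have rd : r <= dist x.
  apply: lb_le_inf => // _ [y Uy <-]; rewrite leNgt; apply/negP => xy.
  by apply: Uy; apply: rU; rewrite -ball_normE.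
apply: cvg_near_cst; near=> k; apply/min_idPl.
rewrite (@le_trans _ _ (k%:R * r))// ?ler_wpM2l// -ler_pdivrMr// div1r.
by near: k; exact: nbhs_infty_ger.
Unshelve. all: by end_near. Qed.

(** The sets with Baire indicator form a sigma-algebra containing the open sets: complements come
    from [1 - f], countable unions from limits of finite maxima. *)
Lemma baire_indic A : measurable A -> baire \1_A.
Proof.
apply: (smallest_sub (C := fun G => sigma_algebra setT G) (G := @open E) (X := [set B | baire \1_B])).
  split => /=.
  - by apply: baire_indic_open; exact: open0.
  - move=> B bB; have := baire_compl bB; congr baire; apply/funext => x.
    by rewrite !indicE setTD in_setC; case: (x \in B); rewrite ?subrr ?subr0.
  - move=> B bB; pose V k := \bigcup_(i < k) B i.
    have bV k : baire \1_(V k).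
      elim: k => [|k IH].
        by rewrite /V bigcup_mkord big_ord0; apply: baire_indic_open; exact: open0.
      have := baire_max IH (bB k); congr baire; apply/funext => x.
      rewrite /V !bigcup_mkord big_ord_recr /= !indicE in_setU.
      by case: (x \in _); case: (x \in _); rewrite /= ?maxxx ?(max_l ler01) ?(max_r ler01).
    apply: (baire_lim bV) => x; rewrite !indicE.
    case: (boolP (x \in \bigcup_i B i)) => /= xB.
      move/set_mem: xB => [i _ Bi]; apply: cvg_near_cst; near=> k.
      rewrite indicE mem_set//; exists i => //=; near: k; exact: nbhs_infty_gt.
    rewrite (_ : (fun k => _) = fun=> 0); first exact: cvg_cst.
    apply/funext => k; rewrite indicE memNset//; move/negP: xB => xB [i ik Bi].
    by apply: xB; apply: mem_set; exists i.
by move=> U oU; exact: baire_indic_open.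
Unshelve. all: by end_near. Qed.

(** The only trace of integration that the extension to Borel sets uses: sequential continuity under
    a common bound and a common bounded support. *)
Definition dct_cont (L : (E -> R) -> R) := forall (F : nat -> E -> R) f (C M : R),
  (forall k, measurable_fun setT (F k)) ->
  (forall k x, `|F k x| <= C) -> (forall k x, M < `|x| -> F k x = 0) ->
  (forall x, F k x @[k --> \oo] --> f x) -> L (F k) @[k --> \oo] --> L f.

Definition cutoff (M : R) : E -> R := fun x => Num.max 0 (1 - Num.max 0 (`|x| - M)).

Lemma Cc_cutoff M : Cc (cutoff M).
Proof.
split.
  apply: contmax; first exact: cst_continuous.
  apply: contB; first exact: cst_continuous.
  apply: contmax; first exact: cst_continuous.
  by apply: contB; [exact: norm_continuous|exact: cst_continuous].
exists (M + 1) => x Mx; rewrite /cutoff; apply/max_idPl.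
by rewrite subr_le0 le_max; apply/orP; right; lra.
Qed.

Lemma cutoff_ge0 M x : 0 <= cutoff M x.
Proof. by rewrite le_max lexx. Qed.

Lemma cutoff_le1 M x : cutoff M x <= 1.
Proof. by rewrite ge_max ler01 /= lerBlDr lerDl le_max lexx. Qed.

Lemma cutoff_eq1 M x : `|x| <= M -> cutoff M x = 1.
Proof.
move=> xM; rewrite /cutoff [Num.max 0 (`|x| - M)]max_l; first by rewrite subr0 max_r.
by rewrite subr_le0.
Qed.

(* Positivity passes from continuous functions to pointwise limits, hence to
   indicators of Borel sets, all of which are Baire functions. *)
Lemma indic_ge0_of_Cc (L : (E -> R) -> R) A M : dct_cont L ->
  (forall phi, Cc phi -> (forall x, 0 <= phi x) -> 0 <= L phi) ->
  measurable A -> (forall x, A x -> `|x| <= M) -> 0 <= L \1_A.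
Proof.
move=> dL posL mA AM.
(* The cutoff equals 1 on [A] and keeps a common bounded support throughout the Baire induction. *)
suff H f : baire f -> 0 <= L (fun x => f x * cutoff M x).
  have := H _ (baire_indic mA); congr (_ <= L _); apply/funext => x.
  rewrite indicE; case: (boolP (x \in A)) => [/set_mem/AM xM|]; last by rewrite mul0r.
  by rewrite cutoff_eq1// mulr1.
have [N NM] : exists N, forall x, N < `|x| -> cutoff M x = 0 by case: (Cc_cutoff M).
elim=> [{}f cf f01|F {}f bF PF Ff].
  apply: posL; first by apply: CcM => //; exact: Cc_cutoff.
  by move=> x; rewrite mulr_ge0 ?cutoff_ge0//; case/andP: (f01 x).
have H : L (fun x => F k x * cutoff M x) @[k --> \oo] --> L (fun x => f x * cutoff M x).
  apply: (dL _ _ 1 N) => [k|k x|k x Nx|x].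
  - apply: measurable_funM; first exact: baire_measurable.
    by apply: continuous_measurable_rV; case: (Cc_cutoff M).
  - have /andP[a b] := baire_range x (bF k).
    by rewrite ger0_norm ?mulr_ge0 ?cutoff_ge0// mulr_ile1 ?cutoff_ge0 ?cutoff_le1.
  - by rewrite NM// mulr0.
  - by apply: cvgM; [exact: Ff|exact: cvg_cst].
rewrite -(cvg_lim (@Rhausdorff R) H); apply: limr_ge; last exact: nearW.
by apply/cvg_ex; eexists; exact: H.
Qed.

Lemma indic_eq_of_Cc (L1 L2 : (E -> R) -> R) A M : dct_cont L1 -> dct_cont L2 ->
  (forall phi, Cc phi -> L1 phi = L2 phi) ->
  measurable A -> (forall x, A x -> `|x| <= M) -> L1 \1_A = L2 \1_A.
Proof.
move=> d1 d2 L12 mA AM; apply/eqP; rewrite eq_le -[_ <= L2 _]subr_ge0 -[_ <= L1 _]subr_ge0.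
rewrite (@indic_ge0_of_Cc (fun f => L2 f - L1 f) A M)//; last 2 first.
- by move=> F f C N h1 h2 h3 h4; apply: cvgB; [exact: (d2 F f C N)|exact: (d1 F f C N)].
- by move=> phi Cphi _; rewrite L12// subrr.
rewrite (@indic_ge0_of_Cc (fun f => L1 f - L2 f) A M)//.
- by move=> F f C N h1 h2 h3 h4; apply: cvgB; [exact: (d1 F f C N)|exact: (d2 F f C N)].
- by move=> phi Cphi _; rewrite L12// subrr.
Qed.

Variables (h : E -> R) (L : R).
Hypotheses (L0 : 0 <= L) (lh : lip L h) (ch : cvx h).

Lemma measurable_J t : 0 < t -> measurable_fun setT (J h t).
Proof.
move=> t0; apply/measurable_fun_rVP => i; apply: continuous_measurable_rV.
exact: (J_cont L0 lh ch t0 (i := i)).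
Qed.

Lemma bms_comp_J t f : 0 < t -> bms f -> bms (fun x => f (J h t x)).
Proof.
move=> t0 [mf [C [M [C0 M0 fC fM]]]]; split.
  exact: measurableT_comp mf (measurable_J t0).
exists C, (m%:R * (t * (m%:R * M)) + L); split => //.
  by rewrite addr_ge0// mulr_ge0// mulr_ge0 ?(ltW t0)// mulr_ge0.
move=> x /(J_large L0 lh ch t0) hx; apply: fM.
have := lt_le_trans hx (enorm_le_mx_norm _).
case: (m) (J _ t x) => [|l] y; first by rewrite !mul0r ltxx.
by rewrite ltr_pM2l.
Qed.

Lemma MA_dct t : 0 < t -> dct_cont (MA h t).
Proof.
move=> t0 F f C M mF FC FM Ff.
have [||||_ H] := @Rint_dct R m (fun k x => F k (J h t x))
  (fun x => f (J h t x)) C (m%:R * (t * (m%:R * M)) + L); last exact: H.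
- by move=> k; exact: measurableT_comp (mF k) (measurable_J t0).
- by move=> k x; exact: FC.
- move=> k x /(J_large L0 lh ch t0) hx; apply: FM.
  have := lt_le_trans hx (enorm_le_mx_norm _).
  case: (m) (J _ t x) => [|l] y; first by rewrite !mul0r ltxx.
  by rewrite ltr_pM2l.
- by move=> x; exact: Ff.
Qed.

Lemma sum_dct (I : Type) (r : seq I) (c : I -> R) (T : I -> (E -> R) -> R) :
  (forall i, dct_cont (T i)) -> dct_cont (fun f => \sum_(i <- r) c i * T i f).
Proof.
move=> dT F f C M mF FC FM Ff; apply: cvg_sum_fin => i _.
by apply: cvgM; [exact: cvg_cst|exact: (dT i F f C M)].
Qed.

Lemma Psi_dct l : dct_cont (Psi h l).
Proof. by apply: sum_dct => k; apply: MA_dct. Qed.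

Lemma Psi_indic_ge0 l A M : (l < m.+1)%N -> measurable A ->
  (forall x, A x -> `|x| <= M) -> 0 <= Psi h l \1_A.
Proof.
move=> lm mA AM; apply: (indic_ge0_of_Cc (M := M)) => //; first exact: Psi_dct.
by move=> phi Cphi phi0; exact: (Psi_ge0 L0 lh ch Cphi lm).
Qed.

Lemma MA_indic_poly A M t : 0 < t -> measurable A -> (forall x, A x -> `|x| <= M) ->
  MA h t \1_A = \sum_(l < m.+1) t ^+ l * Psi h l \1_A.
Proof.
move=> t0 mA AM.
apply: (indic_eq_of_Cc (L2 := fun f => \sum_(l < m.+1) t ^+ l * Psi h l f) (M := M)) => //.
- exact: MA_dct.
- by apply: sum_dct => l; exact: Psi_dct.
- by move=> phi Cphi; exact: (MA_poly L0 lh ch Cphi t0).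
Qed.

Lemma PsiD l f g : bms f -> bms g -> Psi h l (fun x => f x + g x) = Psi h l f + Psi h l g.
Proof.
move=> bf bg; rewrite /Psi -big_split; apply: eq_bigr => k _.
by rewrite /MA RintD ?mulrDr//; exact: bms_comp_J.
Qed.

Lemma PsiZ l c f : bms f -> Psi h l (fun x => c * f x) = c * Psi h l f.
Proof.
move=> bf; rewrite /Psi mulr_sumr; apply: eq_bigr => k _.
by rewrite /MA RintZ 1?mulrCA//; exact: bms_comp_J.
Qed.

End baire_functions.

(** * Area measures *)

Lemma contV (R : realType) (T : topologicalType) (f : T -> R) :
  continuous f -> (forall x, f x != 0) -> continuous (fun x => (f x)^-1).
Proof. by move=> cf f0 x; exact: (@continuousV _ _ f x (f0 x) (cf x)). Qed.

Lemma dotv_sqrB (R : realType) (d : nat) (x y : 'rV[R]_d) :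
  dotv (x - y) (x - y) = dotv x x - 2 * dotv x y + dotv y y.
Proof. by rewrite dotvBl !dotvBr (dotvC y x); ring. Qed.

Lemma eq_indic (R : realType) (T T' : Type) (A : set T) (B : set T') x y :
  (A x <-> B y) -> \1_A x = \1_B y :> R.
Proof.
move=> [AB BA]; rewrite !indicE; congr (_ %:R); congr nat_of_bool.
by apply/idP/idP => /set_mem ?; apply/mem_set; [exact: AB|exact: BA].
Qed.

Lemma measure_of_fun (R : realType) d0 (T : measurableType d0) (nu : set T -> R) :
  (forall A, measurable A -> 0 <= nu A) -> nu set0 = 0 ->
  (forall F : (set T)^nat, (forall k, measurable (F k)) -> trivIset setT F ->
     \sum_(0 <= i < k) nu (F i) @[k --> \oo] --> nu (\bigcup_k F k)) ->
  exists S : {measure set T -> \bar R}, forall A, measurable A -> S A = (nu A)%:E.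
Proof.
move=> nu0 nus0 nuF.
(* A measure must be nonnegative on all sets, while [nu] is only known to be so on measurable ones;
   hence the truncation at 0. *)
pose m A : \bar R := (Num.max 0 (nu A))%:E.
have mE A : measurable A -> m A = (nu A)%:E by move=> mA; rewrite /m max_r// nu0.
have m0 : m set0 = 0%E by rewrite mE// nus0.
have mge0 A : (0 <= m A)%E by rewrite lee_fin le_max lexx.
have msa : semi_sigma_additive m.
  move=> F mF tF mUF; rewrite mE//.
  rewrite (_ : (fun n => _) = (fun n => (\sum_(0 <= i < n) nu (F i))%:E)).
    by apply: cvg_EFin; [exact: nearW|exact: nuF].
  by apply/funext => n; rewrite -sumEFin; apply: eq_bigr => i _; rewrite mE.
pose M := isMeasure.Build d0 T R m m0 mge0 msa.
pose S : {measure set T -> \bar R} := HB.pack m M.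
by exists S => A mA; exact: mE.
Qed.

Lemma staircase_approx (R : realType) (g b : R) (N : nat) : 0 <= b -> 0 <= g <= N%:R * b ->
  `|\sum_(i < N) b * (i.+1%:R * b <= g)%R%:R - g| <= b.
Proof.
move=> b0 /andP[g0 gN].
pose a i : R := Num.min g (i%:R * b).
have a0 : a 0%N = 0 by rewrite /a mul0r min_r.
have tele (u : nat -> R) (k : nat) : \sum_(i < k) (u i.+1 - u i) = u k - u 0%N.
  elim: k => [|k IH]; first by rewrite big_ord0 subrr.
  by rewrite big_ord_recr /= IH; ring.
have nS (i : nat) : i.+1%:R * b = i%:R * b + b by rewrite -natr1 mulrDl mul1r.
have up : \sum_(i < N) b * (i.+1%:R * b <= g)%R%:R <= g.
  apply: (@le_trans _ _ (\sum_(i < N) (a i.+1 - a i))).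
    apply: ler_sum => i _; rewrite /a nS; case: (leP (_ + b) g) => h /=.
      by rewrite mulr1 minC; case: (leP _ g) => h'; lra.
    by rewrite mulr0; case: (leP g _); lra.
  by rewrite tele a0 subr0 ge_min lexx.
have lo : g - b <= \sum_(i < N) b * (i.+1%:R * b <= g)%R%:R.
  apply: (@le_trans _ _ (\sum_(i < N) (a i.+2 - a i.+1))); last first.
    apply: ler_sum => i _; rewrite /a !nS; case: (leP (_ + b) g) => h /=.
      by rewrite mulr1; case: (leP g _); lra.
    by rewrite mulr0; case: (leP g _); lra.
  rewrite (tele (fun i => a i.+1)) /a !nS mul0r add0r.
  rewrite (min_l (x := g) (y := N%:R * b + b)); last by lra.
  by rewrite lerB// ge_min lexx orbT.
by rewrite ler_norml; apply/andP; split; lra.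
Qed.

(** A bounded nonnegative function is a uniform limit of staircases whose steps all have the same
    height, so additivity is only requested for indicators with a common coefficient. *)
Lemma integral_of_indic (R : realType) d0 (T : measurableType d0)
    (S : {measure set T -> \bar R}) (Lf : (T -> R) -> R) (G : T -> R) (C : R) :
  (forall A, measurable A -> S A = (Lf \1_A)%:E) ->
  (forall (n : nat) (c : R) (A : 'I_n -> set T), (forall i, measurable (A i)) ->
     Lf (fun x => \sum_(i < n) c * \1_(A i) x) = \sum_(i < n) c * Lf \1_(A i)) ->
  (forall (F : nat -> T -> R) (f : T -> R) (D : R), (forall k, measurable_fun setT (F k)) ->
     (forall k x, `|F k x| <= D) -> (forall x, F k x @[k --> \oo] --> f x) ->
     Lf (F k) @[k --> \oo] --> Lf f) ->
  measurable_fun setT G -> (forall x, 0 <= G x <= C) ->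
  0 <= C -> (\int[S]_x (G x)%:E)%E = (Lf G)%:E.
Proof.
move=> SL Lsum Ldct mG GC C0.
pose b (k : nat) : R := C / k.+1%:R.
have b0 k : 0 <= b k by rewrite divr_ge0.
pose A (k i : nat) := [set x | i.+1%:R * b k <= G x].
have mA k i : measurable (A k i).
  rewrite (_ : A k i = G @^-1` `[i.+1%:R * b k, +oo[).
    by rewrite -[X in measurable X]setTI; apply: mG => //; exact: measurable_itv.
  by apply/seteqP; split=> x /=; rewrite /A /= in_itv /= andbT.
pose F (k : nat) x := \sum_(i < k.+1) b k * \1_(A k i) x.
have Fapp k x : `|F k x - G x| <= b k.
  have := @staircase_approx R (G x) (b k) k.+1 (b0 k).
  rewrite /b mulrC mulfVK// => /(_ (GC x)); congr (`|_ - _| <= _).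
  apply: eq_bigr => i _; congr (_ * _); rewrite indicE; congr (_%:R); congr nat_of_bool.
  by apply/idP/idP => [h|/set_mem//]; exact: mem_set.
have mF k : measurable_fun setT (F k).
  apply: measurable_sum => i; apply: measurable_funM => //.
have FC k x : `|F k x| <= C + C.
  have h1 := Fapp k x; have h2 : b k <= C by rewrite /b ler_pdivrMr// ler_peMr// ler1n.
  have h3 : `|G x| <= C by have := GC x; case/andP => h3 h4; rewrite ger0_norm.
  by have := ler_normD (F k x - G x) (G x); rewrite subrK; lra.
have Fcvg x : F k x @[k --> \oo] --> G x.
  have C1 : 0 < C + 1 by lra.
  apply/cvgrPdist_le => eps eps0.
  have e1 : 0 < eps / (C + 1) by rewrite divr_gt0.
  near=> k; rewrite distrC; apply: (le_trans (Fapp k x)).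
  have h1 : dk R k < eps / (C + 1) by near: k; exact: dk_near.
  rewrite ltr_pdivlMr// in h1; have := dk_gt0 R k.
  by rewrite /b -/(dk R k); nra.
have IF k : (\int[S]_x (F k x)%:E)%E = (Lf (F k))%:E.
  rewrite Lsum// -sumEFin; under eq_integral do rewrite -sumEFin.
  rewrite ge0_integral_sum//; last 2 first.
  - by move=> i; apply/measurable_EFinP; apply: measurable_funM.
  - by move=> i x _; rewrite lee_fin mulr_ge0// indicE.
  apply: eq_bigr => i _; under eq_integral do rewrite EFinM.
  rewrite ge0_integralZl//; do ?[by apply/measurable_EFinP; exact: measurable_indic |
    by rewrite lee_fin b0 | by move=> *; rewrite lee_fin indicE].
  by rewrite integral_indic// setIT SL.
have Sfin : (S setT < +oo)%E by rewrite SL// ltry.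
have [] := @dominated_convergence _ _ _ S setT measurableT
  (fun k x => (F k x)%:E) (fun x => (G x)%:E) (fun=> (C + C)%:E).
- by move=> k; exact/measurable_EFinP.
- exact/measurable_EFinP.
- by apply: aeW => x _; apply: cvg_EFin; [exact: nearW|exact: Fcvg].
- by apply/integrableP; split => //; rewrite integral_cst// -(fineK (x := S setT)) -?EFinM ?ltry// ge0_fin_numE.
- by apply: aeW => x k _; rewrite lee_fin.
move=> _ _; under eq_fun do rewrite IF.
move=> H; apply: (cvg_unique _ H) => //.
apply: cvg_EFin; first exact: nearW.
by apply: (Ldct _ _ (C + C)).
Unshelve. all: by end_near. Qed.

(** * Support functions, nearest points and parallel sets *)

Section support_functions.
Context (R : realType) (d : nat) (K : set 'rV[R]_d).
Local Notation E := 'rV[R]_d.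
Hypothesis bK : convex_body K.
Local Notation h := (support_function K).
Implicit Types (x y p q : E) (t : R).

Lemma convex_body_bounded : exists2 M, 0 <= M & forall q, K q -> enorm q <= M.
Proof.
have [K0 cK _] := bK.
have [c cinK cmax] := EVT_max_rV K0 cK (continuous_subspaceT (@enorm_cont R d)).
by exists (enorm c) => [|q Kq]; [exact: enorm_ge0|apply: cmax; exact: mem_set].
Qed.

Lemma convex_bodyP p q t : K p -> K q -> 0 <= t <= 1 -> K (t *: p + (1 - t) *: q).
Proof.
move=> Kp Kq /andP[t0 t1]; have [_ _ cK] := bK.
have := cK p q (Itv01 t0 t1) (mem_set Kp) (mem_set Kq).
by move/set_mem.
Qed.

Lemma support_function_ge x q : K q -> dotv x q <= h x.
Proof.
have [M M0 KM] := convex_body_bounded.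
move=> Kq; apply: ub_le_sup; last by exists q.
exists (enorm x * M) => _ [y Ky <-]; apply: le_trans (cauchy_schwarz _ _) _.
by rewrite ler_wpM2l ?enorm_ge0// KM.
Qed.

Lemma support_function_le x M : (forall q, K q -> dotv x q <= M) -> h x <= M.
Proof.
have [[q Kq] _ _] := bK.
by move=> xM; apply: ge_sup; [exists (dotv x q), q|move=> _ [y Ky <-]; exact: xM].
Qed.

Lemma support_function_lip : exists2 L, 0 <= L & lip L h.
Proof.
have [M M0 KM] := convex_body_bounded; exists M => //.
have le x y : h x - h y <= M * enorm (x - y).
  rewrite lerBlDr; apply: support_function_le => q Kq.
  have := support_function_ge y Kq; have := cauchy_schwarz (x - y) q.
  rewrite dotvBl; have := KM q Kq; have := enorm_ge0 (x - y).
  by move=> h1 h2 h3 h4; have := ler_wpM2l h1 h2; lra.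
move=> x y; rewrite ler_norml le andbT; have := le y x.
by rewrite enorm_distC; lra.
Qed.

Lemma support_function_cvx : cvx h.
Proof.
move=> x y t /andP[t0 t1]; apply: support_function_le => q Kq.
rewrite dotvDl !dotvZl lerD// ler_wpM2l ?support_function_ge// subr_ge0//.
Qed.

Lemma support_functionZ x t : 0 <= t -> h (t *: x) = t * h x.
Proof.
move=> t0; have [[q Kq] _ _] := bK.
have le s y : 0 <= s -> h (s *: y) <= s * h y.
  move=> s0; apply: support_function_le => p Kp.
  by rewrite dotvZl ler_wpM2l// support_function_ge.
apply/eqP; rewrite eq_le le//=; case: (ltgtP 0 t) t0 => // [t0 _|<- _]; last first.
  by rewrite mul0r scale0r -(dotv0l q) support_function_ge.
have := le t^-1 (t *: x); rewrite scalerA mulVf ?gt_eqF// scale1r => /(_ _)/wrap[|].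
  by rewrite invr_ge0 ltW.
by rewrite ler_pdivlMl.
Qed.

(** By the variational inequality the nearest point [p] maximises the scalar product with [x - p]
    over [K]. Hence [p] is a subgradient of the support function at every positive multiple of
    [x - p], which identifies the resolvent. *)
Lemma nearest_pointP x : exists p, [/\ K p,
  forall q, K q -> dotv (x - p) (q - p) <= 0 &
  forall t, 0 < t -> J h t x = t^-1 *: (x - p)].
Proof.
have [K0 cK _] := bK.
have cg : continuous (fun q => dotv (x - q) (x - q)).
  rewrite (_ : (fun q => _) = (fun q => dotv x x - 2 * dotv q x + dotv q q)).
    apply: contD; last exact: dotvxx_cont.
    by apply: contB; [exact: cst_continuous|apply: contZ; exact: dotv_cont].
  by apply/funext => q; rewrite dotv_sqrB (dotvC x q).
have [p pK pmin] := EVT_min_rV K0 cK (continuous_subspaceT cg).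
move/set_mem in pK.
have vi q : K q -> dotv (x - p) (q - p) <= 0.
  move=> Kq; rewrite leNgt; apply/negP => D0.
  set D := dotv _ _ in D0; pose N := dotv (q - p) (q - p).
  have N0 : 0 <= N by exact: dotv_ge0.
  pose s := D / (D + N).
  have dn : 0 < D + N by lra.
  have s01 : 0 <= s <= 1 by rewrite /s divr_ge0 ?ler_pdivrMr ?mul1r//=; lra.
  have s0 : 0 < s by rewrite divr_gt0.
  have := pmin (s *: q + (1 - s) *: p) (mem_set (convex_bodyP Kq pK s01)).
  have -> : x - (s *: q + (1 - s) *: p) = (x - p) - s *: (q - p).
    by apply/rowP => i; rewrite !mxE; ring.
  rewrite [leRHS]dotv_sqrB !dotvZr !dotvZl -/D -/N.
  have h1 : s * (s * N - 2 * D) < 0.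
    rewrite pmulr_rlt0// /s mulrAC subr_lt0 ltr_pdivrMr//; nra.
  lra.
exists p; split=> // t t0; apply: J_eq => // y'.
have E1 : x - t *: (t^-1 *: (x - p)) = p.
  by rewrite scalerA mulfV ?gt_eqF// scale1r opprB addrC subrK.
rewrite E1 dotvBr addrA.
have hp : h (t^-1 *: (x - p)) = dotv p (t^-1 *: (x - p)).
  rewrite support_functionZ ?invr_ge0 ?(ltW t0)// dotvZr; congr (_ * _).
  apply/eqP; rewrite eq_le; apply/andP; split; last by rewrite dotvC support_function_ge.
  apply: support_function_le => q Kq; have := vi q Kq.
  by rewrite dotvBr (dotvC p); lra.
by rewrite hp addrAC subrr add0r dotvC support_function_ge.
Qed.

Lemma parallel_bodyP r x : parallel_body K r x <->
  exists q b, [/\ K q, enorm b <= 1 & x = q + r *: b].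
Proof.
split=> [[q Kq [b /= b1 <-]]|[q [b [Kq b1 ->]]]]; first by exists q, b.
by exists q => //; exists b.
Qed.

(** The definition refers to nearest points of the parallel body, the resolvent to those of [K]. The
    former is [p + (r / s) *: y], with [p] the nearest point of [K] and [y = x - p] of norm [s]; so
    outside the parallel body the direction is the same and the distance drops by [r]. *)
Lemma local_parallel_setE r rho (omega : set E) x : 0 < r ->
  local_parallel_set (parallel_body K r) rho omega x <->
  (r < enorm (J h 1 x) <= r + rho /\ omega ((enorm (J h 1 x))^-1 *: J h 1 x)).
Proof.
move=> r0; have [p [Kp vi JE]] := nearest_pointP x.
rewrite JE// invr1 scale1r.
have [y yE] : exists y, y = x - p by exists (x - p).
rewrite -yE in vi *; set s := enorm y.
have ss : s ^+ 2 = dotv y y by exact: enorm_sqr.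
have s_ge0 : 0 <= s by exact: enorm_ge0.
(* The parallel body lies on one side of the hyperplane through [p0] orthogonal to [y]. This gives
   both the distance and the uniqueness of the nearest point. *)
have key q' : parallel_body K r q' -> s * (s - r) <= dotv (x - q') y.
  move=> /parallel_bodyP[q [b [Kq b1 ->]]].
  have -> : x - (q + r *: b) = y - (q - p) - r *: b.
    by apply/rowP => i; rewrite yE !mxE; ring.
  rewrite !dotvBl dotvZl -ss; have := vi q Kq; rewrite (dotvC y) dotvBl.
  have := cauchy_schwarz b y; rewrite -/s => h1 h2.
  have h3 : r * dotv b y <= r * s by rewrite ler_pM2l// (le_trans h1)// ler_piMl.
  by lra.
have inK : s <= r -> parallel_body K r x.
  move=> sr; apply/parallel_bodyP; exists p, (r^-1 *: y); split => //.
    by rewrite enormZ gtr0_norm ?invr_gt0// ler_pdivrMl// mulr1.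
  by rewrite scalerA mulfV ?gt_eqF// scale1r yE addrC subrK.
have outK : r < s -> ~ parallel_body K r x.
  move=> rs /key; rewrite subrr dotv0l leNgt => /negP; apply.
  by rewrite mulr_gt0 ?subr_gt0//; lra.
pose p0 := p + (r / s) *: y.
have p0K : r < s -> parallel_body K r p0.
  move=> rs; apply/parallel_bodyP; exists p, (s^-1 *: y); split => //.
    by rewrite enormZ -/s ger0_norm ?invr_ge0// mulVf// gt_eqF//; lra.
  by rewrite scalerA.
have xp0 : r < s -> x - p0 = ((s - r) / s) *: y.
  move=> rs; rewrite /p0 opprD addrA -yE -{1}[y]scale1r -scalerBl; congr (_ *: _).
  by field; rewrite gt_eqF//; lra.
have nxp0 : r < s -> enorm (x - p0) = s - r.
  move=> rs; rewrite xp0// enormZ -/s ger0_norm ?divr_ge0//; last by lra.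
  by rewrite -mulrA mulVf ?mulr1// gt_eqF//; lra.
have near0 q' : r < s -> parallel_body K r q' -> s - r <= enorm (x - q').
  move=> rs Kq'; have := le_trans (key q' Kq') (cauchy_schwarz _ _).
  by rewrite -/s mulrC ler_pM2r//; lra.
have dir : r < s -> (enorm (x - p0))^-1 *: (x - p0) = s^-1 *: y.
  move=> rs; rewrite nxp0// xp0// scalerA mulrA mulVf ?mul1r//.
  by rewrite gt_eqF// subr_gt0.
split.
  move=> [xK [p' [Kp' p'min p'rho wp']]].
  have rs : r < s by rewrite ltNge; apply/negP => /inK.
  have np' : enorm (x - p') = s - r.
    by apply/eqP; rewrite eq_le near0// andbT -nxp0//; apply: p'min; exact: p0K.
  (* Two nearest points have equal distance to [x]; by [key] the square of their distance from each
     other is at most 0. *)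
  have xp' : x - p' = x - p0.
    apply/eqP; rewrite -subr_eq0; apply/eqP/dotv_eq0/eqP.
    rewrite eq_le dotv_ge0 andbT.
    rewrite dotv_sqrB -2!enorm_sqr np' nxp0//.
    rewrite xp0// dotvZr; have h1 := key _ Kp'.
    have : (s - r) / s * (s * (s - r)) <= (s - r) / s * dotv (x - p') y.
      by rewrite ler_wpM2l// divr_ge0//; lra.
    have -> : (s - r) / s * (s * (s - r)) = (s - r) ^+ 2.
      by field; rewrite gt_eqF//; lra.
    lra.
  split; first by rewrite rs /=; rewrite np' in p'rho; lra.
  by rewrite -dir// -xp'.
move=> [/andP[rs srho] ws]; split; first exact: outK.
exists p0; split.
- exact: p0K.
- by move=> q Kq; rewrite nxp0//; exact: near0.
- by rewrite nxp0//; lra.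
- by rewrite dir.
Qed.

Section area.
Variables (L : R).
Hypotheses (L0 : 0 <= L) (lh : lip L h).
Local Notation mu := (lebesgue_rV R d).

Definition dirv (x : E) : E := (enorm x)^-1 *: x.

(** The apex is left out, so that [dirv] is a unit vector on the cone. *)
Definition cone (t : R) (omega : set E) : set E :=
  [set y | 0 < enorm y <= t /\ omega (dirv y)].

Lemma measurable_enorm : measurable_fun setT (@enorm R d).
Proof. by apply: continuous_measurable_rV; exact: enorm_cont. Qed.

(** The map is discontinuous at the origin, so it is obtained as a limit of continuous maps with the
    norm truncated from below. *)
Lemma measurable_dirv : measurable_fun setT dirv.
Proof.
apply/measurable_fun_rVP => i.
apply: (measurable_fun_cvg (h := fun k (x : E) => (Num.max (enorm x) (dk R k))^-1 * x 0 i)).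
  move=> k; apply: continuous_measurable_rV; apply: contM; last exact: coord_cont.
  apply: contV; last by move=> x; rewrite gt_eqF// lt_max dk_gt0 orbT.
  by apply: contmax; [exact: enorm_cont|exact: cst_continuous].
move=> x _; rewrite mxE; have [x0|x0] := eqVneq x 0.
  rewrite x0 mxE; under eq_fun do rewrite mulr0; rewrite mulr0; exact: cvg_cst.
apply: cvgM; last exact: cvg_cst.
apply: cvg_near_cst; near=> k; rewrite max_l//; apply: ltW.
near: k; apply: dk_near; by rewrite enorm_gt0.
Unshelve. all: by end_near. Qed.

Lemma measurable_cone t omega : measurable omega -> measurable (cone t omega).
Proof.
move=> mw; rewrite (_ : cone t omega = ((@enorm R d) @^-1` `]0, t] `&` dirv @^-1` omega)); last first.
  apply/seteqP; split=> y /=; rewrite /cone /= in_itv //.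
apply: measurableI; rewrite -[X in measurable X]setTI.
  by apply: measurable_enorm => //; exact: measurable_itv.
exact: measurable_dirv.
Qed.

Lemma cone_bounded t omega x : cone t omega x -> `|x| <= t.
Proof. by move=> [/andP[_ xt] _]; apply: le_trans xt; exact: mx_norm_le_enorm. Qed.

Lemma bms_cone t omega : measurable omega -> bms (\1_(cone t omega) : E -> R).
Proof.
move=> mw; split; first by apply: measurable_indic; exact: measurable_cone.
exists 1, `|t|; split=> // x; first by rewrite indicE; case: (_ \in _); rewrite ?normr1 ?normr0.
by move=> tx; rewrite indicE memNset// => /cone_bounded; have := ler_norm t; lra.
Qed.

Lemma J_scale t x : 0 < t -> J h 1 x = t *: J h t x.
Proof.
move=> t0; have [p [_ _ JE]] := nearest_pointP x.
by rewrite !JE// invr1 scale1r scalerA mulfV ?gt_eqF// scale1r.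
Qed.

Lemma cone_J t omega x : 0 < t -> cone t omega (J h 1 x) <-> cone 1 omega (J h t x).
Proof.
move=> t0; rewrite (J_scale x t0) /cone /dirv /= enormZ gtr0_norm//.
have e1 (a : R) : (t * a <= t) = (a <= 1) by rewrite -{2}[t]mulr1 ler_pM2l.
by rewrite pmulr_rgt0// e1 scalerA invfM mulrAC mulVf ?mul1r// gt_eqF.
Qed.

Definition steiner omega : {poly R} :=
  \poly_(l < d.+1) Psi h l \1_(cone 1 omega).

(** Homogeneity trades the radius of the cone for the parameter of the resolvent, so polynomial
    dependence on that parameter becomes polynomial dependence on the radius. *)
Lemma MA_cone t omega : 0 < t -> measurable omega ->
  MA h 1 \1_(cone t omega) = (steiner omega).[t].
Proof.
move=> t0 mw; transitivity (MA h t \1_(cone 1 omega)).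
  by apply: eq_Rintegral => x _; apply: eq_indic; exact: cone_J.
rewrite (MA_indic_poly L0 lh support_function_cvx t0 (measurable_cone 1 mw) (@cone_bounded 1 omega)).
by rewrite horner_poly; apply: eq_bigr => l _; rewrite mulrC.
Qed.

(** The resolvent with parameter 1 maps exactly the local parallel set into the shell between two
    cones. *)
Lemma lebesgue_local_parallel_set r rho omega : 0 < r -> 0 < rho -> measurable omega ->
  mu (local_parallel_set (parallel_body K r) rho omega) =
  ((steiner omega).[r + rho] - (steiner omega).[r])%:E.
Proof.
move=> r0 rho0 mw; have rr : 0 < r + rho by rewrite addr_gt0.
have b1 := bms_comp_J L0 lh support_function_cvx ltr01 (bms_cone (r + rho) mw).
have b2 := bms_comp_J L0 lh support_function_cvx ltr01 (bms_cone r mw).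
rewrite -!MA_cone// /MA -RintB// -integral_bms; last exact: (bmsD b1 (bmsN b2)).
set P := local_parallel_set _ _ _.
have PE : P = J h 1 @^-1` (cone (r + rho) omega `\` cone r omega).
  apply/seteqP; split=> x /=; rewrite /P local_parallel_setE// /cone /=.
    move=> [/andP[h1 h2] w]; split; last by move=> [/andP[_ h3] _]; move: h1; rewrite ltNge h3.
    by split=> //; rewrite h2 andbT; exact: lt_trans h1.
  move=> [[/andP[h1 h2] w] h3]; split=> //; rewrite h2 andbT ltNge; apply/negP => h4.
  by apply: h3; split=> //; rewrite h1 h4.
have mP : measurable P.
  rewrite PE -[X in measurable X]setTI.
  apply: (measurable_J L0 lh support_function_cvx ltr01) => //.
  by apply: measurableD; exact: measurable_cone.
rewrite -[P]setIT -integral_indic//; apply: eq_integral => x _; congr EFin.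
have -> : \1_P x = \1_(cone (r + rho) omega `\` cone r omega) (J h 1 x) :> R by rewrite PE.
rewrite !indicE in_setD; case: (boolP (_ \in cone r omega)) => H /=; last by rewrite andbT subr0.
rewrite andbF (mem_set (A := cone (r + rho) omega)) ?subrr//.
by case/set_mem: H => /andP[h1 h2] w; split=> //; rewrite h1 /=; lra.
Qed.

Lemma steiner_cvg omega r : 0 < r -> measurable omega ->
  surface_area_measure (parallel_body K r) omega = ((steiner omega)^`().[r])%:E.
Proof.
move=> r0 mw; rewrite /surface_area_measure; set P := steiner omega.
have H : rho^-1 * (P.[r + rho] - P.[r]) @[rho --> (0 : R)^'+] --> (P^`()).[r].
  apply: cvg_dnbhs_at_right.
  have [dP dE] : derivable (horner P) r 1 /\ 'D_1 (horner P) r = P^`().[r].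
    by split; [exact: derivable_horner|rewrite derivE derive1E].
  rewrite -dE; have := dP; rewrite /derivable => /cvg_ex[l Hl].
  rewrite /derive (cvg_lim _ Hl)//; move: Hl.
  under eq_fun do rewrite /= /shift /= [_%:A]mulr1 [X in horner P X]addrC.
  by [].
apply: cvg_lim => //; apply/fine_cvgP; split.
  near=> rho; have rho0 : 0 < rho by [].
  by rewrite lebesgue_local_parallel_set.
apply: cvg_trans H; apply: near_eq_cvg; near=> rho; have rho0 : 0 < rho by [].
by rewrite /= lebesgue_local_parallel_set.
Unshelve. all: by end_near. Qed.

Lemma deriv_steiner omega r : (steiner omega)^`().[r] =
  \sum_(0 <= j < d) (d - j)%:R * r ^+ (d - j.+1) * Psi h (d - j) \1_(cone 1 omega).
Proof.
have sz : (size (steiner omega)^`() <= d)%N.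
  have [->|P0] := eqVneq (steiner omega) 0; first by rewrite deriv0 size_poly0.
  by rewrite -ltnS; apply: leq_trans (lt_size_deriv P0) _; exact: size_poly.
rewrite (horner_coef_wide _ sz) (reindex_inj rev_ord_inj) /= big_mkord.
apply: eq_bigr => j _; rewrite coef_deriv coef_poly.
have -> : (d - j.+1).+1 = (d - j)%N by have := ltn_ord j; lia.
rewrite ltnS leq_subr -mulr_natl; ring.
Qed.

Lemma bms_cone_comp (G : E -> R) (C : R) : measurable_fun setT G -> (forall x, `|G x| <= C) ->
  bms (fun y => G (dirv y) * \1_(cone 1 setT) y).
Proof.
move=> mG GC; have [mf [D [M [D0 M0 _ fM]]]] := bms_cone 1 (@measurableT _ E).
split; first by apply: measurable_funM => //; exact: measurableT_comp mG measurable_dirv.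
exists `|C|, M; split=> // y; last by move=> /fM ->; rewrite mulr0.
rewrite normrM indicE; case: (y \in _); rewrite ?normr1 ?normr0 ?mulr1 ?mulr0//.
by rewrite (le_trans (GC _))// ler_norm.
Qed.

Lemma indic_cone (A : set E) y : \1_A (dirv y) * \1_(cone 1 setT) y = \1_(cone 1 A) y :> R.
Proof.
rewrite !indicE -natrM mulnb; congr (_%:R); congr nat_of_bool.
apply/andP/idP => [[/set_mem yA /set_mem[y1 _]]|/set_mem[y1 yA]]; first exact: mem_set.
by split; apply: mem_set.
Qed.

(** The candidate for the integral of [G] against an area measure: [G] is extended along rays, cut
    to the unit cone and tested against one Steiner coefficient. *)
Definition cone_functional (c : R) (l : nat) (G : E -> R) : R :=
  c * Psi h l (fun y => G (dirv y) * \1_(cone 1 setT) y).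

Lemma cone_functional_indic c l A : cone_functional c l \1_A = c * Psi h l \1_(cone 1 A).
Proof. by congr (_ * Psi h l _); apply/funext => y; exact: indic_cone. Qed.

Lemma cone_functional_dct c l (F : nat -> E -> R) (f : E -> R) (D : R) :
  (forall k, measurable_fun setT (F k)) ->
  (forall k x, `|F k x| <= D) -> (forall x, F k x @[k --> \oo] --> f x) ->
  cone_functional c l (F k) @[k --> \oo] --> cone_functional c l f.
Proof.
move=> mF FD Ff; apply: cvgM; first exact: cvg_cst.
apply: (Psi_dct L0 lh support_function_cvx (C := `|D|) (M := 1)) => [k|k x|k x x1|x].
- by apply: (bms_cone_comp (mF k) (FD k)).1.
- rewrite normrM indicE; case: (x \in _); rewrite ?normr1 ?normr0 ?mulr1 ?mulr0//.
  by rewrite (le_trans (FD _ _))// ler_norm.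
- by rewrite indicE memNset ?mulr0// => /cone_bounded; lra.
- by apply: cvgM; [exact: Ff|exact: cvg_cst].
Qed.

Lemma cone_functional_sum c l (n : nat) (b : R) (A : nat -> set E) :
  (forall i, measurable (A i)) ->
  cone_functional c l (fun x => \sum_(i < n) b * \1_(A i) x) =
  \sum_(i < n) b * cone_functional c l \1_(A i).
Proof.
move=> mA; have bA i : bms (\1_(cone 1 (A i)) : E -> R) by exact: bms_cone.
elim: n => [|n IH].
  rewrite big_ord0 /cone_functional (_ : (fun y => _) = (fun y => 0 * (0 : R))).
    by rewrite (PsiZ L0 lh support_function_cvx) ?mul0r ?mulr0//; exact: bms0.
  by apply/funext => y; rewrite big_ord0 !mul0r.
rewrite big_ord_recr /= -IH /cone_functional.
have E1 y : (\sum_(i < n.+1) b * \1_(A i) (dirv y)) * \1_(cone 1 setT) y =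
    (\sum_(i < n) b * \1_(A i) (dirv y)) * \1_(cone 1 setT) y + b * \1_(cone 1 (A n)) y :> R.
  by rewrite big_ord_recr /= mulrDl -(mulrA b) indic_cone.
under eq_fun do rewrite E1.
rewrite (PsiD L0 lh support_function_cvx); last exact: bmsZ.
  rewrite (PsiZ L0 lh support_function_cvx)// mulrDr; congr (_ + _).
  rewrite mulrCA; congr (_ * (_ * Psi h l _)); apply/funext => y; by rewrite indic_cone.
have mS : measurable_fun setT (fun x => \sum_(i < n) b * \1_(A i) x).
  by apply: measurable_sum => i; apply: measurable_funM.
apply: (bms_cone_comp mS (C := \sum_(i < n) `|b|)) => x.
apply: le_trans (ler_norm_sum _ _ _) _; apply: ler_sum => i _.
by rewrite normrM indicE; case: (x \in _); rewrite ?normr1 ?normr0 ?mulr1 ?mulr0.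
Qed.

(** Positivity is [Psi_indic_ge0]; countable additivity is bounded convergence for the partial sums
    of indicators of disjoint sets. *)
Lemma cone_measure_exists c l : 0 <= c -> (l < d.+1)%N ->
  exists S : {measure set E -> \bar R},
    forall A, measurable A -> S A = (cone_functional c l \1_A)%:E.
Proof.
move=> c0 ld; apply: measure_of_fun => [A mA||F mF tF].
- rewrite cone_functional_indic mulr_ge0//.
  apply: (Psi_indic_ge0 L0 lh support_function_cvx ld (measurable_cone 1 mA)).
  exact: cone_bounded.
- have := @cone_functional_sum c l 0 0 (fun=> set0) (fun=> measurable0).
  rewrite big_ord0 => <-; congr (cone_functional _ _ _).
  by apply/funext => y; rewrite big_ord0 indicE in_set0.
have E1 k : \sum_(0 <= i < k) cone_functional c l \1_(F i) =
    cone_functional c l (fun x => \sum_(i < k) 1 * \1_(F i) x).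
  by rewrite cone_functional_sum// big_mkord; apply: eq_bigr => i _; rewrite mul1r.
under eq_fun do rewrite E1.
have E2 k x : \sum_(i < k) 1 * \1_(F i) x = \1_(\bigcup_(i < k) F i) x :> R.
  elim: k => [|k IH].
    by rewrite big_ord0 bigcup_mkord big_ord0 indicE in_set0.
  rewrite big_ord_recr /= IH mul1r !bigcup_mkord big_ord_recr /= -bigcup_mkord.
  rewrite !indicE in_setU; case: (boolP (x \in F k)) => Fk; last by rewrite orbF addr0.
  rewrite (memNset (A := \bigcup_(i < k) F i)) ?add0r// => -[i /= ik Fi].
  have := tF i k Logic.I Logic.I; move: Fk => /set_mem Fk => /(_ _)/wrap[|ike].
    by exists x.
  by rewrite ike ltnn in ik.
apply: (cone_functional_dct (D := 1)) => [k|k x|x].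
- by apply: measurable_sum => i; apply: measurable_funM.
- by rewrite E2 indicE; case: (x \in _); rewrite ?normr1 ?normr0.
under eq_fun do rewrite E2.
rewrite !indicE; case: (boolP (x \in \bigcup_i F i)) => /= xB.
  move/set_mem: xB => [i _ Fi]; apply: cvg_near_cst; near=> k.
  rewrite indicE mem_set//; exists i => //=; near: k; exact: nbhs_infty_gt.
rewrite (_ : (fun k => _) = fun=> 0); first exact: cvg_cst.
apply/funext => k; rewrite indicE memNset//; move/negP: xB => xB [i ik Bi].
by apply: xB; apply: mem_set; exists i.
Unshelve. all: by end_near. Qed.

Lemma integral_cone_measure c l (S : {measure set E -> \bar R}) (G : E -> R) (C : R) :
  (forall A, measurable A -> S A = (cone_functional c l \1_A)%:E) ->
  measurable_fun setT G -> (forall x, 0 <= G x <= C) -> 0 <= C ->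
  (\int[S]_x (G x)%:E)%E = (cone_functional c l G)%:E.
Proof.
move=> SE; apply: integral_of_indic => //; last exact: cone_functional_dct.
move=> n b A mA.
case: n A mA => [|n] A mA.
  have := @cone_functional_sum c l 0 b (fun=> set0) (fun=> measurable0).
  rewrite [RHS]big_ord0 => H; rewrite [RHS]big_ord0.
  transitivity (cone_functional c l (fun x : E => \sum_(i < 0) b * \1_set0 x)); last exact: H.
  by congr (cone_functional _ _ _); apply/funext => x; rewrite !big_ord0.
have := @cone_functional_sum c l n.+1 b (fun i => A (inord i)) (fun i => mA (inord i)).
have E1 (f : 'I_n.+1 -> R) : \sum_(i < n.+1) f (inord i) = \sum_(i < n.+1) f i.
  by apply: eq_bigr => i _; rewrite inord_val.
rewrite (E1 (fun i => b * cone_functional c l \1_(A i))) => <-.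
congr (cone_functional _ _ _); apply/funext => x.
by rewrite (E1 (fun i => b * \1_(A i) x)).
Qed.

End area.

End support_functions.

(** * Identification of the area measures *)

Section area_measure_identification.
Context (R : realType) (n : nat) (K : set 'rV[R]_(n + 1)).
Hypothesis bK : convex_body K.
Local Notation h := (support_function K).
Local Notation E := 'rV[R]_(n + 1).

(** The numerator comes from differentiating the Steiner polynomial in degree [n + 1 - j], the
    denominator is the binomial in the definition of the area measures. *)
Definition area_coef (j : nat) : R := (n.+1 - j)%:R / 'C(n, j)%:R.

(** The cone measures show that a family exists. The chosen family may be another one, but both
    satisfy the same polynomial identity in the radius, so their coefficients agree. *)
Lemma area_measureP j omega : (j <= n)%N -> measurable omega ->
  area_measure K j omega = (cone_functional K (area_coef j) (n + 1 - j) \1_omega)%:E.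
Proof.
have [L L0 lh] := support_function_lip bK.
have binp k : (k <= n)%N -> 0 < 'C(n, k)%:R :> R by move=> kn; rewrite ltr0n bin_gt0.
have srf r w : 0 < r -> measurable w -> surface_area_measure (parallel_body K r) w =
    (\sum_(k < n.+1) 'C(n, k)%:R * r ^+ (n - k) * cone_functional K (area_coef k) (n + 1 - k) \1_w)%:E.
  move=> r0 mw; rewrite (steiner_cvg bK L0 lh r0 mw) (deriv_steiner _ L0); congr EFin.
  pose F k := (n + 1 - k)%:R * r ^+ (n + 1 - k.+1) * Psi h (n + 1 - k) \1_(cone 1 w).
  have aux (G : nat -> R) N M : N = M -> \sum_(0 <= k < N) G k = \sum_(k < M) G k.
    by move=> ->; rewrite big_mkord.
  transitivity (\sum_(k < n.+1) F k); first exact: (aux F _ _ (addn1 n)).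
  apply: eq_bigr => k _; rewrite cone_functional_indic /F /area_coef.
  have -> : (n + 1 - k = n.+1 - k)%N by lia.
  have -> : (n + 1 - k.+1 = n - k)%N by lia.
  by field; rewrite gt_eqF// binp// -ltnS.
have ex : exists S, is_area_measures K S.
  have [S SE] : exists S : nat -> {measure set E -> \bar R}, forall k, (k <= n)%N ->
      forall w, measurable w -> S k w = (cone_functional K (area_coef k) (n + 1 - k) \1_w)%:E.
    have H k : exists S : {measure set E -> \bar R}, (k <= n)%N ->
        forall w, measurable w -> S w = (cone_functional K (area_coef k) (n + 1 - k) \1_w)%:E.
      have lt : (n + 1 - k < (n + 1).+1)%N by lia.
      have c0 : 0 <= area_coef k by rewrite /area_coef divr_ge0.
      by have [S SE] := cone_measure_exists bK L0 lh c0 lt; exists S.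
    by have [S SP] := choice H; exists S.
  exists S => r r0 w mw; rewrite srf// -sumEFin; apply: eq_bigr => k _.
  by rewrite SE// -ltnS.
move=> jn mw; rewrite /area_measure; case: pselect => // h0; case: cid => /= S SP.
have H r : 0 < r -> (\sum_(k < n.+1) ('C(n, k)%:R * r ^+ (n - k))%:E * S k omega)%E =
    (\sum_(k < n.+1) 'C(n, k)%:R * r ^+ (n - k) * cone_functional K (area_coef k) (n + 1 - k) \1_omega)%:E.
  by move=> r0; rewrite -SP// srf.
(* Finiteness has to precede the comparison of coefficients, which takes place among real
   polynomials. It follows from the identity at radius 1, whose summands are nonnegative. *)
have Sfin k : (k <= n)%N -> S k omega \is a fin_num.
  move=> kn; have kn1 : (k < n.+1)%N by [].
  have : (('C(n, k)%:R * 1 ^+ (n - k))%:E * S k omega < +oo)%E.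
    have lt1 : (\sum_(i < n.+1) ('C(n, i)%:R * 1 ^+ (n - i))%R%:E * S i omega < +oo)%E.
      by rewrite (H 1 ltr01) ltry.
    apply: le_lt_trans lt1; rewrite (bigD1 (Ordinal kn1))//=.
    apply: leeDl; apply: sume_ge0 => i _; exact: mule_ge0.
  rewrite expr1n mulr1 => lt; rewrite ge0_fin_numE//.
  rewrite ltNge; apply/negP; rewrite leye_eq => /eqP Soo.
  by move: lt; rewrite Soo gt0_muley ?lte_fin ?binp.
pose a k := 'C(n, k)%:R * fine (S k omega).
pose b k := 'C(n, k)%:R * cone_functional K (area_coef k) (n + 1 - k) \1_omega.
have ab : \poly_(l < n.+1) a (n - l)%N = \poly_(l < n.+1) b (n - l)%N.
  apply: poly_eq_pos => r r0; rewrite !horner_poly.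
  rewrite (reindex_inj rev_ord_inj) [RHS](reindex_inj rev_ord_inj) /=.
  have rev (G : nat -> R) : \sum_(i < n.+1) G (n - (n.+1 - i.+1))%N * r ^+ (n.+1 - i.+1) =
      \sum_(k < n.+1) r ^+ (n - k) * G k.
    by apply: eq_bigr => k _; rewrite subSS subKn 1?mulrC// -ltnS.
  rewrite !rev.
  have := H r r0.
  rewrite (eq_bigr (fun k : 'I_n.+1 => ('C(n, k)%:R * r ^+ (n - k) * fine (S k omega))%:E)).
    rewrite sumEFin => -[HH].
    have comm (u w z : R) : u * (w * z) = w * u * z by ring.
    under eq_bigr do rewrite /a comm.
    by under [RHS]eq_bigr do rewrite /b comm.
  by move=> k _; rewrite [RHS]EFinM fineK// Sfin// -ltnS.
have := congr1 (fun p : {poly R} => p`_(n - j)) ab.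
rewrite !coef_poly ltnS leq_subr subKn// /a /b => H1.
rewrite -[LHS]fineK ?Sfin//; congr EFin; apply: mulfI H1.
by rewrite gt_eqF// binp.
Qed.

Lemma integral_area_measure j (G : E -> R) (C : R) : (j <= n)%N ->
  measurable_fun setT G -> (forall x, 0 <= G x <= C) -> 0 <= C ->
  (\int[area_measure K j]_x (G x)%:E)%E =
  (cone_functional K (area_coef j) (n + 1 - j) G)%:E.
Proof.
move=> jn mG GC C0; have [L L0 lh] := support_function_lip bK.
apply: (integral_cone_measure bK L0 lh) mG GC C0 => A mA.
exact: area_measureP.
Qed.

End area_measure_identification.

(** * The transform T and the gnomonic identity *)

Lemma contX (R : realType) (T : topologicalType) (f : T -> R) k :
  continuous f -> continuous (fun x => f x ^+ k).
Proof.
move=> cf; elim: k => [|k IH]; first exact: cst_continuous.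
by under eq_fun do rewrite exprS; exact: contM.
Qed.

Lemma contN (R : realType) (T : topologicalType) (f : T -> R) :
  continuous f -> continuous (fun x => - f x).
Proof. by move=> cf x; exact: (cvgN (cf x)). Qed.

(** * Even primitives and tail integrals *)

Section even_primitives.
Context (R : realType).
Implicit Types (f F g : R -> R) (s d : R).
Local Notation leb := (@lebesgue_measure R).

Lemma is_derive1_cont F f : (forall s, is_derive s (1 : R) F (f s)) -> continuous F.
Proof.
by move=> dF s; apply: differentiable_continuous; apply/derivable1_diffP; case: (dF s).
Qed.

(** The primitive is normalised to vanish far to the right. Oddness of [f] makes it even, hence it
    vanishes far to the left as well. *)
Lemma even_primitive f d : continuous f -> (forall s, d < `|s| -> f s = 0) ->
  (forall s, f (- s) = - f s) ->
  exists F, [/\ forall s, is_derive s (1 : R) F (f s), forall s, F (- s) = F s &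
    forall s, d < `|s| -> F s = 0].
Proof.
move=> cf fd fodd; have [G [dG Gp _]] := antiderivative_exists cf fd.
pose F s := G s - G (`|d| + 1).
have dF s : is_derive s (1 : R) F (f s).
  have := is_deriveB (dG s) (is_derive_cst (G (`|d| + 1)) s (1 : R)).
  by rewrite subr0.
have even s : F (- s) = F s.
  have dH s' : is_derive s' (1 : R) (fun t => F t - F (- t)) 0.
    have dFN : is_derive s' (1 : R) (fun t : R => F (- t)) (- f (- s')).
      have dN : is_derive s' (1 : R) (fun t : R => - t) (-1).
        exact: (is_deriveN (is_derive_id s' (1 : R))).
      by have := is_derive_comp1 dN (dF (- s')); rewrite mulrN1.
    by have := is_deriveB (dF s') dFN; rewrite fodd opprK subrr.
  have /= := @is_derive_0_is_cst R _ s 0 dH.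
  by rewrite oppr0 subrr => /eqP; rewrite subr_eq0 => /eqP.
have d1 : d < `|d| + 1 by rewrite (le_lt_trans (ler_norm d))// ltrDl.
have pos s : d < s -> F s = 0 by move=> ds; rewrite /F (Gp s (`|d| + 1))// subrr.
exists F; split=> // s; have [s0|s0] := leP 0 s; first by rewrite ger0_norm//; exact: pos.
by rewrite ltr0_norm// => /pos; rewrite even.
Qed.

Lemma Rintegral_tail (f H : R -> R) (M s : R) : (forall t : R, 0 < t -> {for t, continuous f}) -> 0 < s ->
  (forall t : R, 0 < t -> M < t -> f t = 0) ->
  (forall t : R, 0 < t -> is_derive t (1 : R) H (- f t)) ->
  (forall t : R, 0 < t -> M < t -> H t = 0) ->
  \int[leb]_(t in `]s, +oo[) f t = H s.
Proof.
move=> cf s0 fM dH HM; pose b := Num.max s M + 1.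
have sb : s < b by rewrite /b (@le_lt_trans _ _ (Num.max s M)) ?ltrDl// le_max lexx.
have Mb : M < b by rewrite /b (@le_lt_trans _ _ (Num.max s M)) ?ltrDl// le_max lexx orbT.
have pos t : s <= t -> 0 < t by exact: lt_le_trans.
have cab : {within `[s, b], continuous f}.
  apply: continuous_in_subspaceT => t; rewrite inE /= in_itv /= => /andP[st _].
  by apply: cf; exact: pos.
have -> : \int[leb]_(t in `]s, +oo[) f t = \int[leb]_(t in `[s, b]) f t.
  rewrite -(@Rintegral_itv_obnd_cbnd _ s (BRight b)); last first.
    have := continuous_compact_integrable (segment_compact (a := s) (b := b)) cab.
    apply: integrableS => //.
    by move=> x /=; rewrite !in_itv /= => /andP[/ltW -> ->].
  rewrite [LHS]Rintegral_mkcond [RHS]Rintegral_mkcond.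
  apply: eq_Rintegral => x _; rewrite /patch !mem_setE !in_itv /= andbT -/(0 : R).
  case: (ltP s x) => //= sx; case: (leP x b) => //= bx.
  by apply: fM; [apply: pos; exact: ltW|exact: lt_trans bx].
have dH' t : 0 < t -> derivable H t 1 by move=> /dH[].
have cH t : 0 < t -> {for t, continuous H}.
  by move=> t0; apply: differentiable_continuous; apply/derivable1_diffP; exact: dH'.
have := @continuous_FTC2 R (fun t => f t) (fun t => - H t) s b sb cab.
move=> /(_ _)/wrap[|].
  split.
  - move=> t; rewrite in_itv /= => /andP[st _].
    by apply: derivableN; apply: dH'; apply: pos; exact: ltW.
  - apply: cvg_at_right_filter; apply: cvgN; exact: cH.
  - by apply: cvg_at_left_filter; apply: cvgN; apply: cH; apply: pos; exact: ltW.
move=> /(_ _)/wrap[t|].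
  rewrite in_itv /= => /andP[st _]; have t0 := pos t (ltW st).
  rewrite derive1E; have := is_deriveN (dH t t0); rewrite opprK.
  by case.
rewrite /Rintegral => -> /=.
by rewrite (HM b) ?pos ?(ltW sb)// oppr0 sub0r opprK.
Qed.

End even_primitives.

(** * Derivatives of radial functions *)

Section radial_functions.
Context (R : realType) (n : nat).
Local Notation E := 'rV[R]_n.
Local Notation e := (@basis_vec R n).

Lemma is_derive_dotvv (x : E) a : is_derive x (e a) (fun y : E => dotv y y) (2 * x 0 a).
Proof.
apply/is_derive_lineP.
have -> : (fun t : R => dotv (x + t *: e a) (x + t *: e a)) =
    (fun t => dotv x x + (t * (2 * x 0 a) + t * t)).
  apply/funext => t; rewrite !(dotvDl, dotvDr, dotvZl, dotvZr).
  have xe : dotv x (e a) = x 0 a.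
    rewrite /dotv (bigD1 a)//= big1 => [|i ia]; first by rewrite mxE !eqxx mulr1 addr0.
    by rewrite mxE (negbTE ia) andbF mulr0.
  have ee : dotv (e a) (e a) = 1.
    rewrite /dotv (bigD1 a)//= big1 => [|i ia]; first by rewrite mxE !eqxx mulr1 addr0.
    by rewrite mxE (negbTE ia) andbF mulr0.
  by rewrite (dotvC (e a) x) xe ee; ring.
have h1 := is_derive_id (0 : R) (1 : R).
have h2 := is_deriveM h1 (is_derive_cst (2 * x 0 a) (0 : R) (1 : R)).
have := is_deriveD (is_derive_cst (dotv x x) (0 : R) (1 : R)) (is_deriveD h2 (is_deriveM h1 h1)).
congr is_derive; rewrite /cst /=.
change (0 + (0 * 0 + 2 * x 0 a * 1 + (0 * 1 + 0 * 1)) = 2 * x 0 a); ring.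
Qed.

Lemma is_derive_enorm (x : E) a : x != 0 -> is_derive x (e a) (@enorm R n) (x 0 a / enorm x).
Proof.
move=> x0; have xx : 0 < dotv x x by rewrite -enorm_sqr exprn_gt0// enorm_gt0.
have := is_derive_comp1 (is_derive_dotvv x a) (is_derive1_sqrt xx).
congr is_derive; rewrite -/(enorm x); field.
by rewrite gt_eqF// enorm_gt0.
Qed.

(* Evenness of F makes the radial function differentiable at the origin. *)
Lemma is_derive_radial (F f : R -> R) (x : E) a :
  (forall s, is_derive s (1 : R) F (f s)) -> (forall s, F (- s) = F s) -> f 0 = 0 ->
  is_derive x (e a) (fun y => F (enorm y)) (f (enorm x) * (x 0 a / enorm x)).
Proof.
move=> dF Feven f0; have [->|x0] := eqVneq x 0; last first.
  exact: (is_derive_comp1 (is_derive_enorm a x0) (dF _)).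
rewrite mxE mul0r mulr0; apply/is_derive_lineP.
have := dF 0; rewrite f0; congr is_derive; apply/funext => t.
rewrite add0r enormZ.
have -> : enorm (e a) = 1.
  rewrite /enorm /dotv (bigD1 a)//= big1 => [|i ia].
    by rewrite mxE !eqxx mulr1 addr0 sqrtr1.
  by rewrite mxE (negbTE ia) andbF mulr0.
by rewrite mulr1; case: (leP 0 t) => t0; [rewrite ger0_norm|rewrite ltr0_norm// Feven].
Qed.

End radial_functions.

(** * Iterates of the transform *)

Section density.
Context (R : realType).
Implicit Types s t : R.

Definition wt s : R := Num.sqrt (1 + s ^+ 2).

Lemma wt_gt0 s : 0 < wt s.
Proof. by rewrite sqrtr_gt0 ltr_wpDr// sqr_ge0. Qed.

Lemma wt_neq0 s : wt s != 0. Proof. by rewrite gt_eqF// wt_gt0. Qed.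

Lemma wt_sqr s : wt s ^+ 2 = 1 + s ^+ 2.
Proof. by rewrite sqr_sqrtr// addr_ge0// sqr_ge0. Qed.

Lemma wtN s : wt (- s) = wt s. Proof. by rewrite /wt sqrrN. Qed.

Lemma is_derive_wt s : is_derive s (1 : R) wt (s / wt s).
Proof.
have h1 := is_derive_id s (1 : R).
have h2 := is_deriveD (is_derive_cst (1 : R) s (1 : R)) (is_deriveM h1 h1).
have p0 : 0 < 1 + s * s by rewrite ltr_wpDr// -expr2 sqr_ge0.
have := is_derive_comp1 h2 (is_derive1_sqrt p0).
congr is_derive; rewrite -![_ *: _]/(_ * _) -/(_ ^+ 2) -expr2 -/(wt s); field.
exact: wt_neq0.
Qed.

Lemma wt_cont : continuous wt.
Proof. exact: is_derive1_cont is_derive_wt. Qed.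

Lemma is_derive_wtX s (k : nat) :
  is_derive s (1 : R) (fun s => wt s ^+ k) (k%:R * s * wt s ^+ k / wt s ^+ 2).
Proof.
have := is_deriveX k (is_derive_wt s).
congr is_derive; first by rewrite exprfctE.
rewrite -[_ *: _]/(_ * _).
case: k => [|k]; first by rewrite mulr0n !mul0r.
rewrite -mulr_natl succnK; have := wt_neq0 s; move: (wt s) => w w0.
by rewrite [w ^+ k.+1]exprS; field.
Qed.

Lemma is_derive_wtXV s (k : nat) :
  is_derive s (1 : R) (fun s => (wt s ^+ k)^-1) (- (k%:R * s / wt s ^+ k / wt s ^+ 2)).
Proof.
have wk : (fun s => wt s ^+ k) s != 0 by rewrite expf_neq0// wt_neq0.
have := @is_deriveV R (fun s => wt s ^+ k) s _ (1 : R) wk (is_derive_wtX s k).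
congr is_derive; rewrite -[_ *: _]/(_ * _).
by have := wt_neq0 s; move: (wt s) wk => w wk w0; field; rewrite wk w0.
Qed.

Variables (n : nat) (alpha : R -> R).
Hypothesis halpha : Tclass n n alpha.

(** The density may be unbounded near 0; membership in the class only makes [s * alpha s] vanish
    there. The odd extension of this product is continuous. *)
Definition qdens s : R := s * alpha `|s|.

Lemma alpha_supp : exists2 M, 0 < M & forall s, M < `|s| -> alpha `|s| = 0.
Proof.
have [[_ [M MP]] _] := halpha; exists (`|M| + 1); first by rewrite ltr_wpDl.
move=> s Ms; apply: MP; first by apply: lt_trans Ms; rewrite ltr_wpDl.
by apply: lt_trans Ms; rewrite (le_lt_trans (ler_norm M))// ltrDl.
Qed.

Lemma alpha_cont s : 0 < s -> {for s, continuous alpha}.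
Proof.
by have [[ca _] _] := halpha; move=> s0; apply: ca; rewrite in_itv /= s0.
Qed.

Lemma alpha_small eps : 0 < eps -> exists2 r, 0 < r &
  forall s, 0 < s -> s < r -> s * `|alpha s| <= eps.
Proof.
move=> e0; have [_] := halpha; rewrite subnn add0n => /cvgrPdist_le/(_ _ e0).
case=> r /= r0 rP; exists r => // s s0 sr.
have := rP s; rewrite /= sub0r normrN gtr0_norm// => /(_ sr s0).
by rewrite sub0r normrN expr1 normrM gtr0_norm.
Qed.

Lemma qdens_cont : continuous qdens.
Proof.
move=> s; have [->|s0] := eqVneq s 0.
  apply/(@cvgrPdist_le _ _ _ (nbhs (0 : R))) => eps e0.
  have [r r0 rP] := alpha_small e0; apply/nbhs_ballP; exists r => //= t.
  rewrite -ball_normE /= sub0r normrN => tr.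
  rewrite /qdens mul0r sub0r normrN normrM; have [->|t0] := eqVneq t 0.
    by rewrite normr0 mul0r ltW.
  by apply: rP => //; rewrite normr_gt0.
apply: cvgM; first exact: cvg_id.
apply: (@continuous_comp _ _ _ (fun s : R => `|s|) alpha s); first exact: norm_continuous.
by apply: alpha_cont; rewrite normr_gt0.
Qed.

Lemma qdens_odd s : qdens (- s) = - qdens s.
Proof. by rewrite /qdens normrN mulNr. Qed.

(** The integrands are odd and supported in a common bounded interval. Writing the exponent [k - 2]
    as a quotient keeps natural exponents for [k < 2]. *)
Lemma tail_primitives : exists G : nat -> R -> R, exists2 M, 0 < M & forall k,
  [/\ forall s, is_derive s (1 : R) (G k) (- (qdens s * wt s ^+ k / wt s ^+ 2)),
      forall s, G k (- s) = G k s & forall s, M < `|s| -> G k s = 0 /\ alpha `|s| = 0].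
Proof.
have [M M0 MP] := alpha_supp.
have H k : exists Gk : R -> R,
  [/\ forall s, is_derive s (1 : R) Gk (- (qdens s * wt s ^+ k / wt s ^+ 2)),
      forall s, Gk (- s) = Gk s & forall s, M < `|s| -> Gk s = 0].
  apply: even_primitive.
  - have c1 j : continuous (fun s => wt s ^+ j).
      by apply: contX; exact: wt_cont.
    have c2 : continuous (fun s => (wt s ^+ 2)^-1).
      by apply: contV => // s; rewrite expf_neq0// wt_neq0.
    apply: contN.
    by apply: contM => //; apply: contM => //; exact: qdens_cont.
  - by move=> s Ms; rewrite /qdens MP// mulr0 !mul0r oppr0.
  - by move=> s; rewrite qdens_odd wtN !mulNr.
have [G GP] := choice H; exists G, M => // k; have [h1 h2 h3] := GP k.
by split=> // s Ms; split; [exact: h3|exact: MP].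
Qed.

Variables (G : nat -> R -> R) (M : R).
Hypotheses (M0 : 0 < M) (dG : forall k s,
  is_derive s (1 : R) (G k) (- (qdens s * wt s ^+ k / wt s ^+ 2)))
  (GM : forall k s, M < `|s| -> G k s = 0 /\ alpha `|s| = 0).

(** In the induction step the tail integral has a closed form, because the derivative of [wt * G k]
    contains both the integrand coming from [G k] and one shifting [k] to [k + 1]. *)
Lemma iter_Ttrans k s : 0 < s ->
  iter k Ttrans alpha s = wt s ^+ k * alpha s + k%:R * G k s.
Proof.
elim: k s => [|k IH] s s0; first by rewrite expr0 mul1r mul0r addr0.
rewrite iterS {1}/Ttrans (IH s s0) -/(wt s).
pose f t := qdens t * wt t ^+ k.+1 / wt t ^+ 2 + k%:R * (t * G k t / wt t).
(* The product rule gives [t * G k t / wt t] and a multiple of the derivative of [G k.+1], so the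
   derivative of [H] is [- f]. *)
pose H t := k.+1%:R * G k.+1 t - k%:R * (wt t * G k t).
have cG j : continuous (G j) by exact: is_derive1_cont (dG j).
have -> : \int[@lebesgue_measure R]_(t in `]s, +oo[)
    (t * iter k Ttrans alpha t / Num.sqrt (1 + t ^+ 2)) =
    \int[@lebesgue_measure R]_(t in `]s, +oo[) f t.
  apply: eq_Rintegral => t; rewrite inE /= in_itv /= andbT => st.
  have t0 : 0 < t by exact: lt_trans st.
  rewrite IH// -/(wt t) /f /qdens gtr0_norm// exprS.
  by field; exact: wt_neq0.
have cw j : continuous (fun s => wt s ^+ j).
  by apply: contX; exact: wt_cont.
have cwV j : continuous (fun s => (wt s ^+ j)^-1).
  by apply: contV => // t; rewrite expf_neq0// wt_neq0.
have cf : continuous f.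
  apply: contD; first by apply: contM => //; apply: contM => //; exact: qdens_cont.
  apply: contZ; apply: contM; last first.
    by apply: contV; [exact: wt_cont|exact: wt_neq0].
  by apply: contM => // t; exact: cvg_id.
have f0 (t : R) : 0 < t -> M < t -> f t = 0.
  move=> t0 Mt; have Mt' : M < `|t| by rewrite gtr0_norm.
  by rewrite /f /qdens (GM k Mt').1 (GM k Mt').2 !(mulr0, mul0r) addr0.
have H0 (t : R) : 0 < t -> M < t -> H t = 0.
  move=> t0 Mt; have Mt' : M < `|t| by rewrite gtr0_norm.
  by rewrite /H (GM _ Mt').1 (GM _ Mt').1 !mulr0 subrr.
have dH (t : R) : 0 < t -> is_derive t (1 : R) H (- f t).
  move=> t0; have h1 := is_deriveZ k.+1%:R (dG k.+1 t).
  have h2 := is_deriveZ k%:R (is_deriveM (is_derive_wt t) (dG k t)).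
  have := is_deriveB h1 h2; congr is_derive.
  rewrite -![_ *: _]/(_ * _) /f exprS -natr1.
  by field; exact: wt_neq0.
rewrite (Rintegral_tail (fun t _ => cf t) s0 f0 dH H0).
rewrite /H exprS -natr1; ring.
Qed.

End density.

(** * Pencils against the gnomonic metric *)

Section pencil_adjugate.
Context (R : realType).

Lemma size_det_linear (p : nat) (B : 'M[{poly R}]_p) :
  (forall i j, (size (B i j) <= 2)%N) -> (size (\det B) <= p.+1)%N.
Proof.
move=> B2; apply: (leq_trans (size_sum _ _ _)); apply/bigmax_leqP => s _.
rewrite -signr_odd.
have -> : forall (b : bool) (P : {poly R}), size ((-1) ^+ b * P) = size P.
  by case=> P; rewrite ?expr1 ?expr0 ?mulN1r ?mul1r ?size_polyN.
apply: (leq_trans (size_poly_prod_leq _ _)); rewrite leq_subLR card_ord addnS ltnS.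
apply: (@leq_trans (\sum_(i < p) 2)%N); last by rewrite sum_nat_const card_ord; lia.
exact: leq_sum.
Qed.

Variable n : nat.
Implicit Types A : 'M[R]_n.

Lemma size_pencil_adj A i k : (size (pencil_adj A i k) <= n.+1)%N.
Proof.
have BE := pencil_mxE A 1%:M; rewrite /pencil_adj; move: BE.
move: (map_mx polyC A + _) => B BE.
rewrite mxE /cofactor -signr_odd.
have -> : forall (b : bool) (P : {poly R}), size ((-1) ^+ b * P) = size P.
  by case=> P; rewrite ?expr1 ?expr0 ?mulN1r ?mul1r ?size_polyN.
apply: (@leq_trans n.-1.+1); last by rewrite ltnS leq_pred.
apply: size_det_linear => a b; rewrite !mxE BE.
apply: (leq_trans (size_polyD _ _)); rewrite geq_max.
rewrite (leq_trans (size_polyC_leq1 _))//=.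
apply: (leq_trans (size_polyMleq _ _)); rewrite size_polyX.
by have := size_polyC_leq1 ((1%:M : 'M[R]_n) (lift k a) (lift i b)); lia.
Qed.

Lemma pencil_adj_sym A i k : A^T = A -> pencil_adj A i k = pencil_adj A k i.
Proof.
move=> symA; rewrite /pencil_adj -[in LHS](trmxK (_ + _)) -trmx_adj mxE.
congr (\adj _ _ _); apply/matrixP => a b; rewrite [LHS]mxE !pencil_mxE !mxE eq_sym.
by rewrite -{1}symA mxE.
Qed.

(* The inverse of 1 + x^T x. *)
Definition gnomonic_metric (x : 'rV[R]_n) : 'M[R]_n :=
  1%:M - (wt (enorm x) ^+ 2)^-1 *: (x^T *m x).

(** The metric is a rank-one perturbation of the identity. Positivity of [A] makes [A + t]
    invertible for [t > 0], so [det_rank1] applies there, and infinitely many values determine the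
    polynomial. *)
Lemma pencil_gnomonic A (x : 'rV[R]_n) : A^T = A ->
  (forall y : 'rV[R]_n, 0 <= (y *m A *m y^T) 0 0) ->
  pencil A (gnomonic_metric x) = pencil A 1%:M -
    (wt (enorm x) ^+ 2)^-1 *: ('X * \sum_i \sum_k (x 0 i * x 0 k) *: pencil_adj A i k).
Proof.
move=> symA psd; apply: poly_eq_pos => t t0.
rewrite hornerD hornerN hornerZ hornerM hornerX !pencil_horner.
have uA : A + t *: 1%:M \in unitmx by rewrite unitmxE unitfE gt_eqF// det_pencil1_gt0.
have := det_rank1 (- (t / wt (enorm x) ^+ 2)) x x uA.
have -> : A + t *: 1%:M + - (t / wt (enorm x) ^+ 2) *: (x^T *m x) = A + t *: gnomonic_metric x.
  by rewrite /gnomonic_metric scalerBr scalerA scaleNr addrA.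
move=> ->; rewrite mulNr; congr (_ - _).
rewrite -mulrA mulrCA; congr (_ * (_ * _)).
rewrite horner_sum; apply: eq_bigr => i _; rewrite horner_sum; apply: eq_bigr => k _.
by rewrite hornerZ pencil_adj_horner mulrAC.
Qed.

Definition adj_form A (m : nat) (x : 'rV[R]_n) : R :=
  \sum_i \sum_k x 0 i * x 0 k * (pencil_adj A i k)`_m.

Lemma pencil_gnomonic_coefS A (x : 'rV[R]_n) m : A^T = A ->
  (forall y : 'rV[R]_n, 0 <= (y *m A *m y^T) 0 0) ->
  (pencil A (gnomonic_metric x))`_m.+1 =
  (pencil A 1%:M)`_m.+1 - (wt (enorm x) ^+ 2)^-1 * adj_form A m x.
Proof.
move=> symA psd; rewrite pencil_gnomonic// coefB coefZ coefXM /=; congr (_ - _ * _).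
rewrite coef_sum; apply: eq_bigr => i _; rewrite coef_sum; apply: eq_bigr => k _.
by rewrite coefZ.
Qed.

Lemma pencil_gnomonic_coef0 A (x : 'rV[R]_n) : A^T = A ->
  (forall y : 'rV[R]_n, 0 <= (y *m A *m y^T) 0 0) ->
  (pencil A (gnomonic_metric x))`_0 = (pencil A 1%:M)`_0.
Proof.
by move=> symA psd; rewrite pencil_gnomonic// coefB coefZ coefXM /= mulr0 subr0.
Qed.

End pencil_adjugate.

(** * Transfer from the flat to the gnomonic pencil *)

Section gnomonic_identity.
Context (R : realType) (n : nat).
Local Notation E := 'rV[R]_n.
Local Notation mu := (lebesgue_rV R n).
Local Notation e := (@basis_vec R n).
Local Notation z := (fun _ : 'I_n => 0%N).

Lemma cont_det (B : 'I_n -> 'I_n -> E -> R) : (forall i j, continuous (B i j)) ->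
  continuous (fun x => \det (\matrix_(i, j) B i j x)).
Proof.
move=> cB; apply: continuous_sum_fct => s _; apply: contZ; apply: continuous_prod_fct => i _.
suff -> : (fun x : E => (\matrix_(i0, j) B i0 j x) i (s i)) = B i (s i) by [].
by apply/funext => x; rewrite mxE.
Qed.

Lemma Rint_coef0 (N : nat) (P : E -> {poly R}) : (forall x, (size (P x) <= N)%N) ->
  (forall t, bms (fun x => (P x).[t])) ->
  (forall t, 0 < t -> \int[mu]_x (P x).[t] = 0) ->
  forall m, (m < N)%N -> bms (fun x => (P x)`_m) /\ \int[mu]_x (P x)`_m = 0.
Proof.
move=> sP bP P0 m mN; have [c cE] := interpolation R N.
have E1 x : (P x)`_m = \sum_(k < N) c m k * (P x).[k.+1%:R] by exact: cE.
have -> : (fun x => (P x)`_m) = (fun x => \sum_(k < N) c m k * (P x).[k.+1%:R]).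
  by apply/funext => x.
split; first by apply: bms_sum => k _; exact: bmsZ.
rewrite Rint_sum; last by move=> k _; exact: bmsZ.
by rewrite big1// => k _; rewrite RintZ// P0// mulr0.
Qed.

Variables (alpha : R -> R) (G : nat -> R -> R) (M : R).
Hypotheses (halpha : Tclass n n alpha) (M0 : 0 < M)
  (dG : forall k s, is_derive s (1 : R) (G k) (- (qdens alpha s * wt s ^+ k / wt s ^+ 2)))
  (Geven : forall k s, G k (- s) = G k s)
  (GM : forall k s, M < `|s| -> G k s = 0 /\ alpha `|s| = 0).

Lemma cont_radial (g : R -> R) : continuous g -> continuous (fun x : E => g (enorm x)).
Proof. by move=> cg; apply: continuous_comp1 => //; exact: enorm_cont. Qed.

Lemma enormM (x : E) : M < `|x| -> M < `|enorm x|.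
Proof.
move=> Mx; rewrite ger0_norm ?enorm_ge0//.
exact: lt_le_trans Mx (mx_norm_le_enorm _).
Qed.

Definition dens_coord (i : 'I_n) (x : E) : R := alpha (enorm x) * x 0 i.

(** At the origin the factor [x 0 i], bounded by the norm, compensates a possible blow-up of
    [alpha]. *)
Lemma Cc_dens_coord i : Cc (dens_coord i).
Proof.
split; last first.
  exists M => x /enormM Mx; have := (GM 0 Mx).2.
  by rewrite ger0_norm ?enorm_ge0// /dens_coord => ->; rewrite mul0r.
move=> x; have [->|x0] := eqVneq x 0; last first.
  have ca : {for x, continuous (fun y : E => alpha (enorm y))}.
    apply: (@continuous_comp _ _ _ (@enorm R n) alpha x); first exact: enorm_cont.
    by apply: (alpha_cont halpha); rewrite enorm_gt0.
  exact: (cvgM ca (@coord_cont R n i x)).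
apply/(@cvgrPdist_le _ _ _ (nbhs (0 : E)) (nbhs_filter (0 : E))) => eps e0.
have [r r0 rP] := alpha_small halpha e0.
have : \forall y \near (0 : E), enorm y < r.
  have r0' : enorm (0 : E) < r by rewrite enorm0.
  exact: (cvgr_lt _ (@enorm_cont R n 0) _ r0').
apply: filterS => y yr; rewrite {1}/dens_coord mxE mulr0 sub0r normrN normrM.
have [->|y0] := eqVneq y 0; first by rewrite mxE normr0 mulr0 ltW.
have y0' : 0 < enorm y by rewrite enorm_gt0.
apply: le_trans (rP _ y0' yr); rewrite mulrC ler_wpM2r//.
by rewrite (le_trans (mx_norm_coord y i))// mx_norm_le_enorm.
Qed.

Lemma cG k : continuous (G k). Proof. exact: is_derive1_cont (dG k). Qed.

Lemma wtX_cont k : continuous (fun s : R => wt s ^+ k).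
Proof. by apply: contX; exact: wt_cont. Qed.

Lemma wtXV_cont k : continuous (fun s : R => (wt s ^+ k)^-1).
Proof. by apply: contV; [exact: wtX_cont|move=> s; rewrite expf_neq0// wt_neq0]. Qed.

Variables (v : E -> R) (d : R).
Hypotheses (contv : continuous v) (cv : cvx v) (d0 : 0 < d).
Local Notation A := (mollH v d).

Let cA a b : continuous (fun x => A x a b).
Proof.
rewrite (_ : (fun x => _) = moll v d (incr (incr z a) b)); first exact: moll_cont.
by apply/funext => x; rewrite mxE.
Qed.

Let symA x : (A x)^T = A x. Proof. exact: mollH_sym. Qed.

Let psdA x (y : E) : 0 <= (y *m A x *m y^T) 0 0. Proof. exact: mollH_psd. Qed.

Section fixed_index.
Variables (k : nat) (i : 'I_n).

Let c (s : R) := - ((wt s ^+ k)^-1 * G k s).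
Let dc (s : R) := k%:R * s / wt s ^+ k / wt s ^+ 2 * G k s + qdens alpha s / wt s ^+ 2.

Let is_derive_c s : is_derive s (1 : R) c (dc s).
Proof.
have := is_deriveN (is_deriveM (is_derive_wtXV s k) (dG k s)).
congr is_derive; rewrite -![_ *: _]/(_ * _) /dc; have := wt_neq0 s.
move: (wt s) => w w0; have wk : w ^+ k != 0 by rewrite expf_neq0.
by field; rewrite wk w0.
Qed.

Let ceven s : c (- s) = c s. Proof. by rewrite /c wtN Geven. Qed.

Let c0 s : M < `|s| -> c s = 0.
Proof. by move=> /(GM k)[Gs _]; rewrite /c Gs mulr0 oppr0. Qed.

Let cc : continuous c. Proof. exact: is_derive1_cont is_derive_c. Qed.

Let chi (x : E) := c (enorm x).
(** The gradient of [chi] at [x] is [xi x] times [x]. Since [xi] contains [alpha], only its products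
    with a coordinate are claimed to be continuous. *)
Let xi (x : E) := (k%:R / wt (enorm x) ^+ k * G k (enorm x) + alpha (enorm x)) / wt (enorm x) ^+ 2.

Let is_derive_chi x a : is_derive x (e a) chi (xi x * x 0 a).
Proof.
have dc0 : dc 0 = 0 by rewrite /dc /qdens !(mulr0, mul0r) addr0.
have := is_derive_radial x a is_derive_c ceven dc0.
congr is_derive; have [->|x0] := eqVneq x 0; first by rewrite mxE mul0r !mulr0.
have en0 : enorm x != 0 by rewrite gt_eqF// enorm_gt0.
rewrite /dc /xi /qdens ger0_norm ?enorm_ge0//.
have := wt_neq0 (enorm x); move: (wt _) => w w0.
have wk : w ^+ k != 0 by rewrite expf_neq0.
by field; rewrite wk w0.
Qed.

(** The adjugate of a Hessian plus [t] is divergence free, so its pairing with the Jacobian of a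
    field of bounded support integrates to 0 for every [t > 0]; [B] is the coefficient of degree [m]
    of that pairing. *)
Lemma identity_vanishing (m : nat) : k = m.+1 -> (m < n.+1)%N ->
  let B x := xi x * x 0 i * adj_form (A x) m x +
    chi x * x 0 i * ((pencil (A x) 1%:M)`_m.+1 *+ m.+1) in
  bms B /\ \int[mu]_x B x = 0.
Proof.
move=> km mn B.
have [|||Psi0 [dPsi Pe P0]] := @even_primitive R (fun s => s * c s) M.
- by apply: contM => // s; exact: cvg_id.
- by move=> s Ms; rewrite c0// mulr0.
- by move=> s; rewrite ceven mulNr.
pose psi (x : E) := Psi0 (enorm x).
have dpsi x a : is_derive x (e a) psi (chi x * x 0 a).
  have p0 : 0 * c 0 = 0 by rewrite mul0r.
  have := is_derive_radial x a dPsi Pe p0.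
  congr is_derive; have [->|x0] := eqVneq x 0; first by rewrite mxE mul0r !mulr0.
  by rewrite /chi; field; rewrite gt_eqF// enorm_gt0.
(* Differentiating [x 0 i] produces [chi x * x 0 b] in column [i], and differentiating [psi]
   produces the transposed term with opposite sign. Against the symmetric adjugate the two
   cancel. *)
pose X b (x : E) := chi x * x 0 i * x 0 b - psi x * (b == i)%:R.
pose dX b a (x : E) := xi x * x 0 a * x 0 i * x 0 b + chi x * (i == a)%:R * x 0 b +
  chi x * x 0 i * (b == a)%:R - chi x * x 0 a * (b == i)%:R.
have dcoord b x a : is_derive x (e a) (fun y : E => y 0 b) (b == a)%:R.
  have := is_derive_coord (e a) (is_derive_id (x 0 b) (1 : R)).
  by rewrite mxE eqxx mul1r.
have XdX b a x : is_derive x (e a) (X b) (dX b a x).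
  have h1 := is_deriveM (is_deriveM (is_derive_chi x a) (dcoord i x a)) (dcoord b x a).
  have h2 := is_deriveM (dpsi x a) (is_derive_cst ((b == i)%:R : R) x (e a)).
  have := is_deriveB h1 h2; congr is_derive.
  change (chi x * x 0 i * (b == a)%:R + x 0 b * (chi x * (i == a)%:R + x 0 i * (xi x * x 0 a)) -
    (psi x * 0 + (b == i)%:R * (chi x * x 0 a)) = dX b a x).
  rewrite /dX; ring.
have cchi : continuous chi by exact: cont_radial.
have cpsi : continuous psi by apply: cont_radial; exact: is_derive1_cont dPsi.
have cxi a : continuous (fun x => xi x * x 0 a).
  have -> : (fun x : E => xi x * x 0 a) = (fun x => (wt (enorm x) ^+ 2)^-1 *
      (k%:R * (wt (enorm x) ^+ k)^-1 * G k (enorm x) * x 0 a + dens_coord a x)).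
    by apply/funext => x; rewrite /xi /dens_coord; ring.
  have cw (j : nat) : continuous (fun x : E => (wt (enorm x) ^+ j)^-1 : R).
    pose g (s : R) : R := (wt s ^+ j)^-1.
    have cg : continuous g by exact: wtXV_cont.
    exact: (cont_radial cg).
  apply: contM; first exact: cw.
  apply: contD; last by case: (Cc_dens_coord a).
  apply: contM; last exact: coord_cont.
  apply: contM; last exact: (cont_radial (@cG k)).
  by apply: contZ; exact: cw.
have cX b : continuous (X b).
  apply: contB; last by apply: contM => //; exact: cst_continuous.
  by apply: contM; [apply: contM => //; exact: coord_cont|exact: coord_cont].
have cdX b a : continuous (dX b a).
  have cco j : continuous (fun x : E => x 0 j) by exact: coord_cont.
  have cst (r : R) : continuous (fun _ : E => r) by exact: cst_continuous.
  by apply: contB; [apply: contD; [apply: contD|]|]; do ?apply: contM => //.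
have chi0 x : M < `|x| -> chi x = 0 by move=> /enormM; exact: c0.
have xi0 x : M < `|x| -> xi x = 0.
  move=> /enormM /(GM k)[Gx]; rewrite ger0_norm ?enorm_ge0// => ax.
  by rewrite /xi Gx ax mulr0 addr0 mul0r.
have CcdX b a : Cc (dX b a).
  split=> //; exists M => x Mx; by rewrite /dX chi0// xi0// !(mul0r, addr0, subr0).
pose P x : {poly R} := \sum_b \sum_a dX b a x *: pencil_adj (A x) a b.
have sP x : (size (P x) <= n.+1)%N.
  apply: (leq_trans (size_sum _ _ _)); apply/bigmax_leqP => b _.
  apply: (leq_trans (size_sum _ _ _)); apply/bigmax_leqP => a _.
  exact: leq_trans (size_scale_leq _ _) (size_pencil_adj _ _ _).
have PE x t : (P x).[t] = \sum_b \sum_a dX b a x * \adj (A x + t *: 1%:M) a b.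
  rewrite horner_sum; apply: eq_bigr => b _; rewrite horner_sum; apply: eq_bigr => a _.
  by rewrite hornerZ pencil_adj_horner.
(* Pairing with cofactors is expansion along a row: one determinant for each row replaced by a
   gradient, as [null_lagrangian] requires. *)
have PD x t : (P x).[t] = \sum_b \det (\matrix_(k', a)
    if k' == b then dX b a x else A x k' a + t * (k' == a)%:R).
  rewrite PE; apply: eq_bigr => b _; rewrite (expand_det_row _ b).
  apply: eq_bigr => a _; rewrite !mxE eqxx; congr (_ * _).
  rewrite /cofactor; congr (_ * \det _); apply/matrixP => k' a'.
  by rewrite !mxE [lift b k' == b]eq_sym (negbTE (neq_lift b k')) mulr_natr.
have bmsdet b t : bms (fun x => \det (\matrix_(k', a)
    if k' == b then dX b a x else A x k' a + t * (k' == a)%:R)).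
  apply: Cc_bms; split.
    apply: cont_det => k' a; case: (k' == b) => //.
    by apply: contD => //; exact: cst_continuous.
  exists M => x Mx; rewrite (expand_det_row _ b) big1// => a _.
  by rewrite mxE eqxx /dX chi0// xi0// !(mul0r, addr0, subr0).
have bP t : bms (fun x => (P x).[t]).
  rewrite (_ : (fun x => _) = (fun x => \sum_b \det (\matrix_(k', a)
    if k' == b then dX b a x else A x k' a + t * (k' == a)%:R))).
    by apply: bms_sum => b _; exact: bmsdet.
  by apply/funext => x; rewrite PD.
have IP t : 0 < t -> \int[mu]_x (P x).[t] = 0.
  move=> t0; under eq_Rintegral do rewrite PD.
  rewrite Rint_sum// big1// => b _.
  apply: (@null_lagrangian R n b (X b) (fun a => dX b a) (fun k' a x => A x k' a + t * (k' == a)%:R)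
    (fun k' a l x => moll v d (incr (incr (incr z k') a) l) x) M) => //.
  - by move=> k' a; apply: contD => //; exact: cst_continuous.
  - by move=> k' a l; exact: moll_cont.
  - move=> k' a l x; have := is_deriveD (is_derive_moll2 contv d0 x k' a l)
      (is_derive_cst (t * (k' == a)%:R) x (e l)).
    by congr is_derive; [apply/funext => y; rewrite mxE|rewrite addr0].
  - by move=> k' a l x; rewrite (incrC (incr z k') a l).
  - move=> x Mx; left; rewrite /X chi0// /psi P0 ?enormM// !mul0r subrr//.
have [bB IB] := Rint_coef0 sP bP IP mn.
suff -> : B = (fun x => (P x)`_m) by [].
apply/funext => x; rewrite /B /P [RHS]coef_sum.
pose T a b := (pencil_adj (A x) a b)`_m.
have Tsym a b : T a b = T b a by rewrite /T pencil_adj_sym.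
have sumd (F : 'I_n -> R) (l : 'I_n) : \sum_a F a * (l == a)%:R = F l.
  rewrite (bigD1 l)//= eqxx mulr1 big1 ?addr0// => a al.
  by rewrite eq_sym (negbTE al) mulr0.
have inner b : (\sum_a dX b a x *: pencil_adj (A x) a b)`_m =
    xi x * x 0 i * (\sum_a x 0 b * x 0 a * T b a) + chi x * (x 0 b * T i b) +
    chi x * x 0 i * T b b - (\sum_a chi x * (x 0 a * T i a)) * (b == i)%:R.
  rewrite coef_sum -(sumd (fun a => chi x * (x 0 b * T i b)) i).
  rewrite -(sumd (fun a => chi x * x 0 i * T b b) b) mulr_sumr mulr_suml -!big_split -sumrB.
  apply: eq_bigr => a _ /=; rewrite coefZ -/(T a b) (Tsym a b) /dX.
  have h1 : T b a * (i == a)%:R = T i b * (i == a)%:R.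
    by case: eqP => [->|]; rewrite ?mulr0// Tsym.
  have h2 : T b a * (b == a)%:R = T b b * (b == a)%:R by case: eqP => [->|]; rewrite ?mulr0.
  have h3 : T b a * (b == i)%:R = T i a * (b == i)%:R by case: eqP => [->|]; rewrite ?mulr0.
  transitivity (xi x * x 0 i * (x 0 b * x 0 a * T b a) + chi x * x 0 b * (T b a * (i == a)%:R) +
    chi x * x 0 i * (T b a * (b == a)%:R) - chi x * x 0 a * (T b a * (b == i)%:R)); first by ring.
  by rewrite h1 h2 h3; ring.
rewrite (eq_bigr _ (fun b _ => inner b)) sumrB !big_split /= -!mulr_sumr.
have -> : \sum_(b < n) (b == i)%:R = 1 :> R.
  by rewrite (bigD1 i)//= eqxx big1 ?addr0// => b /negbTE ->.
by rewrite pencil1_coef_trace /adj_form; ring.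
Qed.

(** After subtraction of the vanishing integral of [B] the integrands agree pointwise: the choice of
    [c] gives the trace term and the quadratic form the same factor, up to the squared weight in
    [pencil_gnomonic_coefS]. *)
Lemma gnomonic_identity_succ (m : nat) : k = m.+1 -> (m < n.+1)%N ->
  \int[mu]_x (dens_coord i x * (pencil (A x) 1%:M)`_k) =
  \int[mu]_x ((wt (enorm x) ^+ k * alpha (enorm x) + k%:R * G k (enorm x)) * x 0 i /
    wt (enorm x) ^+ k * (pencil (A x) (gnomonic_metric x))`_k).
Proof.
move=> km mn; have [bB IB] := identity_vanishing km mn.
set B := fun x => _ in bB IB.
have bD : bms (fun x => dens_coord i x * (pencil (A x) 1%:M)`_k).
  have := CcM (mollP_coef_cont (l := k) contv d0) (Cc_dens_coord i); move/Cc_bms.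
  by apply: eq_bms => x; rewrite mulrC.
transitivity (\int[mu]_x (dens_coord i x * (pencil (A x) 1%:M)`_k) - \int[mu]_x B x).
  by rewrite IB subr0.
rewrite -RintB//; apply: eq_Rintegral => x _.
have H := pencil_gnomonic_coefS x m (symA x) (@psdA x); rewrite -km in H.
rewrite H /B -km; move: (pencil (A x) 1%:M)`_k (adj_form (A x) m x) => p Q.
rewrite /xi /chi /c /dens_coord -mulr_natr.
have := wt_neq0 (enorm x); move: (wt _) => w w0.
have wk : w ^+ k != 0 by rewrite expf_neq0.
move: (G k _) (alpha _) => g al.
by field; rewrite wk w0.
Qed.

End fixed_index.

(* With s = enorm x, integrate the null Lagrangian of the Hessian against the
   vector field chi(s) x_i x - psi(s) e_i, where chi = - wt^-k G_k and
   psi' = s chi. *)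
Lemma gnomonic_identity (k : nat) (i : 'I_n) : (k <= n)%N ->
  \int[mu]_x (dens_coord i x * (pencil (A x) 1%:M)`_k) =
  \int[mu]_x ((wt (enorm x) ^+ k * alpha (enorm x) + k%:R * G k (enorm x)) * x 0 i /
    wt (enorm x) ^+ k * (pencil (A x) (gnomonic_metric x))`_k).
Proof.
case: k => [|m] mn; last by apply: gnomonic_identity_succ => //; exact: ltnW.
apply: eq_Rintegral => x _; rewrite pencil_gnomonic_coef0//.
by rewrite expr0 mul1r mul0r addr0 divr1.
Qed.

End gnomonic_identity.

(** * Gnomonic coordinates on cones *)

Lemma is_derive_affine (R : realType) (a b t : R) :
  is_derive t (1 : R) (fun s : R => a - s * b) (- b).
Proof.
apply: is_derive_eq; rewrite -![_ *: _]/(_ * _); ring.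
Qed.

Section gnomonic_chart.
Context (R : realType) (n : nat).
Local Notation E := 'rV[R]_n.
Local Notation Y := 'rV[R]_(n + 1).
Implicit Types (y w : Y) (X : E) (a : R).

Definition depth y : R := - rsubmx y 0 0.

(* Truncating the depth at a > 0 makes the chart y' / depth y globally continuous. *)
Definition tdepth a y : R := Num.max (depth y) a.

Definition chart a y : E := (tdepth a y)^-1 *: lsubmx y.

(** The differential of the chart in direction [w] at a point with image [X], multiplied by the
    depth of that point. *)
Definition chart_dir X w : E := lsubmx w + rsubmx w 0 0 *: X.

Lemma depthE y : depth y = - y 0 (rshift n 0).
Proof. by rewrite /depth mxE. Qed.

Lemma depth_cont : continuous depth.
Proof.
have -> : depth = (fun y => - y 0 (rshift n 0)) by apply/funext => y; exact: depthE.
by apply: contN; exact: coord_cont.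
Qed.

Lemma tdepth_cont a : continuous (tdepth a).
Proof. by apply: contmax; [exact: depth_cont|exact: cst_continuous]. Qed.

Lemma tdepth_gt0 a y : 0 < a -> 0 < tdepth a y.
Proof. by move=> a0; rewrite lt_max a0 orbT. Qed.

Lemma tdepth_id a y : a < depth y -> tdepth a y = depth y.
Proof. by move=> ay; apply/max_idPl/ltW. Qed.

Lemma chart_coord a y i : chart a y 0 i = (tdepth a y)^-1 * y 0 (lshift 1 i).
Proof. by rewrite !mxE. Qed.

Lemma chart_cont a : 0 < a -> continuous (chart a).
Proof.
move=> a0; apply: continuous_rV => i.
have -> : (fun y => chart a y 0 i) = (fun y => (tdepth a y)^-1 * y 0 (lshift 1 i)).
  by apply/funext => y; exact: chart_coord.
apply: contM; last exact: coord_cont.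
by apply: contV; [exact: tdepth_cont|move=> y; rewrite gt_eqF// tdepth_gt0].
Qed.

Lemma depth_near a y : a < depth y -> \forall z \near y, a < depth z.
Proof. by move=> ay; exact: (cvgr_gt _ (@depth_cont y) _ ay). Qed.

Lemma depth_line y w (t : R) : depth (y + t *: w) = depth y - t * rsubmx w 0 0.
Proof. by rewrite /depth !mxE opprD. Qed.

(** The chart maps lines to lines: along [y + t w] the image moves on a line through [X] in the
    direction [chart_dir X w] with parameter [s t]. Hence a chain rule in one variable suffices. *)
Lemma is_derive_chart (F : E -> R) a y w df : 0 < a -> a < depth y ->
  is_derive (chart a y) (chart_dir (chart a y) w) F df ->
  is_derive y w (fun z => F (chart a z)) (df / depth y).
Proof.
move=> a0 ay dF; set X := chart a y.
have r0 : 0 < depth y by exact: lt_trans ay.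
apply/is_derive_lineP.
pose s (t : R) := t / (depth y - t * rsubmx w 0 0).
have s0 : s 0 = 0 by rewrite /s mul0r.
have ds : is_derive (0 : R) (1 : R) s (depth y)^-1.
  have d1 : is_derive (0 : R) (1 : R) (fun t : R => depth y - t * rsubmx w 0 0) (- rsubmx w 0 0).
    exact: is_derive_affine.
  have nz : depth y - 0 * rsubmx w 0 0 != 0 by rewrite mul0r subr0 gt_eqF.
  have d2 := @is_deriveV R (fun t : R => depth y - t * rsubmx w 0 0) 0 _ 1 nz d1.
  have d3 : is_derive (0 : R) (1 : R) (fun t : R => t) 1 by exact: is_derive_id.
  have d4 := is_deriveM d3 d2; apply: (is_derive_eq d4).
  by rewrite -![_ *: _]/(_ * _) !mul0r subr0 add0r mulr1.
have dFs : is_derive (s 0) (1 : R) (fun u : R => F (X + u *: chart_dir X w)) df.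
  by rewrite s0; exact: (proj1 (@is_derive_lineP R _ F X (chart_dir X w) df) dF).
have := is_derive_comp1 ds dFs; apply: near_eq_is_derive.
have : \forall t \near (0 : R), a < depth y - t * rsubmx w 0 0.
  have c : continuous (fun t : R => depth y - t * rsubmx w 0 0).
    apply: contB; first exact: cst_continuous.
    by apply: contM; [move=> u; exact: cvg_id|exact: cst_continuous].
  by apply: (cvgr_gt _ (c 0)); rewrite mul0r subr0.
apply: filterS => t at_; congr F; rewrite /X /chart !tdepth_id// ?depth_line//.
apply/rowP => i; rewrite /chart_dir /s !mxE.
have h1 : depth y != 0 by rewrite gt_eqF.
have h2 : depth y - t * w 0 (rshift n 0) != 0.
  by rewrite mxE in at_; rewrite gt_eqF// (lt_trans a0).
by field; rewrite h1 h2.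
Qed.

Lemma is_derive_depth y w : is_derive y w depth (- rsubmx w 0 0).
Proof.
apply/is_derive_lineP; have -> : (fun t : R => depth (y + t *: w)) =
  (fun t : R => depth y - t * rsubmx w 0 0) by apply/funext => t; exact: depth_line.
exact: is_derive_affine.
Qed.

End gnomonic_chart.

(** * Homogeneous extension of a mollification *)

Section chart_moll.
Context (R : realType) (n : nat).
Local Notation E := 'rV[R]_n.
Local Notation Y := 'rV[R]_(n + 1).
Local Notation z := (fun _ : 'I_n => 0%N).
Variables (v : E -> R) (d a : R).
Hypotheses (contv : continuous v) (d0 : 0 < d) (a0 : 0 < a).

Definition cone_moll (y : Y) : R := tdepth a y * moll v d z (chart a y).

Definition cone_moll1 (w y : Y) : R :=
  \sum_i chart_dir (chart a y) w 0 i * moll v d (incr z i) (chart a y) -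
  rsubmx w 0 0 * moll v d z (chart a y).

Definition cone_moll2 (w u y : Y) : R :=
  (tdepth a y)^-1 * \sum_i \sum_j chart_dir (chart a y) w 0 i *
    chart_dir (chart a y) u 0 j * moll v d (incr (incr z i) j) (chart a y).

Lemma moll_chart_cont k : continuous (fun y : Y => moll v d k (chart a y)).
Proof.
move=> y; apply: continuous_comp; first exact: chart_cont.
by apply: moll_cont.
Qed.

Lemma chart_dirE X (w : Y) i : chart_dir X w 0 i = w 0 (lshift 1 i) + rsubmx w 0 0 * X 0 i.
Proof. by rewrite !mxE. Qed.

Lemma chart_dir_cont (w : Y) i : continuous (fun y : Y => chart_dir (chart a y) w 0 i).
Proof.
have -> : (fun y : Y => chart_dir (chart a y) w 0 i) =
  (fun y : Y => w 0 (lshift 1 i) + rsubmx w 0 0 * chart a y 0 i).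
  by apply/funext => y; exact: chart_dirE.
apply: contD; first exact: cst_continuous.
apply: contM; first exact: cst_continuous.
move=> y; apply: (@continuous_comp _ _ _ (chart a) (fun x : E => x 0 i)).
  exact: chart_cont.
exact: coord_cont.
Qed.

Lemma cone_moll1_cont w : continuous (cone_moll1 w).
Proof.
apply: contB.
  by apply: continuous_sum_fct => i _; apply: contM; [exact: chart_dir_cont|exact: moll_chart_cont].
by apply: contM; [exact: cst_continuous|exact: moll_chart_cont].
Qed.

Lemma cone_moll2_cont w u : continuous (cone_moll2 w u).
Proof.
apply: contM.
  by apply: contV; [exact: tdepth_cont|move=> y; rewrite gt_eqF// tdepth_gt0].
apply: continuous_sum_fct => i _; apply: continuous_sum_fct => j _.
by apply: contM; [apply: contM; exact: chart_dir_cont|exact: moll_chart_cont].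
Qed.

Lemma is_derive_moll_chart k (y w : Y) : (forall i, (k i < 3)%N) -> a < depth y ->
  is_derive y w (fun y => moll v d k (chart a y))
   ((\sum_i chart_dir (chart a y) w 0 i * moll v d (incr k i) (chart a y)) / depth y).
Proof.
by move=> k3 ay; apply: (@is_derive_chart _ _ (moll v d k)) => //; exact: is_derive_moll_dir.
Qed.

Lemma is_derive_cone_moll (y w : Y) : a < depth y ->
  is_derive y w cone_moll (cone_moll1 w y).
Proof.
move=> ay; have r0 : depth y != 0 by rewrite gt_eqF// (lt_trans a0).
have D1 := @is_derive_moll_chart z y w (fun=> isT) ay.
have := is_deriveM (is_derive_depth y w) D1.
move=> D2; have {}D2 : is_derive y w cone_moll (depth y * ((\sum_i chart_dir (chart a y) w 0 i * moll v d (incr z i) (chart a y)) / depth y) + moll v d z (chart a y) * (- rsubmx w 0 0)).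
  apply: near_eq_is_derive D2; near=> u; rewrite /cone_moll tdepth_id//.
  by near: u; exact: depth_near.
apply: (is_derive_eq D2).
rewrite /cone_moll1; move: (\sum_i _) => S; move: (moll _ _ _ _) => B.
by field.
Unshelve. all: by end_near.
Qed.

(** The first-order terms from the varying direction [chart_dir] cancel those from the value term,
    as homogeneity of degree one demands. Only the second derivatives survive. *)
Lemma is_derive_cone_moll1 (y w u : Y) : a < depth y ->
  is_derive y u (cone_moll1 w) (cone_moll2 w u y).
Proof.
move=> ay; have r0 : depth y != 0 by rewrite gt_eqF// (lt_trans a0).
have D0 := @is_derive_moll_chart z y u (fun=> isT) ay.
have D1 i : is_derive y u (fun y => moll v d (incr z i) (chart a y))
   ((\sum_j chart_dir (chart a y) u 0 j * moll v d (incr (incr z i) j) (chart a y)) / depth y).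
  by apply: is_derive_moll_chart => // j; rewrite /incr; case: (_ == _).
have DX i : is_derive y u (fun y => chart_dir (chart a y) w 0 i)
   (rsubmx w 0 0 * (chart_dir (chart a y) u 0 i / depth y)).
  have D : is_derive y u (fun y => chart a y 0 i) (chart_dir (chart a y) u 0 i / depth y).
    apply: (@is_derive_chart _ _ (fun x => x 0 i)) => //.
    have := is_derive_coord (chart_dir (chart a y) u) (is_derive_id (chart a y 0 i) (1 : R)).
    by rewrite mul1r.
  have -> : (fun y : Y => chart_dir (chart a y) w 0 i) =
    (fun y : Y => w 0 (lshift 1 i) + rsubmx w 0 0 * chart a y 0 i).
    by apply/funext => x; exact: chart_dirE.
  have := is_deriveD (is_derive_cst (w 0 (lshift 1 i)) y u) (is_deriveZ (rsubmx w 0 0) D).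
  by move=> D2; apply: (is_derive_eq D2); rewrite add0r.
have DM i := is_deriveM (DX i) (D1 i).
have := is_deriveB (is_derive_sum DM) (is_deriveZ (rsubmx w 0 0) D0).
rewrite fct_sumE; move=> D2; apply: (is_derive_eq D2).
rewrite /cone_moll2 tdepth_id//.
pose S1 := \sum_i chart_dir (chart a y) u 0 i * moll v d (incr z i) (chart a y).
have -> : \sum_i \sum_j chart_dir (chart a y) w 0 i *
    chart_dir (chart a y) u 0 j * moll v d (incr (incr z i) j) (chart a y) =
  \sum_i chart_dir (chart a y) w 0 i * (\sum_j chart_dir (chart a y) u 0 j * moll v d (incr (incr z i) j) (chart a y)).
  by apply: eq_bigr => i _; rewrite mulr_sumr; apply: eq_bigr => j _; rewrite mulrA.
rewrite big_split /= -/S1 -![_ *: _]/(_ * _).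
have -> : rsubmx w 0 0 * (S1 / depth y) = \sum_i moll v d (incr z i) (chart a y) * (rsubmx w 0 0 * (chart_dir (chart a y) u 0 i / depth y)).
  by rewrite /S1 mulr_suml mulr_sumr; apply: eq_bigr => i _; ring.
rewrite addrK mulr_sumr; apply: eq_bigr => i _.
by rewrite -![_ *: _]/(_ * _); ring.
Qed.

End chart_moll.

(** * Determinant of the homogeneous extension *)

Section chart_determinant.
Context (R : realType) (n : nat).
Local Notation E := 'rV[R]_n.
Implicit Types (A : 'M[R]_n) (X : E).

Lemma wt_enorm_sqr X : wt (enorm X) ^+ 2 = 1 + dotv X X.
Proof. by rewrite wt_sqr /enorm sqr_sqrtr// dotv_ge0. Qed.

Lemma gnomonic_metricK X : (1%:M + X^T *m X) *m gnomonic_metric X = 1%:M.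
Proof.
have XX : X *m X^T = (dotv X X)%:M.
  by apply/matrixP => i j; rewrite !ord1 !mxE eqxx mulr1n; apply: eq_bigr => k _; rewrite mxE.
have W0 : 1 + dotv X X != 0 by rewrite -wt_enorm_sqr expf_neq0// wt_neq0.
rewrite /gnomonic_metric wt_enorm_sqr mulmxBr mulmx1 mulmxDl mul1mx -scalemxAr.
rewrite mulmxA -(mulmxA X^T) XX mul_mx_scalar -scalemxAl; move: (X^T *m X) (dotv X X) W0 => B s W0.
rewrite scalerA -scalerDl -addrA -[RHS]addr0; congr (_ + _).
rewrite -{1}[B]scale1r -scalerBl; apply/eqP; rewrite scaler_eq0; apply/orP; left; apply/eqP.
by field.
Qed.

Lemma det_one_add_outer X : \det (1%:M + X^T *m X) = wt (enorm X) ^+ 2.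
Proof.
have := det_rank1 1 X X (unitmx1 R n); rewrite scale1r => ->.
rewrite det1 mul1r adj1 wt_enorm_sqr /dotv; congr (_ + _); apply: eq_bigr => i _.
rewrite (bigD1 i)//= mxE eqxx mulr1 big1 ?addr0// => k ki.
by rewrite mxE eq_sym (negbTE ki) mulr0 mul0r.
Qed.

(** The drop from size [n + 1] to size [n] costs one factor [t]. In the smaller matrix [1 + X^T X]
    is split off; its determinant is the squared weight and its inverse is left in the pencil. *)
Lemma det_cone_hessian A X (t rho : R) (N := col_mx 1%:M X : 'M[R]_(n + 1, n)) :
  0 < t -> 0 < rho ->
  \det (t%:M + rho^-1 *: (N *m A *m N^T)) =
  t * (wt (enorm X) ^+ 2 / rho ^+ n) * (pencil A (gnomonic_metric X)).[rho * t].
Proof.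
move=> t0 r0.
have NN : N^T *m N = 1%:M + X^T *m X.
  by rewrite /N tr_col_mx mul_row_col trmx1 mulmx1.
have tn0 : t ^+ n != 0 by rewrite expf_neq0// gt_eqF.
apply: (mulfI tn0).
have := det_sylvester t N (rho^-1 *: (A *m N^T)).
rewrite -scalemxAr mulmxA => ->; rewrite -scalemxAl -mulmxA NN.
have -> : t%:M + rho^-1 *: (A *m (1%:M + X^T *m X)) =
  (rho^-1 *: (A + (rho * t) *: gnomonic_metric X)) *m (1%:M + X^T *m X).
  rewrite -scalemxAl mulmxDl -scalemxAl (mulmx1C (gnomonic_metricK X)) scalerDr scalerA.
  by rewrite mulrA mulVf ?gt_eqF// mul1r addrC scale_scalar_mx mulr1.
by rewrite det_mulmx detZ exprVn det_one_add_outer pencil_horner exprD expr1; ring.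
Qed.

End chart_determinant.

(** * Integration over cones in gnomonic coordinates *)

Section gnomonic_integration.
Context (R : realType) (n : nat).
Local Notation E := 'rV[R]_n.
Local Notation Y := 'rV[R]_(n + 1).
Local Notation mu := (lebesgue_rV R n).
Local Notation nu := (lebesgue_rV R (n + 1)).
Variables (l : nat) (theta : R -> R) (c : R).
Hypotheses (theta_cont : continuous theta) (theta_ge0 : forall s, 0 <= theta s)
  (theta0 : forall s, s <= 0 -> theta s = 0)
  (theta_mass : (\int[@lebesgue_measure R]_b ((- b) ^+ l * theta (- b))%:E = c%:E)%E).

(** At depth [- b] the function is a radial profile in the norm, a power of the depth and [g] of the
    chart. The division by [(- b) ^+ n] anticipates the Jacobian of the dilation of a horizontal
    slice. *)
Definition gnomonic_pair (f : Y -> R) (g : E -> R) : Prop := forall (x : E) (b : R),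
  f (row_mx x (const_mx b)) = if b < 0 then
    (- b) ^+ l * theta (- b * wt (enorm ((- b)^-1 *: x))) / (- b) ^+ n * g ((- b)^-1 *: x)
  else 0.

Let Th (b : R) := (- b) ^+ l * theta (- b).

Let Th_ge0 b : 0 <= Th b.
Proof.
rewrite /Th; have [b0|b0] := leP 0 b; first by rewrite theta0 ?mulr0// oppr_le0.
by rewrite mulr_ge0// exprn_ge0// oppr_ge0 ltW.
Qed.

Let Th_cont : continuous Th.
Proof.
apply: contM; first by apply: contX; apply: contN => x; exact: cvg_id.
move=> x; apply: (@continuous_comp _ _ _ (fun b : R => - b) theta); last exact: theta_cont.
by apply: contN => y; exact: cvg_id.
Qed.

Let Kern (g : E -> R) (x : E) (b : R) := (wt (enorm x) ^+ l)^-1 * g x * Th (b * wt (enorm x)).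

Let wt_enorm_cont : continuous (fun x : E => wt (enorm x)).
Proof. by apply: cont_radial; exact: wt_cont. Qed.

Let measurable_Kern g : measurable_fun setT g ->
  measurable_fun setT (fun p : E * measurableTypeR R => (Kern g p.1 p.2)%:E).
Proof.
move=> mg; apply/measurable_EFinP; apply: measurable_funM.
  apply: measurable_funM; last exact: (measurableT_comp mg measurable_fst).
  apply: (measurableT_comp _ measurable_fst (f := fun x : E => (wt (enorm x) ^+ l)^-1)).
  apply: continuous_measurable_rV; apply: (@cont_radial _ _ (fun s => (wt s ^+ l)^-1)).
  exact: wtXV_cont.
apply: (measurableT_comp (f := Th)).
  exact: continuous_measurable_fun.
apply: measurable_funM; first exact: measurable_snd.
apply: (measurableT_comp _ measurable_fst (f := fun x : E => wt (enorm x))).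
exact: continuous_measurable_rV.
Qed.

(** Each horizontal slice is dilated to the chart, then the order of integration is exchanged. Since
    the norm is depth times [wt], a dilation in [b] separates the profile and leaves the power of
    [wt]. *)
Lemma ge0_gnomonic_integral f g : gnomonic_pair f g ->
  measurable_fun setT f -> measurable_fun setT g -> (forall x, 0 <= g x) ->
  (\int[nu]_y (f y)%:E = \int[mu]_x (c * (g x / wt (enorm x) ^+ l.+1))%:E)%E.
Proof.
move=> fg mf mg g0.
have K0 x b : 0 <= Kern g x b.
  by apply: mulr_ge0 => //; rewrite mulr_ge0// invr_ge0 exprn_ge0// ltW// wt_gt0.
have f0 y : 0 <= f y.
  have -> : y = row_mx (lsubmx y) (const_mx (rsubmx y 0 0)).
    by rewrite -[LHS]hsubmxK; congr row_mx; apply/rowP => i; rewrite !ord1 [RHS]mxE.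
  rewrite fg; case: ifP => // b0; rewrite !mulr_ge0//.
    by rewrite exprn_ge0// oppr_ge0 ltW.
  by rewrite invr_ge0 exprn_ge0// oppr_ge0 ltW.
rewrite ge0_integral_rV_last; last 2 first.
- exact/measurable_EFinP.
- by move=> y; rewrite lee_fin.
transitivity (\int[@lebesgue_measure R]_b \int[mu]_x (f (row_mx x (const_mx b)))%:E)%E.
  apply: (@fubini_tonelli _ _ _ _ _ mu (@lebesgue_measure R) (fun p => (f (row_mx p.1 (const_mx p.2)))%:E)).
    by apply/measurable_EFinP; exact: (measurableT_comp mf (@measurable_row_mx_last R n)).
  by move=> p; rewrite lee_fin.
transitivity (\int[@lebesgue_measure R]_b \int[mu]_x (Kern g x b)%:E)%E.
  apply: eq_integral => b _; have [b0|b0] := ltP b 0; last first.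
    apply: eq_integral => x _; congr EFin; rewrite fg ltNge b0 /= /Kern /Th.
    by rewrite [theta _]theta0 ?mulr0// oppr_le0 mulr_ge0// ltW// wt_gt0.
  have t0 : 0 < - b by rewrite oppr_gt0.
  have mb : measurable_fun setT (fun x : E => f (row_mx x (const_mx b))).
    apply: (measurableT_comp mf); apply/measurable_fun_rVP => i.
    case: (split_ordP i) => k ->.
      under eq_fun do rewrite row_mxEl; exact: measurable_rV_coord.
    by under eq_fun do rewrite row_mxEr mxE; exact: measurable_cst.
  have := @ge0_integral_rV_scale R n (fun x => (f (row_mx x (const_mx b)))%:E) _ t0.
  move=> <-; last 2 first.
  - exact/measurable_EFinP.
  - by move=> x; rewrite lee_fin.
  rewrite -ge0_integralZl//; last 3 first.
  - apply/measurable_EFinP; apply: (measurableT_comp mb).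
    by apply: continuous_measurable_rV_rV => x; exact: scaler_continuous.
  - by move=> x _; rewrite lee_fin.
  - by rewrite lee_fin exprn_ge0// ltW.
  apply: eq_integral => x _; rewrite -EFinM; congr EFin.
  rewrite fg b0 scalerA mulVf ?gt_eqF// scale1r /Kern /Th -mulNr exprMn.
  have : (- b) ^+ n != 0 by rewrite expf_neq0// gt_eqF.
  have : wt (enorm x) ^+ l != 0 by rewrite expf_neq0// wt_neq0.
  by move: (_ ^+ n) (wt _ ^+ l) (theta _) => A W T W0 A0; field; rewrite W0.
transitivity (\int[mu]_x \int[@lebesgue_measure R]_b (Kern g x b)%:E)%E.
  apply/esym; apply: (@fubini_tonelli _ _ _ _ _ mu (@lebesgue_measure R) (fun p => (Kern g p.1 p.2)%:E)).
    exact: measurable_Kern.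
  by move=> p; rewrite lee_fin.
apply: eq_integral => x _.
have w0 := wt_gt0 (enorm x).
have mTh : measurable_fun setT (Th : measurableTypeR R -> R) by exact: continuous_measurable_fun.
have k0 : 0 <= (wt (enorm x) ^+ l)^-1 * g x.
  by rewrite mulr_ge0// invr_ge0 exprn_ge0// ltW.
under eq_integral do rewrite EFinM.
rewrite ge0_integralZl//; last 2 first.
- apply/measurable_EFinP; apply: (measurableT_comp mTh).
  by apply: measurable_funM => //; exact: measurable_cst.
- by move=> b _; rewrite lee_fin.
have := @ge0_integral_lebesgue_scale R (fun b => (Th b)%:E) _ w0.
move=> S.
have -> : (\int[@lebesgue_measure R]_b (Th (b * wt (enorm x)))%:E = ((wt (enorm x))^-1 * c)%:E)%E.
  have {}S : ((wt (enorm x))%:E * \int[@lebesgue_measure R]_b (Th (wt (enorm x) * b))%:E = c%:E)%E.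
    rewrite S => [|//|]; last by move=> b; rewrite lee_fin.
      exact: theta_mass.
    exact/measurable_EFinP.
  under eq_integral do rewrite mulrC.
  rewrite EFinM -S muleA -EFinM mulVf ?gt_eqF// mul1e //.
rewrite -EFinM; congr EFin; rewrite exprS invfM.
by move: ((wt _ ^+ l)^-1) ((wt _)^-1) => A B; ring.
Qed.

Lemma gnomonic_integral f g : gnomonic_pair f g -> bms f -> bms g ->
  \int[nu]_y f y = c * \int[mu]_x (g x / wt (enorm x) ^+ l.+1).
Proof.
move=> fg bf bg.
have mW : measurable_fun setT (fun x : E => (wt (enorm x) ^+ l.+1)^-1).
  apply: continuous_measurable_rV; apply: (@cont_radial _ _ (fun s => (wt s ^+ l.+1)^-1)).
  exact: wtXV_cont.
have W1 (x : E) : `|(wt (enorm x) ^+ l.+1)^-1| <= 1.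
  have w1 : 1 <= wt (enorm x).
    by rewrite -[X in X <= _]sqrtr1 /wt ler_wsqrtr// lerDl sqr_ge0.
  rewrite ger0_norm ?invr_ge0 ?exprn_ge0 ?(le_trans _ w1)// invf_le1 ?exprn_ege1//.
  by rewrite exprn_gt0// wt_gt0.
have bW (h : E -> R) : bms h -> bms (fun x => h x / wt (enorm x) ^+ l.+1).
  move=> bh; apply: eq_bms (bmsM mW _ bh); last by exists 1.
  by move=> x; rewrite mulrC.
have aux F G : gnomonic_pair F G -> bms F -> bms G ->
    \int[nu]_y Num.max (F y) 0 = c * \int[mu]_x (Num.max (G x) 0 / wt (enorm x) ^+ l.+1).
  move=> FG bF bG.
  have FG' : gnomonic_pair (fun y => Num.max (F y) 0) (fun x => Num.max (G x) 0).
    move=> x b; rewrite FG; case: ifP => b0; last by rewrite maxxx.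
    have q0 : 0 <= (- b) ^+ l * theta (- b * wt (enorm ((- b)^-1 *: x))) / (- b) ^+ n.
      by rewrite !mulr_ge0// ?invr_ge0 ?exprn_ge0// oppr_ge0 ltW.
    by rewrite maxr_pMr// mulr0.
  have G0 (x : E) : 0 <= Num.max (G x) 0 by rewrite le_max lexx orbT.
  have := ge0_gnomonic_integral FG' (bms_max0 bF).1 (bms_max0 bG).1 G0.
  rewrite integral_bms; last exact: bms_max0.
  rewrite integral_bms; last by apply: bmsZ; apply: bW; exact: bms_max0.
  by move=> [->]; rewrite RintZ//; apply: bW; exact: bms_max0.
have fgN : gnomonic_pair (fun y => - f y) (fun x => - g x).
  by move=> x b; rewrite fg; case: ifP; rewrite ?oppr0// mulrN.
rewrite [in LHS](max0_split f) RintB ?(aux _ _ fg) ?(aux _ _ fgN)//; do ?[exact: bms_max0 | exact: bmsN | by apply: bms_max0; exact: bmsN].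
rewrite -mulrBr -RintB; do ?[by apply: bW; apply: bms_max0; do ?[exact: bmsN]].
congr (_ * _); congr Rintegral; apply/funext => x.
by rewrite -mulrBl [in RHS](congr1 (@^~ x) (max0_split g)).
Qed.

End gnomonic_integration.

(** * An average that respects homogeneity *)

Section sheared_average.
Context (R : realType) (n : nat).
Local Notation E := 'rV[R]_n.
Local Notation Y := 'rV[R]_(n + 1).
Local Notation z := (fun _ : 'I_n => 0%N).
Variables (h : Y -> R) (L : R).
Hypotheses (L0 : 0 <= L) (lh : lip L h) (ch : cvx h)
  (hZ : forall (t : R) y, 0 <= t -> h (t *: y) = t * h y).

Definition shear (y : Y) (eta : E) : Y := row_mx (lsubmx y + depth y *: eta) (rsubmx y).

Lemma shear_cont y : continuous (shear y).
Proof.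
apply: continuous_rV => i; case: (split_ordP i) => k ->.
  have -> : (fun x : E => shear y x 0 (lshift 1 k)) = (fun x => y 0 (lshift 1 k) + depth y * x 0 k).
    by apply/funext => x; rewrite row_mxEl !mxE.
  apply: contD; first exact: cst_continuous.
  by apply: contM; [exact: cst_continuous|exact: coord_cont].
have -> : (fun x : E => shear y x 0 (rshift n k)) = (fun x => rsubmx y 0 k).
  by apply/funext => x; rewrite row_mxEr.
exact: cst_continuous.
Qed.

Let h_cont : continuous h. Proof. exact: lip_cont lh. Qed.

Let hs_cont y : continuous (fun eta => h (shear y eta)).
Proof. by move=> x; apply: continuous_comp; [exact: shear_cont|exact: h_cont]. Qed.

Lemma shearD (t s : R) y x eta :
  shear (t *: y + s *: x) eta = t *: shear y eta + s *: shear x eta.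
Proof.
apply/rowP => i; rewrite !mxE; case: splitP => k _; rewrite !mxE; last by [].
by rewrite !depthE !mxE; ring.
Qed.

Lemma shear_norm y eta : `|eta| <= 1 -> enorm (shear y eta) <= (n + 1)%:R * 2 * enorm y.
Proof.
move=> e1; apply: (le_trans (enorm_le_mx_norm _)); rewrite -mulrA ler_wpM2l//.
have ye := mx_norm_le_enorm y.
apply/mx_norm_leP; first by rewrite mulr_ge0// enorm_ge0.
move=> i; case: (split_ordP i) => k ->; rewrite /shear; last first.
  rewrite row_mxEr mxE (le_trans (mx_norm_coord _ _))//.
  by have := enorm_ge0 y; lra.
rewrite row_mxEl !mxE; apply: (le_trans (ler_normD _ _)); rewrite normrM depthE normrN.
have h1 := mx_norm_coord y (lshift 1 k); have h2 := mx_norm_coord y (rshift n 0).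
have h3 : `|eta 0 k| <= 1 by exact: le_trans (mx_norm_coord _ _) e1.
have : `|y 0 (rshift n 0)| * `|eta 0 k| <= `|y 0 (rshift n 0)| by rewrite ler_piMr.
lra.
Qed.

Lemma shear_close y eta : enorm (shear y eta - y) <= (n + 1)%:R * (`|y| * `|eta|).
Proof.
apply: (le_trans (enorm_le_mx_norm _)); rewrite ler_wpM2l//.
apply/mx_norm_leP; first by rewrite mulr_ge0.
move=> i; case: (split_ordP i) => k ->; rewrite /shear mxE; last first.
  by rewrite row_mxEr !mxE subrr normr0 mulr_ge0.
rewrite row_mxEl !mxE addrAC subrr add0r normrM depthE normrN.
by rewrite ler_pM// mx_norm_coord.
Qed.

(* Shearing by an amount proportional to the depth makes the average compatible
   with homogeneity: on the lower half-space it is the cone over the mollified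
   section. *)
Definition cone_avg (d : R) (y : Y) : R := avg d (fun eta => h (shear y eta)).

Lemma cone_avg_cvx d : 0 < d -> cvx (cone_avg d).
Proof.
move=> d0 x y t t01; rewrite /cone_avg.
rewrite -avgZ// -avgZ// -avgD//; do ?[by apply: contM; [exact: cst_continuous|exact: hs_cont]].
apply: avg_le => //.
  by apply: contD; apply: contM; [exact: cst_continuous|exact: hs_cont|exact: cst_continuous|exact: hs_cont].
by move=> eta _; rewrite shearD; exact: ch.
Qed.

Lemma cone_avg_lip d : 0 < d -> d <= 1 -> lip (L * ((n + 1)%:R * 2)) (cone_avg d).
Proof.
move=> d0 d1 x y.
have -> : cone_avg d x - cone_avg d y = avg d (fun eta => h (shear x eta) + (-1) * h (shear y eta)).
  rewrite avgD// ?avgZ// ?mulN1r//.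
  by apply: contM; [exact: cst_continuous|exact: hs_cont].
rewrite -[X in `|X|]subr0; apply: avg_close => //.
  by apply: contD => //; apply: contM; [exact: cst_continuous|exact: hs_cont].
move=> eta ed; rewrite subr0 mulN1r; apply: (le_trans (lh _ _)); rewrite -mulrA ler_wpM2l//.
have -> : shear x eta - shear y eta = shear (x - y) eta.
  by have := shearD 1 (-1) x y eta; rewrite !scale1r !scaleN1r.
by apply: shear_norm; exact: le_trans ed d1.
Qed.

Lemma cone_avg_close d y : 0 < d -> `|cone_avg d y - h y| <= L * ((n + 1)%:R * (`|y| * d)).
Proof.
move=> d0; apply: avg_close => // eta ed; apply: (le_trans (lh _ _)); rewrite ler_wpM2l//.
by apply: (le_trans (shear_close _ _)); rewrite ler_wpM2l// ler_wpM2l.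
Qed.

Definition section_fun (x : E) : R := h (row_mx x (const_mx (-1))).

Lemma section_cont : continuous section_fun.
Proof.
have -> : section_fun = (fun x => h (shear (row_mx 0 (const_mx (-1))) x)).
  apply/funext => x; rewrite /section_fun /shear row_mxKl row_mxKr add0r.
  by rewrite /depth row_mxKr mxE opprK scale1r.
exact: hs_cont.
Qed.

Lemma h_section (y : Y) : 0 < depth y -> h y = depth y * section_fun ((depth y)^-1 *: lsubmx y).
Proof.
move=> r0; rewrite /section_fun -hZ ?ltW//; congr h.
apply/rowP => i; case: (split_ordP i) => k ->; rewrite mxE ?row_mxEl ?row_mxEr !mxE.
  by rewrite mulrA mulfV ?gt_eqF// mul1r.
by rewrite ord1 depthE mulrN1 opprK.
Qed.

(** Seen in the chart, the shear is the translation by [eta], and homogeneity pulls out the depth,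
    which the shear preserves. *)
Lemma cone_avg_moll d a y : 0 < d -> 0 < a -> a < depth y ->
  cone_avg d y = cone_moll section_fun d a y.
Proof.
move=> d0 a0 ay; have r0 : 0 < depth y by exact: lt_trans ay.
rewrite /cone_moll moll0E//; last exact: section_cont.
rewrite /cone_avg -avgZ//; last first.
  by apply: shift_cont; exact: section_cont.
congr avg; apply/funext => eta; rewrite tdepth_id// h_section.
  have dE : depth (shear y eta) = depth y by rewrite /depth /shear row_mxKr.
  rewrite dE; congr (_ * section_fun _); rewrite /chart tdepth_id// /shear row_mxKl.
  by rewrite scalerDr scalerA mulVf ?gt_eqF// scale1r.
by rewrite /depth /shear row_mxKr.
Qed.

End sheared_average.

Lemma depth_margin (R : realType) (a X Y : R) :
  0 < a -> 2 * a <= - Y -> `|X - Y| <= a / 2 -> a < - X.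
Proof. by move=> a0 aY; rewrite ler_norml => /andP[_ XY]; lra. Qed.

(** * Steiner coefficients tested on cones *)

Section cone_density.
Context (R : realType) (n : nat).
Local Notation E := 'rV[R]_n.
Local Notation Y := 'rV[R]_(n + 1).
Local Notation z := (fun _ : 'I_n => 0%N).
Local Notation nu := (lebesgue_rV R (n + 1)).
Local Notation mu := (lebesgue_rV R n).
Local Notation e := (@basis_vec R (n + 1)).
Variables (h : Y -> R) (L : R).
Hypotheses (L0 : 0 <= L) (lh : lip L h) (ch : cvx h)
  (hZ : forall (t : R) y, 0 <= t -> h (t *: y) = t * h y).
Variables (theta : R -> R) (f : E -> R) (s0 s1 a : R).
Hypotheses (theta_cont : continuous theta) (theta_ge0 : forall s, 0 <= theta s)
  (s0_gt0 : 0 < s0) (theta_supp : forall s, theta s != 0 -> s0 <= s <= s1)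
  (Cf : Cc f) (a0 : 0 < a) (fa : forall x, f x != 0 -> 2 * a * wt (enorm x) <= s0).
Local Notation v := (section_fun h).

(** The first factor is 0 up to depth [a] and 1 from depth [2 a] on. By [fa] the other two factors
    vanish jointly below depth [2 a], so it does not affect the values in the lower half-space but
    makes the function continuous everywhere. *)
Definition cone_test (y : Y) : R :=
  Num.max 0 (Num.min 1 ((depth y - a) / a)) * theta (enorm y) * f (chart a y).

Let vcont : continuous v. Proof. exact: section_cont lh. Qed.

Lemma enorm_depth (y : Y) : 0 < depth y ->
  enorm y = depth y * wt (enorm ((depth y)^-1 *: lsubmx y)).
Proof.
move=> r0; apply/eqP; rewrite -(@eqrXn2 _ 2)//; last 2 first.
- exact: enorm_ge0.
- by rewrite mulr_ge0// ltW// wt_gt0.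
rewrite exprMn wt_enorm_sqr dotvZl dotvZr enorm_sqr.
have -> : dotv y y = dotv (lsubmx y) (lsubmx y) + depth y ^+ 2.
  rewrite /dotv big_split_ord /= big_ord1 depthE sqrrN expr2; congr (_ + _).
  by apply: eq_bigr => i _; rewrite !mxE.
by apply/eqP; field; rewrite gt_eqF.
Qed.

Lemma cone_testE y : cone_test y =
  if 0 < depth y then theta (enorm y) * f ((depth y)^-1 *: lsubmx y) else 0.
Proof.
rewrite /cone_test; have [ya|ya] := leP (depth y) a.
  rewrite max_l; last by rewrite ge_min orbC pmulr_lle0 ?invr_gt0// subr_le0 ya.
  rewrite !mul0r; case: ifP => // y0; apply/esym/eqP; rewrite mulf_eq0.
  apply/negP => /negP; rewrite negb_or => /andP[/theta_supp/andP[sy _] /fa].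
  move: sy; rewrite (enorm_depth y0); move: (wt_gt0 (enorm ((depth y)^-1 *: lsubmx y))).
  by move: (wt _) => w; nra.
have y0 : 0 < depth y by exact: lt_trans ya.
rewrite y0 /chart tdepth_id//.
have [->|tn0] := eqVneq (theta (enorm y)) 0; first by rewrite mulr0 !mul0r.
have [->|fn0] := eqVneq (f ((depth y)^-1 *: lsubmx y)) 0; first by rewrite !mulr0.
have y2 : 2 * a <= depth y.
  have /andP[sy _] := theta_supp tn0; have := fa fn0.
  move: sy; rewrite (enorm_depth y0); move: (wt_gt0 (enorm ((depth y)^-1 *: lsubmx y))).
  by move: (wt _) => w; nra.
rewrite min_l ?max_r ?mul1r//.
by rewrite ler_pdivlMr// mul1r; lra.
Qed.

Lemma Cc_cone_test : Cc cone_test.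
Proof.
split.
  apply: contM.
    apply: contM.
      apply: contmax; first exact: cst_continuous.
      apply: contmin; first exact: cst_continuous.
      apply: contM; last exact: cst_continuous.
      by apply: contB; [exact: depth_cont|exact: cst_continuous].
    by move=> y; apply: continuous_comp; [exact: enorm_cont|exact: theta_cont].
  by move=> y; apply: continuous_comp; [exact: chart_cont|exact: Cf.1].
exists s1 => y sy; rewrite /cone_test.
have [->|/theta_supp/andP[_ ys]] := eqVneq (theta (enorm y)) 0; first by rewrite mulr0 mul0r.
by have := mx_norm_le_enorm y; lra.
Qed.

Lemma cone_test_depth y : cone_test y != 0 -> 2 * a <= depth y.
Proof.
rewrite cone_testE; case: ifP => [y0|_]; last by rewrite eqxx.
rewrite mulf_eq0 negb_or => /andP[/theta_supp/andP[sy _] /fa].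
move: sy; rewrite (enorm_depth y0); move: (wt_gt0 (enorm ((depth y)^-1 *: lsubmx y))).
by move: (wt _) => w; nra.
Qed.

(** By [det_cone_hessian] this is the coefficient of [t ^+ l.+1] in the Monge-Ampere integral of
    [cone_avg]. *)
Definition cone_moment (d : R) (l : nat) : R :=
  \int[nu]_y (wt (enorm (chart a y)) ^+ 2 * (tdepth a y ^+ n)^-1 * tdepth a y ^+ l *
    (pencil (mollH v d (chart a y)) (gnomonic_metric (chart a y)))`_l * cone_test y).

Lemma mollH_chart_cont d i j : 0 < d -> continuous (fun x : E => mollH v d x i j).
Proof.
move=> d0; rewrite (_ : (fun x => _) = moll v d (incr (incr z i) j)).
  exact: moll_cont.
by apply/funext => x; rewrite mxE.
Qed.

Lemma gnomonic_metric_cont i j : continuous (fun x : E => gnomonic_metric x i j).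
Proof.
have -> : (fun x : E => gnomonic_metric x i j) =
    (fun x => (i == j)%:R - (wt (enorm x) ^+ 2)^-1 * (x 0 i * x 0 j)).
  by apply/funext => x; rewrite !mxE big_ord1 !mxE.
apply: contB; first exact: cst_continuous.
apply: contM; last by apply: contM; exact: coord_cont.
apply: (@cont_radial _ _ (fun s => (wt s ^+ 2)^-1)); exact: wtXV_cont.
Qed.

Lemma gnomonic_coef_cont d l : 0 < d ->
  continuous (fun x : E => (pencil (mollH v d x) (gnomonic_metric x))`_l).
Proof.
move=> d0; apply: pencil_coef_cont => i j; first exact: mollH_chart_cont.
exact: gnomonic_metric_cont.
Qed.

Lemma cone_moment_cont d l : 0 < d -> continuous (fun y : Y =>
  wt (enorm (chart a y)) ^+ 2 * (tdepth a y ^+ n)^-1 * tdepth a y ^+ l *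
    (pencil (mollH v d (chart a y)) (gnomonic_metric (chart a y)))`_l).
Proof.
move=> d0; have cc (g : E -> R) : continuous g -> continuous (fun y : Y => g (chart a y)).
  by move=> cg y; apply: continuous_comp; [exact: chart_cont|exact: cg].
apply: contM; last exact: (cc _ (@gnomonic_coef_cont d l d0)).
apply: contM; last by apply: contX; exact: tdepth_cont.
apply: contM.
  by apply: (cc (fun x => wt (enorm x) ^+ 2)); apply: (@cont_radial _ _ (fun s => wt s ^+ 2)); exact: wtX_cont.
apply: contV; first by apply: contX; exact: tdepth_cont.
by move=> y; rewrite expf_neq0// gt_eqF// tdepth_gt0.
Qed.

Lemma cone_hessianE d y : \matrix_(i, j) cone_moll2 v d a (e i) (e j) y =
  (tdepth a y)^-1 *: (col_mx 1%:M (chart a y) *m mollH v d (chart a y) *m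
    (col_mx 1%:M (chart a y))^T).
Proof.
have cE (x : E) (i : 'I_(n + 1)) k : col_mx 1%:M x i k = chart_dir x (e i) 0 k.
  rewrite chart_dirE; case: (split_ordP i) => m ->.
    by rewrite col_mxEu !mxE !eq_shift /= mulr0n mul0r addr0 eq_sym.
  by rewrite col_mxEd !mxE !eq_shift /= mulr0n add0r !ord1 eqxx mulr1n mul1r.
apply/matrixP => i j; rewrite [LHS]mxE [RHS]mxE [in RHS]mxE /cone_moll2; congr (_ * _).
rewrite exchange_big; apply: eq_bigr => k _; rewrite [X in _ = X * _]mxE mulr_suml.
apply: eq_bigr => m _; rewrite !cE [_^T _ _]mxE cE [mollH _ _ _ _ _]mxE.
by rewrite mulrAC.
Qed.

(** The test function lives at depth at least [2 a], so a margin [a / 2] around its support remains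
    where the average is the smooth homogeneous extension, and [MA_C2] applies. *)
Lemma MA_cone_avg d t : 0 < d -> d <= 1 -> 0 < t ->
  MA (cone_avg h d) t cone_test = \sum_(l < n.+1) t ^+ l.+1 * cone_moment d l.
Proof.
move=> d0 d1 t0.
have LL : 0 <= L * ((n + 1)%:R * 2) by rewrite !mulr_ge0.
have U_eq y : a < depth y -> \forall u \near y, cone_moll v d a u = cone_avg h d u.
  by move=> ay; apply: filterS (depth_near ay) => u au; rewrite (cone_avg_moll lh hZ d0 a0 au).
have H := @MA_C2 R (n + 1) (cone_avg h d) (fun i => cone_moll1 v d a (e i))
  (fun i j => cone_moll2 v d a (e i) (e j)) [set y | a < depth y] _ cone_test t (a / 2)
  LL (cone_avg_lip L0 lh d0 d1) (cone_avg_cvx lh ch d0) t0 Cc_cone_test.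
transitivity (\int[nu]_y (cone_test y *
    (pencil (\matrix_(i, j) cone_moll2 v d a (e i) (e j) y) 1%:M).[t])).
  apply: H; first last.
  - move=> y x /cone_test_depth y2 xy /=.
    have := le_trans (mx_norm_coord (x - y) (rshift n 0)) xy.
    move: y2; rewrite !depthE mxE [(- y) _ _]mxE; move: (x 0 _) (y 0 _) => X Y' y2.
    exact: depth_margin.
  - by move=> i j y /= ay; apply: is_derive_cone_moll1.
  - by move=> i y /= ay; apply: near_eq_is_derive (is_derive_cone_moll vcont d0 a0 (e i) ay); exact: U_eq.
  - by move=> i j; apply: cone_moll2_cont.
  - by move=> i; apply: cone_moll1_cont.
  - by rewrite divr_gt0.
transitivity (\int[nu]_y \sum_(l < n.+1) t ^+ l.+1 *
  (wt (enorm (chart a y)) ^+ 2 * (tdepth a y ^+ n)^-1 * tdepth a y ^+ l *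
    (pencil (mollH v d (chart a y)) (gnomonic_metric (chart a y)))`_l * cone_test y)).
  apply: eq_Rintegral => y _.
  rewrite pencil_horner cone_hessianE addrC scale_scalar_mx mulr1.
  rewrite (det_cone_hessian _ _ t0 (tdepth_gt0 y a0)).
  rewrite (horner_coef_wide _ (size_pencil _ _)) mulr_sumr mulr_sumr.
  apply: eq_bigr => l _; rewrite exprMn [t ^+ _.+1]exprS.
  move: (cone_test y) (wt _ ^+ 2) (tdepth a y ^+ n)^-1 (tdepth a y ^+ l) (_`_l) (t ^+ l).
  by move=> *; ring.
have bm l : bms (fun y : Y => wt (enorm (chart a y)) ^+ 2 * (tdepth a y ^+ n)^-1 * tdepth a y ^+ l *
    (pencil (mollH v d (chart a y)) (gnomonic_metric (chart a y)))`_l * cone_test y).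
  by apply: Cc_bms; apply: CcM Cc_cone_test; exact: cone_moment_cont.
rewrite Rint_sum; last by move=> l _; exact: bmsZ.
by apply: eq_bigr => l _; rewrite RintZ.
Qed.

Lemma cone_moment_cvg l : (l <= n)%N ->
  cone_moment (dk R k) l @[k --> \oo] --> Psi h l.+1 cone_test.
Proof.
move=> ln; pose G (k l : nat) := if l is l'.+1 then cone_moment (dk R k) l' else 0.
have := @coef_cvg R (n + 1) G (fun t => MA h t cone_test) _ l.+1.
apply; last by rewrite ltnS addn1.
move=> t t0.
have : MA (cone_avg h (dk R k)) t cone_test @[k --> \oo] --> MA h t cone_test.
  apply: (@MA_limit R _ _ h cone_test (L * ((n + 1)%:R * 2)) t) => //.
  - by rewrite !mulr_ge0.
  - by move=> k; apply: cone_avg_lip => //; [exact: dk_gt0|rewrite invf_le1// ler1n].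
  - by move=> k; apply: cone_avg_cvx => //; exact: dk_gt0.
  - move=> x y; apply: (le_trans (lh x y)); rewrite ler_wpM2r ?enorm_ge0//.
    by rewrite ler_peMr// -natrM ler1n muln_gt0 addn1.
  - move=> r eps e0; pose C := L * ((n + 1)%:R * `|r|) + 1.
    have C0 : 0 < C by rewrite ltr_wpDl// !mulr_ge0.
    have e1 : 0 < eps / C by rewrite divr_gt0.
    apply: filterS (dk_near e1) => k; rewrite ltr_pdivlMr// => ke y yr.
    apply: (le_trans (cone_avg_close L0 lh _ (dk_gt0 R k))).
    apply: le_trans (ltW ke); rewrite /C mulrDr mulr1 [leRHS]addrC -[leLHS]add0r lerD ?(ltW (dk_gt0 _ _))//.
    rewrite [leRHS]mulrC -!mulrA ler_wpM2l// ler_wpM2l// ler_wpM2r ?(ltW (dk_gt0 _ _))//.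
    by rewrite (le_trans yr)// ler_norm.
  - exact: Cc_cone_test.
apply: cvg_trans; apply: near_eq_cvg; near=> k.
rewrite MA_cone_avg//; [|exact: dk_gt0|by rewrite invf_le1// ler1n].
have aux (F : nat -> R) N M : N = M -> \sum_(i < N) F i = \sum_(i < M) F i by move=> ->.
rewrite (@aux (fun l => t ^+ l * G k l) _ n.+2); last by rewrite addn1.
by rewrite [RHS]big_ord_recl /= mulr0 add0r; apply: eq_bigr => i _.
Unshelve. all: by end_near.
Qed.

Variables (l : nat) (c : R).
Hypotheses (ln : (l <= n)%N)
  (theta_mass : (\int[@lebesgue_measure R]_b ((- b) ^+ l * theta (- b))%:E = c%:E)%E).

Lemma cone_momentE d : 0 < d -> cone_moment d l =
  c * \int[mu]_x (wt (enorm x) ^+ 2 * (pencil (mollH v d x) (gnomonic_metric x))`_l * f x /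
    wt (enorm x) ^+ l.+1).
Proof.
move=> d0; apply: (@gnomonic_integral _ _ l theta c) => //.
- move=> s s_le0; apply/eqP/negP => /negP/theta_supp/andP[ss _].
  by move: (le_lt_trans s_le0 s0_gt0); rewrite ltNge ss.
- move=> x b; set y := row_mx x (const_mx b).
  have yd : depth y = - b by rewrite /depth /y row_mxKr mxE.
  have yl : lsubmx y = x by rewrite /y row_mxKl.
  have [b0|b0] := ltP b 0; last first.
    have -> : cone_test y = 0 by rewrite cone_testE yd oppr_gt0 ltNge b0.
    by rewrite [LHS]mulr0.
  have ctE : cone_test y = theta (- b * wt (enorm ((- b)^-1 *: x))) * f ((- b)^-1 *: x).
    rewrite cone_testE yd yl oppr_gt0 b0 enorm_depth yd ?yl// oppr_gt0.
    exact: b0.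
  have [ct0|/cone_test_depth y2] := eqVneq (cone_test y) 0.
    rewrite ct0 [LHS]mulr0; move: ctE; rewrite ct0.
    move: (theta _) (f _) (_`_l) (wt _ ^+ 2) ((- b) ^+ l) ((- b) ^+ n) => T F P W B B' TF.
    transitivity (B / B' * (W * P) * (T * F)); first by rewrite -TF mulr0.
    ring.
  have ay : a < depth y by rewrite (lt_le_trans _ y2)// mulr_natl mulr2n ltrDl.
  rewrite ctE /chart tdepth_id// yd yl.
  move: (theta _) (f _) (_`_l) (wt _ ^+ 2) ((- b) ^+ l) ((- b) ^+ n) => T F P W B B'.
  ring.
- by apply: Cc_bms; apply: CcM Cc_cone_test; exact: cone_moment_cont.
- apply: Cc_bms; apply: CcM Cf; apply: contM; last exact: gnomonic_coef_cont.
  by apply: (@cont_radial _ _ (fun s => wt s ^+ 2)); exact: wtX_cont.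
Qed.

End cone_density.

(** * The integral representation *)

Section ramp_functions.
Context (R : realType).
Local Notation leb := (@lebesgue_measure R).

(* Continuous approximations of the indicator of ]0, 1] that vanish near 0. *)
Definition ramp (m : nat) (s : R) : R :=
  Num.max 0 (Num.min 1 (m.+1%:R * s - 1)) * Num.max 0 (Num.min 1 (1 - m.+1%:R * (s - 1))).

Lemma clip_cont (a b : R) :
  continuous (fun s : R => Num.max 0 (Num.min 1 (a * s + b))).
Proof.
apply: contmax; first exact: cst_continuous.
apply: contmin; first exact: cst_continuous.
apply: contD; last exact: cst_continuous.
by apply: contM; [exact: cst_continuous|move=> u; exact: cvg_id].
Qed.

Lemma ramp_cont m : continuous (ramp m).
Proof.
have -> : ramp m = (fun s => Num.max 0 (Num.min 1 (m.+1%:R * s + -1)) *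
    Num.max 0 (Num.min 1 (- m.+1%:R * s + (1 + m.+1%:R)))).
  by apply/funext => s; rewrite /ramp; congr (_ * Num.max 0 (Num.min 1 _)); ring.
by apply: contM; exact: clip_cont.
Qed.

Lemma clip_bounds (x : R) : 0 <= Num.max 0 (Num.min 1 x) <= 1.
Proof. by rewrite le_max lexx /= ge_max ler01 ge_min lexx. Qed.

Lemma ramp_bounds m s : 0 <= ramp m s <= 1.
Proof.
have /andP[a0 a1] := clip_bounds (m.+1%:R * s - 1).
have /andP[b0 b1] := clip_bounds (1 - m.+1%:R * (s - 1)).
by rewrite /ramp mulr_ge0//= mulr_ile1.
Qed.

Lemma clip_eq0 (x : R) : x <= 0 -> Num.max 0 (Num.min 1 x) = 0.
Proof. by move=> x0; rewrite max_l// ge_min x0 orbT. Qed.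

Lemma clip_eq1 (x : R) : 1 <= x -> Num.max 0 (Num.min 1 x) = 1.
Proof. by move=> x1; rewrite min_l// max_r. Qed.

Lemma ramp_supp m s : ramp m s != 0 -> dk R m <= s <= 2.
Proof.
have m0 : 0 < m.+1%:R :> R by rewrite ltr0n.
have m1 : 1 <= m.+1%:R :> R by rewrite ler1n.
rewrite /ramp; have [h|h] := leP (m.+1%:R * s - 1) 0; first by rewrite clip_eq0// mul0r eqxx.
have [h'|h'] := leP (1 - m.+1%:R * (s - 1)) 0.
  by rewrite [X in _ * X]clip_eq0// mulr0 eqxx.
move=> _; apply/andP; split.
  by rewrite /dk -[leLHS]mul1r ler_pdivrMr// mulrC ltW// -subr_gt0.
by move: (m.+1%:R) m1 h' => M; nra.
Qed.

Lemma ramp_cvg s : ramp m s @[m --> \oo] --> ((0 < s <= 1)%R%:R : R).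
Proof.
have big (u : R) : 0 < u -> \forall m \near \oo, 1 <= m.+1%:R * u.
  move=> u0; apply: filterS (dk_near u0) => m; rewrite /dk => mu.
  by rewrite -ler_pdivrMl ?ltr0n// mulr1 ltW.
have [s0|s0] := leP s 0.
  rewrite (_ : (fun m => ramp m s) = fun=> 0); first exact: cvg_cst.
  apply/funext => m; rewrite /ramp clip_eq0 ?mul0r//.
  by have : 0 < m.+1%:R :> R := ltr0Sn _ _; move: (m.+1%:R) => M; nra.
have [s1|s1] := leP s 1; last first.
  have s1' : 0 < s - 1 by rewrite subr_gt0.
  have H : (fun=> 0 : R) @ \oo --> (0 : R) by exact: cvg_cst.
  apply: cvg_trans H; apply: near_eq_cvg.
  apply: filterS (big _ s1') => m h; rewrite /ramp [X in _ * X]clip_eq0 ?mulr0//.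
  by rewrite subr_le0.
have s2 : 0 < s / 2 by rewrite divr_gt0.
have H : (fun=> 1 : R) @ \oo --> (1 : R) by exact: cvg_cst.
  apply: cvg_trans H; apply: near_eq_cvg.
apply: filterS (big _ s2) => m h; rewrite /ramp !clip_eq1 ?mulr1//.
  by have : 0 < m.+1%:R :> R := ltr0Sn _ _; move: (m.+1%:R) => M; nra.
by lra.
Qed.

Lemma integral_power_unit k :
  (\int[leb]_b ((- b) ^+ k * (0 < - b <= 1)%R%:R)%:E = (k.+1%:R^-1)%:E)%E.
Proof.
have dF (b : R) : is_derive b (1 : R) (fun b => - (k.+1%:R^-1 * (- b) ^+ k.+1)) ((- b) ^+ k).
  have k1 : k.+1%:R != 0 :> R by rewrite pnatr_eq0.
  have D := is_deriveN (is_derive_id b (1 : R)).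
  have := is_deriveN (is_deriveZ k.+1%:R^-1 (is_deriveX k.+1 D)).
  rewrite exprfctE => D'; apply: (is_derive_eq D').
  by rewrite -![_ *: _]/(_ * _); field.
have cX : continuous (fun b : R => (- b) ^+ k).
  by apply: contX; apply: contN => u; exact: cvg_id.
have dF' b : derivable (fun b : R => - (k.+1%:R^-1 * (- b) ^+ k.+1)) b 1 by case: (dF b).
have cF := is_derive1_cont dF.
have m10 : (-1 : R) < 0 by rewrite oppr_lt0.
have cab : {within `[(-1 : R), 0], continuous (fun b : R => (- b) ^+ k)}.
  exact: continuous_subspaceT.
have := @continuous_FTC2 R (fun b => (- b) ^+ k) (fun b => - (k.+1%:R^-1 * (- b) ^+ k.+1)) (-1) 0 m10 cab.
move=> /(_ _)/wrap[|].
  split; first by move=> *.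
  - by apply: cvg_at_right_filter; exact: cF.
  - by apply: cvg_at_left_filter; exact: cF.
move=> /(_ _)/wrap[b _|]; first by rewrite derive1E; case: (dF b).
have E : - (k.+1%:R^-1 * (- 0) ^+ k.+1) - - (k.+1%:R^-1 * (- -1) ^+ k.+1) = k.+1%:R^-1 :> R.
  by rewrite oppr0 expr0n /= mulr0 oppr0 sub0r opprK [- - 1]opprK expr1n mulr1.
rewrite -EFinB E => <-.
rewrite -(@integral_itv_bndo_bndc R (BLeft (-1)) 0 (fun b => ((- b) ^+ k)%:E)); last first.
  by apply/measurable_EFinP; apply: measurable_funTS; exact: continuous_measurable_fun.
rewrite [RHS]integral_mkcond; apply: eq_integral => b _; rewrite /patch mem_setE in_itv /=.
rewrite oppr_gt0 lerNl andbC; case: ifP => _; by rewrite ?mulr1 ?mulr0.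
Qed.

Lemma ramp_mass k : exists2 c : nat -> R,
  forall m, (\int[leb]_b ((- b) ^+ k * ramp m (- b))%:E = (c m)%:E)%E &
  c m @[m --> \oo] --> (k.+1%:R^-1 : R).
Proof.
pose F m (b : R) := (- b) ^+ k * ramp m (- b).
have cN : continuous (fun b : R => - b) by apply: contN => u; exact: cvg_id.
have cF m : continuous (F m).
  apply: contM; first exact: contX.
  by move=> b; apply: (@continuous_comp _ _ _ (fun b : R => - b) (ramp m)); [exact: cN|exact: ramp_cont].
have F0 m b : 2 < `|b| -> F m b = 0.
  move=> b2; rewrite /F; have [->|/ramp_supp/andP[r1 r2]] := eqVneq (ramp m (- b)) 0.
    by rewrite mulr0.
  by exfalso; move: b2; rewrite -normrN ger0_norm ?ltNge ?r2// (le_trans _ r1)// ltW// dk_gt0.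
have iF m := integrable_bounded_support (cF m) (@F0 m).
have fE m : (\int[leb]_b (F m b)%:E = (\int[leb]_b F m b)%:E)%E.
  by rewrite /Rintegral fineK//; exact: (integrable_fin_num measurableT (iF m)).
exists (fun m => \int[leb]_b F m b) => //.
pose g (b : R) := 2 ^+ k * Num.max 0 (3 - `|b|).
have cg : continuous g.
  apply: contM; first exact: cst_continuous.
  apply: contmax; first exact: cst_continuous.
  by apply: contB; [exact: cst_continuous|exact: norm_continuous].
have ig : leb.-integrable setT (EFin \o g).
  apply: (@integrable_bounded_support _ g 3 cg) => s s3; rewrite /g max_l ?mulr0//.
  by rewrite subr_le0 ltW.
have [] := @dominated_convergence _ _ _ leb setT measurableT
  (fun m b => (F m b)%:E) (fun b => ((- b) ^+ k * (0 < - b <= 1)%R%:R)%:E) (EFin \o g).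
- by move=> m; apply/measurable_EFinP; exact: continuous_measurable_fun.
- apply/measurable_EFinP; apply: measurable_fun_cvg => [m|b _].
  + exact: (continuous_measurable_fun (cF m)).
  + by apply: cvgM; [exact: cvg_cst|exact: ramp_cvg].
- apply/aeW => b _; apply: cvg_EFin; first exact: nearW.
  by apply: cvgM; [exact: cvg_cst|exact: ramp_cvg].
- exact: ig.
- apply/aeW => b m _; rewrite lee_fin /=.
  have [b2|b2] := leP `|b| 2; last first.
    by rewrite F0// normr0 /g mulr_ge0// le_max lexx.
  rewrite /F /g normrM normrX normrN; have /andP[r0 r1] := ramp_bounds m (- b).
  rewrite (ger0_norm r0) ler_pM// ?exprn_ge0//.
    by rewrite lerXn2r// nnegrE.
  by rewrite le_max; apply/orP; right; lra.
move=> _ _; rewrite integral_power_unit => h; apply: fine_cvg.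
by apply: cvg_trans h; apply: near_eq_cvg; apply: nearW => m /=; rewrite fE.
Qed.

End ramp_functions.

(** * Functions on the lower hemisphere *)

Section hemisphere_density.
Context (R : realType) (n : nat).
Local Notation E := 'rV[R]_n.
Local Notation Y := 'rV[R]_(n + 1).
Variable f : E -> R.
Hypothesis Cf : Cc f.

Definition hemi (z : Y) : R := \1_(lower_hemisphere R n) z * f (gno z).

Lemma measurable_lower_hemisphere : measurable (lower_hemisphere R n).
Proof.
rewrite (_ : lower_hemisphere R n = ((@enorm R (n + 1)) @^-1` [set 1] `&` (@depth R n) @^-1` `]0, +oo[)); last first.
  by apply/seteqP; split=> z /=; rewrite in_itv /= andbT /depth oppr_gt0.
apply: measurableI; rewrite -[X in measurable X]setTI.
  by apply: measurable_enorm => //; exact: measurable_set1.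
apply: (continuous_measurable_rV (@depth_cont R n)) => //; exact: measurable_itv.
Qed.

Lemma gnoE (z : Y) : 0 < depth z -> gno z = (depth z)^-1 *: lsubmx z.
Proof. by move=> z0; rewrite /gno -normrN ger0_norm// ltW. Qed.

Lemma measurable_hemi : measurable_fun setT hemi.
Proof.
apply: (measurable_fun_cvg (h := fun m (z : Y) => \1_(lower_hemisphere R n) z * f (chart (dk R m) z))).
  move=> m; apply: measurable_funM; first exact: measurable_indic measurable_lower_hemisphere.
  apply: continuous_measurable_rV => z; apply: continuous_comp; last exact: Cf.1.
  by apply: chart_cont; exact: dk_gt0.
move=> z _; rewrite /hemi indicE.
case: (boolP (z \in lower_hemisphere R n)) => [/set_mem[_]|_]; last first.
  by rewrite mul0r; under eq_fun do rewrite mul0r; exact: cvg_cst.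
rewrite -oppr_gt0 -/(depth z) => z0.
have H : (fun=> true%:R * f (gno z)) @ \oo --> true%:R * f (gno z) by exact: cvg_cst.
apply: cvg_trans H; apply: near_eq_cvg.
by apply: filterS (dk_near z0) => m mz; rewrite /chart tdepth_id// gnoE.
Qed.

Lemma hemi_bounded : exists2 C, 0 <= C & forall z, `|hemi z| <= C.
Proof.
have [_ [C [M [C0 _ fC _]]]] := Cc_bms Cf; exists C => // z.
by rewrite /hemi normrM indicE; case: (_ \in _); rewrite ?normr1 ?normr0 ?mul1r ?mul0r.
Qed.

Lemma hemi_dirv (y : Y) :
  hemi (dirv y) = if 0 < depth y then f ((depth y)^-1 *: lsubmx y) else 0.
Proof.
have dE : depth (dirv y) = (enorm y)^-1 * depth y by rewrite !depthE mxE mulrN.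
rewrite /hemi indicE; case: ifPn => y0.
  have yn0 : y != 0 by apply: contraTneq y0 => ->; rewrite depthE mxE oppr0 ltxx.
  have en0 : 0 < enorm y by rewrite enorm_gt0.
  have d0 : 0 < depth (dirv y) by rewrite dE mulr_gt0// invr_gt0.
  rewrite mem_set ?mul1r; last first.
    split; last by rewrite -oppr_gt0.
    by rewrite /dirv enormZ ger0_norm ?mulVf ?gt_eqF// invr_ge0 ltW.
  rewrite gnoE// dE; congr f; apply/rowP => i; rewrite !mxE.
  by field; rewrite !gt_eqF.
rewrite memNset ?mul0r// => -[_]; rewrite -oppr_gt0 -/(depth (dirv y)) dE.
apply/negP; rewrite -leNgt mulr_ge0_le0 ?invr_ge0 ?enorm_ge0//.
by rewrite leNgt.
Qed.

Lemma hemi_cone (y : Y) : hemi (dirv y) * \1_(cone 1 setT) y =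
  if 0 < depth y then (0 < enorm y <= 1)%R%:R * f ((depth y)^-1 *: lsubmx y) else 0.
Proof.
rewrite hemi_dirv; case: ifP => _; last by rewrite mul0r.
rewrite mulrC; congr (_ * _); rewrite indicE; congr (_%:R); congr nat_of_bool.
by apply/idP/idP => [/set_mem[]//|?]; apply/mem_set.
Qed.

(** Since the norm is depth times [wt], this keeps the cone over the support of [f], outside a ball,
    at a positive depth. *)
Lemma cc_wt_bound : exists2 W, 0 < W & forall x, f x != 0 -> wt (enorm x) <= W.
Proof.
have [_ [M fM]] := Cf; exists (1 + n%:R * `|M|); first by rewrite ltr_pwDl// mulr_ge0.
move=> x fx; have xM : `|x| <= `|M|.
  rewrite leNgt; apply/negP => Mx; move/eqP: fx; apply; apply: fM.
  exact: le_lt_trans (ler_norm M) Mx.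
have xe : enorm x <= n%:R * `|M|.
  by apply: (le_trans (enorm_le_mx_norm _)); rewrite ler_wpM2l.
have e0 := enorm_ge0 x; apply: (@le_trans _ _ (1 + enorm x)); last by rewrite lerD2l.
rewrite -(@ler_pXn2r _ 2)// ?nnegrE; last 2 first.
- by rewrite ltW// wt_gt0.
- by rewrite addr_ge0.
by rewrite wt_sqr; nra.
Qed.

Variables (h : Y -> R) (L : R).
Hypotheses (L0 : 0 <= L) (lh : lip L h) (ch : cvx h)
  (hZ : forall (t : R) y, 0 <= t -> h (t *: y) = t * h y).
Local Notation v := (section_fun h).

Lemma section_cvx : cvx v.
Proof.
move=> x y t t01; rewrite /section_fun; apply: le_trans (ch _ _ t01).
rewrite le_eqVlt; apply/orP; left; apply/eqP; congr h.
rewrite !scale_row_mx add_row_mx; congr row_mx.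
by apply/rowP => i; rewrite !mxE; ring.
Qed.

(** The indicator of the unit cone is not an admissible continuous profile. For ramp profiles the
    value is the moment of the ramp times [S]; as the ramps tend to the indicator of ]0, 1], bounded
    convergence applies and the moments tend to 1 / (l + 1). *)
Lemma Psi_hemi l (S : R) : (l <= n)%N ->
  \int[lebesgue_rV R n]_x (wt (enorm x) ^+ 2 *
    (pencil (mollH v (dk R k) x) (gnomonic_metric x))`_l * f x /
    wt (enorm x) ^+ l.+1) @[k --> \oo] --> S ->
  Psi h l.+1 (fun y => hemi (dirv y) * \1_(cone 1 setT) y) = l.+1%:R^-1 * S.
Proof.
move=> ln IS; have [W W0 fW] := cc_wt_bound; have [c cE cl] := ramp_mass R l.
(* Small enough that a point over the support of [f] whose norm is at least [dk R m] has depth at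
   least [2 a]. *)
pose a m := dk R m / (2 * W).
have a0 m : 0 < a m by rewrite divr_gt0 ?dk_gt0// mulr_gt0.
have fa m x : f x != 0 -> 2 * a m * wt (enorm x) <= dk R m.
  move=> /fW xW; rewrite /a -[leRHS]mulr1 mulrCA -mulrA ler_wpM2l ?(ltW (dk_gt0 _ _))//.
  have -> : 2 / (2 * W) = W^-1 by field; rewrite gt_eqF.
  by rewrite ler_pdivrMl// mulr1.
pose ct m := cone_test (@ramp R m) f (a m).
have ctE m : Psi h l.+1 (ct m) = c m * S.
  have rc := @ramp_cont R m; have rg s : 0 <= ramp m s by case/andP: (ramp_bounds m s).
  have H1 := @cone_moment_cvg R n h L L0 lh ch hZ (@ramp R m) f (dk R m) 2 (a m) rc (@ramp_supp R m) Cf (a0 m) (fa m) l ln.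
  apply: (cvg_unique _ H1) => //.
  have : (fun k => c m * \int[lebesgue_rV R n]_x (wt (enorm x) ^+ 2 *
    (pencil (mollH v (dk R k) x) (gnomonic_metric x))`_l * f x /
    wt (enorm x) ^+ l.+1)) @ \oo --> c m * S by apply: cvgM => //; exact: cvg_cst.
  apply: cvg_trans; apply: near_eq_cvg; apply: nearW => k.
  apply/esym; apply: (@cone_momentE R n h L lh (@ramp R m) f (dk R m) 2 (a m)) => //.
  - exact: dk_gt0.
  - exact: ramp_supp.
  - exact: fa.
  - exact: dk_gt0.
have lim1 : Psi h l.+1 (ct m) @[m --> \oo] --> Psi h l.+1 (fun y => hemi (dirv y) * \1_(cone 1 setT) y).
  have [_ [C [M [C0 _ fC _]]]] := Cc_bms Cf.
  have ctF m y := @cone_testE R n (@ramp R m) f (dk R m) 2 (a m) (@ramp_supp R m) (a0 m) (fa m) y.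
  apply: (Psi_dct L0 lh ch (C := C) (M := 2)) => [m|m y|m y y2|y].
  - have := @Cc_cone_test R n (@ramp R m) f (dk R m) 2 (a m).
    move=> H; have [] := H (@ramp_cont R m) (@ramp_supp R m) Cf (a0 m).
    by move=> cct _; exact: continuous_measurable_rV.
  - rewrite /ct ctF; case: ifP => _; last by rewrite normr0.
    have /andP[r0 r1] := ramp_bounds m (enorm y).
    by rewrite normrM (ger0_norm r0) -[C]mul1r ler_pM.
  - rewrite /ct ctF; case: ifP => // _.
    have [->|/ramp_supp/andP[_]] := eqVneq (ramp m (enorm y)) 0; first by rewrite mul0r.
    by move=> e2; have := lt_le_trans y2 (mx_norm_le_enorm y); rewrite ltNge e2.
  - rewrite hemi_cone; under eq_fun do rewrite /ct ctF; case: ifP => _; last exact: cvg_cst.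
    by apply: cvgM; [exact: ramp_cvg|exact: cvg_cst].
have lim2 : (fun m => Psi h l.+1 (ct m)) @ \oo --> l.+1%:R^-1 * S.
  have -> : (fun m => Psi h l.+1 (ct m)) = (fun m => c m * S) by apply/funext.
  by apply: cvgM => //; exact: cvg_cst.
exact: (cvg_unique _ lim1 lim2).
Qed.

End hemisphere_density.

(** * Signed functions on the lower hemisphere *)

Section hemisphere_integral.
Context (R : realType) (n : nat) (K : set 'rV[R]_(n + 1)).
Hypothesis bK : convex_body K.
Local Notation h := (support_function K).

Lemma integral_hemi (f : 'rV[R]_n -> R) (j : nat) : Cc f -> (j <= n)%N ->
  (\int[area_measure K j]_z (hemi f z)%:E =
   (cone_functional K (area_coef R n j) (n + 1 - j) (hemi f))%:E)%E.
Proof.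
move=> Cf jn; have [C C0 HC] := hemi_bounded Cf; have mH := measurable_hemi Cf.
have [L L0 lh] := support_function_lip bK; have ch := support_function_cvx bK.
have mxb (g : 'rV[R]_(n + 1) -> R) : (forall z, `|g z| <= C) -> forall z, 0 <= Num.max (g z) 0 <= C.
  move=> gC z; rewrite le_max lexx orbT ge_max C0 andbT /=.
  exact: le_trans (ler_norm _) (gC z).
have mmx (g : 'rV[R]_(n + 1) -> R) : measurable_fun setT g -> measurable_fun setT (fun z => Num.max (g z) 0).
  by move=> mg; apply: measurable_maxr => //; exact: measurable_cst.
have mN : measurable_fun setT (fun z => - hemi f z) by exact: measurableT_comp.
have NC z : `|- hemi f z| <= C by rewrite normrN.
rewrite integralE.
have -> : ((fun z => (hemi f z)%:E)^\+ = fun z => (Num.max (hemi f z) 0)%:E)%E.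
  by apply/funext => z; rewrite funeposE EFin_max.
have -> : ((fun z => (hemi f z)%:E)^\- = fun z => (Num.max (- hemi f z) 0)%:E)%E.
  by apply/funext => z; rewrite funenegE EFin_max.
rewrite !(integral_area_measure bK (C := C))//; do ?[exact: mmx | exact: mxb].
rewrite -EFinB; congr EFin; rewrite /cone_functional -mulrBr; congr (_ * _).
have bc (g : 'rV[R]_(n + 1) -> R) : measurable_fun setT g -> (forall z, `|g z| <= C) ->
    bms (fun y => Num.max (g (dirv y)) 0 * \1_(cone 1 setT) y).
  move=> mg gC; apply: (@bms_cone_comp _ _ (fun z => Num.max (g z) 0) C); first exact: mmx.
  by move=> z; have /andP[m0 m1] := mxb _ gC z; rewrite ger0_norm.
have -> : (fun y => hemi f (dirv y) * \1_(cone 1 setT) y) = (fun y =>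
    Num.max (hemi f (dirv y)) 0 * \1_(cone 1 setT) y +
    (-1) * (Num.max (- hemi f (dirv y)) 0 * \1_(cone 1 setT) y)).
  apply/funext => y; rewrite mulN1r -mulrBl; congr (_ * _).
  by rewrite {1}(max0_split (hemi f)).
rewrite (PsiD L0 lh ch); last 2 first.
- exact: bc.
- by apply: bmsZ; exact: (bc (fun z => - hemi f z)).
by rewrite (PsiZ L0 lh ch) ?mulN1r//; exact: (bc (fun z => - hemi f z)).
Qed.

End hemisphere_integral.

(** * Both sides as limits along mollifications *)

Section gnomonic_representation.
Context (R : realType) (n : nat) (alpha : R -> R) (G : nat -> R -> R) (M : R).
Local Notation E := 'rV[R]_n.
Local Notation mu := (lebesgue_rV R n).
Local Notation z := (fun _ : 'I_n => 0%N).
Hypotheses (halpha : Tclass n n alpha) (M0 : 0 < M)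
  (dG : forall k s, is_derive s (1 : R) (G k) (- (qdens alpha s * wt s ^+ k / wt s ^+ 2)))
  (Geven : forall k s, G k (- s) = G k s)
  (GM : forall k s, M < `|s| -> G k s = 0 /\ alpha `|s| = 0).

(** On the hemisphere [z_i] is the chart coordinate [x_i] divided by [wt], and the bracket is the
    iterated transform; the formula also makes sense at the origin. *)
Definition tail_dens (k : nat) (i : 'I_n) (x : E) : R :=
  (wt (enorm x) ^+ k * alpha (enorm x) + k%:R * G k (enorm x)) * x 0 i / wt (enorm x).

Lemma Cc_tail_dens k i : Cc (tail_dens k i).
Proof.
have cW : continuous (fun x : E => (wt (enorm x))^-1).
  have := @wtXV_cont R 1; under eq_fun do rewrite expr1.
  by move=> c; exact: (@cont_radial _ _ (fun s => (wt s)^-1)).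
have -> : tail_dens k i = (fun x => wt (enorm x) ^+ k / wt (enorm x) * dens_coord alpha i x +
    (k%:R * x 0 i / wt (enorm x)) * G k (enorm x)).
  by apply/funext => x; rewrite /tail_dens /dens_coord; ring.
apply: CcD; apply: CcM.
- apply: contM => //; apply: (@cont_radial _ _ (fun s => wt s ^+ k)); exact: wtX_cont.
- exact: (Cc_dens_coord halpha GM).
- by apply: contM => //; apply: contM; [exact: cst_continuous|exact: coord_cont].
- split; first by apply: cont_radial; exact: is_derive1_cont (dG k).
  by exists M => x /enormM Mx; have [] := GM k Mx.
Qed.

Lemma tail_dens_gno k i (y : 'rV[R]_(n + 1)) : lower_hemisphere R n y ->
  iter k Ttrans alpha (enorm (gno y)) * lsubmx y 0 i = tail_dens k i (gno y).
Proof.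
move=> [y1]; rewrite -oppr_gt0 -/(depth y) => y0.
have gE := gnoE y0.
have wE : depth y * wt (enorm (gno y)) = 1 by rewrite gE -enorm_depth.
have xE : gno y 0 i = wt (enorm (gno y)) * lsubmx y 0 i.
  rewrite {1}gE mxE; congr (_ * _); apply: (@mulfI _ (depth y)); first by rewrite gt_eqF.
  by rewrite wE mulfV// gt_eqF.
rewrite /tail_dens xE; have w0 := wt_neq0 (enorm (gno y)).
have [x0|x0] := eqVneq (gno y) 0.
  have -> : lsubmx y 0 i = 0.
    by apply: (mulfI w0); rewrite -xE x0 mxE mulr0.
  by rewrite !(mulr0, mul0r).
rewrite (iter_Ttrans halpha dG GM); last by rewrite enorm_gt0.
by move: (wt _) w0 => w w0; field.
Qed.

(** The value [S] enters only as a limit of integrals over mollified Hessians. [gnomonic_identity]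
    rewrites these integrals as the ones whose limit [Psi_hemi] evaluates. *)
Lemma section_representation (K : set 'rV[R]_(n + 1)) (j : nat) (i : 'I_n) (S : R) :
  convex_body K -> (j <= n)%N ->
  \int[mu]_x (dens_coord alpha i x *
    (pencil (mollH (section_fun (support_function K)) (dk R k) x) 1%:M)`_(n - j))
    @[k --> \oo] --> S ->
  S%:E = ('C(n, j)%:R%:E * \int[area_measure K j]_(y in lower_hemisphere R n)
    (iter (n - j) Ttrans alpha (enorm (gno y)) * lsubmx y 0 i)%:E)%E.
Proof.
move=> bK jn HS; have Cf := Cc_tail_dens (n - j) i.
have [L L0 lh] := support_function_lip bK; have ch := support_function_cvx bK.
have hZ (t : R) (y : 'rV[R]_(n + 1)) := @support_functionZ R (n + 1) K bK y t.
have -> : (\int[area_measure K j]_(y in lower_hemisphere R n)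
    (iter (n - j) Ttrans alpha (enorm (gno y)) * lsubmx y 0 i)%:E =
    \int[area_measure K j]_y (hemi (tail_dens (n - j) i) y)%:E)%E.
  rewrite integral_mkcond; apply: eq_integral => y _; rewrite /patch /hemi indicE.
  case: ifPn => [/set_mem yl|_]; last by rewrite mul0r.
  by rewrite mul1r tail_dens_gno.
rewrite integral_hemi// /cone_functional.
have nj : (n + 1 - j = (n - j).+1)%N by rewrite addn1 subSn.
rewrite nj (@Psi_hemi _ _ _ Cf _ L L0 lh ch hZ _ S) ?leq_subr//; last first.
  apply: cvg_trans HS; apply: near_eq_cvg; apply: nearW => k.
  have sc : continuous (section_fun (support_function K)) by exact: section_cont lh.
  rewrite (gnomonic_identity halpha dG Geven GM sc (section_cvx ch) (dk_gt0 R k)) ?leq_subr//.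
  apply: eq_Rintegral => x _; rewrite /tail_dens.
  have -> : wt (enorm x) ^+ (n - j).+1 = wt (enorm x) * wt (enorm x) ^+ (n - j) by rewrite exprS.
  have w0 := wt_neq0 (enorm x); have wk : wt (enorm x) ^+ (n - j) != 0 by rewrite expf_neq0.
  move: (wt _ ^+ (n - j)) wk (_`_(n - j)) (alpha _) (G _ _) => w' w'0 P A B.
  by move: (wt _) w0 => w w0; field; rewrite ?w0 ?w'0.
(* The binomial, [area_coef] and the factor 1 / (n - j + 1) from the radial moment multiply to 1. *)
rewrite -EFinM; congr EFin; rewrite /area_coef subSn// mulrA.
have b0 : 'C(n, j)%:R != 0 :> R by rewrite pnatr_eq0 -lt0n bin_gt0.
have k0 : (n - j).+1%:R != 0 :> R by rewrite pnatr_eq0.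
by move: ((n - j).+1%:R) k0 => q q0; field; rewrite q0.
Qed.

Variables (j : nat) (tstar : (E -> R) -> E).
Hypotheses (jn : (j <= n)%N) (htstar : is_tstar j alpha tstar).

Lemma moll_C2 (v : E -> R) (d : R) : continuous v -> 0 < d -> C2 (moll v d z) /\
  forall x, hessian (moll v d z) x = mollH v d x.
Proof.
move=> cv d0.
have D1 i : (fun x => 'D_(basis_vec R i) (moll v d z) x) = moll v d (incr z i).
  by apply/funext => x; case: (is_derive_moll0 cv d0 x i).
have D2 i k : (fun x => 'D_(basis_vec R k) (fun y => 'D_(basis_vec R i) (moll v d z) y) x) =
    moll v d (incr (incr z i) k).
  by apply/funext => x; rewrite D1; case: (is_derive_moll1 cv d0 x i k).
split; last first.
  by move=> x; apply/matrixP => i k; rewrite !mxE; exact: (congr1 (fun g : E -> R => g x) (D2 i k)).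
split; first exact: moll_cont.
move=> i; split.
- by move=> x; case: (is_derive_moll0 cv d0 x i).
- by rewrite D1; exact: moll_cont.
- move=> k; split; last by rewrite D2; exact: moll_cont.
  by move=> x; rewrite D1; case: (is_derive_moll1 cv d0 x i k).
Qed.

(** Values at any sequence tending to [x] converge to [v x]. This gives the lower bound, and the
    constant sequence serves as recovery sequence. *)
Lemma epi_cvg_moll v : continuous v -> epi_cvg (fun k => moll v (dk R k) z) v.
Proof.
move=> cv.
have H x (u : nat -> E) : u @ \oo --> x -> moll v (dk R k) z (u k) @[k --> \oo] --> v x.
  move=> ux; apply/cvgrPdist_le => eps e0.
  have : \forall y \near x, `|v x - v y| <= eps by exact: (proj1 (@cvgrPdist_le _ _ _ _ _ _ _) (cv x)).
  move=> /nbhs_ballP[r /= r0 rP].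
  have r2 : 0 < r / 2 by rewrite divr_gt0.
  have H1 : \forall k \near \oo, `|x - u k| < r / 2.
    exact: (proj1 (@cvgrPdist_lt _ _ _ _ _ _ _) ux).
  have H2 := dk_near r2.
  near=> k; rewrite distrC moll0E//; last exact: dk_gt0.
  apply: avg_close; [exact: dk_gt0|exact: shift_cont|move=> y yd].
  rewrite distrC; apply: rP; rewrite -ball_normE /=.
  have h1 : `|x - u k| < r / 2 by near: k.
  have h2 : dk R k < r / 2 by near: k.
  rewrite opprD addrA (le_lt_trans (ler_normB _ _))// [r]splitr ltrD//.
  exact: le_lt_trans yd h2.
move=> x; split.
  move=> u ux; have := H x u ux => hh.
  have /cvg_limn_einf_sup[-> _] : (fun k => (moll v (dk R k) z (u k))%:E) @ \oo --> (v x)%:E.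
    by apply: cvg_EFin => //; exact: nearW.
  by [].
exists (fun=> x); split; first exact: cvg_cst.
by apply: H; exact: cvg_cst.
Unshelve. all: by end_near. Qed.

Lemma tstar_moll_cvg v i : Conv v ->
  \int[mu]_x (dens_coord alpha i x * (pencil (mollH v (dk R k) x) 1%:M)`_(n - j))
    @[k --> \oo] --> tstar v 0 i.
Proof.
move=> hv; have cvv : cvx v by exact/ConvP.
have cv : continuous v by exact: cvx_cont.
have [_ epi _ _ smooth] := htstar.
have Cm k : Conv (moll v (dk R k) z) by apply/ConvP; apply: cvx_moll => //; exact: dk_gt0.
have := epi _ _ Cm hv (epi_cvg_moll cv).
move=> /(cvg_comp _ _)/(_ (@coord_cont R n i (tstar v))).
apply: cvg_trans; apply: near_eq_cvg; apply: nearW => k /=.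
have [c2 hE] := moll_C2 cv (dk_gt0 R k).
have := smooth _ (Cm k) c2 i.
under eq_integral do rewrite hE elementary_sym_eigenvalues ?mollH_sym//.
rewrite integral_bms; first by case.
apply: Cc_bms; have := CcM (@mollP_coef_cont R n v (dk R k) (n - j) cv (dk_gt0 R k)) (Cc_dens_coord halpha GM i).
by congr Cc; apply/funext => x; rewrite mulrC.
Qed.

(** The approximating integrals see [v] only within one mollification width, at most 1, of the
    support of the density. *)
Lemma tstar_local v v' i : Conv v -> Conv v' -> (forall x, `|x| <= M + 1 -> v x = v' x) ->
  tstar v 0 i = tstar v' 0 i.
Proof.
move=> hv hv' vv'; have H := @tstar_moll_cvg v i hv; have H' := @tstar_moll_cvg v' i hv'.
suff E' : (fun k => \int[mu]_x (dens_coord alpha i x * (pencil (mollH v (dk R k) x) 1%:M)`_(n - j))) =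
    (fun k => \int[mu]_x (dens_coord alpha i x * (pencil (mollH v' (dk R k) x) 1%:M)`_(n - j))).
  by move: H'; rewrite -E' => H'; exact: (cvg_unique _ H H').
apply/funext => k; apply: eq_Rintegral => x _.
have [xM|xM] := leP `|x| M; last first.
  have a0 : alpha (enorm x) = 0.
    by have := (GM 0 (enormM xM)).2; rewrite ger0_norm ?enorm_ge0.
  have -> : dens_coord alpha i x = 0 by rewrite /dens_coord a0 mul0r.
  by move: (pencil _ _) (pencil _ _) => p q; rewrite !mul0r.
suff -> : mollH v (dk R k) x = mollH v' (dk R k) x by [].
apply/matrixP => a b; rewrite !mxE; apply: moll_local; first exact: dk_gt0.
move=> y yx; apply: vv'; rewrite -[y](subrK x) (le_trans (ler_normD _ _))// addrC lerD//.
by rewrite (le_trans yx)// invf_le1// ler1n.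
Qed.

End gnomonic_representation.

(** * A convex body for a given convex function *)

Section subgradient.
Context (R : realType) (n : nat).
Local Notation E := 'rV[R]_n.
Local Notation Y := 'rV[R]_(n + 1).
Local Notation z := (fun _ : 'I_n => 0%N).
Variable v : E -> R.
Hypothesis cv : cvx v.

(* Subgradients arise as cluster points of the gradients of mollifications. *)
Lemma cvx_subgradient r : exists2 B, 0 <= B & forall x, `|x| <= r ->
  exists2 p : E, `|p| <= B & forall y, v x + dotv p (y - x) <= v y.
Proof.
have aux (a b c V : R) : a + c <= b -> `|a| <= V -> `|b| <= V -> c <= 2 * V.
  by rewrite !ler_norml => ? /andP[? ?] /andP[? ?]; lra.
have aux' (p q s a b d : R) : p + s <= q -> a - d < p -> q < b + d -> s <= b - a + 2 * d by lra.
(* The margin 2 covers one unit step along a coordinate axis and one mollification width; such steps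
   bound the gradients by [2 * V]. *)
have contv := cvx_cont cv; have [V V0 vV] := cont_bounded_ball (r + 2) contv.
exists (2 * V); first by rewrite mulr_ge0.
move=> x xr; pose g k : E := \row_i moll v (dk R k) (incr z i) x.
have grad k y : moll v (dk R k) z x + dotv (g k) (y - x) <= moll v (dk R k) z y.
  have := moll_gradient contv (dk_gt0 R k) x y cv; apply: le_trans; rewrite lerD2l.
  by apply: ler_sum => i _; rewrite mulrC [g k 0 i]mxE.
have mV k y : `|y| <= r + 1 -> `|moll v (dk R k) z y| <= V.
  move=> yr; rewrite moll0E//; last exact: dk_gt0.
  rewrite -[X in `|X|]subr0; apply: avg_close; [exact: dk_gt0|exact: shift_cont|move=> w wd].
  rewrite subr0; apply: vV; apply: (le_trans (ler_normD _ _)).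
  have d1 : dk R k <= 1 by rewrite invf_le1// ler1n.
  by have := le_trans wd d1; lra.
have gV k : `|g k| <= 2 * V.
  apply/mx_norm_leP; first by rewrite mulr_ge0.
  move=> i; have xV : `|moll v (dk R k) z x| <= V by apply: mV; lra.
  have H s : `|s| = 1 -> s * g k 0 i <= 2 * V.
    move=> s1; have := grad k (x + s *: basis_vec R i); rewrite [_ - x]addrAC subrr add0r.
    have -> : dotv (g k) (s *: basis_vec R i) = s * g k 0 i.
      rewrite dotvZr /dotv (bigD1 i)//= big1 ?addr0; last first.
        by move=> b bi; rewrite [basis_vec _ _ _ _]mxE (negbTE bi) andbF mulr0.
      by rewrite [basis_vec _ _ _ _]mxE !eqxx mulr1.
    have : `|moll v (dk R k) z (x + s *: basis_vec R i)| <= V.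
      apply: mV; apply: (le_trans (ler_normD _ _)); rewrite lerD// normrZ s1 mul1r.
      apply/mx_norm_leP => // b; rewrite mxE; case: (_ && _); by rewrite ?normr1 ?normr0.
    by move=> yV le; exact: aux le xV yV.
  have h1 := H 1 (normr1 _); have h2 := H (-1) (normrN1 _).
  by rewrite ler_norml; apply/andP; split; lra.
have [|p [pV clp]] := @compact_nball R n (2 * V) (g @ \oo).
  by exists 0%N => // k _; exact: gV.
exists p => // y; rewrite leNgt; apply/negP => lt.
pose d := (v x + dotv p (y - x) - v y) / 4.
have d0 : 0 < d by rewrite divr_gt0// subr_gt0.
have [q [h1 h2]] : [set q | dotv q (y - x) <= v y - v x + 2 * d] `&`
    [set q | v y - v x + 2 * d < dotv q (y - x)] !=set0.
  apply: clp.
    have Hx := @moll_cvg R n v x contv; have Hy := @moll_cvg R n v y contv.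
    have Ex : \forall k \near \oo, v x - d < moll v (dk R k) z x.
      by apply: (cvgr_gt _ Hx); rewrite gtrBl.
    have Ey : \forall k \near \oo, moll v (dk R k) z y < v y + d.
      by apply: (cvgr_lt _ Hy); rewrite ltrDl.
    suff : \forall k \near \oo, dotv (g k) (y - x) <= v y - v x + 2 * d by [].
    near=> k; have a : v x - d < moll v (dk R k) z x by near: k.
    have b : moll v (dk R k) z y < v y + d by near: k.
    exact: aux' (grad k y) a b.
  have cd : continuous (fun q : E => dotv q (y - x)) by exact: dotv_cont.
  by apply: (cvgr_gt _ (cd p)); rewrite /d; lra.
by move: h1 h2 => /=; rewrite ltNge => ->.
Unshelve. all: by end_near. Qed.

Lemma dotv_row_mx (x : E) (c : R) (q : Y) :
  dotv (row_mx x (const_mx c)) q = dotv x (lsubmx q) + c * rsubmx q 0 0.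
Proof.
rewrite /dotv big_split_ord big_ord1 /= row_mxEr !mxE; congr (_ + _).
by apply: eq_bigr => i _; rewrite row_mxEl mxE.
Qed.

(** A point of [K] encodes the affine function with slope [p] and constant minus its last
    coordinate. The inequality constraints give one bound for the support function, and a
    subgradient at [x] supplies the point that attains the value. *)
Lemma body_of_section r : 0 <= r -> exists2 K : set Y, convex_body K &
  forall x, `|x| <= r -> section_fun (support_function K) x = v x.
Proof.
move=> r0; have [B B0 sub] := cvx_subgradient r.
have contv := cvx_cont cv; have [V V0 vV] := cont_bounded_ball r contv.
(* Bounds the slope of a subgradient together with the last coordinate [dotv p x - v x] of its
   point. *)
pose C := B + (n%:R * (B * r) + V).
have BC : B <= C by rewrite lerDl addr_ge0// mulr_ge0// mulr_ge0.
have C0 : 0 <= C by exact: le_trans BC.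
pose K : set Y := [set q | `|q| <= C] `&`
  [set q | forall x, `|x| <= r -> dotv (row_mx x (const_mx (-1))) q <= v x].
have Kp x p : `|x| <= r -> `|p| <= B -> (forall y, v x + dotv p (y - x) <= v y) ->
    K (row_mx p (const_mx (dotv p x - v x))).
  move=> xr pB px; split=> /=.
    apply/mx_norm_leP => // i; case: (split_ordP i) => k ->.
      by rewrite row_mxEl (le_trans (mx_norm_coord _ _))// (le_trans pB).
    rewrite row_mxEr mxE (le_trans (ler_normB _ _))// /C -[leLHS]add0r lerD// lerD ?vV//.
    apply: (le_trans (ler_norm_sum _ _ _)).
    apply: (@le_trans _ _ (\sum_(a < n) B * r)); last by rewrite sumr_const card_ord mulr_natl.
    apply: ler_sum => a _; rewrite normrM ler_pM//.
      by rewrite (le_trans (mx_norm_coord _ _)).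
    by rewrite (le_trans (mx_norm_coord _ _)).
  move=> y _; rewrite dotv_row_mx row_mxKl row_mxKr mxE mulN1r; have := px y.
  by rewrite dotvBr (dotvC y p); lra.
have bK : convex_body K.
  split.
  - have [|p pB px] := sub 0; first by rewrite normr0.
    by exists (row_mx p (const_mx (dotv p 0 - v 0))); apply: Kp => //; rewrite normr0.
  - apply: compact_closedI; first exact: compact_nball.
    rewrite (_ : [set q | _] = \bigcap_(x in [set x : E | `|x| <= r])
      ((fun q => dotv (row_mx x (const_mx (-1))) q) @^-1` [set s | s <= v x])); last first.
      by apply/seteqP; split=> q /= h x; apply: h.
    apply: closed_bigI => x _; apply: preimage_closed; last exact: closed_le.
    move=> q _; have -> : (fun q : Y => dotv (row_mx x (const_mx (-1))) q) =
        (fun q => dotv q (row_mx x (const_mx (-1)))) by apply/funext => w; exact: dotvC.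
    exact: dotv_cont.
  - move=> p q t /set_mem[pC pv] /set_mem[qC qv]; apply/mem_set.
    have [t0 t1] : 0 <= t%:num /\ t%:num <= 1 by [].
    have s0 : 0 <= 1 - t%:num by rewrite subr_ge0.
    change (K (t%:num *: (p : Y) + (1 - t%:num) *: (q : Y))); split=> /=.
      apply: (le_trans (ler_normD _ _)); rewrite !normrZ (ger0_norm t0) (ger0_norm s0).
      by move: (t%:num) t0 s0 pC qC => /= s t0 s0 pC qC; nra.
    move=> x xr; rewrite dotvDr !dotvZr; have := pv x xr; have := qv x xr.
    by move: (t%:num) t0 s0 => s t0 s0 h1 h2; nra.
exists K => // x xr; apply/eqP; rewrite eq_le; apply/andP; split.
  by apply: support_function_le => // q [_ /(_ x xr)].
have [p pB px] := sub x xr.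
have := support_function_ge bK (row_mx x (const_mx (-1))) (Kp x p xr pB px).
by rewrite dotv_row_mx row_mxKl row_mxKr mxE (dotvC x) mulN1r opprB addrC subrK.
Qed.

End subgradient.

Theorem theorem5p10 (R : realType) (n : nat) (hn : (1 <= n)%N)
    (alpha : R -> R) (halpha : Tclass n n alpha)
    (j : nat) (hj : (1 <= j <= n)%N)
    (tstar : ('rV[R]_n -> R) -> 'rV[R]_n) (htstar : is_tstar j alpha tstar)
    (v : 'rV[R]_n -> R) (hv : Conv v) :
  (exists Kv : set 'rV[R]_(n + 1), convex_body Kv /\
    forall i : 'I_n,
      (tstar v 0 i)%:E =
      ('C(n, j)%:R%:E * \int[area_measure Kv j]_(z in lower_hemisphere R n)
        (iter (n - j) Ttrans alpha (enorm (gno z)) * lsubmx z 0 i)%:E)%E) /\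
  (forall K : set 'rV[R]_(n + 1), convex_body K ->
    (forall x : 'rV[R]_n, v x = support_function K (row_mx x (const_mx (-1)))) ->
    forall i : 'I_n,
      (tstar v 0 i)%:E =
      ('C(n, j)%:R%:E * \int[area_measure K j]_(z in lower_hemisphere R n)
        (iter (n - j) Ttrans alpha (enorm (gno z)) * lsubmx z 0 i)%:E)%E).
Proof.
have [_ jn] := andP hj.
have [G [M M0 GP]] := tail_primitives halpha.
have dG k s : is_derive s (1 : R) (G k) (- (qdens alpha s * wt s ^+ k / wt s ^+ 2)).
  by have [] := GP k.
have Geven k s : G k (- s) = G k s by have [] := GP k.
have GM k s : M < `|s| -> G k s = 0 /\ alpha `|s| = 0.
  by have [_ _ H] := GP k; exact: H.
have rep (K : set 'rV[R]_(n + 1)) : convex_body K -> forall i : 'I_n,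
    (tstar (section_fun (support_function K)) 0 i)%:E =
    ('C(n, j)%:R%:E * \int[area_measure K j]_(z in lower_hemisphere R n)
      (iter (n - j) Ttrans alpha (enorm (gno z)) * lsubmx z 0 i)%:E)%E.
  move=> bK i; have ch := section_cvx (support_function_cvx bK).
  apply: (section_representation halpha dG Geven GM bK jn).
  by apply: (tstar_moll_cvg halpha GM jn htstar); exact/ConvP.
split; last first.
  move=> K bK vK i; rewrite -rep//; congr (tstar _ 0 i)%:E.
  by apply/funext => x; exact: vK.
have cv : cvx v by exact/ConvP.
(* [M] bounds the support of the density, and [tstar_local] asks for agreement on the ball of radius
   [M + 1]. *)
have [|K bK Kv] := body_of_section cv (_ : 0 <= M + 1); first by rewrite addr_ge0// ltW.
exists K; split=> // i; rewrite -rep//; congr EFin.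
apply: (tstar_local halpha GM jn htstar) => //.
  by apply/ConvP; apply: section_cvx; exact: support_function_cvx.
by move=> x xM; rewrite Kv.
Qed.
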